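(* Consider, for each $N\in\mathbb{N}$, the $N$-server load-balancing network with the $SQ(2)$ routing algorithm described in the context, satisfying the arrival, service and initial-condition assumptions described there (including exchangeability of the initial conditions), and let $Z^0_\ell(r)=\lim_{N\to\infty}\overline Z^{(N)}_\ell(0,r)$, $\ell\ge1$, $r\ge0$. Let $(Z_\ell;\ell\ge1)$ be the unique solution to the hydrodynamic PDE associated to $(\lambda,Z^0_\ell;\ell\ge1)$. Suppose in addition that $\sum_{\ell\ge1}\sup_N\mathbb{P}(X^{(N),1}(0)\ge\ell)<\infty$ and that there is $T_0<\infty$ with $a^{(N),i}(0)<T_0$ for every $N$ and every $i=1,\dots,N$. Then for every $t\ge0$, $$\lim_{N\to\infty}\mathbb{E}[W^{(N)}(t)]=\sum_{\ell\ge2}Z_\ell(t,0)^2+\sum_{\ell\ge1}\big[Z_\ell(t,0)+Z_{\ell+1}(t,0)\big]\int_0^\infty\big[Z_\ell(t,r)-Z_{\ell+1}(t,r)\big]dr.$$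
   Context: Network: for each $N$, there are $N$ servers indexed $i=1,\dots,N$, each with its own infinite-capacity queue, serving jobs first-in-first-out and non-idling. Jobs arrive according to a counting process $E^{(N)}$; job $j$ has service requirement $v_j$, the $v_j$ being i.i.d. with distribution function $G$ and independent of the arrival process; $\overline G=1-G$. Routing ($SQ(2)$): on arrival of a job, two servers are sampled independently and uniformly at random from $\{1,\dots,N\}$ and the job is routed to the one with the smaller queue length, ties broken uniformly at random. $X^{(N),i}(t)$ is the number of jobs at server $i$ at time $t$ (in service plus waiting), $X^{(N)}(t)=\sum_iX^{(N),i}(t)$, $\overline X^{(N)}=X^{(N)}/N$. For a server with $X^{(N),i}(t)\ge1$, the age $a^{(N),i}(t)$ is the time the job currently in service there has spent in service. Define $Z^{(N)}_\ell(t,r)=\sum_{i:\,X^{(N),i}(t)\ge\ell}\overline G(a^{(N),i}(t)+r)/\overline G(a^{(N),i}(t))$ for $r\ge0$, and $\overline Z^{(N)}_\ell=Z^{(N)}_\ell/N$. Virtual waiting time $W^{(N)}(t)$: a hypothetical job arriving at time $t$ is routed by the $SQ(2)$ rule (with fresh independent samples) to some server $i$; if $X^{(N),i}(t)=0$ then $W^{(N)}(t)=0$, and if $X^{(N),i}(t)=\ell\ge1$ then $W^{(N)}(t)$ is the sum of the service times of the $\ell-1$ jobs waiting in queue $i$ plus the residual service time of the job in service at server $i$ at time $t$. Assumptions: (Arrivals) $E^{(N)}$ is a time-inhomogeneous Poisson process with rate $a^{(N)}\lambda(\cdot)$, where $\lambda\ge0$ satisfies $\int_0^T\lambda(t)dt<\infty$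 for all $T<\infty$ and $a^{(N)}>0$ with $a^{(N)}/N\to1$. (Service) $G$ has mean $1$ and density $g$, and the hazard rate $h=g/(1-G)$ is bounded on $[0,\infty)$ by a constant $H$. (Initial condition) (a) almost surely, for every $\ell\ge1$ and every bounded continuous $f$ on $[0,\infty)$, the limit $\lim_{N\to\infty}\frac1N\sum_{i:\,X^{(N),i}(0)\ge\ell}f(a^{(N),i}(0))$ exists, and $\limsup_N\mathbb{E}[\overline X^{(N)}(0)]<\infty$; (b) for every $N$ the vector $(X^{(N),i}(0),\mathbf{1}\{X^{(N),i}(0)>0\}a^{(N),i}(0);\,i=1,\dots,N)$ has a distribution invariant under permutations of the server indices. Hydrodynamic PDE: $\mathbb{C}^1_{\le1}[0,\infty)$ is the set of continuously differentiable $f$ on $[0,\infty)$ with bounded derivative and $|f|\le1$; $\mathbb{X}$ is the set of $\varphi$ on $[0,\infty)^2$ with $\varphi(t,\cdot)\in\mathbb{C}^1_{\le1}[0,\infty)$ for all $t$ and $t\mapsto\varphi(t,r)$ measurable for all $r$; $\partial_r$ is the derivative in the second variable. $(Z_\ell;\ell\ge1)\subset\mathbb{X}$ solves the hydrodynamic PDE associated to $(\lambda,Z^0_\ell;\ell\ge1)$ if for all $t,r\ge0$: $Z_1(t,r)=Z_1^0(t+r)-\int_0^t\overline G(t+r-u)\partial_rZ_2(u,0)du+\int_0^t\lambda(u)\overline G(t+r-u)(1-Z_1(u,0)^2)du$, $Z_1(t,0)=Z_1^0(0)+\int_0^t(\partial_rZ_1(u,0)-\partial_rZ_2(u,0))du+\int_0^t\lambda(u)(1-Z_1(u,0)^2)du$,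 and for $\ell\ge2$: $Z_\ell(t,r)=Z_\ell^0(t+r)-\int_0^t\overline G(t+r-u)\partial_rZ_{\ell+1}(u,0)du+\int_0^t\lambda(u)(Z_{\ell-1}(u,0)+Z_\ell(u,0))(Z_{\ell-1}(u,t+r-u)-Z_\ell(u,t+r-u))du$, $Z_\ell(t,0)=Z_\ell^0(0)+\int_0^t(\partial_rZ_\ell(u,0)-\partial_rZ_{\ell+1}(u,0))du+\int_0^t\lambda(u)(Z_{\ell-1}(u,0)^2-Z_\ell(u,0)^2)du$. *)

(* Defs.v *)
From HB Require Import structures.
From mathcomp Require Import all_boot all_order all_algebra.
From mathcomp Require Import all_classical all_reals all_analysis.
From Stdlib Require List.
Set Implicit Arguments. Unset Strict Implicit. Unset Printing Implicit Defensive.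
Import Order.TTheory GRing.Theory Num.Theory.
Import numFieldNormedType.Exports.
Local Open Scope classical_set_scope.
Local Open Scope ring_scope.

(* Primitive random data of the family of SQ(2) networks (index N = number  *)
(* of servers; servers are numbered 0..N-1, server "1" of the paper is 0;   *)
(* jobs are numbered 0,1,2,... in order of arrival).                        *)
Record network (R : realType) (Omega : Type) := Network {
  arr   : nat -> Omega -> R -> nat;
  serv  : nat -> nat -> Omega -> R;        (* v_j : requirement of the j-th arriving job *)
  smp1  : nat -> nat -> Omega -> nat;      (* first sampled server for job j *)
  smp2  : nat -> nat -> Omega -> nat;      (* second sampled server for job j *)
  tie   : nat -> nat -> Omega -> bool;     (* tie-breaking coin for job j *)
  X0    : nat -> Omega -> nat -> nat;
  age0  : nat -> Omega -> nat -> R;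
  unif0 : nat -> Omega -> nat -> R;        (* uniform generating the residual service
                                              of the job in service at server i at time 0 *)
  wait0 : nat -> Omega -> nat -> nat -> R; (* requirement of the k-th waiting job at server i
                                              at time 0 *)
  fsmp1 : nat -> Omega -> nat;             (* fresh samples for the virtual job *)
  fsmp2 : nat -> Omega -> nat;
  ftie  : nat -> Omega -> bool }.

(* a job is (total service requirement, service received so far);           *)
(* a queue is a FIFO list whose head is the job in service.                 *)
Definition job (R : realType) := (R * R)%type.

Fixpoint flow (R : realType) (d : R) (q : seq (job R)) : seq (job R) :=
  match q with
  | [::] => [::]
  | (v, e) :: rest => if d < v - e then (v, e + d) :: rest
                      else flow (d - (v - e)) rest
  end.

Definition route (R : realType) (q : nat -> seq (job R)) (s1 s2 : nat) (b : bool)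
  : nat :=
  if (size (q s1) < size (q s2))%N then s1
  else if (size (q s2) < size (q s1))%N then s2
  else if b then s1 else s2.

Definition push (R : realType) (q : nat -> seq (job R)) (i : nat) (v : R) :
  nat -> seq (job R) :=
  fun k => if k == i then rcons (q k) (v, 0) else q k.

(* residual service time generated from a uniform u, given the age a:
   P(resid a U > r) = Gbar(a+r)/Gbar(a) *)
Definition resid (R : realType) (Gbar : R -> R) (a u : R) : R :=
  inf [set r : R | 0 <= r /\ Gbar (a + r) <= u * Gbar a].

Definition queue0 (R : realType) (Gbar : R -> R) (x : nat -> nat) (a u : nat -> R)
  (w : nat -> nat -> R) : nat -> seq (job R) :=
  fun i => if x i is n.+1
           then (a i + resid Gbar (a i) (u i), a i) :: [seq (w i k, 0) | k <- iota 0 n]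
           else [::].

(* time of the k-th arrival (k >= 1); arrtime e 0 = 0 *)
Definition arrtime (R : realType) (e : R -> nat) (k : nat) : R :=
  inf [set s : R | 0 <= s /\ (k <= e s)%N].

Fixpoint qafter (R : realType) (q0 : nat -> seq (job R)) (e : R -> nat)
  (v : nat -> R) (s1 s2 : nat -> nat) (b : nat -> bool) (k : nat) :
  nat -> seq (job R) :=
  match k with
  | 0 => q0
  | k'.+1 =>
      let q := fun i => flow (arrtime e k'.+1 - arrtime e k')
                             (qafter q0 e v s1 s2 b k' i) in
      push q (route q (s1 k') (s2 k') (b k')) (v k')
  end.

Definition qstate (R : realType) (Omega : Type) (Gbar : R -> R)
  (nw : network R Omega) (N : nat) (w : Omega) (t : R) : nat -> seq (job R) :=
  let e := arr nw N w in
  let q0 := queue0 Gbar (X0 nw N w) (age0 nw N w) (unif0 nw N w) (wait0 nw N w) in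
  let n := e t in
  fun i => flow (t - arrtime e n)
     (qafter q0 e (fun j => serv nw N j w) (fun j => smp1 nw N j w)
             (fun j => smp2 nw N j w) (fun j => tie nw N j w) n i).

Definition workload (R : realType) (q : seq (job R)) : R :=
  match q with
  | [::] => 0
  | (v, e) :: rest => v - e + \sum_(j <- rest) j.1
  end.

Definition vwait (R : realType) (Omega : Type) (Gbar : R -> R)
  (nw : network R Omega) (N : nat) (w : Omega) (t : R) : R :=
  let q := qstate Gbar nw N w t in
  workload (q (route q (fsmp1 nw N w) (fsmp2 nw N w) (ftie nw N w))).

Definition poisson_pmf (R : realType) (m : R) (n : nat) : R :=
  m ^+ n * expR (- m) / (n`!)%:R.

Definition service_dist (R : realType) (G g : R -> R) (H : R) : Prop :=
  measurable_fun setT g /\ (forall x, 0 <= g x) /\ (forall x, x < 0 -> g x = 0) /\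
  (forall x, (G x)%:E = (\int[@lebesgue_measure R]_(y in `]-oo, x]) (g y)%R%:E)%E) /\
  (\int[@lebesgue_measure R]_(y in [set: R]) (g y)%R%:E)%E = 1%E /\
  (\int[@lebesgue_measure R]_(y in `[0%R, +oo[) (y * g y)%R%:E)%E = 1%E /\
  (forall x, 0 <= x -> g x <= H * (1 - G x)).

Definition rate_ok (R : realType) (lam : R -> R) : Prop :=
  (forall t, 0 <= lam t) /\
  forall T, (@lebesgue_measure R).-integrable `[0, T] (EFin \o lam).

Inductive src := SArr | SInit | SServ of nat | SS1 of nat | SS2 of nat | STie of nat
               | SU of nat | SW of nat & nat | SF1 | SF2 | SFT.

Definition src_events (R : realType) d (Omega : measurableType d)
  (nw : network R Omega) (N : nat) (k : src) : set (set Omega) :=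
  match k with
  | SArr => [set A | exists n (ts : nat -> R) (ns : nat -> nat),
              A = [set w | forall m, (m < n)%N -> arr nw N w (ts m) = ns m]]
  | SInit => [set A | exists (xs : nat -> nat) (Bs : nat -> set R),
              (forall i, measurable (Bs i)) /\
              A = [set w | forall i, (i < N)%N -> X0 nw N w i = xs i /\ Bs i (age0 nw N w i)]]
  | SServ j => [set A | exists B : set R, measurable B /\ A = serv nw N j @^-1` B]
  | SS1 j => [set A | exists i, A = [set w | smp1 nw N j w = i]]
  | SS2 j => [set A | exists i, A = [set w | smp2 nw N j w = i]]
  | STie j => [set A | exists b, A = [set w | tie nw N j w = b]]
  | SU i => [set A | exists B : set R, measurable B /\ A = (fun w => unif0 nw N w i) @^-1` B]
  | SW i k => [set A | exists B : set R, measurable B /\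
                                 A = (fun w => wait0 nw N w i k) @^-1` B]
  | SF1 => [set A | exists i, A = [set w | fsmp1 nw N w = i]]
  | SF2 => [set A | exists i, A = [set w | fsmp2 nw N w = i]]
  | SFT => [set A | exists b, A = [set w | ftie nw N w = b]]
  end.

Definition mutually_indep (R : realType) d (Omega : measurableType d)
  (P : probability Omega R) (I : Type) (C : I -> set (set Omega)) : Prop :=
  forall (J : seq I), List.NoDup J -> forall A : I -> set Omega,
    (forall k, List.In k J -> C k (A k)) ->
    P (\bigcap_(k in [set k | List.In k J]) A k) = (\prod_(k <- J) fine (P (A k)))%:E.

Definition sq2_model (R : realType) d (Omega : measurableType d)
  (P : probability Omega R) (a : nat -> R) (lam G : R -> R)
  (nw : network R Omega) (N : nat) : Prop :=
  (forall t n, measurable [set w | arr nw N w t = n]) /\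
  (forall j, measurable_fun setT (serv nw N j)) /\
  (forall j i, measurable [set w | smp1 nw N j w = i]) /\
  (forall j i, measurable [set w | smp2 nw N j w = i]) /\
  (forall j b, measurable [set w | tie nw N j w = b]) /\
  (forall i n, measurable [set w | X0 nw N w i = n]) /\
  (forall i, measurable_fun setT (fun w => age0 nw N w i)) /\
  (forall i, measurable_fun setT (fun w => unif0 nw N w i)) /\
  (forall i k, measurable_fun setT (fun w => wait0 nw N w i k)) /\
  (forall i, measurable [set w | fsmp1 nw N w = i]) /\
  (forall i, measurable [set w | fsmp2 nw N w = i]) /\
  (forall b, measurable [set w | ftie nw N w = b]) /\
  (forall w, arr nw N w 0 = 0%N) /\
  (forall w s t, 0 <= s -> s <= t -> (arr nw N w s <= arr nw N w t)%N) /\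
  (forall w t, 0 <= t -> exists2 dl, 0 < dl &
       forall s, t <= s -> s < t + dl -> arr nw N w s = arr nw N w t) /\
  (forall w t, 0 < t -> exists2 dl, 0 < dl &
       forall s, t - dl < s -> s < t -> (arr nw N w t <= (arr nw N w s).+1)%N) /\
  (forall (k : nat) (ts : nat -> R) (ns : nat -> nat), ts 0%N = 0 ->
     (forall m, (m < k)%N -> ts m <= ts m.+1) ->
     P [set w | forall m, (m < k)%N -> (arr nw N w (ts m.+1) - arr nw N w (ts m))%N = ns m]
     = (\prod_(m < k) poisson_pmf (a N * \int[@lebesgue_measure R]_(u in `[ts m, ts m.+1]) lam u)
                                   (ns m))%:E) /\
  (forall j x, P [set w | serv nw N j w <= x] = (G x)%:E) /\
  (forall i k x, P [set w | wait0 nw N w i k <= x] = (G x)%:E) /\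
  (forall j i, (i < N)%N -> P [set w | smp1 nw N j w = i] = (N%:R^-1)%:E) /\
  (forall j i, (i < N)%N -> P [set w | smp2 nw N j w = i] = (N%:R^-1)%:E) /\
  (forall j, P [set w | tie nw N j w = true] = (2^-1)%:E) /\
  (forall i, (i < N)%N -> P [set w | fsmp1 nw N w = i] = (N%:R^-1)%:E) /\
  (forall i, (i < N)%N -> P [set w | fsmp2 nw N w = i] = (N%:R^-1)%:E) /\
  (P [set w | ftie nw N w = true] = (2^-1)%:E) /\
  (forall i x, 0 <= x -> x <= 1 -> P [set w | unif0 nw N w i <= x] = x%:E) /\
  (forall w i, (i < N)%N -> (0 < X0 nw N w i)%N -> 0 <= age0 nw N w i) /\
  mutually_indep P (src_events nw N).

Definition exchangeable_init (R : realType) d (Omega : measurableType d)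
  (P : probability Omega R) (nw : network R Omega) (N : nat) : Prop :=
  let Y w i := if (0 < X0 nw N w i)%N then age0 nw N w i else 0 in
  forall sg : nat -> nat, (forall i, (i < N)%N -> (sg i < N)%N) ->
    (forall i j, (i < N)%N -> (j < N)%N -> sg i = sg j -> i = j) ->
    forall (xs : nat -> nat) (Bs : nat -> set R), (forall i, measurable (Bs i)) ->
      P [set w | forall i, (i < N)%N -> X0 nw N w i = xs i /\ Bs i (Y w i)] =
      P [set w | forall i, (i < N)%N -> X0 nw N w (sg i) = xs i /\ Bs i (Y w (sg i))].

Definition Zbar0 (R : realType) (Omega : Type) (Gbar : R -> R)
  (nw : network R Omega) (N : nat) (w : Omega) (l : nat) (r : R) : R :=
  (\sum_(i < N | (l <= X0 nw N w i)%N)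
      Gbar (age0 nw N w i + r) / Gbar (age0 nw N w i)) / N%:R.

Definition init_cond_a (R : realType) d (Omega : measurableType d)
  (P : probability Omega R) (nw : network R Omega) : Prop :=
  {ae P, forall w, forall l, (1 <= l)%N -> forall f : R -> R, continuous f ->
      (exists M, forall x, `|f x| <= M) ->
      cvg ((fun N : nat => (\sum_(i < N | (l <= X0 nw N w i)%N) f (age0 nw N w i)) / N%:R)
             @ \oo)} /\
  exists M : R, \forall N \near \oo,
    (\int[P]_w ((\sum_(i < N) (X0 nw N w i)%:R) / N%:R)%:E <= M%:E)%E.

Definition rderiv0 (R : realType) (f : R -> R) : R :=
  lim ((fun h => (f h - f 0) / h) @ 0^'+).

Definition C1le1 (R : realType) (f : R -> R) : Prop :=
  exists df : R -> R,
    (forall r : R, 0 < r -> is_derive r 1 f (df r)) /\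
    ((fun h => (f h - f 0) / h) @ 0^'+ --> df 0) /\
    {within `[0%R, +oo[, continuous df} /\
    (exists M, forall r, 0 <= r -> `|df r| <= M) /\
    (forall r, 0 <= r -> `|f r| <= 1).

Definition inX (R : realType) (phi : R -> R -> R) : Prop :=
  (forall t, 0 <= t -> C1le1 (phi t)) /\
  (forall r : R, 0 <= r -> measurable_fun (`[0%R, +oo[ : set R) (fun t : R => phi t r)).

(* integral over [0,t] (integrability required separately) *)
Definition Ioo (R : realType) (t : R) (f : R -> R) : Prop :=
  (@lebesgue_measure R).-integrable `[0, t] (EFin \o f).
Definition RI (R : realType) (t : R) (f : R -> R) : R :=
  \int[@lebesgue_measure R]_(u in `[0, t]) f u.

Definition hydro_solution (R : realType) (lam Gbar : R -> R) (Z0 : nat -> R -> R)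
  (Z : nat -> R -> R -> R) : Prop :=
  (forall l, (1 <= l)%N -> inX (Z l)) /\
  forall t r, 0 <= t -> 0 <= r ->
  let F1 u := Gbar (t + r - u) * rderiv0 (Z 2%N u) in
  let F2 u := lam u * Gbar (t + r - u) * (1 - Z 1%N u 0 ^+ 2) in
  let F3 u := rderiv0 (Z 1%N u) - rderiv0 (Z 2%N u) in
  let F4 u := lam u * (1 - Z 1%N u 0 ^+ 2) in
  (Ioo t F1 /\ Ioo t F2 /\ Ioo t F3 /\ Ioo t F4 /\
   Z 1%N t r = Z0 1%N (t + r) - RI t F1 + RI t F2 /\
   Z 1%N t 0 = Z0 1%N 0 + RI t F3 + RI t F4) /\
  forall l, (2 <= l)%N ->
  let G1 u := Gbar (t + r - u) * rderiv0 (Z l.+1 u) in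
  let G2 u := lam u * (Z l.-1 u 0 + Z l u 0) *
              (Z l.-1 u (t + r - u) - Z l u (t + r - u)) in
  let G3 u := rderiv0 (Z l u) - rderiv0 (Z l.+1 u) in
  let G4 u := lam u * (Z l.-1 u 0 ^+ 2 - Z l u 0 ^+ 2) in
  Ioo t G1 /\ Ioo t G2 /\ Ioo t G3 /\ Ioo t G4 /\
  Z l t r = Z0 l (t + r) - RI t G1 + RI t G2 /\
  Z l t 0 = Z0 l 0 + RI t G3 + RI t G4.

(* Main.v *)
Require Import Defs.
From HB Require Import structures.
From mathcomp Require Import all_boot all_order all_algebra.
From mathcomp Require Import all_classical all_reals all_analysis.
From mathcomp Require Import measurable_realfun.
From mathcomp Require Import zify ring lra.
Set Implicit Arguments.
Unset Strict Implicit.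
Unset Printing Implicit Defensive.
Import Order.TTheory GRing.Theory Num.Theory.
Import numFieldNormedType.Exports.
Local Open Scope classical_set_scope.
Local Open Scope ring_scope.

(* Every queue is followed job by job: job [n] starts at [sta n], when its server clears, and ends at
   [cpl n], so the number of queues of length at least [l] whose job in service at time [s] lasts beyond
   [x] is a sum over the starts of service before [s], plus a term for the arrivals that raised a
   queue to length [l].  The service time of [n] is independent of everything before [sta n], and the
   samples of an arrival are independent of its past; replacing the indicators by their conditional
   expectations costs [O(N^(-1/2))] in mean, since the errors are orthogonal.  The result is a
   perturbed version of the hydrodynamic equations.  The distance to [Z], weighted by
   [2 ^ l exp (A (s + int_0^s lam))], is halved by these equations, so it tends to zero in [L^1]; this
   avoids compactness and uniqueness arguments.  Finally the mean waiting time is an integral over [r]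
   of survival probabilities, dominated by a multiple of [1 - G] because the initial ages are bounded,
   and the levels are uniformly summable because a queue of length [l] needs either [l] initial jobs
   or an arrival that sampled two queues of length almost [l]. *)

(** The number of jobs is unbounded, so expectations are taken in a system with at most [K] initial
    jobs per server and at most [K] arrivals up to the horizon. Every observable is then bounded.
    [K] is chosen for each [N] so that the capped mean wait is within [1 / N] of the true one, or
    else is at least [N], which convergence excludes. The levels are infinitely many, and level [l]
    depends on level [l + 1] through departures; the weight [2 ^ l] lets the error double from one
    level to the next, at the price of a constant factor absorbed in [A]. Each halving uses a finite
    time grid fixed before [N] grows, so errors need only be controlled pointwise in level and time,
    without uniform rates. Independence of a service time from the past is made checkable by
    substitution: what is decided before [n] starts does not change when its service time is set to
    [1], hence is measurable for the other sources. Nonnegativity of [Z] and its monotonicity in [l]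
    and [r], needed in the last limit, are not derived from the equations but inherited from the
    finite systems. *)

Definition cnt (m : nat) (p : nat -> bool) : nat := (\sum_(j < m) p j)%N.

(** * Counting indices below a bound *)

Section Counting.
Implicit Types (m n : nat) (p q : nat -> bool).

Lemma cnt0 p : cnt 0 p = 0%N. Proof. by rewrite /cnt big_ord0. Qed.

Lemma cntS m p : cnt m.+1 p = (cnt m p + p m)%N.
Proof. by rewrite /cnt big_ord_recr. Qed.

Lemma eq_cnt m p q : (forall j, (j < m)%N -> p j = q j) -> cnt m p = cnt m q.
Proof. by move=> pq; apply: eq_bigr => j _; rewrite pq. Qed.

Lemma leq_cnt m p q : (forall j, (j < m)%N -> p j -> q j) -> (cnt m p <= cnt m q)%N.
Proof.
by move=> pq; apply: leq_sum => j _; have := pq _ (ltn_ord j); case: (p j) => // ->.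
Qed.

Lemma cnt_le m p : (cnt m p <= m)%N.
Proof. by elim: m => [|m IH]; rewrite ?cnt0 ?cntS //; case: (p m); lia. Qed.

Lemma cntT m p : (forall j, (j < m)%N -> p j) -> cnt m p = m.
Proof.
elim: m => [|m IH] pm; first by rewrite cnt0.
by rewrite cntS IH ?pm ?addn1 // => j jm; apply: pm; lia.
Qed.

Lemma cntF m p : (forall j, (j < m)%N -> ~~ p j) -> cnt m p = 0%N.
Proof.
elim: m => [|m IH] pm; first by rewrite cnt0.
rewrite cntS IH ?(negbTE (pm _ _)) // => j jm; apply: pm; lia.
Qed.

Lemma cnt_gt0P m p : reflect (exists2 j, (j < m)%N & p j) (0 < cnt m p)%N.
Proof.
elim: m => [|m IH]; first by rewrite cnt0; constructor; case.
rewrite cntS; case pm: (p m).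
  by rewrite addn1; constructor; exists m.
rewrite addn0; apply: (iffP IH) => -[j jm pj]; exists j => //; first by lia.
have : j != m by apply: contraTneq pj => ->; rewrite pm.
by lia.
Qed.

Lemma cnt_le1 m p : (forall i j, (i < m)%N -> (j < m)%N -> p i -> p j -> i = j) ->
  (cnt m p <= 1)%N.
Proof.
elim: m => [|m IH] u; first by rewrite cnt0.
rewrite cntS; case pm: (p m); last first.
  by rewrite addn0; apply: IH => i j im jm; apply: u; lia.
rewrite cntF // => j jm; apply/negP => pj.
by have := u j m (ltnW jm) (ltnSn _) pj pm; lia.
Qed.

Lemma cnt_gt0_le1 m p : (forall i j, (i < m)%N -> (j < m)%N -> p i -> p j -> i = j) ->
  ((0 < cnt m p)%N : nat) = cnt m p.
Proof. by move=> /cnt_le1; case: (cnt m p) => [|[]]. Qed.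

(** At most one index of [p] has exactly [l] predecessors in [p]. A threshold on a count thus
    becomes a sum over the index that crosses it, which can be exchanged with other sums; the
    balance identities for queues rest on this. *)
Lemma cnt_rank m p l : cnt m (fun k => p k && (cnt k p == l)) = (l < cnt m p)%N.
Proof.
elim: m => [|m IH]; first by rewrite !cnt0.
rewrite !cntS IH; case: (p m) => //=; last by rewrite !addn0.
by case: ltngtP; lia.
Qed.

Lemma cnt_split m p q : cnt m p = (cnt m (fun j => p j && q j) + cnt m (fun j => p j && ~~ q j))%N.
Proof.
elim: m => [|m IH]; first by rewrite !cnt0.
by rewrite !cntS IH; case: (p m); case: (q m); lia.
Qed.

Lemma cnt_widen m n p : (m <= n)%N -> (forall j, (m <= j < n)%N -> ~~ p j) -> cnt n p = cnt m p.
Proof.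
move=> mn; elim: n mn => [|n IH] mn pm; first by have -> : m = 0%N by lia.
have [->//|nm] := eqVneq m n.+1.
rewrite cntS IH; [|lia|by move=> j ?; apply: pm; lia].
by rewrite (negbTE (pm _ _)) ?addn0 //; lia.
Qed.

Lemma leq_cnt_widen m n p : (m <= n)%N -> (cnt m p <= cnt n p)%N.
Proof.
elim: n => [|n IH] mn; first by have -> : m = 0%N by lia.
have [->//|nm] := eqVneq m n.+1; rewrite cntS.
by apply: leq_trans (IH _) (leq_addr _ _); lia.
Qed.

Lemma exchange_cnt m n (p : nat -> nat -> bool) :
  (\sum_(i < m) cnt n (p i) = \sum_(j < n) cnt m (p ^~ j))%N.
Proof. by rewrite /cnt exchange_big. Qed.

Lemma cnt_eq1 m a p : cnt m (fun i => (i == a) && p i) = ((a < m)%N && p a : nat).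
Proof.
elim: m => [|m IH]; first by rewrite cnt0.
rewrite cntS IH; have [->|ma] := eqVneq m a.
  by rewrite ltnn /= ltnSn.
by rewrite /= addn0 [in RHS]ltnS [in RHS]leq_eqVlt [in RHS]eq_sym (negbTE ma).
Qed.

(** Summing over servers a count of their jobs meets each job once, at its own server. Jobs sent to
    the dummy server [N] drop out, hence the conditions [srv I n < N] in the definitions that
    follow. *)
Lemma sum_cnt_fiber m N (f : nat -> nat) (p : nat -> nat -> bool) :
  (\sum_(i < N) cnt m (fun n => (f n == i) && p i n))%N =
  cnt m (fun n => (f n < N)%N && p (f n) n).
Proof.
rewrite (exchange_cnt _ _ (fun i n => (f n == i) && p i n)); apply: eq_bigr => j _ /=.
rewrite -(cnt_eq1 N (f j) (p ^~ j)); apply: eq_cnt => i _.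
by rewrite eq_sym.
Qed.

End Counting.

(** * FIFO queues as a recursion over jobs *)

(* Job [k] arrives at time [tau k] with requirement [sv k]; its sampled servers are [sa k] and
   [sb k] and its coin is [tb k]. *)
Record inp (R : realType) := Inp {
  tau : nat -> R; sv : nat -> R; sa : nat -> nat; sb : nat -> nat; tb : nat -> bool }.

(** The rule of [route], read on a vector of queue lengths instead of on queues. *)
Definition rt (f : nat -> nat) (a c : nat) (b : bool) : nat :=
  if (f a < f c)%N then a else if (f c < f a)%N then c else if b then a else c.

Section System.
Variable R : realType.
Implicit Types (I : inp R) (i j k l m n : nat) (s x u : R).

(* [h] lists the servers and completion times of the jobs routed so far, so [clr h i t] is the time
   at which a job reaching server [i] at time [t] starts its service. *)
Definition clr (h : seq (nat * R)) i (t : R) : R :=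
  foldr (fun p acc => if p.1 == i then Num.max p.2 acc else acc) t h.

Fixpoint hist I k : seq (nat * R) :=
  if k is k'.+1 then
    let h := hist I k' in
    let i := rt (fun i => count (fun p => (p.1 == i) && (tau I k' < p.2)) h)
                (sa I k') (sb I k') (tb I k') in
    (i, clr h i (tau I k') + sv I k') :: h
  else [::].

(* Server, completion time and starting time of job [k]; [X I m i s] is the number of jobs among
   the first [m] that are at server [i] at time [s]. *)
Definition srv I k := (head (0%N, 0) (hist I k.+1)).1.
Definition cpl I k := (head (0%N, 0) (hist I k.+1)).2.
Definition sta I k := clr (hist I k) (srv I k) (tau I k).
Definition X I m i s := cnt m (fun j => (srv I j == i) && (s < cpl I j)).

Lemma histE I k : hist I k = rev [seq (srv I j, cpl I j) | j <- iota 0 k].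
Proof.
elim: k => [//|k IH].
by rewrite -addn1 iotaD map_cat rev_cat /= -IH add0n addn1 /srv /cpl /=.
Qed.

Lemma cplE I k : cpl I k = sta I k + sv I k.
Proof. by []. Qed.

Lemma srvE I k : srv I k = rt (fun i => X I k i (tau I k)) (sa I k) (sb I k) (tb I k).
Proof.
rewrite {1}/srv [hist I k.+1]/= /=; congr rt; apply/funext => i.
rewrite histE count_rev count_map /X /cnt -sum1_count /= big_mkcond -{1}[k]subn0.
by rewrite -/(index_iota 0 k) big_mkord; apply: eq_bigr => j _; case: ifP.
Qed.

Lemma clr_ge h i (t : R) : t <= clr h i t.
Proof.
elim: h => //= -[a c] h IH /=; case: ifP => // _.
by rewrite le_max IH orbT.
Qed.

Lemma clr_in h i (t c : R) : (i, c) \in h -> c <= clr h i t.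
Proof.
elim: h => //= -[a e] h IH; rewrite inE => /orP[/eqP[<- <-]|/IH ch] /=.
  by rewrite eqxx le_max lexx.
by case: ifP => // _; rewrite le_max ch orbT.
Qed.

Lemma clr_cases h i (t : R) : clr h i t = t \/ exists2 c, (i, c) \in h & clr h i t = c.
Proof.
elim: h => /= [|[a e] h IH]; first by left.
case: ifP => /= [/eqP ai|_].
  rewrite /Num.max; case: ifP => _; last by right; exists e => //; rewrite inE ai eqxx.
  by case: IH => [->|[c ch ->]]; [left|right; exists c; rewrite ?inE ?ch ?orbT].
by case: IH => [->|[c ch ->]]; [left|right; exists c; rewrite ?inE ?ch ?orbT].
Qed.

Lemma mem_hist I k i (c : R) :
  reflect (exists2 j, (j < k)%N & i = srv I j /\ c = cpl I j) ((i, c) \in hist I k).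
Proof.
rewrite histE mem_rev; apply: (iffP mapP) => [[j]|[j jk [-> ->]]].
  by rewrite mem_iota add0n => jk [-> ->]; exists j.
by exists j => //; rewrite mem_iota.
Qed.

Lemma tau_sta I k : tau I k <= sta I k. Proof. exact: clr_ge. Qed.

Lemma cpl_sta I j k : (j < k)%N -> srv I j = srv I k -> cpl I j <= sta I k.
Proof. by move=> jk e; apply: clr_in; apply/mem_hist; exists j. Qed.

Lemma sta_cases I k : sta I k = tau I k \/
  exists j, [/\ (j < k)%N, srv I j = srv I k & sta I k = cpl I j].
Proof.
case: (clr_cases (hist I k) (srv I k) (tau I k)) => [|[c]]; first by left.
by move=> /mem_hist[j jk [e ->]] h; right; exists j.
Qed.

Definition valid I := (forall j k, (j <= k)%N -> tau I j <= tau I k) /\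
  (forall k, 0 < sv I k).

(** Once [n] is in service the earlier jobs of its server have left, so for an arrival [k] during
    that service this is the queue length it meets ([X_rk], [lvl_rk]). *)
Definition rk I n k := cnt k (fun j => (n <= j)%N && (srv I j == srv I n)).
(* number of jobs, [n] included, at the server of [n] when [n] leaves the waiting line; it is [0]
   if [n] is served on arrival *)
Definition lev I M n := cnt M (fun j => [&& (n <= j)%N, srv I j == srv I n & tau I j < sta I n]).
Definition isv I m i s x := cnt m (fun j => [&& srv I j == i, sta I j <= s & x < cpl I j]).
Definition res I m i s (ox : option R) : bool :=
  if ox is Some x then (0 < isv I m i s x)%N else true.
(* [Yn] with [ox = Some x] counts the queues of length at least [l] whose job in service completes
   after [x]; divided by [N] it is close to [Z_l (s, x - s)].  The option [None], which drops the
   condition on the job in service, is [Z_l (s, 0)].  [Dn] counts the departures that leave at least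
   [l] jobs behind and approximates minus the integral of [d_r Z_(l+1) (u, 0)]. *)
Definition Yn I N m l s (ox : option R) :=
  cnt N (fun i => (l <= X I m i s)%N && res I m i s ox).
Definition startY I N M l u x :=
  cnt M (fun n => [&& (srv I n < N)%N, sta I n <= u, (l <= lev I M n)%N & x < cpl I n]).
Definition Dn I N M l u :=
  cnt M (fun n => [&& (srv I n < N)%N, sta I n <= u & (l <= lev I M n)%N]).
Definition lvl I k := X I k (srv I k) (tau I k).
Definition arrY I N m l (ox : option R) :=
  cnt m (fun k => [&& (srv I k < N)%N, lvl I k == l & res I k.+1 (srv I k) (tau I k) ox]).

Section Valid.
Variable I : inp R.
Hypothesis vI : valid I.

Lemma tau_mono j k : (j <= k)%N -> tau I j <= tau I k.
Proof. by have [h _] := vI; exact: h. Qed.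

Lemma sta_cpl k : sta I k < cpl I k.
Proof. by rewrite cplE ltrDl; have [_ h] := vI; exact: h. Qed.

Lemma tau_cpl k : tau I k < cpl I k.
Proof. exact: le_lt_trans (tau_sta _ _) (sta_cpl _). Qed.

Lemma cpl_cpl j k : (j < k)%N -> srv I j = srv I k -> cpl I j < cpl I k.
Proof. by move=> jk e; apply: le_lt_trans (cpl_sta jk e) (sta_cpl k). Qed.

Lemma in_service_inj i j s x : s <= x -> srv I i = srv I j ->
  sta I i <= s -> x < cpl I i -> sta I j <= s -> x < cpl I j -> i = j.
Proof.
move=> sx e si xi sj xj; case: (ltngtP i j) => // ij.
  by exfalso; have := cpl_sta ij e; lra.
by exfalso; have := cpl_sta ij (esym e); lra.
Qed.

Lemma isv_uniq m i s x : s <= x -> ((0 < isv I m i s x)%N : nat) = isv I m i s x.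
Proof.
move=> sx; apply: cnt_gt0_le1 => j k _ _ /and3P[/eqP ej sj xj] /and3P[/eqP ek sk xk].
by apply: (in_service_inj sx _ sj xj sk xk); rewrite ej ek.
Qed.

(* While [n] is in service the jobs present are exactly those from [n] on. *)
Lemma X_rk n m u : sta I n <= u -> u < cpl I n -> X I m (srv I n) u = rk I n m.
Proof.
move=> sn un; apply: eq_cnt => j _; rewrite andbC.
case: (boolP (srv I j == srv I n)) => /= [/eqP e|]; last by rewrite !andbF.
rewrite !andbT; case: (leqP n j) => [nj|jn].
  case: (ltngtP n j) nj => // [nj|<-] _; last by rewrite un.
  by apply/idP; have := cpl_cpl nj (esym e); lra.
by apply/negbTE; rewrite -leNgt; have := cpl_sta jn e; lra.
Qed.

Section PerJob.
Variable M : nat.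

Lemma lev_rank n l : ((l < lev I M n)%N : nat) =
  cnt M (fun k => [&& (n <= k)%N, srv I k == srv I n, tau I k < sta I n & rk I n k == l]).
Proof.
rewrite -cnt_rank; apply: eq_cnt => k kM; rewrite -!andbA; do 2! congr (_ && _).
case tk: (tau I k < sta I n) => //=; congr (_ == _); apply: eq_cnt => j jk.
have := tau_mono (ltnW jk) => jk'; have -> : tau I j < sta I n by lra.
by rewrite andbT.
Qed.

Lemma rk_rank n m l : ((l < rk I n m)%N : nat) =
  cnt m (fun k => [&& (n <= k)%N, srv I k == srv I n & rk I n k == l]).
Proof. by rewrite -cnt_rank; apply: eq_cnt => k _; rewrite -andbA. Qed.

(** The jobs from [n] on that have arrived by [u] exceed [l] in number exactly when one of them has
    rank [l]. That job is unique and came either before [n] started, which [lev] records, or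
    afterwards. *)
Lemma per_job n m u l : (m <= M)%N -> (forall j, (j < M)%N -> (j < m)%N = (tau I j <= u)) ->
  sta I n <= u -> ((l < rk I n m)%N : nat) =
  ((l < lev I M n)%N + cnt m (fun k =>
     [&& (n <= k)%N, srv I k == srv I n, (sta I n <= tau I k)%R & rk I n k == l]))%N.
Proof.
move=> mM val sn; rewrite rk_rank lev_rank (cnt_split _ _ (fun k => tau I k < sta I n)).
congr (_ + _)%N.
  rewrite (cnt_widen mM) => [|j /andP[mj jM]].
    by apply: eq_cnt => k _; rewrite -!andbA; do 2! congr (_ && _); rewrite andbC.
  have := val _ jM; rewrite ltnNge mj /= => /esym/negbT; rewrite -ltNge => ju.
  have -> : tau I j < sta I n = false by apply/negbTE; rewrite -leNgt; lra.
  by rewrite !andbF.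
by apply: eq_cnt => k _; rewrite -!andbA; do 2! congr (_ && _); rewrite -leNgt andbC.
Qed.

(* At the end of its service, [n] leaves behind the jobs present at the next start. *)
Lemma per_job_cpl n l : ((l < cnt M (fun j => [&& (n <= j)%N, srv I j == srv I n & (tau I j < cpl I n)%R]))%N : nat) =
  ((l < lev I M n)%N + cnt M (fun k =>
     [&& (n <= k)%N, srv I k == srv I n, (sta I n <= tau I k)%R, (tau I k < cpl I n)%R & rk I n k == l]))%N.
Proof.
have -> : ((l < cnt M (fun j => [&& (n <= j)%N, srv I j == srv I n & (tau I j < cpl I n)%R]))%N : nat) =
  cnt M (fun k => [&& (n <= k)%N, srv I k == srv I n, tau I k < cpl I n & rk I n k == l]).
  rewrite -cnt_rank; apply: eq_cnt => k kM; rewrite -!andbA; do 2! congr (_ && _).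
  case tk: (tau I k < cpl I n) => //=; congr (_ == _); apply: eq_cnt => j jk.
  have := tau_mono (ltnW jk) => jk'; have -> : tau I j < cpl I n by lra.
  by rewrite andbT.
rewrite lev_rank (cnt_split _ _ (fun k => tau I k < sta I n)).
have sc := sta_cpl n.
congr (_ + _)%N; apply: eq_cnt => k _; rewrite -!andbA; do 2! congr (_ && _).
  case tk: (tau I k < sta I n); rewrite ?andbF //= andbT.
  by have -> : tau I k < cpl I n by lra.
by rewrite -leNgt [RHS]andbCA; congr (_ && _); rewrite andbC.
Qed.

Lemma lvl_rk n k : (n <= k)%N -> srv I k = srv I n -> sta I n <= tau I k -> tau I k < cpl I n ->
  lvl I k = rk I n k.
Proof. by move=> nk e sn tn; rewrite /lvl e X_rk. Qed.

(** The job is the one of least index at this server that completes after [tau I k]: if it started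
    later, it would be waiting for a job of smaller index that also completes after [tau I k]. *)
Lemma in_service_after k : cnt k.+1 (fun n => [&& srv I n == srv I k, sta I n <= tau I k & tau I k < cpl I n]) = 1%N.
Proof.
rewrite -[cnt _ _]/(isv I k.+1 (srv I k) (tau I k) (tau I k)) -isv_uniq //.
suff -> : (0 < isv I k.+1 (srv I k) (tau I k) (tau I k))%N by [].
apply/cnt_gt0P.
have [n [nk /andP[/eqP en tn] nmin]] : exists n, [/\ (n <= k)%N, (srv I n == srv I k) && (tau I k < cpl I n) &
   forall j, (srv I j == srv I k) && (tau I k < cpl I j) -> (n <= j)%N].
  have ex : exists n, (srv I n == srv I k) && (tau I k < cpl I n).
    by exists k; rewrite eqxx tau_cpl.
  case: (ex_minnP ex) => n pn nmin; exists n; split => //.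
  by apply: nmin; rewrite eqxx tau_cpl.
exists n => //; rewrite en eqxx tn andbT /=.
case: (sta_cases I n) => [->|[j [jn ej ->]]]; first exact: tau_mono.
rewrite leNgt; apply/negP => tj.
by have := nmin j; rewrite ej en eqxx tj /= => /(_ isT); lia.
Qed.

End PerJob.

Lemma YnE N m l u x : u <= x -> Yn I N m l u (Some x) =
  cnt m (fun n => [&& (srv I n < N)%N, sta I n <= u, x < cpl I n & (l <= X I m (srv I n) u)%N]).
Proof.
move=> ux; rewrite /Yn /cnt.
transitivity (\sum_(i < N) cnt m (fun n => (srv I n == i) &&
   [&& (sta I n <= u)%R, (x < cpl I n)%R & (l <= X I m i u)%N]))%N; last first.
  by rewrite (sum_cnt_fiber _ _ (srv I) (fun i n => [&& (sta I n <= u)%R, (x < cpl I n)%R & (l <= X I m i u)%N])).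
apply: eq_bigr => i _; case: leqP => /= [lX|lX].
  by rewrite isv_uniq // /isv; apply: eq_cnt => j _; rewrite andbT.
by rewrite cntF // => j _; rewrite !andbF.
Qed.

(** Each queue with a job [n] in service at [u] is handled by [per_job]: either more than [l] jobs
    were there when [n] started, or one arrival during the service of [n] raised the length to
    [l + 1]. In the second case the job in service at that arrival is [n] itself, so the conditions
    on the completion time refer to the same job. *)
Lemma Yn_decomp N M m l u x : u <= x -> (m <= M)%N ->
  (forall j, (j < M)%N -> (j < m)%N = (tau I j <= u)) ->
  Yn I N m l.+1 u (Some x) = (startY I N M l.+1 u x + arrY I N m l (Some x))%N.
Proof.
move=> ux mM val; rewrite YnE //.
have -> : startY I N M l.+1 u x = cnt m (fun n =>
   [&& (srv I n < N)%N, sta I n <= u, x < cpl I n & (l < lev I M n)%N]).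
  rewrite /startY (cnt_widen mM) => [|j /andP[mj jM]].
    by apply: eq_cnt => n _; do 2! congr (_ && _); rewrite andbC.
  have := val _ jM; rewrite ltnNge mj /= => /esym/negbT; rewrite -ltNge => ju.
  have -> : sta I j <= u = false by apply/negbTE; rewrite -ltNge; have := tau_sta I j; lra.
  by rewrite !andbF.
(* Pairs of a job [n] in service and an arrival [k] that meets it at length [l]. The case [k = n] is
   included: it is an arrival at an idle server, with [l = 0]. *)
pose Q n k := [&& (srv I n < N)%N, sta I n <= u, x < cpl I n &
     [&& (n <= k)%N, srv I k == srv I n, sta I n <= tau I k & rk I n k == l]].
have -> : arrY I N m l (Some x) = (\sum_(n < m) cnt m (Q n))%N.
  rewrite (exchange_cnt _ _ Q) /Q; apply: eq_bigr => k _ /=.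
  have ku : tau I k <= u by rewrite -val //; have := ltn_ord k; lia.
  rewrite [RHS](@cnt_widen k.+1) //; last first.
    by move=> j /andP[kj _]; apply/negP => /and4P[_ _ _ /and4P[jk _ _ _]]; lia.
  transitivity (cnt k.+1 (fun n => [&& (srv I k < N)%N, lvl I k == l & [&& srv I n == srv I k, sta I n <= tau I k & x < cpl I n]])).
    case: (srv I k < N)%N (lvl I k == l) => -[] /=; rewrite ?(@cntF k.+1 (fun=> false)) //.
    by rewrite isv_uniq //; lra.
  apply: eq_cnt => n nk; rewrite [srv I k == _]eq_sym.
  case e : (srv I n == srv I k); rewrite ?andbF //= (eqP e).
  case sn : (sta I n <= tau I k); rewrite ?andbF //=.
  case xn : (x < cpl I n); rewrite ?andbF //=.
  have -> : sta I n <= u by lra.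
  have -> : (n <= k)%N by lia.
  by rewrite (@lvl_rk n k) ?(eqP e) ?andbT //; lra.
rewrite /cnt -big_split /=; apply: eq_bigr => n _.
have Q0 : ~~ [&& (srv I n < N)%N, sta I n <= u & x < cpl I n] -> (\sum_(j < m) Q n j = 0)%N.
  move=> h; apply: big1 => j _; rewrite /Q; move: h.
  by case: (srv I n < N)%N => //; case: (sta I n <= u) => //; case: (x < cpl I n).
case nN: (srv I n < N)%N; last by rewrite Q0 // nN.
case sn : (sta I n <= u); last by rewrite Q0 // sn andbF.
case xn : (x < cpl I n); last by rewrite Q0 // xn !andbF.
rewrite /= X_rk //; last by lra.
by rewrite (per_job l mM val sn) /Q nN sn xn.
Qed.

(** A departure that leaves [l] jobs behind and the start of the next job are one event. If the next
    job comes only after the departure, both conditions fail: its [lev] is [0], and on the other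
    side only [n] itself is counted. *)
Lemma lev_next M n n' l : (n < n')%N -> (n' < M)%N -> srv I n' = srv I n ->
  (forall j, (n < j < n')%N -> srv I j != srv I n) -> (0 < l)%N ->
  (l <= lev I M n')%N =
  (l < cnt M (fun j => [&& (n <= j)%N, srv I j == srv I n & (tau I j < cpl I n)%R]))%N /\
  ((l <= lev I M n')%N -> sta I n' = cpl I n).
Proof.
move=> nn' n'M e nxt l0.
have [tc|ct] := ltP (tau I n') (cpl I n).
  have st : sta I n' = cpl I n.
    apply/eqP; rewrite eq_le cpl_sta // andbT.
    case: (sta_cases I n') => [->|[j [jn' ej ->]]]; first exact: ltW.
    case: (ltngtP j n) => [jn|nj|->//].
      by apply/ltW/cpl_cpl => //; rewrite ej e.
    by have := nxt j; rewrite nj jn' ej e eqxx /= => /(_ isT).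
  split=> //.
  suff -> : cnt M (fun j => [&& (n <= j)%N, srv I j == srv I n & (tau I j < cpl I n)%R]) = (lev I M n').+1 by [].
  rewrite (cnt_split _ _ (fun j => j == n)) addnC -addn1; congr (_ + _)%N.
    rewrite /lev; apply: eq_cnt => j _; rewrite st e.
    case: (srv I j =P srv I n) => ej; rewrite ?andbF //= andbAC; congr (_ && _).
    apply/idP/idP => [/andP[nj jn]|jn]; last by lia.
    rewrite leqNgt; apply/negP => jn'; have := nxt j; rewrite jn' ej eqxx.
    have nj' : (n < j)%N by lia.
    by rewrite nj' => /(_ isT).
  rewrite (eq_cnt (q := fun j => (j == n) && (tau I n < cpl I n))); last first.
    by move=> j _; case: (j =P n) => [->|]; rewrite ?andbF // leqnn eqxx /= andbT.
  by rewrite cnt_eq1 tau_cpl; have -> : (n < M)%N by lia.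
have -> : lev I M n' = 0%N.
  apply: cntF => j jM; apply/negP => /and3P[n'j ej].
  rewrite ltNge; move/negP; apply; have tj := tau_mono n'j.
  case: (sta_cases I n') => [->//|[i [ji ei ->]]].
  apply: le_trans tj; apply: le_trans ct.
  case: (ltngtP i n) => [jn|nj|->//].
    by apply/ltW/cpl_cpl => //; rewrite ei e.
  by have := nxt i; rewrite nj ji ei e eqxx /= => /(_ isT).
split; last by lia.
apply/idP/idP; first by lia.
rewrite ltnNge => /negP[]; apply: leq_trans l0.
apply: cnt_le1 => i j iM jM /and3P[ni /eqP ei ti] /and3P[nj /eqP ej tj].
have aux a : (n <= a)%N -> srv I a = srv I n -> tau I a < cpl I n -> a = n.
  move=> na ea ta; case: (ltngtP a n) na => // na _.
  have : (a < n')%N by rewrite ltnNge; apply/negP => /tau_mono; lra.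
  by move=> an'; have := nxt a; rewrite na an' ea eqxx => /(_ isT).
by rewrite (aux i) // (aux j).
Qed.

Definition succ n n' := [&& (n < n')%N, srv I n' == srv I n &
  cnt n' (fun j => (n < j)%N && (srv I j == srv I n)) == 0%N].

Lemma succP n n' : reflect [/\ (n < n')%N, srv I n' = srv I n &
  forall j, (n < j < n')%N -> srv I j != srv I n] (succ n n').
Proof.
apply: (iffP and3P) => [[nn' /eqP e /eqP c]|[nn' e c]]; split => //.
- move=> j /andP[nj jn']; apply/negP => ej.
  have : (0 < 0)%N by rewrite -{2}c; apply/cnt_gt0P; exists j => //; rewrite nj.
  by [].
- by rewrite e.
- apply/eqP/cntF => j jn'; apply/negP => /andP[nj ej].
  by have := c j; rewrite nj jn' => /(_ isT); rewrite ej.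
Qed.

(** Departures leaving at least [l] jobs are sorted by the state when the departing job started.
    Either more than [l] jobs were present, which gives all such starts less those still in service
    at [u]; or an arrival during the service raised the queue, which gives all arrivals at level [l]
    less those whose job in service outlasts [u]. *)
Lemma Dn_decomp N M m l u : (0 < l)%N -> (m <= M)%N ->
  (forall j, (j < M)%N -> (j < m)%N = (tau I j <= u)) ->
  (Dn I N M l u + startY I N M l.+1 u u + arrY I N m l (Some u) = Dn I N M l.+1 u + arrY I N m l None)%N.
Proof.
move=> l0 mM val.
pose C n := cnt M (fun j => [&& (n <= j)%N, srv I j == srv I n & (tau I j < cpl I n)%R]).
(* A start counted on the left has [lev > 0], hence a predecessor at its server; [lev_next]
   identifies the start with the departure of that predecessor. *)
have -> : Dn I N M l u = cnt M (fun n => [&& (srv I n < N)%N, cpl I n <= u & (l < C n)%N]).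
  pose Q n n' := [&& succ n n', (srv I n' < N)%N, sta I n' <= u & (l <= lev I M n')%N].
  transitivity (\sum_(n < M) cnt M (Q n))%N.
    rewrite (exchange_cnt _ _ Q) /Q; apply: eq_bigr => n' _ /=.
    case P: [&& (srv I n' < N)%N, sta I n' <= u & (l <= lev I M n')%N]; last first.
      by rewrite cntF // => j _; rewrite andbF.
    have [_ _ lv] := and3P P.
    have : (0 < lev I M n')%N by lia.
    move=> /cnt_gt0P[j jM /and3P[n'j ej tj]].
    case: (sta_cases I n') => [h|[i [ii ei ci]]]; first by exfalso; have := tau_mono n'j; lra.
    rewrite -cnt_gt0_le1; last first.
      move=> a b _ _ /andP[/succP[an ea sa] _] /andP[/succP[bn eb sb] _].
      case: (ltngtP a b) => // ab.
        by have := sa b; rewrite ab bn -ea eb eqxx => /(_ isT).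
      by have := sb a; rewrite ab an -ea eb eqxx => /(_ isT).
    suff -> : (0 < cnt M (fun i0 => succ i0 n' && true))%N by [].
    have ex : exists i, (i < n')%N && (srv I i == srv I n') by exists i; rewrite ii ei eqxx.
    have bd : forall i, (i < n')%N && (srv I i == srv I n') -> (i <= n')%N by move=> ? /andP[/ltnW].
    case: (ex_maxnP ex bd) => p /andP[pn /eqP ep] pmax.
    apply/cnt_gt0P; exists p; first exact: ltn_trans (ltn_ord n').
    rewrite andbT; apply/succP; split => // q /andP[pq qn]; apply/negP => /eqP eq'.
    by have := pmax q; rewrite qn eq' ep eqxx => /(_ isT); lia.
  apply: eq_bigr => n _.
  have e1 n' : succ n n' -> (n' < M)%N ->
     ([&& (srv I n' < N)%N, sta I n' <= u & (l <= lev I M n')%N] =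
      [&& (srv I n < N)%N, cpl I n <= u & (l < C n)%N]) .
    move=> /succP[nn' e sn] n'M; have [h1 h2] := lev_next nn' n'M e sn l0.
    rewrite e -h1; case lv: (l <= lev I M n')%N; last by rewrite !andbF.
    by rewrite h2.
  rewrite (eq_cnt (q := fun n' => [&& (srv I n < N)%N, cpl I n <= u & (l < C n)%N] && succ n n')); last first.
    by move=> n' n'M; rewrite /Q andbC; case sn: (succ n n'); rewrite ?andbF //= !andbT e1.
  case P: [&& (srv I n < N)%N, cpl I n <= u & (l < C n)%N]; last by rewrite cntF.
  have -> : cnt M (fun n' => true && succ n n') = (0 < cnt M (fun j => (n < j)%N && (srv I j == srv I n)))%N.
    by rewrite -cnt_rank; apply: eq_cnt => j _; rewrite /succ -andbA.
  have [_ _ lC] := and3P P.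
  suff -> : (0 < cnt M (fun j => (n < j)%N && (srv I j == srv I n)))%N by [].
  have : (1 < C n)%N by lia.
  rewrite {1}/C (cnt_split _ _ (fun j => j == n)) => h.
  have h1 : (cnt M (fun j => [&& (n <= j)%N, srv I j == srv I n & (tau I j < cpl I n)%R] && (j == n)) <= 1)%N.
    by apply: cnt_le1 => a b _ _ /andP[_ /eqP ->] /andP[_ /eqP ->].
  have : (0 < cnt M (fun j => [&& (n <= j)%N, srv I j == srv I n & (tau I j < cpl I n)%R] && (j != n)))%N by lia.
  move=> /cnt_gt0P[j jM /andP[/and3P[nj ej _] jn]].
  by apply/cnt_gt0P; exists j => //; rewrite ej andbT; lia.
have -> : Dn I N M l.+1 u = (cnt M (fun n => [&& (srv I n < N)%N, (cpl I n <= u)%R & (l < lev I M n)%N]) + startY I N M l.+1 u u)%N.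
  rewrite /Dn (cnt_split _ _ (fun n => cpl I n <= u)); congr (_ + _)%N; apply: eq_cnt => n _.
    have sc := sta_cpl n; case: (srv I n < N)%N => //=; case: (l < lev I M n)%N; rewrite ?andbF ?andbT //=.
    case c: (cpl I n <= u); rewrite ?andbF ?andbT //; apply/idP; lra.
  by rewrite -ltNge -!andbA.
rewrite [RHS]addnAC [LHS]addnAC; congr (_ + _)%N.
pose Q n k := [&& (srv I n < N)%N, cpl I n <= u, (n <= k)%N, srv I k == srv I n, sta I n <= tau I k, tau I k < cpl I n & rk I n k == l].
have -> : cnt M (fun n => [&& (srv I n < N)%N, cpl I n <= u & (l < C n)%N]) =
   (cnt M (fun n => [&& (srv I n < N)%N, (cpl I n <= u)%R & (l < lev I M n)%N]) + \sum_(n < M) cnt M (Q n))%N.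
  rewrite /cnt -big_split /=; apply: eq_bigr => n _.
  case sn: (srv I n < N)%N; last by rewrite /= [X in (_ + X)%N]big1 // /Q => k _; rewrite sn.
  case cn: (cpl I n <= u); last by rewrite /= [X in (_ + X)%N]big1 // /Q => k _; rewrite cn andbF.
  by rewrite /= /C per_job_cpl /Q sn cn.
rewrite -addnA; congr (_ + _)%N; rewrite (exchange_cnt _ _ Q).
rewrite -[X in (X + _)%N]/(\sum_(k < M) cnt M (Q^~ k))%N.
have big_cnt (f : nat -> nat) : (forall j, (m <= j < M)%N -> f j = 0)%N -> (\sum_(k < M) f k = \sum_(k < m) f k)%N.
  move=> f0; rewrite -!(big_mkord xpredT) (big_cat_nat (leq0n m) mM) //=; rewrite [X in (_ + X)%N]big1_seq ?addn0 // => j.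
  by rewrite mem_index_iota => /andP[_ jm]; rewrite f0.
rewrite (big_cnt (fun k => cnt M (Q^~ k))); last first.
  move=> k /andP[mk kM]; apply: cntF => n _; apply/negP => /and5P[_ cu _ _ /and3P[_ tc _]].
  have := val _ kM; rewrite ltnNge mk /= => /esym/negbT; rewrite -ltNge; lra.
rewrite /arrY [X in (_ + X)%N]/cnt -big_split [RHS]/cnt; apply: eq_bigr => k _ /=.
have kM : (k < M)%N by apply: leq_trans mM.
have ku : tau I k <= u by rewrite -val.
rewrite (@cnt_widen k.+1) //; last first.
  by move=> j /andP[kj _]; apply/negP => /and5P[_ _ jk _ _]; lia.
(* Every arrival meets exactly one job in service, itself if the server is idle; that job has or has
   not completed by [u]. *)
have is1 := in_service_after k.
rewrite (cnt_split _ _ (fun n => cpl I n <= u)) in is1.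
have e2 : cnt k.+1 (fun j => [&& srv I j == srv I k, sta I j <= tau I k & tau I k < cpl I j] && ~~ (cpl I j <= u)) =
   isv I k.+1 (srv I k) (tau I k) u.
  apply: eq_cnt => n _; rewrite -ltNge -!andbA; do 2! congr (_ && _).
  by apply/andP/idP => [[]//|h]; split => //; lra.
rewrite e2 -isv_uniq // in is1.
transitivity (((srv I k < N)%N && (lvl I k == l)) * (cnt k.+1
          (fun j => [&& srv I j == srv I k, (sta I j <= tau I k)%R & (tau I k < cpl I j)%R] && (cpl I j <= u)%R) + (0 < isv I k.+1 (srv I k) (tau I k) u)))%N; last first.
  by rewrite is1 muln1 andbT.
rewrite mulnDr andbA mulnb; congr (_ + _)%N.
case A: (_ && _); last first.
  rewrite cntF // => n nk; apply/negP => /and5P[nN _ nk' /eqP e /and3P[sn tn rl]].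
  by move: A; rewrite e nN (@lvl_rk n k) // rl.
rewrite mul1n; apply: eq_cnt => n nk; have [kN lv] := andP A.
rewrite /Q [srv I k == _]eq_sym; case e: (srv I n == srv I k); rewrite ?andbF //= (eqP e) kN.
case sn : (sta I n <= tau I k); rewrite ?andbF //=.
case tn : (tau I k < cpl I n); rewrite ?andbF //=.
have nk' : (n <= k)%N by lia.
by rewrite nk' -(@lvl_rk n k) ?lv ?andbT // (eqP e).
Qed.

(** Among the jobs of a queue still present at [u], the one with [l] others ahead met at least those
    [l] on arrival, and distinct levels give distinct jobs. *)
Lemma tail_bound N m u L B : (forall k, (k < m)%N -> tau I k <= u) ->
  (\sum_(L <= l < B) Yn I N m l.+1 u None <= cnt m (fun k => (srv I k < N)%N && (L <= lvl I k)%N))%N.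
Proof.
move=> ku.
pose c k := cnt k (fun j => (srv I j == srv I k) && (u < cpl I j)).
have YE l : Yn I N m l.+1 u None = cnt m (fun k => (srv I k < N)%N && ((u < cpl I k) && (c k == l))).
  rewrite -[RHS](sum_cnt_fiber m N (srv I) (fun i k => (u < cpl I k) && (cnt k (fun j => (srv I j == i) && (u < cpl I j)) == l))).
  apply: eq_bigr => i _; rewrite /= andbT /X -cnt_rank; apply: eq_cnt => j _.
  by rewrite andbA.
under eq_bigr => l _ do rewrite YE.
rewrite /cnt exchange_big /=; apply: leq_sum => k _.
have ck : (c k <= lvl I k)%N.
  apply: leq_cnt => j jk /andP[-> uj] /=; have := ku k (ltn_ord k); lra.
case: (srv I k < N)%N; last by rewrite big1.
case: (u < cpl I k); last by rewrite big1.
rewrite /=; case: (leqP L (lvl I k)) => Lk; last first.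
  by rewrite big1_seq // => l /andP[_]; rewrite mem_index_iota; case: eqP => //; lia.
elim: B => [|B IH]; first by rewrite big_geq.
case: (leqP L B) => LB; last by rewrite big_geq //; lia.
rewrite big_nat_recr //=; case: (c k =P B) => [cB|_]; last by rewrite addn0.
rewrite big1_seq // => l /andP[_]; rewrite mem_index_iota; case: eqP => //; lia.
Qed.

Definition chg N m m' s s' :=
  cnt m' (fun j => (srv I j < N)%N && ((m <= j)%N || ((s < cpl I j) && (cpl I j <= s')))).

(** A service can begin only at an arrival or at a completion. A queue with neither in the interval
    therefore keeps both its length and its job in service, and the number of such events bounds the
    change. *)
Lemma Yn_change N m m' s s' l ox : (m <= m')%N -> s <= s' ->
  (forall j, (j < m')%N -> (j < m)%N = (tau I j <= s)) ->
  (if ox is Some x then s' <= x else true) ->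
  (Yn I N m l s ox <= Yn I N m' l s' ox + chg N m m' s s')%N /\
  (Yn I N m' l s' ox <= Yn I N m l s ox + chg N m m' s s')%N.
Proof.
move=> mm' ss' val sx.
pose c i := cnt m' (fun j => (srv I j == i) && ((m <= j)%N || ((s < cpl I j) && (cpl I j <= s')))).
have -> : chg N m m' s s' = (\sum_(i < N) c i)%N.
  by rewrite (sum_cnt_fiber m' N (srv I) (fun _ j => (m <= j)%N || ((s < cpl I j) && (cpl I j <= s')))).
suff H i : c i = 0%N -> (l <= X I m i s)%N && res I m i s ox = (l <= X I m' i s')%N && res I m' i s' ox.
  rewrite /Yn /cnt -!big_split; split; apply: leq_sum => i _ /=; case ci: (c i) => [|n];
    rewrite ?(H _ ci) ?addn0 //; case: (_ && _); case: (_ && _); lia.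
move=> c0.
have nc j : (j < m')%N -> srv I j = i -> (j < m)%N && ((cpl I j <= s) || (s' < cpl I j)).
  move=> jm ej; apply/negPn/negP => h.
  suff : (0 < c i)%N by rewrite c0.
  apply/cnt_gt0P; exists j => //; rewrite ej eqxx /=.
  move: h; rewrite negb_and negb_or -!ltNge -leqNgt.
  by rewrite (leNgt (cpl I j) s').
have eX : X I m i s = X I m' i s'.
  rewrite /X (cnt_widen mm') => [|j /andP[mj jm]].
    apply: eq_cnt => j jm; case: eqP => //= ej.
    have /andP[_ /orP[]] := nc j (leq_trans jm mm') ej; lra.
  by apply/negP => /andP[/eqP ej _]; have := nc j jm ej; lia.
congr (_ && _); first by rewrite eX.
case: ox sx => //= x sx; congr (0 < _)%N; rewrite /isv [RHS](cnt_widen mm') => [|j /andP[mj jm]].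
  apply: eq_cnt => j jm; case: eqP => //= ej; case xj: (x < cpl I j); rewrite ?andbF //= !andbT.
  apply/idP/idP => [|sj]; first by lra.
  case: (sta_cases I j) => [->|[a [aj ea ca]]]; first by rewrite -val //; lia.
  have am : (a < m')%N by lia.
  have /andP[_ /orP[]] := nc a am (etrans ea ej); lra.
by apply/negP => /andP[/eqP ej _]; have := nc j jm ej; lia.
Qed.

End Valid.

(** * Causality: a service time has no influence before its service starts *)

Section Causality.
Variables (I J : inp R) (k : nat).
Hypotheses (vI : valid I) (vJ : valid J).
Hypotheses (eqt : forall j, tau I j = tau J j) (eqa : forall j, sa I j = sa J j)
  (eqb : forall j, sb I j = sb J j) (eqc : forall j, tb I j = tb J j)
  (eqv : forall j, j != k -> sv I j = sv J j).

Lemma causal_prefix m : (m <= k)%N -> hist I m = hist J m.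
Proof.
elim: m => // m IH mk /=; rewrite IH ?(ltnW mk) // eqt eqa eqb eqc eqv //; lia.
Qed.

Lemma causal_srv_lt j : (j <= k)%N -> srv I j = srv J j.
Proof. by move=> jk; rewrite /srv /= causal_prefix // eqt eqa eqb eqc. Qed.

Lemma causal_sta_le j : (j <= k)%N -> sta I j = sta J j.
Proof. by move=> jk; rewrite /sta causal_srv_lt // causal_prefix // eqt. Qed.

Let S := sta I k.
Let SJ : S = sta J k. Proof. exact: causal_sta_le. Qed.

(** Jobs numbered after [k] may arrive, and start at other servers, while [k] still waits, so equal
    histories up to [k] are not enough. The induction over all [j] compares only what happens up to
    time [S]; the last two clauses make a start before [S] in either system a start in both. *)
Let inv j := [/\ tau I j <= S -> srv I j = srv J j, sta I j <= S -> sta J j = sta I j &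
  sta J j <= S -> sta I j = sta J j].

(** For [j = k] the two service times differ, but both completions come after [S] because both are
    positive. A job that starts after [S] in both systems also makes both sides true. *)
Let lt_cpl j s : inv j -> s <= S -> (s < cpl I j) = (s < cpl J j).
Proof.
move=> [_ i2 i3] sS.
have [->|jk] := eqVneq j k.
  have := sta_cpl vI k; have := sta_cpl vJ k; rewrite -SJ -/S => *.
  by apply/idP/idP; lra.
have [h|h] := leP (sta I j) S; first by rewrite !cplE (i2 h) eqv.
have [h'|h'] := leP (sta J j) S; first by rewrite !cplE (i3 h') eqv.
have := sta_cpl vI j; have := sta_cpl vJ j => *; apply/idP/idP; lra.
Qed.

Let inv_all j : inv j.
Proof.
have [n] := ubnP j; elim: n j => // n IH j jn.
have es : tau I j <= S -> srv I j = srv J j.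
  move=> tS; rewrite !srvE eqa eqb eqc eqt; congr rt; apply/funext => i.
  apply: eq_cnt => a aj; have ia : inv a by apply: IH; lia.
  have ta : tau I a <= S by apply: le_trans tS; apply: tau_mono => //; lia.
  by rewrite -eqt; have [-> // _ _] := ia; rewrite lt_cpl.
(* Stated for two arbitrary systems because it is used once in each direction. *)
have half (I1 I2 : inp R) : valid I1 -> (forall j, tau I1 j = tau I2 j) ->
    (forall j, j != k -> sv I1 j = sv I2 j) -> S = sta I1 k ->
    (forall a, (a < j)%N -> tau I1 a <= S -> srv I1 a = srv I2 a) ->
    (forall a, (a < j)%N -> sta I1 a <= S -> sta I2 a = sta I1 a) ->
    (tau I1 j <= S -> srv I1 j = srv I2 j) ->
    sta I1 j <= S -> sta I2 j = sta I1 j.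
  move=> v1 et ev eS hs ht hj sS.
  have tj : tau I1 j <= S by apply: le_trans sS; exact: tau_sta.
  have e := hj tj.
  have ha a : (a < j)%N -> tau I1 a <= S.
    by move=> aj; apply: le_trans tj; apply: tau_mono => //; lia.
  have cplS a : (a < j)%N -> srv I1 a = srv I1 j -> cpl I2 a = cpl I1 a.
    move=> aj ea; have c1 : cpl I1 a <= S := le_trans (cpl_sta aj ea) sS.
    have ak : a != k by apply: contraTneq c1 => ->; rewrite -ltNge eS sta_cpl.
    by rewrite !cplE ev // ht //; apply: le_trans c1; apply/ltW/sta_cpl.
  apply/le_anti/andP; split.
    case: (sta_cases I2 j) => [->|[a [aj ea ->]]]; first by rewrite -et tau_sta.
    have ea1 : srv I1 a = srv I1 j by rewrite hs ?ha // e.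
    by rewrite cplS // cpl_sta.
  case: (sta_cases I1 j) => [->|[a [aj ea ->]]]; first by rewrite et tau_sta.
  by rewrite -cplS // cpl_sta // -hs ?ha // -e.
split => //.
  apply: (half I J) => //; last 1 first.
  - by move=> a aj; have [] : inv a by apply: IH; lia.
  - by move=> a aj; have [] : inv a by apply: IH; lia.
apply: (half J I) => //.
- by move=> a ak; rewrite eqv.
- by move=> a aj; rewrite -eqt => ta; have [-> //] : inv a by apply: IH; lia.
- by move=> a aj; have [] : inv a by apply: IH; lia.
- by rewrite -eqt => /es.
Qed.

Lemma causal_srv j : tau I j <= S -> srv I j = srv J j.
Proof. by have [] := inv_all j. Qed.

Lemma causal_sta j : (sta I j <= S) = (sta J j <= S).
Proof. by have [_ i2 i3] := inv_all j; apply/idP/idP => h; [rewrite i2|rewrite i3]. Qed.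

Lemma causal_staE j : sta I j <= S -> sta I j = sta J j.
Proof. by have [_ i2 _] := inv_all j => /i2. Qed.

Lemma causal_cplE j : j != k -> sta I j <= S -> cpl I j = cpl J j.
Proof. by move=> jk h; rewrite !cplE causal_staE // eqv. Qed.

Lemma causal_ltcpl j s : s <= S -> (s < cpl I j) = (s < cpl J j).
Proof. exact: lt_cpl (inv_all j). Qed.

Lemma causal_X m i s : s <= S -> (forall j, (j < m)%N -> tau I j <= S) -> X I m i s = X J m i s.
Proof. by move=> sS h; apply: eq_cnt => j jm; rewrite causal_srv ?h // causal_ltcpl. Qed.

Lemma causal_lvl j : tau I j <= S -> lvl I j = lvl J j.
Proof.
move=> tS; rewrite /lvl -causal_srv // -eqt causal_X // => a aj.
by apply: le_trans tS; apply: tau_mono => //; lia.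
Qed.

Lemma causal_lev M n : sta I n <= S -> lev I M n = lev J M n.
Proof.
move=> nS; apply: eq_cnt => j _; rewrite -eqt -(causal_staE nS) -(causal_srv (j := n)).
  case t: (tau I j < sta I n); rewrite ?andbF // causal_srv //; lra.
by apply: le_trans nS; exact: tau_sta.
Qed.

End Causality.

End System.

(** Among the [N^2] pairs of samples with two values of the coin, a pair containing [a] selects [a]
    for both values against a longer queue and for one value against an equal one; this is the
    weight [c]. Each position of [a] in the pair gives the same total, and the diagonal pair is
    counted correctly with weight [1 + 1]. *)
Lemma route_count (N : nat) (f : nat -> nat) a : (a < N)%N ->
  (\sum_(i < N) \sum_(j < N) ((rt f i j true == a) + (rt f i j false == a)) =
   2 * (cnt N (fun j => (f a <= f j)%N) + cnt N (fun j => (f a < f j)%N)))%N.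
Proof.
move=> aN.
pose c j := (((f a < f j) * 2) + (f j == f a))%N.
have e i j : ((rt f i j true == a) + (rt f i j false == a) = (i == a) * c j + (j == a) * c i)%N.
  rewrite /rt /c; case: (ltngtP (f i) (f j)) => fij; case: (i =P a) => [ia|ia]; case: (j =P a) => [ja|ja];
   subst; rewrite ?eqxx; try (case: eqP => //; lia); lia.
under eq_bigr => i _ do under eq_bigr => j _ do rewrite e.
have s1 (g : nat -> nat) : (\sum_(i < N) ((i : nat) == a) * g i = g a)%N.
  by rewrite (bigD1 (Ordinal aN)) //= eqxx mul1n big1 ?addn0 // => i /negbTE; rewrite -val_eqE /= => ->.
transitivity (\sum_(i < N) (((i : nat) == a) * (\sum_(j < N) c j) + c i))%N.
  by apply: eq_bigr => i _; rewrite big_split /= -big_distrr /= (s1 (fun=> c i)).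
rewrite big_split /= (s1 (fun=> (\sum_(j < N) c j)%N)).
suff -> : (\sum_(j < N) c j)%N = (cnt N (fun j => (f a <= f j)%N) + cnt N (fun j => (f a < f j)%N))%N by lia.
rewrite /cnt -big_split /=; apply: eq_bigr => j _; rewrite /c; case: ltngtP; lia.
Qed.

(** * Expectation and freezing *)

Section DiscreteMeasurable.
Context d (T : measurableType d).

(** Measurability by fibres, for values in a type that carries no sigma-algebra; for countable types
    it gives all preimages ([md_preimage]). *)
Definition md (D : Type) (f : T -> D) := forall x, measurable (f @^-1` [set x]).

Lemma md_preimage (D : countType) (f : T -> D) (A : set D) : md f -> measurable (f @^-1` A).
Proof.
move=> mf.
have -> : f @^-1` A = \bigcup_n (if @unpickle D n is Some x then
    (if `[< A x >] then f @^-1` [set x] else set0) else set0).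
  apply/seteqP; split => [w Afw|w [n _]].
    by exists (pickle (f w)) => //; rewrite pickleK; case: asboolP.
  by case: unpickle => // x; case: asboolP => // Ax /= ->.
apply: bigcup_measurable => n _; case: unpickle => // x.
by case: asboolP => _; [exact: mf|exact: measurable0].
Qed.

Lemma md_cst (D : Type) (x : D) : md (fun=> x).
Proof.
move=> y; have [->|xy] := pselect (x = y).
  by rewrite (_ : _ @^-1` _ = setT); [exact: measurableT|apply/seteqP; split].
by rewrite (_ : _ @^-1` _ = set0); [exact: measurable0|apply/seteqP; split].
Qed.

Lemma md_comp (D : countType) (E : Type) (f : T -> D) (h : D -> E) : md f -> md (fun w => h (f w)).
Proof. by move=> mf y; exact: (md_preimage (h @^-1` [set y]) mf). Qed.

Lemma md_pair (D E : Type) (f : T -> D) (g : T -> E) : md f -> md g -> md (fun w => (f w, g w)).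
Proof.
move=> mf mg [x y].
rewrite (_ : _ @^-1` _ = f @^-1` [set x] `&` g @^-1` [set y]).
  by apply: measurableI; [exact: mf|exact: mg].
by apply/seteqP; split => w /= => [[-> ->]|[-> ->]].
Qed.

Lemma md_comp2 (D E : countType) F (f : T -> D) (g : T -> E) (h : D -> E -> F) :
  md f -> md g -> md (fun w => h (f w) (g w)).
Proof. by move=> mf mg; apply: (md_comp (fun p => h p.1 p.2) (md_pair mf mg)). Qed.

Lemma md_comp3 (D E G : countType) F (f : T -> D) (g : T -> E) (k : T -> G) (h : D -> E -> G -> F) :
  md f -> md g -> md k -> md (fun w => h (f w) (g w) (k w)).
Proof. by move=> mf mg mk; apply: (md_comp2 (fun p z => h p.1 p.2 z) (md_pair mf mg) mk). Qed.

Lemma mdP (p : T -> bool) : measurable [set w | p w] -> md p.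
Proof.
move=> mp [].
  by rewrite (_ : _ @^-1` _ = [set w | p w]).
rewrite (_ : _ @^-1` _ = ~` [set w | p w]); first exact: measurableC.
by apply/seteqP; split => w /=; case: (p w).
Qed.

Lemma md_set (p : T -> bool) : md p -> measurable [set w | p w].
Proof. by move/(_ true). Qed.

Lemma md_and (p q : T -> bool) : md p -> md q -> md (fun w => p w && q w).
Proof. exact: md_comp2. Qed.

Lemma md_or (p q : T -> bool) : md p -> md q -> md (fun w => p w || q w).
Proof. exact: md_comp2. Qed.

Lemma md_neg (p : T -> bool) : md p -> md (fun w => ~~ p w).
Proof. exact: md_comp. Qed.

Lemma md_cnt m (p : nat -> T -> bool) : (forall j, (j < m)%N -> md (p j)) -> md (fun w => cnt m (fun j => p j w)).
Proof.
elim: m => [|m IH] mp.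
  by rewrite (_ : (fun w => _) = fun=> 0%N); [exact: md_cst|apply/funext => w; rewrite cnt0].
rewrite (_ : (fun w => _) = fun w => (cnt m (fun j => p j w) + nat_of_bool (p m w))%N).
  apply: (@md_comp2 nat bool nat _ (p m) (fun a (b : bool) => a + b)%N); last exact: mp.
  by apply: IH => j jm; apply: mp; lia.
by apply/funext => w; rewrite cntS.
Qed.

Variable R : realType.
Implicit Types f g : T -> R.

Lemma md_ltr f g : measurable_fun setT f -> measurable_fun setT g -> md (fun w => f w < g w).
Proof.
move=> mf mg; apply: mdP; have := measurable_fun_ltr mf mg.
by move/(_ measurableT [set true] I); rewrite setTI.
Qed.

Lemma md_ler f g : measurable_fun setT f -> measurable_fun setT g -> md (fun w => f w <= g w).
Proof.
move=> mf mg; rewrite (_ : (fun w => _) = fun w => ~~ (g w < f w)).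
  by apply: md_neg; apply: md_ltr.
by apply/funext => w; rewrite leNgt.
Qed.

Lemma measurable_md (D : countType) (F : D -> R) (f : T -> D) : md f -> measurable_fun setT (fun w => F (f w)).
Proof. by move=> mf _ B _; rewrite setTI; exact: (md_preimage (F @^-1` B) mf). Qed.

Lemma measurable_if (p : T -> bool) f g : md p -> measurable_fun setT f -> measurable_fun setT g ->
  measurable_fun setT (fun w => if p w then f w else g w).
Proof.
move=> mp mf mg; rewrite (_ : (fun w => _) = fun w => (p w)%:R * f w + (~~ p w)%:R * g w).
  apply: measurable_funD; apply: measurable_funM => //.
    exact: (@measurable_md bool (fun b => b%:R)).
  exact: (@measurable_md bool (fun b => (~~ b)%:R)).
by apply/funext => w; case: (p w); rewrite ?mul1r ?mul0r ?addr0 ?add0r.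
Qed.

Lemma measurable_select (D : countType) (F : D -> T -> R) (f : T -> D) : md f ->
  (forall x, measurable_fun setT (F x)) -> measurable_fun setT (fun w => F (f w) w).
Proof.
move=> mf mF _ B mB; rewrite setTI.
rewrite (_ : _ @^-1` B = \bigcup_n (if @unpickle D n is Some x then
    f @^-1` [set x] `&` F x @^-1` B else set0)).
  apply: bigcup_measurable => n _; case: unpickle => // x.
  by apply: measurableI; [exact: mf|rewrite -[X in measurable X]setTI; exact: mF].
apply/seteqP; split => [w Bw|w [n _]]; first by exists (pickle (f w)) => //; rewrite pickleK.
by case: unpickle => // x [<-].
Qed.

(** In the capped system all observables are bounded, so this one predicate settles every
    integrability condition on [Ex]. *)
Definition bm f := measurable_fun setT f /\ exists M, forall w, `|f w| <= M.

Lemma bm_meas f : bm f -> measurable_fun setT f. Proof. by case. Qed.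

Lemma bm_cst (c : R) : bm (fun=> c).
Proof. by split; [exact: measurable_cst|exists `|c|]. Qed.

Lemma bmD f g : bm f -> bm g -> bm (fun w => f w + g w).
Proof.
move=> [mf [A Af]] [mg [B Bg]]; split; first exact: measurable_funD.
by exists (A + B) => w; apply: le_trans (ler_normD _ _) _; exact: lerD.
Qed.

Lemma bmN f : bm f -> bm (fun w => - f w).
Proof.
move=> [mf [A Af]]; split; first exact: measurableT_comp.
by exists A => w; rewrite normrN.
Qed.

Lemma bmB f g : bm f -> bm g -> bm (fun w => f w - g w).
Proof. by move=> bf bg; apply: bmD => //; exact: bmN. Qed.

Lemma bmM f g : bm f -> bm g -> bm (fun w => f w * g w).
Proof.
move=> [mf [A Af]] [mg [B Bg]]; split; first exact: measurable_funM.
by exists (A * B) => w; rewrite normrM; apply: ler_pM.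
Qed.

Lemma bmX f n : bm f -> bm (fun w => f w ^+ n).
Proof.
move=> bf; elim: n => [|n IH].
  by rewrite (_ : (fun w => _) = fun=> 1); [exact: bm_cst|apply/funext => w; rewrite expr0].
rewrite (_ : (fun w => _) = fun w => f w * f w ^+ n); first exact: bmM.
by apply/funext => w; rewrite exprS.
Qed.

Lemma bm_abs f : bm f -> bm (fun w => `|f w|).
Proof.
move=> [mf [A Af]]; split; first exact: measurableT_comp.
by exists A => w; rewrite normr_id.
Qed.

Lemma bm_sum (I : Type) (s : seq I) (p : pred I) (F : I -> T -> R) : (forall i, bm (F i)) ->
  bm (fun w => \sum_(i <- s | p i) F i w).
Proof.
move=> bF; elim: s => [|i s IH].
  by rewrite (_ : (fun w => _) = fun=> 0); [exact: bm_cst|apply/funext => w; rewrite big_nil].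
case pi: (p i).
  rewrite (_ : (fun w => _) = fun w => F i w + \sum_(i <- s | p i) F i w); first exact: bmD.
  by apply/funext => w; rewrite big_cons pi.
rewrite (_ : (fun w => _) = fun w => \sum_(i <- s | p i) F i w) //.
by apply/funext => w; rewrite big_cons pi.
Qed.

Lemma bm_ind (p : T -> bool) : md p -> bm (fun w => (p w)%:R : R).
Proof.
move=> mp; split; first exact: (@measurable_md bool (fun b => b%:R)).
by exists 1 => w; case: (p w); rewrite ?normr1 ?normr0.
Qed.

Lemma bm_cnt m (p : nat -> T -> bool) : (forall j, (j < m)%N -> md (p j)) ->
  bm (fun w => (cnt m (fun j => p j w))%:R : R).
Proof.
move=> mp; split; first exact: (@measurable_md nat (fun n => n%:R) _ (md_cnt mp)).
by exists m%:R => w; rewrite ger0_norm ?ler_nat ?cnt_le.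
Qed.

Lemma bm_min f g : bm f -> bm g -> bm (fun w => Num.min (f w) (g w)).
Proof.
move=> [mf [A Af]] [mg [B Bg]]; split; first exact: measurable_minr.
exists (A + B) => w; have := Af w; have := Bg w; have := normr_ge0 (f w); have := normr_ge0 (g w).
by rewrite minElt; case: ifP => _; lra.
Qed.

End DiscreteMeasurable.

Section Expectation.
Context d (T : measurableType d) (R : realType) (P : probability T R).
Implicit Types f g : T -> R.

Definition Ex f : R := \int[P]_w f w.

Lemma bm_integrable f : bm f -> P.-integrable setT (EFin \o f).
Proof.
move=> [mf [M Mf]]; apply: measurable_bounded_integrable => //.
  by apply: le_lt_trans (ltry 1); exact: probability_le1.
by exists M; split => [|y My w _]; [exact: num_real|exact: le_trans (Mf w) (ltW My)].
Qed.

Lemma ExE f : bm f -> (\int[P]_w (f w)%:E)%E = (Ex f)%:E.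
Proof. by move=> bf; rewrite /Ex /Rintegral fineK //; exact: integrable_fin_num (bm_integrable bf). Qed.

Lemma Ex_cst (c : R) : Ex (fun=> c) = c.
Proof.
have e : fine (P setT) = 1 by rewrite probability_setT.
by transitivity (c * fine (P setT)); [exact: Rintegral_cst|rewrite e mulr1].
Qed.

Lemma eq_Ex f g : (forall w, f w = g w) -> Ex f = Ex g.
Proof. by move=> fg; congr Ex; apply/funext. Qed.

Lemma ExD f g : bm f -> bm g -> Ex (fun w => f w + g w) = Ex f + Ex g.
Proof. by move=> /bm_integrable ? /bm_integrable ?; exact: RintegralD. Qed.

Lemma ExB f g : bm f -> bm g -> Ex (fun w => f w - g w) = Ex f - Ex g.
Proof. by move=> /bm_integrable ? /bm_integrable ?; exact: RintegralB. Qed.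

Lemma ExZ (c : R) f : bm f -> Ex (fun w => c * f w) = c * Ex f.
Proof. by move=> /bm_integrable ?; exact: RintegralZl. Qed.

Lemma Ex_le f g : bm f -> bm g -> (forall w, f w <= g w) -> Ex f <= Ex g.
Proof. by move=> /bm_integrable ? /bm_integrable ? fg; apply: le_Rintegral. Qed.

Lemma Ex_ge0 f : (forall w, 0 <= f w) -> 0 <= Ex f.
Proof. by move=> f0; apply: Rintegral_ge0. Qed.

Lemma Ex_sum (I : Type) (s : seq I) (p : pred I) (F : I -> T -> R) : (forall i, bm (F i)) ->
  Ex (fun w => \sum_(i <- s | p i) F i w) = \sum_(i <- s | p i) Ex (F i).
Proof.
move=> bF; elim: s => [|i s IH].
  rewrite big_nil -[RHS](Ex_cst 0); by apply: eq_Ex => w; rewrite big_nil.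
rewrite big_cons; case pi: (p i); last first.
  by rewrite -IH; apply: eq_Ex => w; rewrite big_cons pi.
by rewrite -IH -ExD //; [apply: eq_Ex => w; rewrite big_cons pi|exact: bm_sum].
Qed.

Lemma Ex_abs f : bm f -> `|Ex f| <= Ex (fun w => `|f w|).
Proof. by move=> /bm_integrable ?; exact: le_normr_Rintegral. Qed.

(** From [|f| <= f^2 / (2 c) + c / 2], which replaces the Cauchy-Schwarz inequality and avoids
    square roots. *)
Lemma Ex_abs_sqr f (c : R) : 0 < c -> bm f -> Ex (fun w => f w ^+ 2) <= c ^+ 2 -> Ex (fun w => `|f w|) <= c.
Proof.
move=> c0 bf h.
have bf2 := bmX 2 bf.
have : Ex (fun w => `|f w|) <= Ex (fun w => (2 * c)^-1 * f w ^+ 2 + c / 2).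
  apply: Ex_le; [exact: bm_abs| |move=> w].
    by apply: bmD; [apply: bmM => //; exact: bm_cst|exact: bm_cst].
  rewrite -(ler_pM2r (_ : 0 < 2 * c)) ?mulr_gt0 //.
  have -> : ((2 * c)^-1 * f w ^+ 2 + c / 2) * (2 * c) = `|f w| ^+ 2 + c ^+ 2.
    by rewrite real_normK ?num_real //; field; rewrite gt_eqF.
  by have := sqr_ge0 (`|f w| - c); nra.
rewrite ExD ?Ex_cst; [|by apply: bmM => //; exact: bm_cst|exact: bm_cst].
rewrite ExZ // => h2; apply: le_trans h2 _.
have e : c = (2 * c)^-1 * c ^+ 2 + c / 2 by field; rewrite gt_eqF.
by rewrite [leRHS]e lerD2r ler_pM2l // invr_gt0 mulr_gt0.
Qed.

Lemma Ex_ind (p : T -> bool) : md p -> Ex (fun w => (p w)%:R) = fine (P [set w | p w]).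
Proof.
move=> mp; rewrite /Ex /Rintegral; have := integral_indic P measurableT (md_set mp); rewrite setIT => <-.
by congr fine; apply: eq_integral => w _; rewrite indicE; congr ((nat_of_bool _)%:R%:E); apply/esym; case: (boolP (p w)) => pw; [exact/mem_set|exact/memNset/negP].
Qed.

End Expectation.

(** * Conditional expectation by freezing an independent variable *)

Section Freeze.
Context d (Om : measurableType d) (R : realType) (P : probability Om R).
Variable C : set (set Om).
Hypothesis Cm : C `<=` measurable.

(** The same points with a smaller sigma-algebra: measurability on [TC] expresses that a function
    depends only on the sources behind [C]. *)
Let TC := g_sigma_algebraType C.

Lemma sub_measurable (A : set Om) : measurable (A : set TC) -> measurable A.
Proof. by apply: smallest_sub => //; exact: sigma_algebra_measurable. Qed.

Lemma sub_measurable_fun d' (U : measurableType d') (f : TC -> U) :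
  measurable_fun setT f -> measurable_fun setT (f : Om -> U).
Proof. by move=> mf _ B mB; apply: sub_measurable; exact: mf. Qed.

Lemma sub_bm (f : TC -> R) : bm f -> bm (f : Om -> R).
Proof. by move=> [mf bf]; split => //; exact: sub_measurable_fun. Qed.

Lemma sub_md D (f : TC -> D) : md f -> md (f : Om -> D).
Proof. by move=> mf x; apply: sub_measurable; exact: mf. Qed.

Variable V : Om -> R.
Hypothesis mV : measurable_fun setT V.
Hypothesis indep : forall A B, measurable (A : set TC) -> measurable B ->
  P (A `&` V @^-1` B) = (P A * P (V @^-1` B))%E.

Let Vm : {mfun Om >-> R} := mfun_Sub (mem_set mV).

(** Independence makes the joint law of the identity into [TC] and of [V] a product measure; the
    rest is Tonelli. *)
Lemma freeze_joint (f : TC * R -> \bar R) : measurable_fun setT f -> (forall z, 0 <= f z)%E ->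
  (\int[P]_w f (w, V w) = \int[P]_w \int[distribution P Vm]_v f (w, v))%E.
Proof.
move=> mf f0.
have mid : measurable_fun setT (fun w : Om => (w : TC)).
  by move=> _ B mB; rewrite setTI; exact: sub_measurable.
have mpair : measurable_fun setT (fun w : Om => (w : TC, V w)) by exact: measurable_fun_pair.
pose idm : {mfun Om >-> TC} := mfun_Sub (mem_set mid).
pose prm : {mfun Om >-> (TC * R)%type} := mfun_Sub (mem_set mpair).
have prodE X : measurable X -> (distribution P idm \x distribution P Vm)%E X = distribution P prm X.
  apply: product_measure_unique => A B mA mB.
  by rewrite /distribution /pushforward /= -indep.
transitivity (\int[distribution P prm]_z f z)%E.
  by rewrite [RHS](ge0_integral_pushforward mpair).
transitivity (\int[(distribution P idm \x distribution P Vm)%E]_z f z)%E.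
  by apply: eq_measure_integral => A mA _; apply/esym; apply: prodE.
rewrite fubini_tonelli1 // [LHS](ge0_integral_pushforward mid) //=.
  exact: measurable_fun_fubini_tonelli_F.
by move=> w _; apply: integral_ge0.
Qed.

Variable surv : R -> R.
Hypothesis msurv : measurable_fun setT surv.
Hypothesis survE : forall y, P [set w | y < V w] = (surv y)%:E.

Lemma surv_bounds y : 0 <= surv y <= 1.
Proof.
have m : measurable [set w | y < V w].
  rewrite (_ : [set w | _] = V @^-1` `]y, +oo[%classic); last by apply/seteqP; split => w /=; rewrite in_itv /= andbT.
  by rewrite -[X in measurable X]setTI; apply: mV => //; exact: measurable_itv.
by rewrite -!lee_fin -survE measure_ge0 /= probability_le1.
Qed.

Lemma bm_surv d' (T : measurableType d') (y : T -> R) : measurable_fun setT y -> bm (fun w => surv (y w)).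
Proof.
move=> my; split; first exact: measurableT_comp.
by exists 1 => w; have /andP[h1 h2] := surv_bounds (y w); rewrite ger0_norm.
Qed.

Lemma bm_gt (c y : TC -> R) : bm c -> measurable_fun setT y -> bm (fun w : Om => c w * (y w < V w)%R%:R).
Proof.
by move=> bc my; apply: bmM; [exact: sub_bm|apply/bm_ind/md_ltr => //; exact: sub_measurable_fun].
Qed.

(** The conditional probability of [y < V] given [C] is [surv y], used only in integrated form
    against a weight [c] known from [C]. *)
Lemma freeze_gt (c y : TC -> R) : bm c -> measurable_fun setT y ->
  Ex P (fun w => c w * (y w < V w)%R%:R) = Ex P (fun w => c w * surv (y w)).
Proof.
move=> bc my.
have pos (c' : TC -> R) : bm c' -> (forall w, 0 <= c' w) ->
    Ex P (fun w => c' w * (y w < V w)%R%:R) = Ex P (fun w => c' w * surv (y w)).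
  move=> bc' c0; apply: EFin_inj; rewrite -!ExE //; first last.
  - exact: bm_gt.
  - by apply: bmM; [exact: sub_bm|apply: bm_surv; exact: sub_measurable_fun].
  pose f (z : (TC * R)%type) := (c' z.1 * (y z.1 < z.2)%R%:R)%:E.
  have mf : measurable_fun setT f.
    apply/measurable_EFinP; apply: measurable_funM.
      by apply: measurableT_comp; [exact: (bm_meas bc')|exact: measurable_fst].
    apply/bm_meas/bm_ind/md_ltr; last exact: measurable_snd.
    by apply: measurableT_comp => //; exact: measurable_fst.
  rewrite (freeze_joint mf) => [|z]; last by rewrite lee_fin mulr_ge0.
  apply: eq_integral => w _; rewrite /f /=.
  under eq_integral do rewrite EFinM.
  rewrite ge0_integralZl //=; last 2 first.
  - by apply/measurable_EFinP/bm_meas/bm_ind/md_ltr => //; exact: measurable_cst.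
  - by rewrite lee_fin.
  rewrite EFinM; congr (_ * _)%E; rewrite -survE.
  have mi : measurable (`]y w, +oo[%classic : set R) by exact: measurable_itv.
  transitivity (distribution P Vm `]y w, +oo[%classic).
    have := integral_indic (distribution P Vm) measurableT mi; rewrite setIT => <-; apply: eq_integral => v _; rewrite indicE.
    congr ((nat_of_bool _)%:R%:E); case: (boolP (y w < v)) => h; apply/esym; [apply/mem_set|apply/memNset]; rewrite /= in_itv /= andbT //.
    exact/negP.
  rewrite /distribution /pushforward /=; congr (P _); apply/seteqP.
  by split => v /=; rewrite in_itv /= andbT.
(* For signed [c], add its bound [M] and subtract the contribution of the constant. *)
have [mc [M cM]] := bc.
have M0 : 0 <= M by apply: le_trans (cM point); exact: normr_ge0.
have bcM : bm (fun w => c w + M) by apply: bmD => //; exact: bm_cst.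
have e1 : Ex P (fun w => c w * (y w < V w)%R%:R) = Ex P (fun w => (c w + M) * (y w < V w)%R%:R) - Ex P (fun w => M * (y w < V w)%R%:R).
  rewrite -ExB; [|exact: bm_gt|by apply: bm_gt => //; exact: bm_cst].
  by apply: eq_Ex => w; rewrite mulrDl addrK.
have bs : bm (fun w : Om => surv (y w)) by apply: bm_surv; exact: sub_measurable_fun.
have e2 : Ex P (fun w => c w * surv (y w)) = Ex P (fun w => (c w + M) * surv (y w)) - Ex P (fun w => M * surv (y w)).
  rewrite -ExB; [|by apply: bmM => //; exact: sub_bm|by apply: bmM => //; exact: bm_cst].
  by apply: eq_Ex => w; rewrite mulrDl addrK.
rewrite e1 e2 pos //; last by move=> w; have := cM w; rewrite ler_norml => /andP[]; lra.
by rewrite (pos (fun=> M)) //; exact: bm_cst.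
Qed.

End Freeze.

Section FreezeEvent.
Context d (Om : measurableType d) (R : realType) (P : probability Om R).
Variable C : set (set Om).
Hypothesis Cm : C `<=` measurable.
Let TC := g_sigma_algebraType C.

(** This is [freeze_gt] with the indicator of [b] as independent variable; its survival function is
    a step function equal to [p] on [[0, 1)]. *)
Lemma freeze_event (b : Om -> bool) (p : R) (c : TC -> R) : md b ->
  (forall A, measurable (A : set TC) -> P (A `&` [set w | b w]) = (P A * p%:E)%E) ->
  bm c -> Ex P (fun w => c w * (b w)%:R) = p * Ex P c.
Proof.
move=> mb ind bc.
have Pb : P [set w | b w] = p%:E by rewrite -[LHS](congr1 P (setTI _)) ind // probability_setT mul1e.
have mB := md_set mb.
have p01 : 0 <= p <= 1 by rewrite -!lee_fin -Pb measure_ge0 /= probability_le1.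
pose V w : R := (b w)%:R.
have mV : measurable_fun setT V by exact: (bm_meas (bm_ind R mb)).
pose surv (y : R) : R := if y < 0 then 1 else if y < 1 then p else 0.
have msurv : measurable_fun setT surv.
  apply: (@measurable_if _ _ R (fun y : R => y < 0)); first by apply: md_ltr => //; exact: measurable_cst.
    exact: measurable_cst.
  apply: (@measurable_if _ _ R (fun y : R => y < 1)); first by apply: md_ltr => //; exact: measurable_cst.
    exact: measurable_cst.
  exact: measurable_cst.
have survE y : P [set w | y < V w] = (surv y)%:E.
  rewrite /surv; case: ltP => y0.
    rewrite -(@probability_setT _ _ _ P); congr (P _); apply/seteqP; split => // w _ /=.
    by rewrite /V; case: (b w) => //; apply: lt_trans y0 _.
  case: ltP => y1.
    by rewrite -Pb; congr (P _); apply/seteqP; split => w; rewrite /= /V; case: (b w) => //; rewrite ltNge y0.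
  transitivity (P set0); last exact: measure0.
  congr (P _); apply/seteqP; split => // w; rewrite /= /V.
  by case: (b w); rewrite ltNge ?y0 ?y1.
have indep A B : measurable (A : set TC) -> measurable B -> P (A `&` V @^-1` B) = (P A * P (V @^-1` B))%E.
  move=> mA _; have mA' := sub_measurable Cm mA.
  have pc : P (~` [set w | b w]) = (1 - p)%:E by rewrite probability_setC // Pb EFinB.
  have indC : P (A `&` ~` [set w | b w]) = (P A * (1 - p)%:E)%E.
    rewrite -setDE measureD //; last by apply: le_lt_trans (ltry 1); exact: probability_le1.
    transitivity (P A - P A * p%:E)%E; first by congr (_ - _)%E; exact: ind.
    by rewrite EFinB muleBr ?mule1 // fin_num_measure.
  have [B1|B1] := pselect (B 1); have [B0|B0] := pselect (B 0).
  - rewrite (_ : V @^-1` B = setT) ?setIT ?probability_setT ?mule1 //.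
    by apply/seteqP; split => // w _; rewrite /= /V; case: (b w).
  - rewrite (_ : V @^-1` B = [set w | b w]) ?ind ?Pb //.
    by apply/seteqP; split => w; rewrite /= /V; case: (b w).
  - rewrite (_ : V @^-1` B = ~` [set w | b w]) ?indC ?pc //.
    by apply/seteqP; split => w; rewrite /= /V; case: (b w).
  - rewrite (_ : V @^-1` B = set0) ?setI0 ?measure0 ?mule0 //.
    by apply/seteqP; split => // w; rewrite /= /V; case: (b w).
have := @freeze_gt _ _ _ P C Cm V mV indep surv msurv survE c (fun=> 0) bc.
have -> : surv 0 = p by rewrite /surv ltxx ltr01.
move=> /(_ (measurable_cst _)) h.
transitivity (Ex P (fun w => c w * p)).
  by rewrite -h; apply: eq_Ex => w; rewrite /V; case: (b w); rewrite ?ltr01 ?ltxx.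
have bc' := sub_bm Cm bc; rewrite -ExZ //; apply: eq_Ex => w; exact: mulrC.
Qed.

End FreezeEvent.

(** * Independence of groups of sources *)

Section Independence.
Context d (Om : measurableType d) (R : realType) (P : probability Om R).
Variables (I : Type) (Cl : I -> set (set Om)).
Hypothesis Clm : forall k A, Cl k A -> measurable A.
Hypothesis ClI : forall k A B, Cl k A -> Cl k B -> Cl k (A `&` B) \/ A `&` B = set0.
Hypothesis ind : mutually_indep P Cl.

Definition capL (J : seq I) (A : I -> set Om) := \bigcap_(k in [set k | List.In k J]) A k.

(* the pi-system of finite intersections of events of the sources outside [K] *)
Definition gen (K : seq I) : set (set Om) := [set E | E = set0 \/ exists J A,
  [/\ List.NoDup J, forall k, List.In k J -> ~ List.In k K,
      forall k, List.In k J -> Cl k (A k) & E = capL J A]].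

Lemma capL_measurable J A : (forall k, List.In k J -> Cl k (A k)) -> measurable (capL J A).
Proof.
elim: J => [|k J IH] clA; rewrite /capL.
  rewrite (_ : [set _ | _] = set0) ?bigcap_set0; first exact: measurableT.
  by apply/seteqP; split.
rewrite (_ : [set _ | _] = k |` [set k | List.In k J]); last first.
  by apply/seteqP; split => j /= [->|?]; [left|right|left|right].
rewrite bigcap_setU1; apply: measurableI; first by apply: (@Clm k); apply: clA; left.
by apply: IH => j jJ; apply: clA; right.
Qed.

Lemma gen_measurable K : gen K `<=` measurable.
Proof.
move=> E [->|[J [A [_ _ clA ->]]]]; first exact: measurable0.
exact: capL_measurable.
Qed.

Lemma gen_setT K : gen K setT.
Proof.
right; exists [::], (fun=> setT); split => //; first exact: List.NoDup_nil.
by apply/seteqP; split => // w _ k.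
Qed.

Lemma gen_source K k A : ~ List.In k K -> Cl k A -> gen K A.
Proof.
move=> kK clA; right; exists [:: k], (fun=> A); split => //.
- by apply: List.NoDup_cons; [case|exact: List.NoDup_nil].
- by move=> j [<-|[]].
- by move=> j [<-|[]].
- by apply/seteqP; split => [w Aw j|w h]; [|apply: (h k); left].
Qed.

(** Two finite intersections may involve a common source; [ClI] merges its two events unless they
    are disjoint, which is why [gen] contains the empty set. *)
Lemma gen_setI K : setI_closed (gen K).
Proof.
move=> E F [->|[J [A [nJ JK clA ->]]]]; first by rewrite set0I; left.
move=> [->|[J' [A' [nJ' JK' clA' ->]]]]; first by rewrite setI0; left.
pose L := List.nodup (fun x y : I => pselect (x = y)) (J ++ J').
have LP k : List.In k L <-> List.In k J \/ List.In k J'.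
  by rewrite /L List.nodup_In List.in_app_iff.
pose B k := (if pselect (List.In k J) then A k else setT) `&` (if pselect (List.In k J') then A' k else setT).
have EB : capL J A `&` capL J' A' = capL L B.
  apply/seteqP; split => w.
    move=> [h h'] k _; split; case: pselect => //= ?; [exact: h|exact: h'].
  move=> h; split => k kJ.
    by have /h [] : List.In k L; [apply/LP; left|case: pselect].
  by have /h [_] : List.In k L; [apply/LP; right|case: pselect].
have [[k kL B0]|h] := pselect (exists2 k, List.In k L & B k = set0).
  left; rewrite EB; apply/seteqP; split => // w /(_ k kL); by rewrite B0.
right; exists L, B; split => //; first exact: List.NoDup_nodup.
  by move=> k /LP [/JK|/JK'].
move=> k kL; rewrite /B; case: pselect => kJ; case: pselect => kJ'.
- have [//|B0] := ClI (clA _ kJ) (clA' _ kJ'); exfalso; apply: h; exists k => //.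
  by rewrite /B; case: pselect => //; case: pselect.
- by rewrite setIT; exact: clA.
- by rewrite setTI; exact: clA'.
- by have /LP [] := kL.
Qed.

(** The measures [P (E]&[capL K B)] and [P (capL K B) * P E] of [E] agree on the pi-system [gen K]
    by mutual independence, hence on the sigma-algebra it generates. *)
Lemma gen_indep K B : List.NoDup K -> (forall k, List.In k K -> Cl k (B k)) ->
  forall E, <<s gen K >> E -> P (E `&` capL K B) = (P E * P (capL K B))%E.
Proof.
move=> nK clB; have mB := capL_measurable clB.
pose p := NngNum (fine_ge0 (measure_ge0 P (capL K B))).
have fP E : measurable E -> P E = (fine (P E))%:E by move=> mE; rewrite fineK // fin_num_measure.
have main : forall E, <<s gen K >> E -> mrestr P mB E = mscale p P E.
  apply: (@g_sigma_algebra_measure_unique _ _ _ (gen K) (@gen_measurable K) (fun=> setT)) => //.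
  - by move=> _; exact: gen_setT.
  - by apply/seteqP; split => // w _; exists 0%N.
  - exact: gen_setI.
  - move=> E gE; rewrite -[LHS]/(P (E `&` capL K B)) -[RHS]/((p%:num)%:E * P E)%E; move: gE.
    move=> [->|[J [A [nJ JK clA ->]]]]; first by rewrite set0I !measure0 mule0.
    pose F k := if pselect (List.In k K) then B k else A k.
    have -> : capL J A `&` capL K B = capL (J ++ K) F.
      apply/seteqP; split => w.
        move=> [h h'] k /List.in_app_iff kJK; rewrite /F; case: pselect => kK; first exact: h'.
        by apply: h; case: kJK.
      move=> h; split => k kk.
        have FJ : F k = A k by rewrite /F; case: pselect => // kK; case: (JK _ kk kK).
        by rewrite -FJ; apply: h; apply/List.in_app_iff; left.
      have FK : F k = B k by rewrite /F; case: pselect.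
      by rewrite -FK; apply: h; apply/List.in_app_iff; right.
    rewrite [LHS]ind; first last.
    - move=> k /List.in_app_iff kJK; rewrite /F; case: pselect => kK; first exact: clB.
      by apply: clA; case: kJK.
    - by apply: List.NoDup_app => // k kJ kK; exact: (JK k).
    rewrite [P (capL J A)]ind // -[p%:num]/(fine (P (capL K B))) [P (capL K B)]ind //= -EFinM big_cat /= mulrC; congr (_ * _)%:E.
      have : forall k, List.In k K -> List.In k K by [].
      elim: {-2}K => [|k L IH] LK; first by rewrite !big_nil.
      rewrite !big_cons IH; last by move=> j jL; apply: LK; right.
      congr (_ * _); rewrite /F; case: pselect => // h; exfalso; apply: h; apply: LK; by left.
    have : forall k, List.In k J -> List.In k J by [].
    elim: {-2}J => [|k L IH] LJ; first by rewrite !big_nil.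
    rewrite !big_cons IH; last by move=> j jL; apply: LJ; right.
    by congr (_ * _); rewrite /F; case: pselect => // h; exfalso; apply: (JK k) => //; apply: LJ; left.
  - move=> _; rewrite /mrestr /=; apply: le_lt_trans (ltry 1); apply: probability_le1.
    exact: measurableI.
move=> E sE; rewrite [LHS](main E sE) -[LHS]/((p%:num)%:E * P E)%E.
by rewrite muleC -fP.
Qed.

End Independence.

Section NetworkSources.
Context d (Om : measurableType d) (R : realType) (P : probability Om R).
Variables (a : nat -> R) (lam G : R -> R) (nw : network R Om) (N : nat).
Hypothesis mdl : sq2_model P a lam G nw N.

Lemma src_measurable k A : src_events nw N k A -> measurable A.
Proof.
have [m1 [m2 [m3 [m4 [m5 [m6 [m7 [m8 [m9 [m10 [m11 [m12 _]]]]]]]]]]]] := mdl.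
have pre (f : Om -> R) B : measurable_fun setT f -> measurable B -> measurable (f @^-1` B).
  by move=> mf mB; rewrite -[X in measurable X]setTI; exact: mf.
case: k => /=.
- move=> [n [ts [ns ->]]].
  rewrite (_ : [set w | _] = \bigcap_(m < n) [set w | arr nw N w (ts m) = ns m]).
    by apply: fin_bigcap_measurable => // m _; exact: m1.
  by apply/seteqP; split.
- move=> [xs [Bs [mB ->]]].
  rewrite (_ : [set w | _] = \bigcap_(i < N) ([set w | X0 nw N w i = xs i] `&` (fun w => age0 nw N w i) @^-1` Bs i)).
    by apply: fin_bigcap_measurable => // i _; apply: measurableI; [exact: m6|exact: pre].
  by apply/seteqP; split.
- by move=> j [B [mB ->]]; apply: pre.
- by move=> j [i ->].
- by move=> j [i ->].
- by move=> j [i ->].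
- by move=> i [B [mB ->]]; exact: (pre (fun w => unif0 nw N w i)).
- by move=> i k [B [mB ->]]; exact: (pre (fun w => wait0 nw N w i k)).
- by move=> [i ->].
- by move=> [i ->].
- by move=> [i ->].
Qed.

Lemma src_setI k A B : src_events nw N k A -> src_events nw N k B ->
  src_events nw N k (A `&` B) \/ A `&` B = set0.
Proof.
have sgl (D : Type) (f : Om -> D) : (exists i, A = [set w | f w = i]) -> (exists i, B = [set w | f w = i]) ->
    (exists i, A `&` B = [set w | f w = i]) \/ A `&` B = set0.
  move=> [i ->] [j ->]; have [->|ij] := pselect (i = j); first by left; exists j; rewrite setIid.
  by right; apply/seteqP; split => // w [/= -> /ij].
have pre (f : Om -> R) : (exists B0, measurable B0 /\ A = f @^-1` B0) -> (exists B0, measurable B0 /\ B = f @^-1` B0) ->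
    (exists B0, measurable B0 /\ A `&` B = f @^-1` B0) \/ A `&` B = set0.
  move=> [A0 [mA ->]] [B0 [mB ->]]; left; exists (A0 `&` B0); split; first exact: measurableI.
  by rewrite preimage_setI.
case: k => /=.
- move=> [n [ts [ns ->]]] [n' [ts' [ns' ->]]]; left.
  exists (n + n')%N, (fun m => if (m < n)%N then ts m else ts' (m - n)%N), (fun m => if (m < n)%N then ns m else ns' (m - n)%N).
  apply/seteqP; split => w /=.
    move=> [h h'] m mn; case: ifP => mn'; first exact: h.
    by apply: h'; lia.
  move=> h; split => m mn.
    by have := h m; rewrite mn; apply; lia.
  have := h (n + m)%N; have -> : (n + m < n)%N = false by lia.
  by rewrite addKn; apply; lia.
- move=> [xs [Bs [mB ->]]] [xs' [Bs' [mB' ->]]].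
  have [e|ne] := pselect (forall i, (i < N)%N -> xs i = xs' i).
    left; exists xs, (fun i => Bs i `&` Bs' i); split; first by move=> i; exact: measurableI.
    apply/seteqP; split => w /=.
      by move=> [h h'] i iN; have [? ?] := h i iN; have [? ?] := h' i iN.
    move=> h; split => i iN; have [? [? ?]] := h i iN; split => //.
    by rewrite -e.
  right; apply/seteqP; split => // w /= [h h']; apply: ne => i iN.
  by have [<- _] := h i iN; have [<- _] := h' i iN.
- by move=> j; exact: pre.
- by move=> j; exact: sgl.
- by move=> j; exact: sgl.
- by move=> j; exact: sgl.
- by move=> i; exact: (pre (fun w => unif0 nw N w i)).
- by move=> i k; exact: (pre (fun w => wait0 nw N w i k)).
- exact: sgl.
- exact: sgl.
- exact: sgl.
Qed.

Lemma src_indep : mutually_indep P (src_events nw N).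
Proof. by move: mdl; do 27 (case=> _). Qed.

End NetworkSources.

(** * Measurability of the queueing system *)

Section SystemMeasurable.
Context d (T : measurableType d) (R : realType).
Implicit Types (J : T -> inp R).

(** Stated over an arbitrary measurable space because it is applied both to the full one and to the
    sub-sigma-algebras used for freezing. *)
Definition minp J := [/\ forall k, measurable_fun setT (fun w => tau (J w) k),
  forall k, measurable_fun setT (fun w => sv (J w) k),
  forall k, md (fun w => sa (J w) k), forall k, md (fun w => sb (J w) k) &
  forall k, md (fun w => tb (J w) k)].

Variable J : T -> inp R.
Hypothesis mJ : minp J.

Lemma meas_tau k : measurable_fun setT (fun w => tau (J w) k). Proof. by case: mJ. Qed.

Let sys k := md (fun w => srv (J w) k) /\ measurable_fun setT (fun w => cpl (J w) k).

Let md_X_lt m i (s : T -> R) : (forall j, (j < m)%N -> sys j) -> measurable_fun setT s ->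
  md (fun w => X (J w) m i (s w)).
Proof.
move=> h ms; apply: md_cnt => j /h [mj cj]; apply: md_and; last exact: md_ltr.
exact: (md_comp (eq_op^~ i)).
Qed.

Let md_srv_lt k : (forall j, (j < k)%N -> sys j) -> md (fun w => srv (J w) k).
Proof.
move=> h; have [mt _ ma mb mc] := mJ.
have mX (f : T -> nat) : md f -> md (fun w => X (J w) k (f w) (tau (J w) k)).
  move=> mf x; rewrite (_ : _ @^-1` _ = \bigcup_n (f @^-1` [set n] `&` (fun w => X (J w) k n (tau (J w) k)) @^-1` [set x])).
    by apply: bigcup_measurable => n _; apply: measurableI; [exact: mf|exact: md_X_lt].
  by apply/seteqP; split => [w e|w [n _ [/= <-]]] //; exists (f w).
pose hh (p q : nat * nat) (c : bool) := if (p.2 < q.2)%N then p.1 else if (q.2 < p.2)%N then q.1 else if c then p.1 else q.1.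
rewrite (_ : (fun w => _) = fun w => hh (sa (J w) k, X (J w) k (sa (J w) k) (tau (J w) k)) (sb (J w) k, X (J w) k (sb (J w) k) (tau (J w) k)) (tb (J w) k)).
  apply: (md_comp3 hh _ _ (mc k)); [exact: md_pair (ma k) (mX _ (ma k))|exact: md_pair (mb k) (mX _ (mb k))].
by apply/funext => w; rewrite srvE.
Qed.

Let meas_sta_lt k : (forall j, (j < k)%N -> sys j) -> measurable_fun setT (fun w => sta (J w) k).
Proof.
move=> h; have ms := md_srv_lt h.
apply: (measurable_select (F := fun i w => clr (hist (J w) k) i (tau (J w) k)) ms) => i.
rewrite (_ : (fun w => _) = fun w => clr (rev [seq (srv (J w) j, cpl (J w) j) | j <- iota 0 k]) i (tau (J w) k)); last first.
  by apply/funext => w; rewrite histE.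
have {}h : forall j, j \in rev (iota 0 k) -> sys j.
  by move=> j; rewrite mem_rev mem_iota => /andP[_ jk]; apply: h.
under eq_fun do rewrite -map_rev.
elim: (rev (iota 0 k)) h => [|j l IH] h /=; first exact: meas_tau.
have [mj cj] := h j (mem_head _ _).
apply: measurable_if; first exact: (md_comp (eq_op^~ i)).
  by apply: measurable_maxr => //; apply: IH => a al; apply: h; rewrite inE al orbT.
by apply: IH => a al; apply: h; rewrite inE al orbT.
Qed.

Let sys_all k : sys k.
Proof.
have [n] := ubnP k; elim: n k => // n IH k kn.
have h j : (j < k)%N -> sys j by move=> jk; apply: IH; lia.
split; first exact: md_srv_lt.
rewrite (_ : (fun w => _) = fun w => sta (J w) k + sv (J w) k); last by apply/funext => w; rewrite cplE.
by apply: measurable_funD; [exact: meas_sta_lt|case: mJ].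
Qed.

Lemma md_srv k : md (fun w => srv (J w) k). Proof. by case: (sys_all k). Qed.
Lemma meas_cpl k : measurable_fun setT (fun w => cpl (J w) k). Proof. by case: (sys_all k). Qed.
Lemma meas_sta k : measurable_fun setT (fun w => sta (J w) k).
Proof. by apply: meas_sta_lt => j _. Qed.

Lemma md_srv_eq j (f : T -> nat) : md f -> md (fun w => srv (J w) j == f w).
Proof. by move=> mf; apply: (md_comp2 (fun a b : nat => a == b)) => //; exact: md_srv. Qed.

Lemma md_srv_lt' j N : md (fun w => (srv (J w) j < N)%N).
Proof. by apply: (md_comp (fun a => (a < N)%N)); exact: md_srv. Qed.

Lemma md_X (m : nat) (i : T -> nat) (s : T -> R) : md i -> measurable_fun setT s ->
  md (fun w => X (J w) m (i w) (s w)).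
Proof.
move=> mi ms; apply: md_cnt => j _; apply: md_and; first exact: md_srv_eq.
by apply: md_ltr => //; exact: meas_cpl.
Qed.

Lemma md_lvl k : md (fun w => lvl (J w) k).
Proof. by apply: md_X; [exact: md_srv|exact: meas_tau]. Qed.

Lemma md_lev M n : md (fun w => lev (J w) M n).
Proof.
apply: md_cnt => j _; apply: md_and; first exact: md_cst.
by apply: md_and; [apply: md_srv_eq; exact: md_srv|apply: md_ltr; [exact: meas_tau|exact: meas_sta]].
Qed.

Lemma md_res m (i : T -> nat) (s : T -> R) ox : md i -> measurable_fun setT s ->
  md (fun w => res (J w) m (i w) (s w) ox).
Proof.
move=> mi ms; case: ox => [x|]; last exact: md_cst.
apply: (md_comp (fun n => (0 < n)%N)); apply: md_cnt => j _.
apply: md_and; first exact: md_srv_eq.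
apply: md_and; first by apply: md_ler => //; exact: meas_sta.
by apply: md_ltr; [exact: measurable_cst|exact: meas_cpl].
Qed.

End SystemMeasurable.

(** * Replacing the data of one job by constants *)

Section Frozen.
Variable R : realType.
Implicit Types (I J : inp R).

(** After the replacement the whole system is a function of the sources other than the service time
    of [k], while by causality its past up to [sta I k] is unchanged. [sets] plays the same role for
    the samples and the coin. *)
Definition setv I k v := Inp (tau I) (fun j => if j == k then v else sv I j) (sa I) (sb I) (tb I).
Definition sets I k i i' b := Inp (tau I) (sv I) (fun j => if j == k then i else sa I j)
  (fun j => if j == k then i' else sb I j) (fun j => if j == k then b else tb I j).

Lemma valid_setv I k v : valid I -> 0 < v -> valid (setv I k v).
Proof. by move=> [h1 h2] v0; split => // j /=; case: ifP. Qed.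

Lemma setv_sv I k v j : j != k -> sv I j = sv (setv I k v) j.
Proof. by move=> /negbTE /= ->. Qed.

Section SetvCausal.
Variables (I : inp R) (k : nat) (v : R).
Hypotheses (vI : valid I) (v0 : 0 < v).
Let J := setv I k v.
Let vJ : valid J := valid_setv k vI v0.

Lemma setv_sta_self : sta I k = sta J k.
Proof. by apply: (@causal_sta_le _ I J k) => // j; exact: setv_sv. Qed.

Lemma setv_sta n : (sta I n <= sta I k) = (sta J n <= sta J k).
Proof.
rewrite -setv_sta_self; apply: (@causal_sta _ I J k) => // j; exact: setv_sv.
Qed.

Lemma setv_staE n : sta I n <= sta I k -> sta I n = sta J n.
Proof. by apply: (@causal_staE _ I J k) => // j; exact: setv_sv. Qed.

Lemma setv_cplE n : n != k -> sta I n <= sta I k -> cpl I n = cpl J n.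
Proof. by apply: (@causal_cplE _ I J k) => // j; exact: setv_sv. Qed.

Lemma setv_srv n : tau I n <= sta I k -> srv I n = srv J n.
Proof. by apply: (@causal_srv _ I J k) => // j; exact: setv_sv. Qed.

Lemma setv_lvl n : tau I n <= sta I k -> lvl I n = lvl J n.
Proof. by apply: (@causal_lvl _ I J k) => // j; exact: setv_sv. Qed.

Lemma setv_lev M n : sta I n <= sta I k -> lev I M n = lev J M n.
Proof. by apply: (@causal_lev _ I J k) => // j; exact: setv_sv. Qed.

Lemma setv_X m i s : s <= sta I k -> (forall j, (j < m)%N -> tau I j <= sta I k) -> X I m i s = X J m i s.
Proof. by apply: (@causal_X _ I J k) => // j; exact: setv_sv. Qed.

End SetvCausal.

Lemma hist_prefix I J m : (forall j, (j < m)%N -> [/\ tau I j = tau J j, sv I j = sv J j,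
  sa I j = sa J j, sb I j = sb J j & tb I j = tb J j]) -> hist I m = hist J m.
Proof.
elim: m => // m IH h /=; have [-> -> -> -> ->] := h m (ltnSn m).
by rewrite IH // => j jm; apply: h; lia.
Qed.

Lemma hist_lt I J m j : (j < m)%N -> hist I m = hist J m -> srv I j = srv J j /\ cpl I j = cpl J j.
Proof.
move=> jm e; have := congr1 (fun h => nth (0%N, 0) (rev h) j) e.
rewrite !histE !revK !(nth_map 0%N) ?size_iota // !nth_iota // => -[].
by [].
Qed.

Lemma hist_take I J m j : (j <= m)%N -> hist I m = hist J m -> hist I j = hist J j.
Proof.
move=> jm e; rewrite !histE; congr rev; apply/eq_in_map => i.
by rewrite mem_iota => /andP[_ ij]; have [-> ->] := hist_lt (leq_trans ij jm) e.
Qed.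

Lemma hist_X I J m i s : hist I m = hist J m -> X I m i s = X J m i s.
Proof. by move=> e; apply: eq_cnt => j jm; have [-> ->] := hist_lt jm e. Qed.

(** The quantification over all measurable spaces allows one functional to be evaluated at the true
    input over the full space and at a frozen input over a sub-sigma-algebra. *)
Definition mfm (f : inp R -> R) := forall d (T : measurableType d) (J : T -> inp R),
  minp J -> bm (fun w => f (J w)).
Definition mfr (f : inp R -> R) := forall d (T : measurableType d) (J : T -> inp R),
  minp J -> measurable_fun setT (fun w => f (J w)).
Definition mfd (D : Type) (f : inp R -> D) := forall d (T : measurableType d) (J : T -> inp R),
  minp J -> md (fun w => f (J w)).

End Frozen.

(** * Mean-square estimates *)

(* The capped system: jobs below [K * N] are the initial ones (layer [m] of server [i]
   is job [m * N + i]; absent jobs go to the dummy server [N]), the next [K] are arrivals. *)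
Record core_spec d (Om : measurableType d) (R : realType) (P : probability Om R)
  (N K : nat) (I : Om -> inp R) (Gbar : R -> R) (H hor : R) (Cv Cs : nat -> set (set Om)) : Prop := CoreSpec {
  c_N0 : (0 < N)%N;
  c_K0 : (0 < K)%N;
  c_minp : minp I;
  c_valid : forall w, valid (I w);
  c_H0 : 0 <= H;
  c_Gm : measurable_fun setT Gbar;
  c_G01 : forall x, 0 <= Gbar x <= 1;
  c_Gneg : forall x, x <= 0 -> Gbar x = 1;
  c_Gdec : forall x y, x <= y -> Gbar y <= Gbar x;
  c_GL : forall x y, x <= y -> Gbar x - Gbar y <= H * (y - x);
  c_init : forall k w, (k < K * N)%N -> [/\ tau (I w) k = 0, sa (I w) k = sb (I w) k &
     sa (I w) k = (k %% N)%N \/ sa (I w) k = N];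
  c_tau : forall k w, (K * N <= k)%N -> 0 < tau (I w) k;
  c_arr : forall k w, (K * N <= k)%N -> tau (I w) k <= hor -> (sa (I w) k < N)%N /\ (sb (I w) k < N)%N;
  c_minpv : forall n, (N <= n < K * N + K)%N ->
     minp (fun w : g_sigma_algebraType (Cv n) => setv (I w) n 1);
  c_minps : forall n, (K * N <= n < K * N + K)%N ->
     minp (fun w : g_sigma_algebraType (Cs n) => sets (I w) n 0 0 true);
  c_freezeV : forall n, (N <= n < K * N + K)%N -> forall c y : g_sigma_algebraType (Cv n) -> R,
     bm c -> measurable_fun setT y ->
     Ex P (fun w => c w * (y w < sv (I w) n)%R%:R) = Ex P (fun w => c w * Gbar (y w));
  c_freezeS : forall n, (K * N <= n < K * N + K)%N -> forall (c : g_sigma_algebraType (Cs n) -> R) i j b,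
     bm c -> (forall w, hor < tau (I w) n -> c w = 0) -> (i < N)%N -> (j < N)%N ->
     Ex P (fun w => c w * [&& sa (I w) n == i, sb (I w) n == j & tb (I w) n == b]%:R) =
     (2 * N%:R ^+ 2)^-1 * Ex P c;
  c_haz0 : forall n s s', (n < N)%N -> 0 <= s -> s <= s' ->
     Ex P (fun w => [&& (srv (I w) n < N)%N, s < cpl (I w) n & cpl (I w) n <= s']%R%:R) <=
     H * (s' - s) * Ex P (fun w => (srv (I w) n < N)%N%:R) }.

Section Core.
Context d (Om : measurableType d) (R : realType) (P : probability Om R).
Variables (N K : nat) (I : Om -> inp R) (Gbar : R -> R) (H hor : R) (Cv Cs : nat -> set (set Om)).
Hypothesis core : core_spec P N K I Gbar H hor Cv Cs.
Let M := (K * N + K)%N.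

Lemma coreV n (f y : inp R -> R) : (N <= n < M)%N -> mfm f -> mfr y ->
  (forall w, f (I w) = f (setv (I w) n 1)) -> (forall w, y (I w) = y (setv (I w) n 1)) ->
  Ex P (fun w => f (I w) * (y (I w) < sv (I w) n)%R%:R) = Ex P (fun w => f (I w) * Gbar (y (I w))).
Proof.
move=> nM mf my ef ey.
have := c_freezeV core nM (mf _ _ _ (c_minpv core nM)) (my _ _ _ (c_minpv core nM)).
move=> h; transitivity (Ex P (fun w => f (setv (I w) n 1) * (y (setv (I w) n 1) < sv (I w) n)%R%:R)).
  by apply: eq_Ex => w; rewrite -ef -ey.
by rewrite h; apply: eq_Ex => w; rewrite -ef -ey.
Qed.

Section StartsL2.
Variables (B : nat -> inp R -> bool) (x : R).
Hypothesis Bm : forall n, mfd (B n).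
Hypothesis BN : forall n w, B n (I w) -> (N <= n)%N.
Hypothesis Bc : forall n k J, (N <= k)%N -> valid J -> sta J n <= sta J k -> B n J = B n (setv J k 1).

(** Centred given everything decided before [n] starts; the jobs of layer [0] are excluded by [BN]
    because their remaining times are not fresh service times. *)
Let xi n J : R := (B n J)%:R * ((x < cpl J n)%R%:R - Gbar (x - sta J n)).

Lemma mfm_gbar n : mfm (fun J => Gbar (x - sta J n)).
Proof.
move=> d' T J mJ; split.
  apply: measurableT_comp; first exact: (c_Gm core).
  by apply: measurable_funB; [exact: measurable_cst|exact: meas_sta].
by exists 1 => w; have /andP[h1 h2] := c_G01 core (x - sta (J w) n); rewrite ger0_norm.
Qed.

Lemma mfm_ind (b : inp R -> bool) : mfd b -> mfm (fun J => (b J)%:R : R).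
Proof. by move=> mb d' T J mJ; apply: bm_ind; exact: mb. Qed.

Lemma mfd_ltcpl n : mfd (fun J => x < cpl J n).
Proof. by move=> d' T J mJ; apply: md_ltr; [exact: measurable_cst|exact: meas_cpl]. Qed.

Let mfm_xi n : mfm (xi n).
Proof.
move=> d' T J mJ; apply: bmM; first exact: (mfm_ind (Bm n)).
by apply: bmB; [exact: (mfm_ind (mfd_ltcpl n))|exact: mfm_gbar].
Qed.

Let setv_causal n k w (r : bool) : (N <= k)%N -> n != k ->
  xi n (I w) * (if r then sta (I w) n <= sta (I w) k else sta (I w) n < sta (I w) k)%R%:R =
  xi n (setv (I w) k 1) * (if r then sta (setv (I w) k 1) n <= sta (setv (I w) k 1) k else
     sta (setv (I w) k 1) n < sta (setv (I w) k 1) k)%R%:R.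
Proof.
move=> kN nk; have v := c_valid core w.
have ek := setv_sta_self (I w) k 1.
have [h|h] := leP (sta (I w) n) (sta (I w) k).
  have en := setv_staE v ltr01 h.
  have ec := setv_cplE v ltr01 nk h.
  by rewrite /xi (Bc kN v h) -ek -en -ec h.
have := setv_sta k v ltr01 n.
rewrite leNgt h /= -ek => /esym/negbT; rewrite -ltNge => h'.
have e1 : (sta (I w) n < sta (I w) k) = false by lra.
have e2 : (sta (setv (I w) k 1) n < sta (I w) k) = false by lra.
have e3 : (sta (setv (I w) k 1) n <= sta (I w) k) = false by lra.
by rewrite e1 e2 e3; case: r; rewrite !mulr0.
Qed.

(** If [n] starts no later than [k], then [xi n] does not involve the service time of [k], given
    which [xi k] has mean zero. The flag [r] chooses between the weak and the strict order, so that
    the two orders partition the outcomes for each pair. *)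
Let orth n k (r : bool) : (k < M)%N -> n != k ->
  Ex P (fun w => xi n (I w) * (if r then sta (I w) n <= sta (I w) k else sta (I w) n < sta (I w) k)%R%:R * xi k (I w)) = 0.
Proof.
move=> kM nk; case: (leqP N k) => Nk; last first.
  rewrite -[RHS](Ex_cst P 0); apply: eq_Ex => w; rewrite {2}/xi.
  by case b: (B k (I w)); [have := BN b; lia|rewrite mul0r mulr0].
pose c J : R := xi n J * (if r then sta J n <= sta J k else sta J n < sta J k)%R%:R * (B k J)%:R.
have mc : mfm c.
  move=> d' T J mJ; apply: bmM; last exact: (mfm_ind (Bm k)).
  apply: bmM; first exact: mfm_xi.
  by apply: bm_ind; case: (r); [apply: md_ler|apply: md_ltr]; exact: meas_sta.
have my : mfr (fun J => x - sta J k).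
  by move=> d' T J mJ; apply: measurable_funB; [exact: measurable_cst|exact: meas_sta].
have kM' : (N <= k < M)%N by rewrite Nk.
have ek w := setv_sta_self (I w) k 1.
have ec w : c (I w) = c (setv (I w) k 1).
  by rewrite /c setv_causal // (Bc Nk (c_valid core w) (lexx _)).
have := coreV kM' mc my ec (fun w => congr1 (fun z => x - z) (ek w)).
move/eqP; rewrite -subr_eq0 -ExB; first last.
- by apply: bmM; [exact: mc (c_minp core)|exact: mfm_gbar (c_minp core)].
- apply: bmM; first exact: mc (c_minp core).
  by apply/bm_ind/md_ltr; [exact: my (c_minp core)|case: (c_minp core)].
move=> /eqP h; rewrite -[RHS]h; apply: eq_Ex => w; rewrite {2}/xi /c cplE.
by rewrite ltrBlDl; ring.
Qed.

Lemma starts_L2 : Ex P (fun w => (\sum_(n < M) xi n (I w)) ^+ 2) <= Ex P (fun w => \sum_(n < M) (B n (I w))%:R).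
Proof.
have mI := c_minp core.
have bxi n : bm (fun w => xi n (I w)) by exact: mfm_xi.
have -> : Ex P (fun w => (\sum_(n < M) xi n (I w)) ^+ 2) =
    \sum_(n < M) \sum_(k < M) Ex P (fun w => xi n (I w) * xi k (I w)).
  transitivity (Ex P (fun w => \sum_(n < M) \sum_(k < M) xi n (I w) * xi k (I w))).
    by apply: eq_Ex => w; rewrite expr2 big_distrlr.
  rewrite Ex_sum => [|n]; last by apply: bm_sum => k; exact: bmM.
  by apply: eq_bigr => n _; rewrite Ex_sum // => k; exact: bmM.
rewrite Ex_sum => [|n]; last exact: (mfm_ind (Bm n)).
apply: ler_sum => n _; rewrite (bigD1 n) //= big1 ?addr0 => [|k kn].
  apply: Ex_le; [exact: bmM|exact: (mfm_ind (Bm n))|move=> w].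
  rewrite /xi; have /andP[h1 h2] := c_G01 core (x - sta (I w) n).
  by case: (B n (I w)); case: (x < cpl _ _); rewrite /= ?mul0r ?mul1r ?mulr0n ?mulr1n ?sub0r; nra.
have nk : (n : nat) != k by rewrite eq_sym -val_eqE in kn *.
transitivity (Ex P (fun w => xi n (I w) * (sta (I w) n <= sta (I w) k)%R%:R * xi k (I w)) +
    Ex P (fun w => xi k (I w) * (sta (I w) k < sta (I w) n)%R%:R * xi n (I w))).
  have ml : md (fun w => sta (I w) n <= sta (I w) k) by apply: md_ler; exact: meas_sta.
  have ml' : md (fun w => sta (I w) k < sta (I w) n) by apply: md_ltr; exact: meas_sta.
  rewrite -ExD; [|by do 2?apply: bmM => //; exact: bm_ind|by do 2?apply: bmM => //; exact: bm_ind].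
  apply: eq_Ex => w; case: leP => _ /=; rewrite ?mulr1 ?mulr0 ?mul0r ?addr0 ?add0r //; exact: mulrC.
by rewrite (orth true) // (orth false) ?addr0 // eq_sym.
Qed.

End StartsL2.

Section RoutingL2.
Variables (A : nat -> nat -> inp R -> bool) (om : nat -> inp R -> R) (l : nat).
Hypothesis Am : forall k i, mfd (A k i).
Hypothesis omm : forall k, mfm (om k).
Hypothesis Ap : forall k i J J', hist J k = hist J' k -> (forall i, tau J i = tau J' i) -> A k i J = A k i J'.
Hypothesis omp : forall k J J', hist J k = hist J' k -> (forall i, tau J i = tau J' i) -> om k J = om k J'.
Hypothesis Al : forall k i J, A k i J -> X J k i (tau J k) = l.

Definition Sn (J : inp R) k m : nat := cnt N (fun i => (m <= X J k i (tau J k))%N).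
(** Conditional probability that job [k] joins a server of [A k]. All these servers have length [l],
    and by [route_count] each is selected with probability [(Sn l + Sn (l + 1)) / N^2]. *)
Definition prt k J : R := (cnt N (fun i => A k i J))%:R * (Sn J k l + Sn J k l.+1)%:R / N%:R ^+ 2.

Lemma mfm_prt k : mfm (prt k).
Proof.
move=> d' T J mJ; apply: bmM; last exact: bm_cst.
apply: bmM; first by apply: bm_cnt => i _; exact: Am.
rewrite (_ : (fun w => _) = fun w => (Sn (J w) k l)%:R + (Sn (J w) k l.+1)%:R); last by apply/funext => w; rewrite natrD.
by apply: bmD; apply: bm_cnt => i _; [apply: (md_comp (fun a => (l <= a)%N))|apply: (md_comp (fun a => (l < a)%N))];
  apply: md_X => //; [exact: md_cst|exact: meas_tau|exact: md_cst|exact: meas_tau].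
Qed.

Lemma Sn_hist k m J J' : hist J k = hist J' k -> (forall i, tau J i = tau J' i) -> Sn J k m = Sn J' k m.
Proof. by move=> e et; apply: eq_cnt => i _; rewrite et (hist_X _ _ e). Qed.

Lemma prt_hist k J J' : hist J k = hist J' k -> (forall i, tau J i = tau J' i) -> prt k J = prt k J'.
Proof.
move=> e et; rewrite /prt !(Sn_hist _ e et); congr (_%:R * _ / _).
by apply: eq_cnt => i _; exact: Ap.
Qed.

Let hist_sets w n k i j b : (k <= n)%N -> hist (I w) k = hist (sets (I w) n i j b) k.
Proof.
move=> kn; apply: hist_prefix => a ak /=.
by have /negbTE -> : a != n by lia.
Qed.

Lemma route_sum k J : (\sum_(i < N) \sum_(j < N)
   ((A k (rt (fun i => X J k i (tau J k)) i j true) J)%:R + (A k (rt (fun i => X J k i (tau J k)) i j false) J)%:R) : R) =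
  2 * N%:R ^+ 2 * prt k J.
Proof.
set f := fun i => X J k i (tau J k).
have rN i j b : (i < N)%N -> (j < N)%N -> (rt f i j b < N)%N.
  by move=> iN jN; rewrite /rt; case: ifP => // _; case: ifP => // _; case: b.
have eA a : (a < N)%N -> ((A k a J)%:R : R) = \sum_(c < N) (A k c J)%:R * (a == c :> nat)%:R.
  move=> aN; rewrite (bigD1 (Ordinal aN)) //= eqxx mulr1 big1 ?addr0 // => c ca.
  by rewrite eq_sym; move: ca; rewrite -val_eqE /= => /negbTE ->; rewrite mulr0.
transitivity (\sum_(c < N) (A k c J)%:R * (\sum_(i < N) \sum_(j < N) ((rt f i j true == c) + (rt f i j false == c)))%N%:R : R).
  transitivity (\sum_(i < N) \sum_(j < N) \sum_(c < N) ((A k c J)%:R * ((rt f i j true == c) + (rt f i j false == c))%N%:R : R)).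
    apply: eq_bigr => i _; apply: eq_bigr => j _; rewrite !eA ?rN // -big_split /=.
    by apply: eq_bigr => c _; rewrite natrD mulrDr.
  transitivity (\sum_(i < N) \sum_(c < N) \sum_(j < N) ((A k c J)%:R * ((rt f i j true == c) + (rt f i j false == c))%N%:R : R)).
    by apply: eq_bigr => i _; exact: exchange_big.
  rewrite exchange_big; apply: eq_bigr => c _ /=; rewrite natr_sum big_distrr /=.
  by apply: eq_bigr => i _; rewrite natr_sum big_distrr.
have N0 : N%:R != 0 :> R by rewrite pnatr_eq0; have := c_N0 core; lia.
have -> : 2 * N%:R ^+ 2 * prt k J = \sum_(c < N) (A k c J)%:R * (2 * (Sn J k l + Sn J k l.+1))%N%:R.
  rewrite -big_distrl /= -natr_sum /prt natrM; field; exact: N0.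
apply: eq_bigr => c _; case Ac: (A k c J); last by rewrite !mul0r.
by rewrite route_count // /f (Al Ac).
Qed.

(** Sum over the values of the two samples and the coin of [k]: each triple has probability
    [1 / (2 N^2)] and is independent of the history, which is unchanged when these data are frozen.
    Beyond the horizon the samples are not uniform, hence the condition that [c] vanishes there. *)
Lemma route_mean k (c : inp R -> R) : (K * N <= k < M)%N -> mfm c -> (forall w, hor < tau (I w) k -> c (I w) = 0) ->
  (forall J J', hist J k = hist J' k -> (forall i, tau J i = tau J' i) -> c J = c J') ->
  Ex P (fun w => c (I w) * (A k (srv (I w) k) (I w))%:R) = Ex P (fun w => c (I w) * prt k (I w)).
Proof.
move=> kM mc ch cp; have mI := c_minp core.
have ms := c_minps core kM.
pose f w := fun i => X (I w) k i (tau (I w) k).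
pose q w i j b : R := c (I w) * (A k (rt (f w) i j b) (I w))%:R.
pose e w i j b : R := [&& sa (I w) k == i, sb (I w) k == j & tb (I w) k == b]%:R.
pose g J i j b : R := c J * (A k (rt (fun i => X J k i (tau J k)) i j b) J)%:R.
have mg i j b : mfm (fun J => g J i j b).
  move=> d' T J mJ; apply: bmM; first exact: mc.
  apply: bm_ind.
  have mr : md (fun w => rt (fun i => X (J w) k i (tau (J w) k)) i j b).
    have mX a : md (fun w => X (J w) k a (tau (J w) k)) by apply: md_X => //; [exact: md_cst|exact: meas_tau].
    exact: (md_comp2 (fun p q : nat => if (p < q)%N then i else if (q < p)%N then j else if b then i else j) (mX i) (mX j)).
  move=> z; rewrite (_ : _ @^-1` _ = \bigcup_a ((fun w => rt (fun i => X (J w) k i (tau (J w) k)) i j b) @^-1` [set a] `&` (fun w => A k a (J w)) @^-1` [set z])).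
    by apply: bigcup_measurable => a _; apply: measurableI; [exact: mr|exact: Am].
  by apply/seteqP; split => [w h|w [a _ [/= <-]]] //; exists (rt (fun i => X (J w) k i (tau (J w) k)) i j b).
have gs i j b w : g (sets (I w) k 0 0 true) i j b = q w i j b.
  have h : hist (sets (I w) k 0 0 true) k = hist (I w) k by rewrite -hist_sets.
  rewrite /g /q (cp _ _ h) //; congr (_ * _%:R).
  rewrite (Ap _ h) //; congr (A k (rt _ _ _ _) _); apply/funext => a /=.
  exact: hist_X h.
have bq i j b : bm (fun w => q w i j b) by exact: mg.
have be i j b : bm (fun w => e w i j b).
  have [_ _ ma mb mt] := mI; apply: bm_ind; apply: md_and; first exact: (md_comp (eq_op^~ i) (ma k)).
  by apply: md_and; [exact: (md_comp (eq_op^~ j) (mb k))|exact: (md_comp (eq_op^~ b) (mt k))].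
have bqe i j b : bm (fun w => q w i j b * e w i j b) by apply: bmM; [exact: bq|exact: be].
have qe i j b : (i < N)%N -> (j < N)%N -> Ex P (fun w => q w i j b * e w i j b) = (2 * N%:R ^+ 2)^-1 * Ex P (fun w => q w i j b).
  have gh w : hor < tau (I w) k -> g (sets (I w) k 0 0 true) i j b = 0 by move=> h; rewrite gs /q ch // mul0r.
  move=> iN jN; have := c_freezeS core kM b (mg i j b _ _ _ ms) gh iN jN => h.
  rewrite (_ : (fun w => q w i j b) = fun w => g (sets (I w) k 0 0 true) i j b); last by apply/funext => w; rewrite gs.
  by rewrite -h; apply: eq_Ex => w; rewrite gs.
transitivity (Ex P (fun w => \sum_(i < N) \sum_(j < N) (q w i j true * e w i j true + q w i j false * e w i j false))).
  apply: eq_Ex => w; have [th|th] := leP (tau (I w) k) hor; last first.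
    by rewrite ch // mul0r big1 // => i _; rewrite big1 // => j _; rewrite /q ch // !mul0r addr0.
  have [sN sN'] := c_arr core (proj1 (andP kM)) th.
  rewrite (bigD1 (Ordinal sN)) //= [X in _ + X]big1 ?addr0 => [|i]; last first.
    rewrite -val_eqE eq_sym /= => /negbTE iN; by apply: big1 => j _; rewrite /e iN !mulr0 addr0.
  rewrite (bigD1 (Ordinal sN')) //= [X in _ + X]big1 ?addr0 => [|j]; last first.
    by rewrite -val_eqE eq_sym /= => /negbTE jN; rewrite /e jN !andbF !mulr0 addr0.
  rewrite /e !eqxx /q /f srvE; case: (tb (I w) k); rewrite /= ?mulr1 ?mulr0 ?addr0 ?add0r //.
rewrite Ex_sum => [|i]; last by apply: bm_sum => j; exact: bmD.
transitivity (\sum_(i < N) \sum_(j < N) (2 * N%:R ^+ 2)^-1 * (Ex P (fun w => q w i j true + q w i j false))).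
  apply: eq_bigr => i _; rewrite Ex_sum => [|j]; last exact: bmD.
  apply: eq_bigr => j _; rewrite ExD //.
  by rewrite ExD // !qe // mulrDr.
have bq2 (i j : nat) : bm (fun w => q w i j true + q w i j false) by exact: bmD.
transitivity ((2 * N%:R ^+ 2)^-1 * Ex P (fun w => \sum_(i < N) \sum_(j < N) (q w i j true + q w i j false))).
  rewrite Ex_sum => [|i]; last by apply: bm_sum => j; exact: bq2.
  rewrite big_distrr /=; apply: eq_bigr => i _; rewrite Ex_sum => [|j]; last exact: bq2.
  by rewrite big_distrr.
rewrite -ExZ; last by apply: bm_sum => i; apply: bm_sum => j; exact: bmD.
apply: eq_Ex => w.
transitivity ((2 * N%:R ^+ 2)^-1 * (c (I w) * (2 * N%:R ^+ 2 * prt k (I w)))).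
  congr (_ * _); rewrite -route_sum big_distrr /=; apply: eq_bigr => i _; rewrite big_distrr /=.
  by apply: eq_bigr => j _; rewrite mulrDr.
have N0 : N%:R != 0 :> R by rewrite pnatr_eq0; have := c_N0 core; lia.
by field.
Qed.


Let phi k J : R := om k J * ((A k (srv J k) J)%:R - prt k J).

Hypothesis om1 : forall k J, 0 <= om k J <= 1.
Hypothesis omh : forall k w, hor < tau (I w) k -> om k (I w) = 0.

Lemma prt01 k J : 0 <= prt k J <= 1.
Proof.
have N0 : 0 < N%:R :> R by rewrite ltr0n (c_N0 core).
have c1 (p : nat -> bool) : (cnt N p)%:R <= N%:R :> R by rewrite ler_nat cnt_le.
(* Servers of [A k] have length exactly [l] and so are disjoint from those longer than [l]; this
   gives [a (b + c) <= (n - c) (n + c) <= n^2]. *)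
have h : ((cnt N (fun i => A k i J))%:R <= N%:R - (Sn J k l.+1)%:R :> R).
  rewrite lerBrDr -natrD ler_nat -{2}(cntT (m := N) (p := xpredT)) //.
  rewrite (cnt_split N xpredT (fun i => A k i J)) /= leq_add2l /Sn.
  apply: leq_cnt => i _ Xi; apply/negP => /Al; lia.
have h2 := c1 (fun i => (l <= X J k i (tau J k))%N).
rewrite /prt divr_ge0 ?mulr_ge0 //= ler_pdivrMr ?exprn_gt0 // mul1r natrD.
have := ler0n R (Sn J k l.+1); have := ler0n R (Sn J k l); have := ler0n R (cnt N (fun i => A k i J)).
have : (Sn J k l)%:R <= N%:R :> R := h2.
move: h; set a := (cnt _ _)%:R; set b := (Sn J k l)%:R; set c := (Sn J k l.+1)%:R; set n := N%:R in N0 *.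
move=> h hb a0 b0 c0.
have : a * (b + c) <= (n - c) * (n + c) by apply: ler_pM => //; lra.
by have := sqr_ge0 c; nra.
Qed.

Lemma mfd_route k : mfd (fun J => A k (srv J k) J).
Proof.
move=> d' T J mJ z; rewrite (_ : _ @^-1` _ = \bigcup_a ((fun w => srv (J w) k) @^-1` [set a] `&` (fun w => A k a (J w)) @^-1` [set z])).
  by apply: bigcup_measurable => a _; apply: measurableI; [exact: md_srv|exact: Am].
by apply/seteqP; split => [w h|w [a _ [/= <-]]] //; exists (srv (J w) k).
Qed.

Let mfm_phi k : mfm (phi k).
Proof.
move=> d' T J mJ; apply: bmM; first exact: omm.
by apply: bmB; [apply: bm_ind; exact: mfd_route|exact: mfm_prt].
Qed.

Let phi_hist j k J J' : (j < k)%N -> hist J k = hist J' k -> (forall i, tau J i = tau J' i) -> phi j J = phi j J'.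
Proof.
move=> jk e et; have ej := hist_take (ltnW jk) e; have tj := et.
have [es _] := hist_lt jk e.
by rewrite /phi (omp ej tj) (prt_hist ej tj) es (Ap _ ej tj).
Qed.

(** For [j < k] the term [phi j] and the weight of [k] depend only on the history before the samples
    of [k] are drawn, so [phi j] and [phi k] are orthogonal by [route_mean], and the square of the
    sum reduces to its diagonal. *)
Lemma arrivals_L2 : Ex P (fun w => (\sum_(K * N <= k < M) phi k (I w)) ^+ 2) <= Ex P (fun w => \sum_(K * N <= k < M) om k (I w)).
Proof.
have mI := c_minp core.
have bphi n : bm (fun w => phi n (I w)) by exact: mfm_phi.
have -> : Ex P (fun w => (\sum_(K * N <= k < M) phi k (I w)) ^+ 2) =
    \sum_(K * N <= n < M) \sum_(K * N <= k < M) Ex P (fun w => phi n (I w) * phi k (I w)).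
  transitivity (Ex P (fun w => \sum_(K * N <= n < M) \sum_(K * N <= k < M) phi n (I w) * phi k (I w))).
    by apply: eq_Ex => w; rewrite expr2 big_distrlr.
  rewrite Ex_sum => [|n]; last by apply: bm_sum => k; exact: bmM.
  by apply: eq_bigr => n _; rewrite Ex_sum // => k; exact: bmM.
rewrite Ex_sum => [|n]; last exact: omm.
have orth j k : (K * N <= k < M)%N -> (j < k)%N -> Ex P (fun w => phi j (I w) * phi k (I w)) = 0.
  move=> kM jk.
  pose c J : R := phi j J * om k J.
  have kM1 : (k < M)%N by case/andP: kM.
  have mc : mfm c by move=> d' T J mJ; apply: bmM; [exact: mfm_phi|exact: omm].
  have h : Ex P (fun w => c (I w) * (A k (srv (I w) k) (I w))%:R) = Ex P (fun w => c (I w) * prt k (I w)).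
    apply: route_mean => // [w /omh h|J J' e et]; first by rewrite /c h mulr0.
    rewrite /c (omp e et); congr (_ * _).
    exact: (phi_hist jk e et).
  move/eqP: h; rewrite -subr_eq0 -ExB; first last.
  - by apply: bmM; [exact: mc|exact: mfm_prt].
  - by apply: bmM; [exact: mc|apply: bm_ind; exact: mfd_route].
  by move=> /eqP h; rewrite -[RHS]h; apply: eq_Ex => w; rewrite /c {2}/phi; ring.
rewrite big_nat_cond [leRHS]big_nat_cond; apply: ler_sum => n /andP[nM _].
rewrite (bigD1_seq n) ?mem_index_iota ?iota_uniq //= big1_seq ?addr0 => [|k /andP[kn]]; last first.
  rewrite mem_index_iota => kM; have [nk|nk] := ltnP n k; first exact: orth.
  rewrite -(orth k n) //; last by lia.
  by apply: eq_Ex => w; exact: mulrC.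
apply: Ex_le; [exact: bmM|exact: omm|move=> w].
rewrite /phi; have /andP[h1 h2] := prt01 n (I w); have /andP[h3 h4] := om1 n (I w).
move: h1 h2 h3 h4; set p := prt n (I w); set o := om n (I w) => h1 h2 h3 h4.
have : ((A n (srv (I w) n) (I w))%:R - p) ^+ 2 <= 1 by case: (A _ _ _); rewrite ?mulr1n ?mulr0n; nra.
set z := _ - p => z1; have -> : o * z * (o * z) = o ^+ 2 * z ^+ 2 by ring.
have : o ^+ 2 * z ^+ 2 <= o ^+ 2 * 1 by apply: ler_wpM2l => //; exact: sqr_ge0.
nra.
Qed.

End RoutingL2.

End Core.

(** * Time grids *)

Section GridLemmas.
Context (R : realType).
Variables (g : nat -> R) (m : nat) (s dl : R).
Hypotheses (g0 : g 0%N = 0) (gm : g m = s) (gstep : forall i, (i < m)%N -> g i <= g i.+1 <= g i + dl).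

Lemma grid_mono i j : (i <= j)%N -> (j <= m)%N -> g i <= g j.
Proof.
move=> ij; elim: j ij => [|j IH] ij jm; first by have -> : i = 0%N by lia.
have [->//|ne] := eqVneq i j.+1.
have /andP[h _] := gstep jm; apply: le_trans h; apply: IH; lia.
Qed.

Lemma grid_ge0 i : (i <= m)%N -> 0 <= g i.
Proof. by move=> im; rewrite -g0; exact: grid_mono. Qed.

Lemma grid_cell (t : R) (f : nat -> R) : 0 < t -> t <= s ->
  exists2 i, (i < m)%N /\ (g i < t) && (t <= g i.+1) &
  \sum_(j < m) ((g j < t) && (t <= g j.+1))%:R * f j = f i.
Proof.
move=> t0 ts.
have [i [im ti]] : exists i, (i < m)%N /\ (g i < t) && (t <= g i.+1).
  have : t <= g m by rewrite gm.
  elim: (m) => [|k IH tk]; first by rewrite g0; lra.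
  have [h|h] := leP t (g k); last by exists k; rewrite h tk.
  by have [i [ik hi]] := IH h; exists i; split => //; lia.
exists i => //; rewrite (bigD1 (Ordinal im)) //= ti mul1r big1 ?addr0 // => j ji.
have -> : (g j < t) && (t <= g j.+1) = false; last by rewrite mul0r.
apply/negP => /andP[h1 h2]; have /andP[h3 h4] := ti.
move: ji; rewrite -val_eqE /=; case: (ltngtP j i) => // ij _.
  by have := @grid_mono j.+1 i ij (ltnW im); lra.
by have := @grid_mono i.+1 j ij (ltnW (ltn_ord j)); lra.
Qed.

End GridLemmas.

Section ArrivalCount.
Variable R : realType.
Implicit Types (J : inp R) (s : R).

Definition arrd J M s := cnt M (fun j => tau J j <= s).

(** Arrival times are nondecreasing, so the jobs arrived by time [s] form an initial segment; this
    is the hypothesis on [m] in the counting identities. *)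
Lemma arrd_val J m s : valid J -> forall j, (j < m)%N -> (j < arrd J m s)%N = (tau J j <= s).
Proof.
move=> v; elim: m => // m IH j jm.
have all_le : tau J m <= s -> arrd J m s = m.
  move=> t; apply: cntT => a am; apply: le_trans t; apply: tau_mono => //; lia.
have -> : arrd J m.+1 s = if tau J m <= s then m.+1 else arrd J m s.
  rewrite /arrd cntS -/(arrd J m s); case: ifP => t; last by rewrite addn0.
  by rewrite all_le // addn1.
have [jm'|mj] := ltnP j m.
  by case: ifP => t; rewrite -IH // (all_le t) jm' ltnS ltnW.
have -> : j = m by lia.
case: ifP => t; first by rewrite ltnSn.
by apply/negbTE; rewrite -leqNgt; exact: cnt_le.
Qed.

Lemma arrd_le J m s : (arrd J m s <= m)%N. Proof. exact: cnt_le. Qed.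

Lemma cnt_ge m a (p : nat -> bool) : (a <= m)%N ->
  cnt m p = (cnt a p + cnt m (fun k => (a <= k)%N && p k))%N.
Proof.
move=> am; rewrite (cnt_split m p (fun k => (k < a)%N)); congr (_ + _)%N.
  rewrite (cnt_widen am) => [|j /andP[aj _]]; last by rewrite ltnNge aj andbF.
  by apply: eq_cnt => j ->; rewrite andbT.
by apply: eq_cnt => j _; rewrite -leqNgt andbC.
Qed.

End ArrivalCount.

(** * Normalised counts: balance equations, departures and starts of service *)

Section Estimates.
Context d (Om : measurableType d) (R : realType) (P : probability Om R).
Variables (N K : nat) (I : Om -> inp R) (Gbar : R -> R) (H hor : R) (Cv Cs : nat -> set (set Om)).
Hypothesis core : core_spec P N K I Gbar H hor Cv Cs.
Let M := (K * N + K)%N.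
Let n : R := N%:R.
Implicit Types (J : inp R) (l k i : nat) (s x : R) (ox : option R).

Definition Yh J N m l s ox : R := (Yn J N m l s ox)%:R / N%:R.
Definition yb J N M l s ox : R := Yh J N (arrd J M s) l s ox.
Definition Db J N M l s : R := (Dn J N M l s)%:R / N%:R.
Definition stb J N M l s x : R := (startY J N M l s x)%:R / N%:R.
(** Initial jobs are part of the input as arrivals at time [0]; [arrY] is cut at index [K * N] into
    their contribution [i0b] and that of the true arrivals, [aYb]. *)
Definition aYb J N K l s ox : R := (cnt (K * N + K) (fun k => [&& (K * N <= k)%N, tau J k <= s,
  lvl J k == l & res J k.+1 (srv J k) (tau J k) ox]))%:R / N%:R.
Definition i0b J N K l ox : R := (arrY J N (K * N) l ox)%:R / N%:R.
(* for level [0] the routed set consists of all idle servers *)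
Definition oxl l ox : option R := if l is 0%N then None else ox.
(** A job routed to an idle server starts at once, so its completion after [x] has conditional
    probability [Gb (x - s)]. At higher levels the job in service is already there and its
    completion time is a condition on the routed set. *)
Definition wgt (Gb : R -> R) l ox s : R := if (l, ox) is (0%N, Some x) then Gb (x - s) else 1.
(** Empirical routing term: the share of servers of length exactly [l] (with the condition [ox])
    times the sum of the tails at [l] and [l + 1], as in [prt]. *)
Definition gqm J N (Gb : R -> R) m l s ox : R :=
  wgt Gb l ox s * (Yh J N m l s (oxl l ox) - Yh J N m l.+1 s (oxl l ox)) *
  (Yh J N m l s None + Yh J N m l.+1 s None).
Definition gq J N M (Gb : R -> R) l s ox : R := gqm J N Gb (arrd J M s) l s ox.
Definition dA J N K s s' : R := (cnt (K * N + K) (fun k => [&& (K * N <= k)%N, s < tau J k & tau J k <= s']))%:R / N%:R.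
Definition dep J N M s s' : R := (cnt M (fun j => [&& (srv J j < N)%N, s < cpl J j & cpl J j <= s']))%:R / N%:R.
Definition njobs J N M : R := (cnt M (fun j => (srv J j < N)%N))%:R / N%:R.

Let n0 : 0 < n. Proof. by rewrite ltr0n (c_N0 core). Qed.
Let vJ w := c_valid core w.

Lemma arrd_init w s : 0 <= s -> (K * N <= arrd (I w) M s)%N.
Proof.
move=> s0; case: (posnP (K * N)) => [->//|KN].
suff : ((K * N).-1 < arrd (I w) M s)%N by lia.
rewrite arrd_val //; last by rewrite /M; have := c_K0 core; lia.
have kk : ((K * N).-1 < K * N)%N by lia.
by have [-> _ _] := c_init core w kk.
Qed.

Lemma srv_arr w k : (K * N <= k)%N -> tau (I w) k <= hor -> (srv (I w) k < N)%N.
Proof.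
move=> Kk th; have [h1 h2] := c_arr core Kk th; rewrite srvE /rt.
by case: ifP => // _; case: ifP => // _; case: ifP.
Qed.

Let arrY_split w l s ox : 0 <= s -> s <= hor -> (arrY (I w) N (arrd (I w) M s) l ox)%:R / n =
  i0b (I w) N K l ox + aYb (I w) N K l s ox.
Proof.
move=> s0 sh; rewrite /i0b /aYb -mulrDl -natrD; congr (_%:R / _).
rewrite /arrY (cnt_ge _ (arrd_init w s0)); congr (_ + _)%N.
rewrite [RHS](@cnt_widen (arrd (I w) M s)) ?arrd_le // => [|j /andP[aj jM]]; last first.
  have := arrd_val s (vJ w) jM; rewrite ltnNge aj /= => <-.
  by rewrite /= andbF.
apply: eq_cnt => k ka; case Kk: (K * N <= k)%N => //=.
have ts : tau (I w) k <= s by rewrite -(@arrd_val _ (I w) M s (vJ w)) ?ka //; apply: leq_trans ka (arrd_le _ _ _).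
by rewrite srv_arr ?ts //; exact: le_trans sh.
Qed.

(** Finite form of the equation for [Z_(l+1) (s, x - s)]: the three terms tend to the integral
    against the departure rate, the initial datum and the routing integral. *)
Lemma balance_Y w l s x : 0 <= s -> s <= hor -> s <= x ->
  yb (I w) N M l.+1 s (Some x) = stb (I w) N M l.+1 s x + i0b (I w) N K l (Some x) + aYb (I w) N K l s (Some x).
Proof.
move=> s0 sh sx; rewrite /yb /Yh (@Yn_decomp _ _ (vJ w) N M) ?arrd_le //; last exact: arrd_val.
by rewrite natrD mulrDl -addrA arrY_split.
Qed.

(** The difference of [Db] and [stb] at level [l + 1] counts completed services and is kept as one
    term: after summation by parts only the time integral of the error of [Db] enters it. *)
Lemma balance_D w l s : 0 <= s -> s <= hor -> (0 < l)%N ->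
  Db (I w) N M l s = (Db (I w) N M l.+1 s - stb (I w) N M l.+1 s s) +
   (i0b (I w) N K l None - i0b (I w) N K l (Some s)) + (aYb (I w) N K l s None - aYb (I w) N K l s (Some s)).
Proof.
move=> s0 sh l0; have := @Dn_decomp _ _ (vJ w) N M (arrd (I w) M s) l s l0 (arrd_le _ _ _) (arrd_val s (vJ w)).
move=> /(congr1 (fun a => a%:R / n : R)); rewrite !natrD !mulrDl !arrY_split // -/(Db _ _ _ _ _).
rewrite -[X in _ + X + _ = _]/(stb (I w) N M l.+1 s s) -[X in _ = X + _]/(Db (I w) N M l.+1 s).
by rewrite /Db; lra.
Qed.

Lemma mfd_arrd m s : mfd (fun J => arrd J m s).
Proof. by move=> d' T J mJ; apply: md_cnt => j _; apply: md_ler; [exact: meas_tau|exact: measurable_cst]. Qed.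

Lemma md_select d' (T : measurableType d') (D : countType) (E : Type) (F : D -> T -> E) (f : T -> D) : md f ->
  (forall z, md (F z)) -> md (fun w => F (f w) w).
Proof.
move=> mf mF z; rewrite (_ : _ @^-1` _ = \bigcup_a (if @unpickle D a is Some y then f @^-1` [set y] `&` F y @^-1` [set z] else set0)).
  by apply: bigcup_measurable => a _; case: unpickle => // y; apply: measurableI; [exact: mf|exact: mF].
apply/seteqP; split => [w h|w [a _]]; first by exists (pickle (f w)) => //; rewrite pickleK.
by case: unpickle => // y [/= ->].
Qed.

Lemma mfd_Yn N' m l (s : inp R -> R) ox : mfr s -> mfd (fun J => Yn J N' m l (s J) ox).
Proof.
move=> ms d' T J mJ; apply: md_cnt => i _; apply: md_and.
  by apply: (md_comp (fun a => (l <= a)%N)); apply: md_X => //; [exact: md_cst|exact: ms].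
by apply: md_res => //; [exact: md_cst|exact: ms].
Qed.

Lemma Yh01 J N' m l s ox : 0 <= Yh J N' m l s ox <= 1.
Proof.
rewrite /Yh divr_ge0 //=; case: (posnP N') => [->|N0]; first by rewrite invr0 mulr0.
by rewrite ler_pdivrMr ?ltr0n // mul1r ler_nat cnt_le.
Qed.

Lemma mfm_Yh N' (m : inp R -> nat) l (s : inp R -> R) ox : mfd m -> mfr s -> mfm (fun J => Yh J N' (m J) l (s J) ox).
Proof.
move=> mm ms d' T J mJ; split; last first.
  by exists 1 => w; have /andP[h1 h2] := Yh01 (J w) N' (m (J w)) l (s (J w)) ox; rewrite ger0_norm.
apply: (@measurable_md _ _ R nat (fun a => a%:R / N'%:R)).
apply: (@md_select _ _ nat nat (fun a w => Yn (J w) N' a l (s (J w)) ox)); first exact: mm.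
by move=> a; apply: mfd_Yn.
Qed.

Lemma mfr_cst s : mfr (fun=> s). Proof. by move=> *; exact: measurable_cst. Qed.
Lemma mfm_yb N' m l s ox : mfm (fun J => yb J N' m l s ox).
Proof. by apply: mfm_Yh; [exact: mfd_arrd|exact: mfr_cst]. Qed.

Lemma mfm_cnt m (p : nat -> inp R -> bool) c : (forall j, mfd (p j)) -> mfm (fun J => (cnt m (fun j => p j J))%:R / c).
Proof. by move=> mp d' T J mJ; apply: bmM; [apply: bm_cnt => j _; exact: mp|exact: bm_cst]. Qed.

Lemma mfd_srvN N' j : mfd (fun J => (srv J j < N')%N).
Proof. by move=> d' T J mJ; exact: md_srv_lt'. Qed.
Lemma mfd_tau_le j s : mfd (fun J => tau J j <= s).
Proof. by move=> d' T J mJ; apply: md_ler; [exact: meas_tau|exact: measurable_cst]. Qed.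
Lemma mfd_tau_gt j s : mfd (fun J => s < tau J j).
Proof. by move=> d' T J mJ; apply: md_ltr; [exact: measurable_cst|exact: meas_tau]. Qed.
Lemma mfd_sta_le j s : mfd (fun J => sta J j <= s).
Proof. by move=> d' T J mJ; apply: md_ler; [exact: meas_sta|exact: measurable_cst]. Qed.
Lemma mfd_cpl_gt j s : mfd (fun J => s < cpl J j).
Proof. by move=> d' T J mJ; apply: md_ltr; [exact: measurable_cst|exact: meas_cpl]. Qed.
Lemma mfd_cpl_le j s : mfd (fun J => cpl J j <= s).
Proof. by move=> d' T J mJ; apply: md_ler; [exact: meas_cpl|exact: measurable_cst]. Qed.
Lemma mfd_lev m j l : mfd (fun J => (l <= lev J m j)%N).
Proof. by move=> d' T J mJ; apply: (md_comp (fun a => (l <= a)%N)); exact: md_lev. Qed.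
Lemma mfd_lvl j l : mfd (fun J => lvl J j == l).
Proof. by move=> d' T J mJ; apply: (md_comp (eq_op^~ l)); exact: md_lvl. Qed.
Lemma mfd_cst (b : bool) : @mfd R bool (fun=> b). Proof. by move=> *; exact: md_cst. Qed.
Lemma mfd_and (p q : inp R -> bool) : mfd p -> mfd q -> mfd (fun J => p J && q J).
Proof. by move=> mp mq d' T J mJ; apply: md_and; [exact: mp|exact: mq]. Qed.
Lemma mfd_res k ox : mfd (fun J => res J k.+1 (srv J k) (tau J k) ox).
Proof. by move=> d' T J mJ; apply: md_res => //; [exact: md_srv|exact: meas_tau]. Qed.

Lemma mfm_Db N' m l s : mfm (fun J => Db J N' m l s).
Proof. by apply: mfm_cnt => j; do 2?[apply: mfd_and]; [exact: mfd_srvN|exact: mfd_sta_le|exact: mfd_lev]. Qed.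
Lemma mfm_stb N' m l s x : mfm (fun J => stb J N' m l s x).
Proof. by apply: mfm_cnt => j; do 3?[apply: mfd_and]; [exact: mfd_srvN|exact: mfd_sta_le|exact: mfd_lev|exact: mfd_cpl_gt]. Qed.
Lemma mfm_aYb N' K' l s ox : mfm (fun J => aYb J N' K' l s ox).
Proof. by apply: mfm_cnt => j; do 3?[apply: mfd_and]; [exact: mfd_cst|exact: mfd_tau_le|exact: mfd_lvl|exact: mfd_res]. Qed.
Lemma mfm_i0b N' K' l ox : mfm (fun J => i0b J N' K' l ox).
Proof. by apply: mfm_cnt => j; do 2?[apply: mfd_and]; [exact: mfd_srvN|exact: mfd_lvl|exact: mfd_res]. Qed.
Lemma mfm_dA N' K' s s' : mfm (fun J => dA J N' K' s s').
Proof. by apply: mfm_cnt => j; do 2?[apply: mfd_and]; [exact: mfd_cst|exact: mfd_tau_gt|exact: mfd_tau_le]. Qed.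
Lemma mfm_dep N' m s s' : mfm (fun J => dep J N' m s s').
Proof. by apply: mfm_cnt => j; do 2?[apply: mfd_and]; [exact: mfd_srvN|exact: mfd_cpl_gt|exact: mfd_cpl_le]. Qed.
Lemma mfm_njobs N' m : mfm (fun J => njobs J N' m).
Proof. by apply: mfm_cnt => j; exact: mfd_srvN. Qed.

Let Jn := Ex P (fun w => njobs (I w) N M).

Lemma bmI (f : inp R -> R) : mfm f -> bm (fun w => f (I w)).
Proof. by move=> mf; apply: mf (c_minp core). Qed.

Lemma bm_yb l s ox : bm (fun w => yb (I w) N M l s ox). Proof. exact: bmI (mfm_yb N M l s ox). Qed.
Lemma bm_Db l s : bm (fun w => Db (I w) N M l s). Proof. exact: bmI (mfm_Db N M l s). Qed.
Lemma bm_stb l s x : bm (fun w => stb (I w) N M l s x). Proof. exact: bmI (mfm_stb N M l s x). Qed.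
Lemma bm_aYb l s ox : bm (fun w => aYb (I w) N K l s ox). Proof. exact: bmI (mfm_aYb N K l s ox). Qed.
Lemma bm_i0b l ox : bm (fun w => i0b (I w) N K l ox). Proof. exact: bmI (mfm_i0b N K l ox). Qed.
Lemma bm_dA s s' : bm (fun w => dA (I w) N K s s'). Proof. exact: bmI (mfm_dA N K s s'). Qed.
Lemma bm_dep s s' : bm (fun w => dep (I w) N M s s'). Proof. exact: bmI (mfm_dep N M s s'). Qed.
Lemma bm_njobs : bm (fun w => njobs (I w) N M). Proof. exact: bmI (mfm_njobs N M). Qed.
Lemma bm_mfd (p : inp R -> bool) : mfd p -> bm (fun w => (p (I w))%:R : R).
Proof. by move=> mp; apply: bm_ind; apply: mp (c_minp core). Qed.

Lemma srv_frozen w k : srv (I w) k = srv (setv (I w) k 1) k.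
Proof. by apply: setv_srv => //; exact: tau_sta. Qed.

(** Given its start, a job completes in the interval with probability at most [H (s' - s)] because
    [Gbar] is [H]-Lipschitz; the jobs of layer [0], whose age is not zero, are covered by
    [c_haz0]. *)
Lemma dep_est s s' : 0 <= s -> s <= s' -> Ex P (fun w => dep (I w) N M s s') <= H * (s' - s) * Jn.
Proof.
move=> s0 ss'.
pose q j J : R := [&& (srv J j < N)%N, s < cpl J j & cpl J j <= s']%:R.
have mq j : mfm (q j) by apply: mfm_ind; do 2?[apply: mfd_and]; [exact: mfd_srvN|exact: mfd_cpl_gt|exact: mfd_cpl_le].
have mr j : mfm (fun J => (srv J j < N)%N%:R : R) by apply: mfm_ind; exact: mfd_srvN.
rewrite (_ : (fun w => dep _ _ _ _ _) = fun w => n^-1 * \sum_(j < M) q j (I w)); last first.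
  by apply/funext => w; rewrite /dep /cnt natr_sum mulrC.
rewrite /Jn (_ : (fun w => njobs _ _ _) = fun w => n^-1 * \sum_(j < M) (srv (I w) j < N)%N%:R); last first.
  by apply/funext => w; rewrite /njobs /cnt natr_sum mulrC.
have bS1 : bm (fun w => \sum_(j < M) q j (I w)) by apply: bm_sum => j; exact: bmI (mq j).
have bS2 : bm (fun w => \sum_(j < M) (srv (I w) j < N)%N%:R : R) by apply: bm_sum => j; exact: bmI (mr j).
rewrite (ExZ _ _ bS1) (ExZ _ _ bS2).
rewrite mulrCA ler_pM2l ?invr_gt0 // Ex_sum => [|j]; last exact: bmI (mq j).
rewrite Ex_sum => [|j]; last exact: bmI (mr j).
rewrite big_distrr /=; apply: ler_sum => j _.
have [jN|Nj] := ltnP j N; first exact: (c_haz0 core jN s0 ss').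
have jM : (N <= j < M)%N by rewrite Nj ltn_ord.
have v y := @coreV _ _ _ _ _ _ _ _ _ _ _ _ core j (fun J => (srv J j < N)%N%:R) (fun J => y - sta J j) jM (mr j).
have {}v y : Ex P (fun w => (srv (I w) j < N)%N%:R * (y < cpl (I w) j)%R%:R) = Ex P (fun w => (srv (I w) j < N)%N%:R * Gbar (y - sta (I w) j)).
  rewrite -v.
  - by apply: eq_Ex => w; rewrite cplE ltrBlDl.
  - by move=> d' T J mJ; apply: measurable_funB; [exact: measurable_cst|exact: meas_sta].
  - by move=> w; rewrite -srv_frozen.
  - by move=> w; rewrite -setv_sta_self.
have b1 y : bm (fun w => (srv (I w) j < N)%N%:R * (y < cpl (I w) j)%R%:R : R).
  by apply: bmM; [exact: (bm_mfd (mfd_srvN N j))|exact: (bm_mfd (mfd_cpl_gt j y))].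
have b2 y : bm (fun w => (srv (I w) j < N)%N%:R * Gbar (y - sta (I w) j)).
  by apply: bmM; [exact: (bm_mfd (mfd_srvN N j))|exact: (bmI (mfm_gbar core y j))].
rewrite (_ : (fun w => q j (I w)) = fun w => (srv (I w) j < N)%N%:R * (s < cpl (I w) j)%R%:R - (srv (I w) j < N)%N%:R * (s' < cpl (I w) j)%R%:R); last first.
  apply/funext => w; rewrite /q; case: (srv _ _ < _)%N; rewrite ?mul0r ?subr0 // !mul1r /=.
  have [h|h] := ltP s (cpl (I w) j); have [h'|h'] := ltP s' (cpl (I w) j); rewrite /= ?subr0 ?subrr ?sub0r //; lra.
rewrite ExB // !v -ExB // -ExZ; last exact: (bm_mfd (mfd_srvN N j)).
apply: Ex_le; [exact: bmB|by apply: bmM; [exact: bm_cst|exact: (bm_mfd (mfd_srvN N j))]|move=> w].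
rewrite -mulrBr mulrC ler_wpM2r //.
have := c_GL core (_ : s - sta (I w) j <= s' - sta (I w) j); rewrite lerD2r => /(_ ss').
by rewrite (_ : s' - sta (I w) j - (s - sta (I w) j) = s' - s) //; ring.
Qed.

Lemma Jn_ge0 : 0 <= Jn.
Proof. by apply: Ex_ge0 => w; rewrite divr_ge0. Qed.

(** The first initial job of a server starts at time [0] without waiting. Starts at level [l > 0]
    thus never involve a residual service time, and [starts_L2] applies to them. *)
Lemma lev_layer0 w k : (k < N)%N -> (srv (I w) k < N)%N -> lev (I w) M k = 0%N.
Proof.
move=> kN sN.
have K1 := c_K0 core.
have kKN a : (a < N)%N -> (a < K * N)%N by nia.
have srvE' a : (a < N)%N -> (srv (I w) a < N)%N -> srv (I w) a = a.
  move=> aN; have [_ e h] := c_init core w (kKN a aN).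
  rewrite srvE /rt -e; rewrite ltnn; case: (tb _ _); case: h => ->; rewrite ?modn_small //; lia.
have st : sta (I w) k = tau (I w) k.
  case: (sta_cases (I w) k) => // -[j [jk ej _]].
  have jN : (j < N)%N by lia.
  by move: (srvE' j jN); rewrite ej => /(_ sN); rewrite srvE' //; lia.
apply: cntF => j _; apply/negP => /and3P[kj _]; rewrite st ltNge.
by move=> /negP; apply; apply: tau_mono.
Qed.

Section Grid.
Variables (g : nat -> R) (m : nat) (s dl : R).
Hypotheses (dl0 : 0 <= dl) (g0 : g 0%N = 0) (gm : g m = s) (gstep : forall i, (i < m)%N -> g i <= g i.+1 <= g i + dl).

Let s0 : 0 <= s. Proof. by rewrite -gm; exact: (grid_ge0 g0 gstep). Qed.

Let Bst l k J := [&& (N <= k)%N, (srv J k < N)%N, sta J k <= s & (l <= lev J M k)%N].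

Let Bst_eq l w k : (0 < l)%N -> Bst l k (I w) = [&& (srv (I w) k < N)%N, sta (I w) k <= s & (l <= lev (I w) M k)%N].
Proof.
move=> l0; rewrite /Bst; case: (leqP N k) => //= kN; case sN: (srv (I w) k < N)%N => //=.
by rewrite lev_layer0 // leqNgt l0 /= andbF.
Qed.

Lemma Db_sum l w t : (0 < l)%N -> Db (I w) N M l t = n^-1 * \sum_(k < M) [&& (srv (I w) k < N)%N, sta (I w) k <= t & (l <= lev (I w) M k)%N]%:R.
Proof. by rewrite /Db /Dn /cnt natr_sum mulrC. Qed.

(** Two replacements: [starts_L2] exchanges the indicator of a late completion for [Gbar (x - sta)]
    at mean-square cost [c], and rounding the starts to the grid costs [H dl] per job. What remains
    is a Stieltjes sum against [Db]. *)
Lemma starts_est l x (c : R) : (0 < l)%N -> s <= x -> 0 < c -> Jn <= c ^+ 2 * n ->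
  Ex P (fun w => `|stb (I w) N M l s x - \sum_(i < m) Gbar (x - g i) * (Db (I w) N M l (g i.+1) - Db (I w) N M l (g i))|)
  <= c + H * dl * Jn.
Proof.
move=> l0 sx c0 hJ.
pose xi k J : R := (Bst l k J)%:R * ((x < cpl J k)%R%:R - Gbar (x - sta J k)).
have mB k : mfd (Bst l k) by do 3?[apply: mfd_and]; [exact: mfd_cst|exact: mfd_srvN|exact: mfd_sta_le|exact: mfd_lev].
have L2 := @starts_L2 _ _ _ _ _ _ _ _ _ _ _ _ core (Bst l) x mB.
have {}L2 : Ex P (fun w => (\sum_(k < M) xi k (I w)) ^+ 2) <= n * Jn.
  apply: le_trans (L2 _ _) _.
  - by move=> k w /and4P[].
  - move=> k a J Na v h; rewrite /Bst -(setv_staE v ltr01 h) -(setv_lev v ltr01 M h) -setv_srv //.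
    by apply: le_trans h; exact: tau_sta.
  rewrite /Jn -ExZ; last exact: bm_njobs.
  apply: Ex_le.
  - by apply: bm_sum => k; exact: (bm_mfd (mB k)).
  - by apply: bmM; [exact: bm_cst|exact: bm_njobs].
  move=> w; rewrite /njobs mulrC divfK ?gt_eqF // /cnt natr_sum; apply: ler_sum => k _.
  by rewrite ler_nat /Bst; case: (srv _ _ < _)%N; rewrite ?andbF //; case: (_ && _).
have mxi k : mfm (xi k).
  move=> d' T J mJ; apply: bmM; first by apply: bm_ind; exact: mB.
  by apply: bmB; [exact: (mfm_ind (mfd_cpl_gt k x))|exact: (mfm_gbar core)].
have bxi k : bm (fun w => xi k (I w)) by exact: bmI (mxi k).
have bS : bm (fun w => n^-1 * \sum_(k < M) xi k (I w)).
  by apply: bmM; [exact: bm_cst|exact: bm_sum].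
have e1 : Ex P (fun w => `|n^-1 * \sum_(k < M) xi k (I w)|) <= c.
  apply: Ex_abs_sqr => //.
  rewrite (_ : (fun w => _) = fun w => n^-1 ^+ 2 * (\sum_(k < M) xi k (I w)) ^+ 2); last first.
    by apply/funext => w; rewrite exprMn.
  rewrite ExZ; last by apply: bmX; exact: bm_sum.
  apply: le_trans (_ : n^-1 ^+ 2 * (n * Jn) <= _); first by rewrite ler_pM2l ?exprn_gt0 ?invr_gt0.
  have -> : n^-1 ^+ 2 * (n * Jn) = Jn / n by field; rewrite gt_eqF.
  by rewrite ler_pdivrMr.
pose gs w := \sum_(i < m) Gbar (x - g i) * (Db (I w) N M l (g i.+1) - Db (I w) N M l (g i)).
have bgs : bm gs.
  apply: bm_sum => i; apply: bmM; first exact: bm_cst.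
  by apply: bmB; exact: bm_Db.
pose Sg w := n^-1 * \sum_(k < M) (Bst l k (I w))%:R * Gbar (x - sta (I w) k).
have bSg : bm Sg.
  apply: bmM; first exact: bm_cst.
  by apply: bm_sum => k; apply: bmM; [exact: (bm_mfd (mB k))|exact: (bmI (mfm_gbar core x k))].
(* A start with positive [lev] happens after time [0], so it lies in exactly one cell, and rounding
   it down changes [Gbar] by at most [H dl]. *)
have key w : `|Sg w - gs w| <= H * dl * njobs (I w) N M.
  have -> : gs w = n^-1 * \sum_(k < M) (Bst l k (I w))%:R * \sum_(i < m) ((g i < sta (I w) k) && (sta (I w) k <= g i.+1))%:R * Gbar (x - g i).
    rewrite /gs big_distrr /=; under [RHS]eq_bigr => k _ do rewrite mulrCA big_distrr /= big_distrr /=.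
    rewrite exchange_big; apply: eq_bigr => i _ /=.
    rewrite !Db_sum // -mulrBr -sumrB mulrCA big_distrr /= big_distrr /=; apply: eq_bigr => k _.
    rewrite Bst_eq //.
    have gi := grid_mono gstep (leqnSn i) (ltn_ord i).
    have gs' : g i.+1 <= s by rewrite -gm; exact: (grid_mono gstep (ltn_ord i) (leqnn m)).
    case: (srv _ _ < _)%N; case: (l <= lev _ _ _)%N; rewrite /= ?andbF ?andbT ?subrr ?mul0r ?mulr0 //.
    have [h1|h1] := ltP (g i) (sta (I w) k); have [h2|h2] := leP (sta (I w) k) (g i.+1); have [h3|h3] := leP (sta (I w) k) s;
      rewrite /= ?subr0 ?subrr ?mul0r ?mulr0 ?mul1r ?mulr1 //; lra.
  rewrite /Sg -mulrBr -sumrB normrM gtr0_norm ?invr_gt0 // /njobs mulrA [leRHS]mulrC ler_pM2l ?invr_gt0 //.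
  rewrite /cnt natr_sum big_distrr /=; apply: le_trans (ler_norm_sum _ _ _) _; apply: ler_sum => k _.
  case b: (Bst l k (I w)); last first.
    by rewrite !mul0r subrr normr0 !mulr_ge0 // (c_H0 core).
  rewrite !mul1r; have /and4P[_ sN sk lk] := b; rewrite sN mulr1.
  have t0 : 0 < sta (I w) k.
    have : (0 < lev (I w) M k)%N by exact: leq_trans lk.
    move=> /cnt_gt0P[j jM /and3P[_ _ tj]]; apply: le_lt_trans tj.
    have KN : (0 < K * N)%N by rewrite muln_gt0 (c_K0 core) (c_N0 core).
    by have [h _ _] := c_init core w KN; rewrite -h; apply: tau_mono.
  have [i [im /andP[h1 h2]] ->] := grid_cell g0 gm gstep (fun i => Gbar (x - g i)) t0 sk.
  have /andP[h3 h4] := gstep im.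
  have h5 := c_Gdec core (_ : x - sta (I w) k <= x - g i).
  have h6 := c_GL core (_ : x - sta (I w) k <= x - g i).
  have hh : x - sta (I w) k <= x - g i by lra.
  rewrite ger0_norm ?subr_ge0 ?h5 //; apply: le_trans (h6 hh) _.
  by rewrite ler_wpM2l ?(c_H0 core) //; lra.
apply: le_trans (_ : Ex P (fun w => `|n^-1 * \sum_(k < M) xi k (I w)| + H * dl * njobs (I w) N M) <= _).
  apply: Ex_le.
  - by apply: bm_abs; apply: bmB => //; exact: bm_stb.
  - by apply: bmD; [exact: bm_abs|apply: bmM; [exact: bm_cst|exact: bm_njobs]].
  move=> w; apply: le_trans (_ : `|n^-1 * \sum_(k < M) xi k (I w)| + `|Sg w - gs w| <= _); last by rewrite lerD2l.
  apply: le_trans (ler_normD _ _); rewrite le_eqVlt; apply/orP; left; apply/eqP; congr `|_|.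
  rewrite addrA; congr (_ - _); rewrite /Sg -mulrDr -big_split /= /stb /startY /cnt natr_sum mulrC; congr (_ * _).
  apply: eq_bigr => k _; rewrite /xi -mulrDr subrK Bst_eq //.
  by case: (srv _ _ < _)%N; case: (sta _ _ <= _); case: (l <= lev _ _ _)%N; case: (x < _); rewrite /= ?mul0r ?mulr0 ?mulr1.
rewrite ExD; [|exact: bm_abs|by apply: bmM; [exact: bm_cst|exact: bm_njobs]].
by rewrite ExZ; [rewrite lerD2r|exact: bm_njobs].
Qed.

End Grid.
End Estimates.

(** One factor is changed at a time: the weight gives [2 p], the difference [4 q] and the sum [2 q],
    from [|A - B| <= 1] and [|E + F| <= 2]. *)
Lemma prod_change (R : realType) (W W' A B A' B' E F E' F' p q : R) : 0 <= W' <= 1 ->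
  0 <= A <= 1 -> 0 <= B <= 1 -> 0 <= A' <= 1 -> 0 <= B' <= 1 -> 0 <= E <= 1 -> 0 <= F <= 1 -> `|W - W'| <= p ->
  `|A - A'| <= q -> `|B - B'| <= q -> `|E - E'| <= q -> `|F - F'| <= q ->
  `|W * (A - B) * (E + F) - W' * (A' - B') * (E' + F')| <= 6 * q + 2 * p.
Proof.
move=> /andP[w0 w1] /andP[? ?] /andP[? ?] /andP[? ?] /andP[? ?] /andP[? ?] /andP[? ?] hW hA hB hE hF.
have [hAB hAB' hEF] : [/\ `|A - B| <= 1, `|A' - B'| <= 1 & `|E + F| <= 2].
  by split; rewrite ler_norml; apply/andP; split; lra.
have nb (z z' za zb : R) : `|z| <= za -> `|z'| <= zb -> `|z * z'| <= za * zb.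
  by move=> h h'; rewrite normrM; apply: ler_pM.
have hW' : `|W'| <= 1 by rewrite ger0_norm.
have hAA : `|(A - A') - (B - B')| <= q + q := le_trans (ler_normB _ _) (lerD hA hB).
have hEE : `|(E - E') + (F - F')| <= q + q := le_trans (ler_normD _ _) (lerD hE hF).
have -> : W * (A - B) * (E + F) - W' * (A' - B') * (E' + F') =
  (W - W') * ((A - B) * (E + F)) + W' * (((A - A') - (B - B')) * (E + F)) + W' * ((A' - B') * ((E - E') + (F - F'))) by ring.
have t1 := nb _ _ _ _ hW (nb _ _ _ _ hAB hEF).
have t2 := nb _ _ _ _ hW' (nb _ _ _ _ hAA hEF).
have t3 := nb _ _ _ _ hW' (nb _ _ _ _ hAB' hEE).
apply: le_trans (ler_normD _ _) (le_trans (lerD (le_trans (ler_normD _ _) (lerD t1 t2)) t3) _); lra.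
Qed.

(** * Replacing arrivals by their conditional intensities *)

Section ArrivalEstimate.
Context d (Om : measurableType d) (R : realType) (P : probability Om R).
Variables (N K : nat) (I : Om -> inp R) (Gbar : R -> R) (H hor : R) (Cv Cs : nat -> set (set Om)).
Hypothesis core : core_spec P N K I Gbar H hor Cv Cs.
Let M := (K * N + K)%N.
Let n : R := N%:R.
Implicit Types (J : inp R) (l k i : nat) (s x : R) (ox : option R).
Let n0 : 0 < n. Proof. by rewrite ltr0n (c_N0 core). Qed.
Let vJ w := c_valid core w.
Let Jn := Ex P (fun w => njobs (I w) N M).

Lemma res_succ J k ox : valid J -> (0 < lvl J k)%N ->
  res J k.+1 (srv J k) (tau J k) ox = res J k (srv J k) (tau J k) ox.
Proof.
move=> v /cnt_gt0P[j jk /andP[/eqP ej tj]]; case: ox => //= x.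
rewrite /isv cntS; have := cpl_sta jk ej => h.
have -> : sta J k <= tau J k = false by apply/negbTE; rewrite -ltNge; lra.
by rewrite andbF addn0.
Qed.

Lemma idle_sta J k : valid J -> lvl J k = 0%N -> sta J k = tau J k.
Proof.
move=> v l0; case: (sta_cases J k) => // -[j [jk ej e]].
apply/le_anti; rewrite tau_sta andbT leNgt; apply/negP => h.
suff : (0 < lvl J k)%N by rewrite l0.
by apply/cnt_gt0P; exists j => //; rewrite ej eqxx /= -e.
Qed.

Lemma idle_res J k x : valid J -> tau J k <= x -> lvl J k = 0%N ->
  res J k.+1 (srv J k) (tau J k) (Some x) = (x < cpl J k).
Proof.
move=> v tx l0; rewrite /= /isv cntS eqxx (idle_sta v l0) lexx /=.
rewrite cntF ?add0n => [|j jk]; first by case: (x < _).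
apply/negP => /and3P[/eqP ej _ xj].
suff : (0 < lvl J k)%N by rewrite l0.
by apply/cnt_gt0P; exists j => //; rewrite ej eqxx /=; lra.
Qed.

Section Routed.
Variables (l : nat) (ox : option R) (s : R).
Hypothesis sh : s <= hor.

Let Aset k i J := (X J k i (tau J k) == l) && res J k i (tau J k) (oxl l ox).
Let om k J : R := (tau J k <= s)%R%:R * wgt Gbar l ox (tau J k).

Let mA k i : mfd (Aset k i).
Proof.
move=> d' T J mJ; apply: md_and.
  by apply: (md_comp (eq_op^~ l)); apply: md_X => //; [exact: md_cst|exact: meas_tau].
by apply: md_res => //; [exact: md_cst|exact: meas_tau].
Qed.

Lemma wgt01 s' : 0 <= wgt Gbar l ox s' <= 1.
Proof. by rewrite /wgt; case: l => [|?]; case: ox => [?|]; rewrite ?ler01 ?lexx // (c_G01 core). Qed.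

Let mom k : mfm (om k).
Proof.
move=> d' T J mJ; apply: bmM; first by apply: bm_ind; exact: mfd_tau_le.
split; last by exists 1 => w; have /andP[h1 h2] := wgt01 (tau (J w) k); rewrite ger0_norm.
rewrite /wgt; case: l => [|?]; case: ox => [x|]; try exact: measurable_cst.
apply: measurableT_comp; first exact: (c_Gm core).
by apply: measurable_funB; [exact: measurable_cst|exact: meas_tau].
Qed.

Let Ap k i J J' : hist J k = hist J' k -> (forall i, tau J i = tau J' i) -> Aset k i J = Aset k i J'.
Proof.
move=> e et; rewrite /Aset et (hist_X _ _ e); congr (_ && _).
case: (oxl l ox) => //= x; congr (0 < _)%N; apply: eq_cnt => j jk.
have [-> ->] := hist_lt jk e; congr [&& _, _ <= _ & _].
by rewrite /sta (hist_take (ltnW jk) e) (hist_lt jk e).1 et.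
Qed.

Let omp k J J' : hist J k = hist J' k -> (forall i, tau J i = tau J' i) -> om k J = om k J'.
Proof. by move=> _ et; rewrite /om !et. Qed.

Let Al k i J : Aset k i J -> X J k i (tau J k) = l.
Proof. by move=> /andP[/eqP]. Qed.

Lemma card_diff J m s' ox' : (cnt N (fun i => (X J m i s' == l) && res J m i s' ox') + Yn J N m l.+1 s' ox' = Yn J N m l s' ox')%N.
Proof.
rewrite /Yn /cnt -big_split /=; apply: eq_bigr => i _.
by case: ltngtP; case: (res _ _ _ _ _).
Qed.

Let om_prt k J : om k J * prt N Aset l k J = (tau J k <= s)%R%:R * gqm J N Gbar k l (tau J k) ox.
Proof.
rewrite /om -mulrA; congr (_ * _); rewrite /gqm -mulrA; congr (_ * _).
have SE a : Sn N J k a = Yn J N k a (tau J k) None by apply: eq_cnt => i _; rewrite /= andbT.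
have := card_diff J k (tau J k) (oxl l ox) => /(congr1 (fun a => a%:R : R)); rewrite natrD => h.
rewrite /prt !SE /Yh -!mulrDl -mulrBl -h addrK natrD.
by field; rewrite gt_eqF.
Qed.

Lemma gqm_bounds J m s' : 0 <= gqm J N Gbar m l s' ox <= 2.
Proof.
rewrite /gqm; have /andP[w0 w1] := wgt01 s'.
have /andP[a0 a1] := Yh01 J N m l s' (oxl l ox); have /andP[b0 b1] := Yh01 J N m l.+1 s' (oxl l ox).
have /andP[e0 e1] := Yh01 J N m l s' None; have /andP[f0 f1] := Yh01 J N m l.+1 s' None.
have ab : Yh J N m l.+1 s' (oxl l ox) <= Yh J N m l s' (oxl l ox).
  by rewrite ler_pM2r ?invr_gt0 // ler_nat -card_diff leq_addl.
move: (wgt _ _ _ _) (Yh J N m l s' (oxl l ox)) (Yh J N m l.+1 s' (oxl l ox)) (Yh J N m l s' None) (Yh J N m l.+1 s' None) w0 w1 a0 a1 b0 b1 e0 e1 f0 f1 ab.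
move=> w a b e f w0 w1 a0 a1 b0 b1 e0 e1 f0 f1 ab.
have h : 0 <= w * (a - b) <= 1 by apply/andP; split; nra.
by case/andP: h => h1 h2; apply/andP; split; nra.
Qed.

(** An instance of [arrivals_L2]: the routed set consists of the servers of length [l] satisfying
    [oxl l ox], and the weight contains [wgt]. With these choices weight times [prt] is exactly
    [gqm]. *)
Lemma routed_est (c : R) : 0 < c -> Jn <= c ^+ 2 * n ->
  Ex P (fun w => `|n^-1 * \sum_(k < M) [&& (K * N <= k)%N, tau (I w) k <= s & (lvl (I w) k == l) && res (I w) k (srv (I w) k) (tau (I w) k) (oxl l ox)]%:R * wgt Gbar l ox (tau (I w) k)
    - n^-1 * \sum_(k < M) ((K * N <= k)%N && (tau (I w) k <= s))%:R * gqm (I w) N Gbar k l (tau (I w) k) ox|) <= c.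
Proof.
move=> c0 hJ.
have om01 k J : 0 <= om k J <= 1.
  by rewrite /om; have /andP[h1 h2] := wgt01 (tau J k); case: (_ <= s); rewrite ?mul0r ?mul1r ?ler01 ?lexx ?h1.
have omh k w : hor < tau (I w) k -> om k (I w) = 0.
  by move=> h; rewrite /om leNgt (le_lt_trans sh h) mul0r.
have L2 := @arrivals_L2 _ _ _ _ _ _ _ _ _ _ _ _ core Aset om l mA mom Ap omp Al om01 omh.
have big_om (F : nat -> R) : \sum_(K * N <= k < M) F k = \sum_(k < M) (K * N <= k)%N%:R * F k.
  rewrite (@big_nat_widenl _ _ _ (K * N) 0) // big_mkord big_mkcond; apply: eq_bigr => k _ /=.
  by case: leqP; rewrite ?mul1r ?mul0r.
pose ph k J := om k J * ((Aset k (srv J k) J)%:R - prt N Aset l k J).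
have e w : n^-1 * \sum_(k < M) [&& (K * N <= k)%N, tau (I w) k <= s & (lvl (I w) k == l) && res (I w) k (srv (I w) k) (tau (I w) k) (oxl l ox)]%:R * wgt Gbar l ox (tau (I w) k)
    - n^-1 * \sum_(k < M) ((K * N <= k)%N && (tau (I w) k <= s))%:R * gqm (I w) N Gbar k l (tau (I w) k) ox = n^-1 * \sum_(K * N <= k < M) ph k (I w).
  rewrite -mulrBr -sumrB big_om; congr (_ * _); apply: eq_bigr => k _.
  case: (K * N <= k)%N; last by rewrite /= !mul0r subrr.
  rewrite /ph mulrBr om_prt mul1r /= /om /Aset /lvl; congr (_ - _).
  by case: (tau (I w) k <= s); rewrite /= ?mul0r ?mul1r // mulrC.
have bph : bm (fun w => \sum_(K * N <= k < M) ph k (I w)).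
  apply: bm_sum => k; apply: bmM; first exact: (bmI core (mom k)).
  apply: bmB; last exact: (bmI core (mfm_prt N l mA k)).
  apply: bm_ind; exact: (mfd_route mA k (c_minp core)).
rewrite (eq_Ex P (g := fun w => `|n^-1 * \sum_(K * N <= k < M) ph k (I w)|)); last by move=> w; rewrite e.
apply: Ex_abs_sqr => //; first by apply: bmM => //; exact: bm_cst.
rewrite (_ : (fun w => _) = fun w => n^-1 ^+ 2 * (\sum_(K * N <= k < M) ph k (I w)) ^+ 2); last first.
  by apply/funext => w; rewrite exprMn.
rewrite ExZ; last exact: bmX.
apply: le_trans (_ : n^-1 ^+ 2 * (n * Jn) <= _); last first.
  have -> : n^-1 ^+ 2 * (n * Jn) = Jn / n by field; rewrite gt_eqF.
  by rewrite ler_pdivrMr.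
rewrite ler_pM2l ?exprn_gt0 ?invr_gt0 //; apply: le_trans L2 _.
rewrite /Jn -ExZ; last exact: (bm_njobs core).
apply: Ex_le.
- by apply: bm_sum => k; exact: (bmI core (mom k)).
- by apply: bmM; [exact: bm_cst|exact: (bm_njobs core)].
move=> w; rewrite /njobs mulrC divfK ?gt_eqF // /cnt natr_sum big_om; apply: ler_sum => k _.
case: (leqP (K * N) k) => Kk; last by rewrite mul0r.
have [th|/omh ->] := leP (tau (I w) k) hor; last by rewrite mulr0.
by rewrite mul1r (srv_arr core) //; have /andP[] := om01 k (I w).
Qed.

(* replaces the service time of a job that starts at once by its survival function *)
Lemma idle_est x (c : R) : 0 < c -> s <= x -> Jn <= c ^+ 2 * n ->
  Ex P (fun w => `|n^-1 * \sum_(k < M) [&& (K * N <= k)%N, tau (I w) k <= s & lvl (I w) k == 0%N]%:R * ((x < cpl (I w) k)%R%:R - Gbar (x - tau (I w) k))|) <= c.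
Proof.
move=> c0 sx hJ.
pose B k J := [&& (K * N <= k)%N, tau J k <= s & lvl J k == 0%N].
have mB k : mfd (B k) by do 2?[apply: mfd_and]; [exact: mfd_cst|exact: mfd_tau_le|exact: mfd_lvl].
have L2 := @starts_L2 _ _ _ _ _ _ _ _ _ _ _ _ core B x mB.
pose xi k J : R := (B k J)%:R * ((x < cpl J k)%R%:R - Gbar (x - sta J k)).
have {}L2 : Ex P (fun w => (\sum_(k < M) xi k (I w)) ^+ 2) <= n * Jn.
  apply: le_trans (L2 _ _) _.
  - by move=> k w /and3P[Kk _ _]; have := c_K0 core; nia.
  - move=> k a J Na v h; rewrite /B -(setv_lvl v ltr01) //.
    by apply: le_trans h; exact: tau_sta.
  rewrite /Jn -ExZ; last exact: (bm_njobs core).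
  apply: Ex_le.
  - by apply: bm_sum => k; exact: (bm_mfd core (mB k)).
  - by apply: bmM; [exact: bm_cst|exact: (bm_njobs core)].
  move=> w; rewrite /njobs mulrC divfK ?gt_eqF // /cnt natr_sum; apply: ler_sum => k _.
  rewrite ler_nat /B; case: (leqP (K * N) k) => Kk //=; case: leP => //= ts; rewrite (srv_arr core) ?(le_trans ts) //; by case: (_ == _).
have bxi k : bm (fun w => xi k (I w)).
  apply: bmM; first exact: (bm_mfd core (mB k)).
  by apply: bmB; [exact: (bm_mfd core (mfd_cpl_gt k x))|exact: (bmI core (mfm_gbar core x k))].
rewrite (eq_Ex P (g := fun w => `|n^-1 * \sum_(k < M) xi k (I w)|)); last first.
  move=> w; congr `|_ * _|; apply: eq_bigr => k _; rewrite /xi -/(B k (I w)).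
  case b: (B k (I w)); last by rewrite !mul0r.
  by have /and3P[_ _ /eqP lk] := b; rewrite idle_sta.
apply: Ex_abs_sqr => //; first by apply: bmM; [exact: bm_cst|exact: bm_sum].
rewrite (_ : (fun w => _) = fun w => n^-1 ^+ 2 * (\sum_(k < M) xi k (I w)) ^+ 2); last first.
  by apply/funext => w; rewrite exprMn.
rewrite ExZ; last by apply: bmX; exact: bm_sum.
apply: le_trans (_ : n^-1 ^+ 2 * (n * Jn) <= _); first by rewrite ler_pM2l ?exprn_gt0 ?invr_gt0.
have -> : n^-1 ^+ 2 * (n * Jn) = Jn / n by field; rewrite gt_eqF.
by rewrite ler_pdivrMr.
Qed.

Section GridSum.
Variables (g : nat -> R) (m : nat) (dl : R).
Hypotheses (dl0 : 0 <= dl) (g0 : g 0%N = 0) (gm : g m = s) (gstep : forall i, (i < m)%N -> g i <= g i.+1 <= g i + dl).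
Variable Lam : nat -> R.
Hypothesis Lam0 : forall i, 0 <= Lam i.
Hypothesis sox : if ox is Some x then s <= x else true.

(** Between the left grid point and the arrival only queues hit by an arrival or a completion in the
    cell can change ([Yn_change]); the factors [6] and [2] come from [prod_change]. *)
Lemma gqm_change w i k : (i < m)%N -> (k < M)%N -> g i < tau (I w) k -> tau (I w) k <= g i.+1 ->
  `|gqm (I w) N Gbar k l (tau (I w) k) ox - gq (I w) N M Gbar l (g i) ox| <=
  6 * (dA (I w) N K (g i) (g i.+1) + dep (I w) N M (g i) (g i.+1)) + 2 * (H * dl).
Proof.
move=> im kM gt tg; set t := tau (I w) k in gt tg *.
have /andP[gg gd] := gstep im.
have gs : g i.+1 <= s by rewrite -gm; exact: (grid_mono gstep im (leqnn m)).
set a := arrd (I w) M (g i).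
have ak : (a <= k)%N.
  by rewrite leqNgt; apply/negP => h; have := arrd_val (g i) (vJ w) kM; rewrite h -/t => /esym; lra.
have val j : (j < k)%N -> (j < a)%N = (tau (I w) j <= g i).
  by move=> jk; apply: arrd_val => //; exact: ltn_trans kM.
pose q : R := (chg (I w) N a k (g i) t)%:R / n.
have qle : q <= dA (I w) N K (g i) (g i.+1) + dep (I w) N M (g i) (g i.+1).
  rewrite /q /dA /dep -mulrDl ler_pM2r ?invr_gt0 // -natrD ler_nat.
  apply: (@leq_trans (cnt k (fun j => (a <= j)%N) + cnt k (fun j => [&& (srv (I w) j < N)%N, (g i < cpl (I w) j)%R & (cpl (I w) j <= t)%R]))%N).
    rewrite /chg /cnt -big_split; apply: leq_sum => j _ /=.
    by case: (srv _ _ < _)%N; case: (a <= _)%N; case: (_ && _).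
  apply: leq_add; apply: leq_trans (leq_cnt_widen _ (ltnW kM)); apply: leq_cnt => j jk.
    move=> aj; have aK : (K * N <= a)%N by apply: (arrd_init core); apply: (grid_ge0 g0 gstep); exact: ltnW.
    rewrite (leq_trans aK aj) /=; have := val j jk; rewrite ltnNge aj /= => /esym/negbT; rewrite -ltNge => -> /=.
    by apply: le_trans tg; apply: tau_mono => //; exact: ltnW.
  by move=> /and3P[-> -> /= h]; exact: le_trans tg.
have ychg b ox' : (if ox' is Some x then s <= x else true) ->
    `|Yh (I w) N k b t ox' - Yh (I w) N a b (g i) ox'| <= q.
  move=> h; have h' : is_true (if ox' is Some x then t <= x else true) by case: ox' h => //= x h; lra.
  have [h1 h2] := @Yn_change _ (I w) N a k (g i) t b ox' ak (ltW gt) val h'.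
  rewrite /Yh /q -mulrBl normrM [`|n^-1|]gtr0_norm ?invr_gt0 // ler_pM2r ?invr_gt0 //.
  move: h1 h2; rewrite -!(ler_nat R) !natrD => h1 h2.
  by rewrite ler_norml; apply/andP; split; lra.
have oxl' : is_true (if oxl l ox is Some x then s <= x else true).
  by move: sox; rewrite /oxl; case: (l) => [|l'] //; case: (ox).
have wch : `|wgt Gbar l ox t - wgt Gbar l ox (g i)| <= H * dl.
  have Hd : 0 <= H * dl by rewrite mulr_ge0 ?(c_H0 core).
  rewrite /wgt; case: (l) => [|?]; last by rewrite subrr normr0.
  case: ox sox => [x sx|]; last by rewrite subrr normr0.
  have h1 := c_Gdec core (_ : x - t <= x - g i); have h2 := c_GL core (_ : x - t <= x - g i).
  have hh : x - t <= x - g i by lra.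
  rewrite ger0_norm ?subr_ge0 ?h1 //; apply: le_trans (h2 hh) _.
  by rewrite ler_wpM2l ?(c_H0 core) //; lra.
rewrite /gq -/a /gqm.
have c1 := ychg l _ oxl'; have c2 := ychg l.+1 _ oxl'; have c3 := ychg l None isT; have c4 := ychg l.+1 None isT.
apply: le_trans (_ : 6 * q + 2 * (H * dl) <= _); last by rewrite lerD2r ler_pM2l.
by apply: prod_change; rewrite ?Yh01 ?wgt01.
Qed.

Lemma grid_arrivals w :
  `|n^-1 * \sum_(k < M) ((K * N <= k)%N && (tau (I w) k <= s))%:R * gqm (I w) N Gbar k l (tau (I w) k) ox
    - \sum_(i < m) Lam i * gq (I w) N M Gbar l (g i) ox| <=
  \sum_(i < m) (4 * `|dA (I w) N K (g i) (g i.+1) - Lam i| +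
     Lam i * (6 * (dA (I w) N K (g i) (g i.+1) + dep (I w) N M (g i) (g i.+1)) + 2 * (H * dl))).
Proof.
pose ce i k := [&& (K * N <= k)%N, g i < tau (I w) k & tau (I w) k <= g i.+1].
have -> : n^-1 * \sum_(k < M) ((K * N <= k)%N && (tau (I w) k <= s))%:R * gqm (I w) N Gbar k l (tau (I w) k) ox =
    \sum_(i < m) n^-1 * \sum_(k < M) (ce i k)%:R * gqm (I w) N Gbar k l (tau (I w) k) ox.
  rewrite -big_distrr /= exchange_big /=; congr (_ * _); apply: eq_bigr => k _.
  rewrite -big_distrl /=; congr (_ * _); rewrite /ce.
  case: (leqP (K * N) k) => Kk /=; last by rewrite big1.
  have t0 := c_tau core w Kk.
  case: (leP (tau (I w) k) s) => ts.
    have [i _ h] := grid_cell g0 gm gstep (fun=> 1) t0 ts.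
    by rewrite -[LHS]h; apply: eq_bigr => j _; rewrite mulr1.
  rewrite big1 // => i _; have -> : tau (I w) k <= g i.+1 = false; last by rewrite andbF.
  by apply/negbTE; rewrite -ltNge; apply: le_lt_trans ts; rewrite -gm; exact: (grid_mono gstep (ltn_ord i) (leqnn m)).
rewrite -sumrB; apply: le_trans (ler_norm_sum _ _ _) _; apply: ler_sum => i _.
set q := 6 * _ + 2 * _.
have q0 : 0 <= q.
  rewrite /q addr_ge0 ?mulr_ge0 ?(c_H0 core) // addr_ge0 // /dA /dep divr_ge0 //.
set D := dA _ _ _ _ _.
have DE : D = n^-1 * \sum_(k < M) (ce i k)%:R by rewrite /D /dA /cnt natr_sum mulrC.
set G := gq _ _ _ _ _ _ _.
have -> : n^-1 * \sum_(k < M) (ce i k)%:R * gqm (I w) N Gbar k l (tau (I w) k) ox - Lam i * G =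
  n^-1 * \sum_(k < M) (ce i k)%:R * (gqm (I w) N Gbar k l (tau (I w) k) ox - G) + (D - Lam i) * G.
  have -> : \sum_(k < M) (ce i k)%:R * (gqm (I w) N Gbar k l (tau (I w) k) ox - G) = \sum_(k < M) (ce i k)%:R * gqm (I w) N Gbar k l (tau (I w) k) ox - (\sum_(k < M) (ce i k)%:R) * G.
    by rewrite big_distrl -sumrB; apply: eq_bigr => k _; rewrite mulrBr.
  rewrite DE; ring.
have /andP[G0 G2] : 0 <= G <= 2 by exact: gqm_bounds.
have b1 : `|n^-1 * \sum_(k < M) (ce i k)%:R * (gqm (I w) N Gbar k l (tau (I w) k) ox - G)| <= D * Num.min 2 q.
  rewrite normrM gtr0_norm ?invr_gt0 // DE -mulrA ler_pM2l ?invr_gt0 // big_distrl /=.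
  apply: le_trans (ler_norm_sum _ _ _) _; apply: ler_sum => k _.
  case c: (ce i k); last by rewrite !mul0r normr0.
  rewrite !mul1r le_min; have /and3P[_ h1 h2] := c; apply/andP; split; last exact: gqm_change.
  have /andP[h3 h4] := gqm_bounds (I w) k (tau (I w) k).
  by rewrite ler_norml; apply/andP; split; lra.
(* The product of the two random quantities [D] and [q] has no controlled mean. Since the change is
   also at most [2], the factor [D] can be exchanged for the constant [Lam i] at the cost of
   [2 |D - Lam i|]. *)
have b2 : D * Num.min 2 q <= 2 * `|D - Lam i| + Lam i * q.
  have D0 : 0 <= D by rewrite divr_ge0.
  have [m1 m2 m3] : [/\ Num.min 2 q <= 2, Num.min 2 q <= q & 0 <= Num.min 2 q].
    by rewrite !ge_min !lexx /= ?orbT le_min q0 ler0n.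
  have d1 := ler_norm (D - Lam i); have := Lam0 i; have := normr_ge0 (D - Lam i).
  set x := Num.min 2 q in m1 m2 m3 *; set y := `|_| in d1 * => y0 L0.
  have : D * x <= (y + Lam i) * x by rewrite ler_wpM2r //; lra.
  have : y * x <= y * 2 by rewrite ler_wpM2l.
  have : Lam i * x <= Lam i * q by rewrite ler_wpM2l.
  lra.
apply: le_trans (ler_normD _ _) _; rewrite (normrM (D - Lam i)) (ger0_norm G0).
have := normr_ge0 (D - Lam i); nra.
Qed.

(** Three replacements in turn: the fresh service time of a job that starts at once by its survival
    function ([T1]), the routing decision by its probability ([T2]), and arrival times by grid
    points with deterministic intensities ([T3]). The first two cost [c] each. *)
Lemma arr_est (c : R) : 0 < c -> Jn <= c ^+ 2 * n ->
  Ex P (fun w => `|aYb (I w) N K l s ox - \sum_(i < m) Lam i * gq (I w) N M Gbar l (g i) ox|) <=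
  2 * c + \sum_(i < m) (4 * Ex P (fun w => `|dA (I w) N K (g i) (g i.+1) - Lam i|) +
     Lam i * (6 * (Ex P (fun w => dA (I w) N K (g i) (g i.+1)) + H * dl * Jn) + 2 * (H * dl))).
Proof.
move=> c0 hJ.
pose T1 w := n^-1 * \sum_(k < M) [&& (K * N <= k)%N, tau (I w) k <= s & (lvl (I w) k == l) && res (I w) k (srv (I w) k) (tau (I w) k) (oxl l ox)]%:R * wgt Gbar l ox (tau (I w) k).
pose T2 w := n^-1 * \sum_(k < M) ((K * N <= k)%N && (tau (I w) k <= s))%:R * gqm (I w) N Gbar k l (tau (I w) k) ox.
pose T3 w := \sum_(i < m) Lam i * gq (I w) N M Gbar l (g i) ox.
have bwgt k : bm (fun w => wgt Gbar l ox (tau (I w) k)).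
  rewrite /wgt; case: (l) => [|?]; case: (ox) => [x|]; try exact: bm_cst.
  split; first by apply: measurableT_comp; [exact: (c_Gm core)|apply: measurable_funB; [exact: measurable_cst|apply: meas_tau; exact: (c_minp core)]].
  by exists 1 => w; have /andP[h1 h2] := c_G01 core (x - tau (I w) k); rewrite ger0_norm.
have bgqm k (mm : inp R -> nat) (t : inp R -> R) : mfd mm -> mfr t -> bm (fun w => (Yh (I w) N (mm (I w)) l (t (I w)) (oxl l ox) - Yh (I w) N (mm (I w)) l.+1 (t (I w)) (oxl l ox)) * (Yh (I w) N (mm (I w)) l (t (I w)) None + Yh (I w) N (mm (I w)) l.+1 (t (I w)) None)).
  move=> hm ht; apply: bmM; [apply: bmB|apply: bmD]; exact: (bmI core (mfm_Yh _ _ _ hm ht)).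
have bT2 : bm T2.
  apply: bmM; first exact: bm_cst.
  apply: bm_sum => k; apply: bmM; first by apply: (bm_mfd core (p := fun J => (K * N <= k)%N && (tau J k <= s))); apply: mfd_and; [exact: mfd_cst|exact: mfd_tau_le].
  rewrite /gqm; under eq_fun do rewrite -mulrA; apply: bmM; first exact: bwgt.
  by apply: (bgqm k (fun=> k) (fun J => tau J k)) => d' T J mJ; [exact: md_cst|exact: meas_tau].
have bT1 : bm T1.
  apply: bmM; first exact: bm_cst.
  apply: bm_sum => k; apply: bmM; last exact: bwgt.
  apply: (bm_mfd core (p := fun J => [&& (K * N <= k)%N, tau J k <= s & (lvl J k == l) && res J k (srv J k) (tau J k) (oxl l ox)])).
  do 3?[apply: mfd_and]; [exact: mfd_cst|exact: mfd_tau_le|exact: mfd_lvl|].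
  by move=> d' T J mJ; apply: md_res => //; [exact: md_srv|exact: meas_tau].
have bT3 : bm T3.
  apply: bm_sum => i; apply: bmM; first exact: bm_cst.
  rewrite /gq /gqm; under eq_fun do rewrite -mulrA; apply: bmM.
    split; first exact: measurable_cst.
    by exists 1 => w; have /andP[h1 h2] := wgt01 (g i); rewrite ger0_norm.
  by apply: (bgqm i (fun J => arrd J M (g i)) (fun=> g i)); [exact: mfd_arrd|exact: mfr_cst].
have bA := bm_aYb core l s ox.
have e1 : Ex P (fun w => `|aYb (I w) N K l s ox - T1 w|) <= c.
  case: (pselect (l = 0%N /\ ox <> None)) => [[l0 oxN]|h].
    case E : ox oxN sox => [x|] // _ sx.
    apply: le_trans (idle_est c0 sx hJ); rewrite le_eqVlt; apply/orP; left; apply/eqP; apply: eq_Ex => w.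
    congr `|_|; rewrite /T1 /aYb -/M E l0 /cnt natr_sum mulrC -mulrBr -sumrB; congr (_ * _); apply: eq_bigr => k _ /=.
    case: (leqP (K * N) k) => //= Kk; last by rewrite !mul0r subr0.
    case: (leP (tau (I w) k) s) => //= ts; last by rewrite !mul0r subr0.
    case: (lvl (I w) k =P 0%N) => //= lk; last by rewrite !mul0r subr0.
    by rewrite -[(0 < _)%N]/(res (I w) k.+1 (srv (I w) k) (tau (I w) k) (Some x)) idle_res //; [rewrite !mul1r|lra].
  rewrite (eq_Ex P (g := fun=> 0)) ?Ex_cst ?ltW // => w; apply/normr0P; rewrite subr_eq0; apply/eqP.
  rewrite /T1 /aYb -/M /cnt natr_sum mulrC; congr (_ * _); apply: eq_bigr => k _ /=.
  case: (leqP (K * N) k) => //= Kk; last by rewrite mul0r.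
  case: (leP (tau (I w) k) s) => //= ts; last by rewrite mul0r.
  case: (lvl (I w) k =P l) => //= lk; last by rewrite mul0r.
  case: (posnP l) => l0; last first.
    rewrite res_succ ?lk // /oxl /wgt; case: (l) l0 => // l' _; by rewrite mulr1.
  by case: ox h => [x h|_]; [exfalso; apply: h|rewrite /oxl /wgt l0 /= mulr1].
have e2 := routed_est c0 hJ; rewrite -/(Ex P (fun w => `|T1 w - T2 w|)) in e2.
pose B w := \sum_(i < m) (4 * `|dA (I w) N K (g i) (g i.+1) - Lam i| +
     Lam i * (6 * (dA (I w) N K (g i) (g i.+1) + dep (I w) N M (g i) (g i.+1)) + 2 * (H * dl))).
have bdA i : bm (fun w => `|dA (I w) N K (g i) (g i.+1) - Lam i|) by apply: bm_abs; apply: bmB; [exact: (bm_dA core)|exact: bm_cst].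
have b6 i : bm (fun w => 6 * (dA (I w) N K (g i) (g i.+1) + dep (I w) N M (g i) (g i.+1))).
  by apply: bmM; [exact: bm_cst|apply: bmD; [exact: (bm_dA core)|exact: (bm_dep core)]].
have bLam i : bm (fun w => Lam i * (6 * (dA (I w) N K (g i) (g i.+1) + dep (I w) N M (g i) (g i.+1)) + 2 * (H * dl))).
  by apply: bmM; [exact: bm_cst|apply: bmD => //; exact: bm_cst].
have b4 i : bm (fun w => 4 * `|dA (I w) N K (g i) (g i.+1) - Lam i|) by apply: bmM => //; exact: bm_cst.
have bB : bm B by apply: bm_sum => i; exact: bmD.
apply: le_trans (_ : Ex P (fun w => `|aYb (I w) N K l s ox - T1 w| + `|T1 w - T2 w| + B w) <= _).
  apply: Ex_le.
  - by apply: bm_abs; exact: bmB.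
  - by apply: bmD => //; apply: bmD; apply: bm_abs; exact: bmB.
  move=> w; have h := grid_arrivals w; rewrite -/(B w) in h.
  apply: le_trans (_ : `|aYb (I w) N K l s ox - T1 w| + `|T1 w - T2 w| + `|T2 w - T3 w| <= _); last by rewrite lerD2l.
  have -> : aYb (I w) N K l s ox - \sum_(i < m) Lam i * gq (I w) N M Gbar l (g i) ox = (aYb (I w) N K l s ox - T1 w) + (T1 w - T2 w) + (T2 w - T3 w) by rewrite /T3; ring.
  by apply: le_trans (ler_normD _ _) _; rewrite lerD2r ler_normD.
rewrite ExD //; [|by apply: bmD; apply: bm_abs; exact: bmB].
rewrite ExD; [|by apply: bm_abs; exact: bmB|by apply: bm_abs; exact: bmB].
apply: lerD; first by lra.
rewrite /B Ex_sum => [|i]; last exact: bmD.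
apply: ler_sum => i _; rewrite (ExD P (b4 i) (bLam i)) (ExZ P _ (bdA i)).
rewrite lerD2l ExZ; last by apply: bmD => //; exact: bm_cst.
rewrite ler_wpM2l // ExD ?Ex_cst //; last exact: bm_cst.
rewrite lerD2r ExZ; last by apply: bmD; [exact: (bm_dA core)|exact: (bm_dep core)].
rewrite ler_pM2l // ExD; [|exact: (bm_dA core)|exact: (bm_dep core)].
rewrite lerD2l; have /andP[h1 h2] := gstep (ltn_ord i).
apply: le_trans (dep_est core (grid_ge0 g0 gstep (ltnW (ltn_ord i))) h1) _.
rewrite ler_wpM2r ?Jn_ge0 // ler_wpM2l ?(c_H0 core) //; lra.
Qed.

End GridSum.
End Routed.
End ArrivalEstimate.

(** * Convergence to the hydrodynamic limit *)

Section RealIntegrals.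
Variable R : realType.
Local Notation mu := (@lebesgue_measure R).
Implicit Types (f q : R -> R) (s t T : R).

Definition uc T f := forall eps, 0 < eps -> exists2 dl, 0 < dl &
  forall x y, 0 <= x -> x <= y -> y <= T -> y - x < dl -> `|f y - f x| < eps.

Lemma heine T f : {within `[0, T], continuous f} -> uc T f.
Proof.
move=> cf eps e0.
pose Q (dl x : R) := `[0, T]%classic x -> forall y, `[0, T]%classic y -> `|x - y| < dl -> `|f x - f y| < eps.
have cov : \forall dl \near 0^'+, `[0, T]%classic `<=` Q dl.
  have /compact_near_coveringP h := @segment_compact R 0 T.
  apply: (h R (0^'+) Q) => x Tx.
  have /subspace_continuousP /(_ x Tx) := cf.
  have e2 : 0 < eps / 2 by rewrite divr_gt0.
  move=> /cvgrPdist_lt /(_ _ e2); rewrite /= near_withinE => /nbhs_ballP[r r0 hr].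
  have {}r0 : 0 < r := r0.
  exists (ball x (r / 2), [set dl | 0 < dl < r / 2]); last first.
    move=> [x' dl] /= [bx /andP[d0 dr]] Tx' y Ty xy.
    have h1 : `|f x - f x'| < eps / 2.
      by apply: hr => //; apply: le_ball bx; lra.
    have h2 : `|f x - f y| < eps / 2.
      apply: hr => //; move: bx; rewrite /ball /= => bx.
      have -> : x - y = (x - x') + (x' - y) by ring.
      by apply: le_lt_trans (ler_normD _ _) _; lra.
    have -> : f x' - f y = - (f x - f x') + (f x - f y) by ring.
    by apply: le_lt_trans (ler_normD _ _) _; rewrite normrN; lra.
  split => /=; first by apply: nbhsx_ballx; lra.
  near=> dl; apply/andP; split; first by near: dl; exact: nbhs_right_gt.
  by near: dl; apply: nbhs_right_lt; lra.
have [dl [d0 hd]] : exists dl : R, 0 < dl /\ `[0, T]%classic `<=` Q dl.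
  near (0:R)^'+ => dl; exists dl; split; first by near: dl; exact: nbhs_right_gt.
  by near: dl.
exists dl => // x y x0 xy yT yx.
have Tx : `[0, T]%classic x by rewrite /= in_itv /= x0; lra.
have Ty : `[0, T]%classic y by rewrite /= in_itv /=; lra.
apply: hd => //; rewrite ger0_norm; lra.
Unshelve. all: by end_near. Qed.

Lemma Ioo_sub s t f : s <= t -> Ioo t f -> Ioo s f.
Proof.
rewrite /Ioo => st hf; apply: integrableS hf; [exact: measurable_itv|exact: measurable_itv|].
by move=> x /=; rewrite !in_itv /= => /andP[-> h]; exact: le_trans st.
Qed.

Lemma RI_B t f q : Ioo t f -> Ioo t q -> RI t (fun u => f u - q u) = RI t f - RI t q.
Proof. by move=> hf hq; apply: RintegralB => //; exact: measurable_itv. Qed.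

Lemma Ioo_B t f q : Ioo t f -> Ioo t q -> Ioo t (fun u => f u - q u).
Proof.
rewrite /Ioo => hf hq.
have h : mu.-integrable `[0, t] ((EFin \o f) \- (EFin \o q))%E by exact: integrableB.
by apply: eq_integrable h => // u _ /=; rewrite EFinB.
Qed.

Lemma Ioo_Z t (c : R) f : Ioo t f -> Ioo t (fun u => c * f u).
Proof.
rewrite /Ioo => hf.
have h : mu.-integrable `[0, t] (fun x => c%:E * (EFin \o f) x)%E by exact: integrableZl.
by apply: eq_integrable h => // u _ /=; rewrite EFinM.
Qed.

Lemma RI_Z t (c : R) f : Ioo t f -> RI t (fun u => c * f u) = c * RI t f.
Proof. by move=> hf; apply: RintegralZl => //; exact: measurable_itv. Qed.

Lemma Ioo_abs t f : Ioo t f -> Ioo t (fun u => `|f u|).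
Proof. by move=> hf; have := integrable_norm hf. Qed.

Lemma RI_abs t f : Ioo t f -> `|RI t f| <= RI t (fun u => `|f u|).
Proof. by move=> hf; apply: le_normr_Rintegral => //; exact: measurable_itv. Qed.

Lemma RI0 f : RI 0 f = 0.
Proof. by rewrite /RI set_itv1 Rintegral_set1. Qed.

Lemma eq_RI t f q : (forall u, 0 <= u <= t -> f u = q u) -> RI t f = RI t q.
Proof. by move=> fq; apply: eq_Rintegral => u; rewrite inE /= in_itv /= => /fq. Qed.

Lemma eq_Ioo t f q : (forall u, 0 <= u <= t -> f u = q u) -> Ioo t f -> Ioo t q.
Proof.
move=> fq; apply: eq_integrable; first exact: measurable_itv.
by move=> u; rewrite inE /= in_itv /= => /fq ->.
Qed.

Lemma RI_split s t f : 0 <= s -> s <= t -> Ioo t f ->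
  RI t f - RI s f = \int[mu]_(u in `]s, t]) f u.
Proof. by move=> s0 st hf; rewrite /RI (Rintegral_itvB hf) // bnd_simp. Qed.

Let sub_oc s t : 0 <= s -> `]s, t]%classic `<=` `[0, t]%classic.
Proof. by move=> s0 x /=; rewrite !in_itv /= => /andP[sx ->]; rewrite andbT; lra. Qed.

Lemma RI_incr_le s t f q : 0 <= s -> s <= t -> Ioo t f -> Ioo t q ->
  (forall u, s < u -> u <= t -> f u <= q u) -> RI t f - RI s f <= RI t q - RI s q.
Proof.
move=> s0 st hf hq fq; rewrite !RI_split //; apply: le_Rintegral.
- exact: measurable_itv.
- by apply: integrableS hf; [exact: measurable_itv|exact: measurable_itv|exact: sub_oc].
- by apply: integrableS hq; [exact: measurable_itv|exact: measurable_itv|exact: sub_oc].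
- by move=> u /=; rewrite in_itv /= => /andP[su ut]; exact: fq.
Qed.

Lemma RI_mono s t f : 0 <= s -> s <= t -> Ioo t f -> (forall u, 0 <= u -> 0 <= f u) -> RI s f <= RI t f.
Proof.
move=> s0 st hf f0; rewrite -subr_ge0.
have h0 : Ioo t (fun=> 0) by apply: eq_Ioo (Ioo_Z 0 hf) => u _; rewrite mul0r.
have z a : RI a (fun=> 0) = 0 by rewrite /RI Rintegral_cst ?mul0r.
have := RI_incr_le s0 st h0 hf (fun u su _ => f0 u (le_trans s0 (ltW su))).
by rewrite !z subr0.
Qed.

Lemma RI_incr_abs s t f q : 0 <= s -> s <= t -> Ioo t f -> Ioo t q ->
  (forall u, s < u -> u <= t -> `|f u| <= q u) -> `|RI t f - RI s f| <= RI t q - RI s q.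
Proof.
move=> s0 st hf hq fq; rewrite ler_norml; apply/andP; split.
  have := RI_incr_le s0 st (Ioo_Z (-1) hf) hq.
  rewrite !RI_Z //; last exact: (Ioo_sub st).
  move=> h; have {}h := h (fun u su ut => le_trans (_ : -1 * f u <= `|f u|) (fq u su ut)).
  have : -1 * RI t f - -1 * RI s f <= RI t q - RI s q.
    by apply: h => u; rewrite mulN1r -normrN ler_norm.
  lra.
by apply: RI_incr_le => // u su ut; apply: le_trans (fq u su ut); exact: ler_norm.
Qed.

Lemma uc_RI T f : 0 <= T -> Ioo T f -> uc T (fun a => RI a f).
Proof.
move=> T0 hf; apply: heine.
exact: (@parameterized_integral_continuous R 0 T f T0 hf).
Qed.

Lemma uc_sub S T f : S <= T -> uc T f -> uc S f.
Proof.
move=> ST h e e0; have [dl d0 hd] := h e e0; exists dl => // x y x0 xy yS.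
by apply: hd => //; exact: le_trans ST.
Qed.

Lemma uc_D T f q : uc T f -> uc T q -> uc T (fun u => f u + q u).
Proof.
move=> hf hq e e0; have e2 : 0 < e / 2 by rewrite divr_gt0.
have [d1 d10 h1] := hf _ e2; have [d2 d20 h2] := hq _ e2.
exists (Num.min d1 d2); first by rewrite lt_min d10.
move=> x y x0 xy yT; rewrite lt_min => /andP[yd1 yd2].
have -> : f y + q y - (f x + q x) = (f y - f x) + (q y - q x) by ring.
apply: le_lt_trans (ler_normD _ _) _; have := h1 x y x0 xy yT yd1; have := h2 x y x0 xy yT yd2; lra.
Qed.

Lemma uc_M T f q (B : R) : (forall u, 0 <= u <= T -> `|f u| <= B) -> (forall u, 0 <= u <= T -> `|q u| <= B) ->
  uc T f -> uc T q -> uc T (fun u => f u * q u).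
Proof.
move=> bf bq hf hq e e0.
have B1 : 0 < `|B| + 1 by have := normr_ge0 B; lra.
have e2 : 0 < e / (2 * (`|B| + 1)) by rewrite divr_gt0 // mulr_gt0.
have [d1 d10 h1] := hf _ e2; have [d2 d20 h2] := hq _ e2.
exists (Num.min d1 d2); first by rewrite lt_min d10.
move=> x y x0 xy yT; rewrite lt_min => /andP[yd1 yd2].
have -> : f y * q y - f x * q x = (f y - f x) * q y + f x * (q y - q x) by ring.
apply: le_lt_trans (ler_normD _ _) _; rewrite !normrM.
have k1 := h1 x y x0 xy yT yd1; have k2 := h2 x y x0 xy yT yd2.
have xT : 0 <= x <= T by apply/andP; split => //; exact: le_trans yT.
have yT' : 0 <= y <= T by rewrite yT andbT; exact: le_trans xy.
have bx : `|f x| <= `|B| + 1 by have := bf x xT; have := ler_norm B; lra.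
have bY : `|q y| <= `|B| + 1 by have := bq y yT'; have := ler_norm B; lra.
have t1 : `|f y - f x| * `|q y| < e / 2.
  apply: le_lt_trans (_ : `|f y - f x| * (`|B| + 1) < _); first by rewrite ler_wpM2l.
  move: k1; rewrite !ltr_pdivlMr ?mulr_gt0 // => k1.
  by have -> : `|f y - f x| * (`|B| + 1) * 2 = `|f y - f x| * (2 * (`|B| + 1)) by ring.
have t2 : `|f x| * `|q y - q x| < e / 2.
  apply: le_lt_trans (_ : (`|B| + 1) * `|q y - q x| < _); first by rewrite ler_wpM2r.
  move: k2; rewrite !ltr_pdivlMr ?mulr_gt0 // => k2.
  by have -> : (`|B| + 1) * `|q y - q x| * 2 = `|q y - q x| * (2 * (`|B| + 1)) by ring.
lra.
Qed.

Lemma uc_cst T (c : R) : uc T (fun=> c).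
Proof. by move=> e e0; exists 1 => // x y _ _ _ _; rewrite subrr normr0. Qed.

Lemma uc_lip T (L : R) f : (forall x y, 0 <= x -> x <= y -> y <= T -> `|f y - f x| <= L * (y - x)) -> uc T f.
Proof.
move=> h e e0; have L1 : 0 < `|L| + 1 by have := normr_ge0 L; lra.
exists (e / (`|L| + 1)); first by rewrite divr_gt0.
move=> x y x0 xy yT; rewrite ltr_pdivlMr // => yx; apply: le_lt_trans (h x y x0 xy yT) _.
have := ler_norm L; nra.
Qed.

Lemma uc_eq T f q : (forall u, 0 <= u <= T -> f u = q u) -> uc T f -> uc T q.
Proof.
move=> fq hf e e0; have [dl d0 h] := hf e e0; exists dl => // x y x0 xy yT yx.
rewrite -!fq; [exact: h| |]; apply/andP; split => //; [exact: le_trans yT|exact: le_trans xy].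
Qed.

(** A left-endpoint Stieltjes sum against the primitive of [f]. Only the oscillation of [q] over a
    cell matters; [f] is merely integrable. *)
Lemma riemann s f q (e dl : R) (g : nat -> R) (m : nat) : 0 <= e -> Ioo s f -> Ioo s (fun u => f u * q u) ->
  g 0%N = 0 -> g m = s -> (forall i, (i < m)%N -> g i <= g i.+1 <= g i + dl) ->
  (forall x y, 0 <= x -> x <= y -> y <= s -> y - x <= dl -> `|q y - q x| <= e) ->
  `|RI s (fun u => f u * q u) - \sum_(i < m) q (g i) * (RI (g i.+1) f - RI (g i) f)| <= e * RI s (fun u => `|f u|).
Proof.
move=> e0 hf hfq g0 gm gstep hq.
have tel (F : R -> R) : F 0 = 0 -> F s = \sum_(i < m) (F (g i.+1) - F (g i)).
  move=> F0; rewrite -(big_mkord xpredT (fun i => F (g i.+1) - F (g i))) telescope_sumr // gm g0 F0 subr0 //.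
rewrite (tel (fun a => RI a (fun u => f u * q u)) (RI0 _)) (tel (fun a => RI a (fun u => `|f u|)) (RI0 _)).
rewrite -sumrB mulr_sumr; apply: le_trans (ler_norm_sum _ _ _) _; apply: ler_sum => i _.
have /andP[h1 h2] := gstep i (ltn_ord i).
have gi0 := grid_ge0 g0 gstep (ltnW (ltn_ord i)).
have gis : g i.+1 <= s by rewrite -gm; exact: (grid_mono gstep (ltn_ord i) (leqnn m)).
have gis' : g i <= s by exact: le_trans h1 gis.
have i1 : Ioo (g i.+1) f by exact: Ioo_sub gis hf.
have i2 : Ioo (g i.+1) (fun u => f u * q u) by exact: Ioo_sub gis hfq.
have i3 : Ioo (g i.+1) (fun u => q (g i) * f u) by exact: Ioo_Z.
have i1' : Ioo (g i) f by exact: Ioo_sub gis' hf.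
have i2' : Ioo (g i) (fun u => f u * q u) by exact: Ioo_sub gis' hfq.
have i3' : Ioo (g i) (fun u => q (g i) * f u) by exact: Ioo_Z.
have i4 : Ioo (g i.+1) (fun u => e * `|f u|) by apply: Ioo_Z; exact: Ioo_abs.
have i5 := Ioo_abs i1; have i5' := Ioo_abs i1'.
have := RI_incr_abs gi0 h1 (Ioo_B i2 i3) i4.
rewrite !RI_B // !RI_Z // => h.
have -> : RI (g i.+1) (fun u => f u * q u) - RI (g i) (fun u => f u * q u) - q (g i) * (RI (g i.+1) f - RI (g i) f) =
  RI (g i.+1) (fun u => f u * q u) - q (g i) * RI (g i.+1) f - (RI (g i) (fun u => f u * q u) - q (g i) * RI (g i) f) by ring.
rewrite mulrBr; apply: h => u gu ug.
rewrite [q (g i) * _]mulrC -mulrBr normrM mulrC ler_wpM2r //.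
by apply: hq => //; lra.
Qed.

Definition gr s m (i : nat) : R := s * i%:R / m%:R.

Lemma gr0 s m : gr s m 0 = 0. Proof. by rewrite /gr mulr0 mul0r. Qed.
Lemma grm s m : (0 < m)%N -> gr s m m = s.
Proof. by move=> m0; rewrite /gr mulfK // pnatr_eq0; lia. Qed.
Lemma grS s m i : gr s m i.+1 = gr s m i + s / m%:R.
Proof. by rewrite /gr -natr1; ring. Qed.
Lemma gr_step s m i : 0 <= s -> gr s m i <= gr s m i.+1 <= gr s m i + s / m%:R.
Proof. by move=> s0; rewrite grS lexx andbT lerDl divr_ge0. Qed.

Lemma fine_grid s dl : 0 <= s -> 0 < dl -> exists2 m0, (0 < m0)%N & forall m, (m0 <= m)%N -> s / m%:R < dl.
Proof.
move=> s0 d0; exists (Num.Def.truncn (s / dl)).+1 => // m hm.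
have m0 : (0 : R) < m%:R by rewrite ltr0n; lia.
rewrite ltr_pdivrMr // mulrC -ltr_pdivrMr //.
apply: lt_le_trans (_ : (Num.Def.truncn (s / dl)).+1%:R <= _); last by rewrite ler_nat.
by rewrite truncnS_gt.
Qed.

End RealIntegrals.

(** * Upper limits and discrete summation *)

Section LimsupCalculus.
Variable R : realType.
Implicit Types (u v : nat -> R) (c : R).

(** The statement that the upper limit of [u] is at most [c], in a form that needs no bound on [u]
    and is stable under finite sums. *)
Definition LS u c := forall e, 0 < e -> exists N0, forall N, (N0 <= N)%N -> u N <= c + e.

Lemma LS_le u v c : (exists N1, forall N, (N1 <= N)%N -> u N <= v N) -> LS v c -> LS u c.
Proof.
move=> [N1 h] hv e e0; have [N0 h0] := hv e e0; exists (maxn N0 N1) => N; rewrite geq_max => /andP[h1 h2].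
by apply: le_trans (h N h2) (h0 N h1).
Qed.

Lemma LS_ext u v c : (forall N, u N = v N) -> LS v c -> LS u c.
Proof. by move=> h; apply: LS_le; exists 0%N => N _; rewrite h. Qed.

Lemma LS_mono u c c' : c <= c' -> LS u c -> LS u c'.
Proof. by move=> cc h e e0; have [N0 h0] := h e e0; exists N0 => N hN; apply: le_trans (h0 N hN) _; lra. Qed.

Lemma LS_cst c c' : c <= c' -> LS (fun=> c) c'.
Proof. by move=> cc e e0; exists 0%N => N _; lra. Qed.

Lemma LS_add u v c c' : LS u c -> LS v c' -> LS (fun N => u N + v N) (c + c').
Proof.
move=> hu hv e e0; have e2 : 0 < e / 2 by rewrite divr_gt0.
have [N0 h0] := hu _ e2; have [N1 h1] := hv _ e2; exists (maxn N0 N1) => N; rewrite geq_max => /andP[k1 k2].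
by have := h0 N k1; have := h1 N k2; lra.
Qed.

Lemma LS_scale u c k : 0 <= k -> LS u c -> LS (fun N => k * u N) (k * c).
Proof.
move=> k0 hu e e0; have k1 : 0 < k + 1 by lra.
have [N0 h0] := hu _ (divr_gt0 e0 k1); exists N0 => N /h0 h.
apply: le_trans (ler_wpM2l k0 h) _; rewrite mulrDr lerD2l mulrA ler_pdivrMr //; nra.
Qed.

Lemma LS_sum m (U : 'I_m -> nat -> R) (C : 'I_m -> R) : (forall i, LS (U i) (C i)) ->
  LS (fun N => \sum_i U i N) (\sum_i C i).
Proof.
elim: m U C => [|m IH] U C h.
  by rewrite big_ord0; apply: LS_ext (LS_cst (lexx 0)) => N; rewrite big_ord0.
rewrite big_ord_recr; apply: LS_ext (LS_add (IH _ _ (fun i => h (widen_ord (leqnSn m) i))) (h ord_max)) => N.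
by rewrite big_ord_recr.
Qed.

Lemma LS_lim u c : (forall e, 0 < e -> LS u (c + e)) -> LS u c.
Proof.
move=> h e e0; have e2 : 0 < e / 2 by rewrite divr_gt0.
by have [N0 h0] := h _ e2 _ e2; exists N0 => N /h0; lra.
Qed.

(** From [exp x >= 1 + x], a left sum of the differential of [psi] against [exp (A psi)] is below
    its primitive. This produces the factor [1 / A] that makes the iteration contract. *)
Lemma phi_sum (A : R) (psi : nat -> R) m : 0 < A ->
  \sum_(i < m) (psi i.+1 - psi i) * expR (A * psi i) <= expR (A * psi m) / A.
Proof.
move=> A0; elim: m => [|m IH]; first by rewrite big_ord0 divr_ge0 ?expR_ge0 ?ltW.
rewrite big_ord_recr /=; apply: le_trans (lerD IH (lexx _)) _.
rewrite -lerBrDl -mulrBl ler_pdivlMr //.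
have -> : A * psi m.+1 = A * psi m + A * (psi m.+1 - psi m) by ring.
rewrite expRD; have := expR_ge1Dx (A * (psi m.+1 - psi m)); have := expR_gt0 (A * psi m).
move: (expR _) (expR _) => x y x0 h; nra.
Qed.

Lemma halve_le (x e : R) : 0 < e -> exists n, x / 2 ^+ n <= e.
Proof.
move=> e0; pose n := (Num.Def.truncn (x / e)).+1; exists n.
have n2 : (0 : R) < 2 ^+ n by exact: exprn_gt0.
rewrite ler_pdivrMr // mulrC -ler_pdivrMr //; apply/ltW/lt_le_trans; first exact: truncnS_gt.
by rewrite -natrX ler_nat; apply/ltnW/ltn_expl.
Qed.

Lemma sum_shift (c : R) (psi : nat -> R) m :
  \sum_(i < m) c * psi i.+1 = \sum_(i < m) c * psi i + c * (psi m - psi 0%N).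
Proof.
elim: m => [|m IH]; first by rewrite !big_ord0 subrr mulr0 addr0.
by rewrite !big_ord_recr /= IH; ring.
Qed.

(** The increments of [D] are not known to be close to their limit, only its values; summation by
    parts moves the difference onto the Lipschitz factor [a]. *)
Lemma by_parts (a D : nat -> R) m : D 0%N = 0 ->
  \sum_(i < m) a i * (D i.+1 - D i) - a m * D m = - \sum_(i < m) (a i.+1 - a i) * D i.+1.
Proof.
move=> D0; elim: m => [|m IH]; first by rewrite !big_ord0 D0 mulr0 subr0 oppr0.
rewrite !big_ord_recr /= opprD -IH; ring.
Qed.

End LimsupCalculus.

Lemma X_isv (R : realType) (J : inp R) m i (s : R) : (forall k, (k < m)%N -> tau J k <= s) ->
  (0 < X J m i s)%N -> (0 < isv J m i s s)%N.
Proof.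
move=> h /cnt_gt0P[k km pk].
have ex : exists k, (srv J k == i) && (s < cpl J k) by exists k.
case: (ex_minnP ex) => n /andP[/eqP en sn] mn.
have nm : (n < m)%N by apply: leq_ltn_trans km; exact: mn.
apply/cnt_gt0P; exists n => //; rewrite en eqxx sn andbT /=.
case: (sta_cases J n) => [->|[a [an ea ->]]]; first exact: h.
rewrite leNgt; apply/negP => sa; have := mn a; rewrite ea en eqxx sa => /(_ isT); lia.
Qed.

Lemma yb_None (R : realType) (J : inp R) N M l (s : R) : valid J -> (0 < l)%N ->
  yb J N M l s None = yb J N M l s (Some s).
Proof.
move=> v l0; rewrite /yb /Yh /Yn; congr (_%:R / _); apply: eq_cnt => i _ /=.
case: (leqP l _) => //= lX; apply/esym/X_isv; last exact: leq_trans lX.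
by move=> k km; rewrite -(arrd_val (m := M) s v) //; apply: leq_trans km (arrd_le _ _ _).
Qed.

Lemma yb0_None (R : realType) (J : inp R) N M (s : R) : (0 < N)%N -> yb J N M 0 s None = 1.
Proof. by move=> N0; rewrite /yb /Yh /Yn cntT // divff // pnatr_eq0; lia. Qed.

Lemma Ex_tri d (T : measurableType d) (R : realType) (P : probability T R) (f g : T -> R) :
  bm f -> bm g -> Ex P (fun w => `|f w + g w|) <= Ex P (fun w => `|f w|) + Ex P (fun w => `|g w|).
Proof.
move=> bf bg; rewrite -ExD; try exact: bm_abs.
by apply: Ex_le => [||w]; [apply/bm_abs/bmD|apply: bmD; exact: bm_abs|exact: ler_normD].
Qed.

Lemma Ex_tri_sum d (T : measurableType d) (R : realType) (P : probability T R) m (c : nat -> R) (f : nat -> T -> R) :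
  (forall i, bm (f i)) -> Ex P (fun w => `|\sum_(i < m) c i * f i w|) <= \sum_(i < m) `|c i| * Ex P (fun w => `|f i w|).
Proof.
move=> bf.
have bz (i : 'I_m) : bm (fun w => `|c i| * `|f i w|) by apply: bmM; [exact: bm_cst|exact: bm_abs].
apply: le_trans (_ : Ex P (fun w => \sum_(i < m) `|c i| * `|f i w|) <= _).
  apply: Ex_le => [||w]; [apply/bm_abs/bm_sum => i; apply: bmM => //; exact: bm_cst|exact: bm_sum|].
  by apply: le_trans (ler_norm_sum _ _ _) _; apply: ler_sum => i _; rewrite normrM.
by rewrite Ex_sum //; apply: ler_sum => i _; rewrite ExZ //; exact: bm_abs.
Qed.

(** * The contraction argument *)

Section Limit.
Context d (Om : measurableType d) (R : realType) (P : probability Om R).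
Variables (K : nat -> nat) (I : nat -> Om -> inp R) (Gbar : R -> R) (H T : R) (Cv Cs : nat -> nat -> set (set Om)).
Hypothesis core : forall N, (0 < N)%N -> core_spec P N (K N) (I N) Gbar H T (Cv N) (Cs N).
Let M N := (K N * N + K N)%N.
Implicit Types (l m : nat) (s t x v u e : R) (ox : option R).
Variables (C : R) (lam : R -> R) (j : nat -> R -> R) (Z0 : nat -> R -> R) (Z : nat -> R -> R -> R).
Let Lam s := RI s lam.

(** With level [0] constantly [1], every queue having length at least [0], the equation of the first
    level becomes the case [l = 0] of the general one. *)
Definition zx (l : nat) (v : R) (ox : option R) : R :=
  if l is 0%N then 1 else if ox is Some x then Z l v (x - v) else Z l v 0.
Definition qz (l : nat) (ox : option R) (v : R) : R :=
  wgt Gbar l ox v * (zx l v (oxl l ox) - zx l.+1 v (oxl l ox)) * (zx l v None + zx l.+1 v None).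

Hypotheses (T0 : 0 <= T) (C0 : 0 <= C).
Hypothesis lam0 : forall u, 0 <= lam u.
Hypothesis lamI : Ioo T lam.
Hypothesis jI : forall l, (0 < l)%N -> Ioo T (j l).
Hypothesis jGI : forall l s x, (0 < l)%N -> 0 <= s <= T -> s <= x -> Ioo s (fun u => j l u * Gbar (x - u)).
Hypothesis qI : forall l s ox, 0 <= s <= T -> (if ox is Some x then s <= x else true) -> Ioo s (fun u => lam u * qz l ox u).
Hypothesis Zb : forall l v r, (0 < l)%N -> 0 <= v <= T -> 0 <= r -> `|Z l v r| <= 1.
Hypothesis Zu : forall l s x, (0 < l)%N -> 0 <= s <= T -> s <= x -> uc s (fun u => Z l u (x - u)).
Hypothesis Zu0 : forall l, (0 < l)%N -> uc T (fun u => Z l u 0).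
Hypothesis ZY : forall l s x, 0 <= s <= T -> s <= x ->
  Z l.+1 s (x - s) = Z0 l.+1 x + RI s (fun u => j l.+1 u * Gbar (x - u)) + RI s (fun u => lam u * qz l (Some x) u).
Hypothesis ZD : forall l s, (0 < l)%N -> 0 <= s <= T ->
  RI s (j l) = (RI s (j l.+1) - RI s (fun u => j l.+1 u * Gbar (s - u))) + (Z0 l.+1 0 - Z0 l.+1 s) +
    RI s (fun u => lam u * qz l None u) - RI s (fun u => lam u * qz l (Some s) u).
Hypothesis hJ : forall N, (0 < N)%N -> Ex P (fun w => njobs (I N w) N (M N)) <= C.
Hypothesis hA : forall s s', 0 <= s -> s <= s' -> s' <= T ->
  LS (fun N => Ex P (fun w => `|dA (I N w) N (K N) s s' - (Lam s' - Lam s)|)) 0.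
Hypothesis hI : forall l x, 0 <= x -> LS (fun N => Ex P (fun w => `|i0b (I N w) N (K N) l (Some x) - Z0 l.+1 x|)) 0.
Hypothesis hI0 : forall l, (0 < l)%N -> LS (fun N => Ex P (fun w => `|i0b (I N w) N (K N) l None - Z0 l.+1 0|)) 0.

Let core1 := core (ltn0Sn 0).
Let H0 : 0 <= H := c_H0 core1.
Let G01 := c_G01 core1.

Definition eY l v ox N := Ex P (fun w => `|yb (I N w) N (M N) l v ox - zx l v ox|).
Definition eD l v N := Ex P (fun w => `|Db (I N w) N (M N) l v - RI v (j l)|).

Let LSN1 (u v : nat -> R) c : (forall N, (0 < N)%N -> u N <= v N) -> LS v c -> LS u c.
Proof. by move=> h; apply: LS_le; exists 1%N. Qed.

Let Lam_mono s t : 0 <= s -> s <= t -> t <= T -> Lam s <= Lam t.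
Proof. by move=> s0 st tT; apply: RI_mono => //; exact: (Ioo_sub tT). Qed.

Let zxb l v ox : 0 <= v <= T -> (if ox is Some x then v <= x else true) -> `|zx l v ox| <= 1.
Proof.
move=> vT; rewrite /zx; case: l => [|l]; first by rewrite normr1.
by case: ox => [x vx|_]; apply: Zb => //; rewrite subr_ge0.
Qed.

Let oxlP l ox s : (if ox is Some x then s <= x else true) -> (if oxl l ox is Some x then s <= x else true).
Proof. by case: l => //; case: ox. Qed.

Let oxle (ox : option R) v s : v <= s -> (if ox is Some x then s <= x else true) -> (if ox is Some x then v <= x else true).
Proof. by case: ox => // x vs; exact: le_trans. Qed.

Let zxu l s ox : 0 <= s <= T -> (if ox is Some x then s <= x else true) -> uc s (fun v => zx l v ox).
Proof.
move=> sT; rewrite /zx; case: l => [|l]; first by move=> _; exact: uc_cst.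
case: ox => [x sx|_]; first exact: Zu.
by apply: uc_sub (Zu0 (ltn0Sn l)); case/andP: sT.
Qed.

Let wgt1 l ox v : 0 <= wgt Gbar l ox v <= 1.
Proof. by rewrite /wgt; case: l => [|?]; case: ox => [?|]; rewrite ?ler01 ?lexx // G01. Qed.

Let wgtu l s ox : uc s (wgt Gbar l ox).
Proof.
rewrite /wgt; case: l => [|l]; last exact: uc_cst.
case: ox => [x|]; last exact: uc_cst.
apply: (@uc_lip _ _ H) => u v u0 uv vs.
have hh : x - v <= x - u by lra.
rewrite ger0_norm ?subr_ge0 ?(c_Gdec core1 hh) //; apply: le_trans (c_GL core1 hh) _.
by rewrite ler_wpM2l //; lra.
Qed.

Let qzb l s ox : 0 <= s <= T -> (if ox is Some x then s <= x else true) -> `|qz l ox s| <= 4.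
Proof.
move=> sT sx; rewrite /qz !normrM.
have /andP[w0 w1] := wgt1 l ox s; rewrite ger0_norm //.
have a1 := zxb l sT (oxlP l sx); have a2 := zxb l.+1 sT (oxlP l sx).
have a3 := zxb l (ox := None) sT isT; have a4 := zxb l.+1 (ox := None) sT isT.
have h1 : `|zx l s (oxl l ox) - zx l.+1 s (oxl l ox)| <= 2 by apply: le_trans (ler_normB _ _) _; lra.
have h2 : `|zx l s None + zx l.+1 s None| <= 2 by apply: le_trans (ler_normD _ _) _; lra.
have -> : 4 = 1 * 2 * 2 :> R by ring.
by apply: ler_pM => //; [exact: mulr_ge0|apply: ler_pM].
Qed.

Let qzu l s ox : 0 <= s <= T -> (if ox is Some x then s <= x else true) -> uc s (qz l ox).
Proof.
move=> sT sx; have /andP[s0 sT'] := sT.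
have vT v : 0 <= v <= s -> 0 <= v <= T by move=> /andP[-> h]; exact: le_trans sT'.
have b1 v : 0 <= v <= s -> `|zx l v (oxl l ox) - zx l.+1 v (oxl l ox)| <= 2.
  move=> hv; have /andP[_ vs] := hv.
  have a1 := zxb l (vT v hv) (oxle vs (oxlP l sx)); have a2 := zxb l.+1 (vT v hv) (oxle vs (oxlP l sx)).
  by apply: le_trans (ler_normB _ _) _; lra.
have b2 v : 0 <= v <= s -> `|zx l v None + zx l.+1 v None| <= 2.
  move=> hv; have a1 := zxb l (ox := None) (vT v hv) isT; have a2 := zxb l.+1 (ox := None) (vT v hv) isT.
  by apply: le_trans (ler_normD _ _) _; lra.
have b3 v : 0 <= v <= s -> `|wgt Gbar l ox v| <= 2.
  by move=> _; have /andP[w0 w1] := wgt1 l ox v; rewrite ger0_norm //; lra.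
have ucN f : uc s f -> uc s (fun v => - f v).
  by move=> h e e0; have [dl d0 hd] := h e e0; exists dl => // x y *; rewrite -opprB normrN opprK addrC; apply: hd.
have u1 : uc s (fun v => zx l v (oxl l ox) - zx l.+1 v (oxl l ox)).
  by apply: uc_D; [apply: zxu => //; exact: oxlP|apply/ucN/zxu => //; exact: oxlP].
have u2 : uc s (fun v => zx l v None + zx l.+1 v None) by apply: uc_D; apply: zxu.
have b4 v : 0 <= v <= s -> `|wgt Gbar l ox v * (zx l v (oxl l ox) - zx l.+1 v (oxl l ox))| <= 4.
  move=> hv; rewrite normrM; have -> : 4 = 2 * 2 :> R by ring.
  by apply: ler_pM => //; [exact: b3|exact: b1].
apply: (@uc_M _ _ _ _ 4) => //; first by move=> v /b2; lra.
by apply: (@uc_M _ _ _ _ 2).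
Qed.

(* nonrandom Riemann approximations on the uniform grid of [0, s] *)
Let rie_q l s ox e : 0 < e -> 0 <= s <= T -> (if ox is Some x then s <= x else true) ->
  exists m0, forall m, (m0 <= m)%N -> (0 < m)%N ->
   `|RI s (fun u => lam u * qz l ox u) - \sum_(i < m) qz l ox (gr s m i) * (Lam (gr s m i.+1) - Lam (gr s m i))| <= e.
Proof.
move=> e0 sT sx; have /andP[s0 sT'] := sT.
have Ls : 0 <= RI s (fun u => `|lam u|).
  by apply: Rintegral_ge0 => u _.
have e1 : 0 < e / (RI s (fun u => `|lam u|) + 1) by rewrite divr_gt0 //; lra.
have [dl d0 hd] := qzu l sT sx e1; have [m0 m00 hm] := fine_grid s0 d0.
exists m0 => m mm m1; have h := hm m mm.
apply: le_trans (_ : e / (RI s (fun u => `|lam u|) + 1) * RI s (fun u => `|lam u|) <= _).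
  apply: (@riemann _ _ _ _ _ (s / m%:R)); [exact: ltW|exact: Ioo_sub lamI|exact: qI|exact: gr0|exact: grm|by move=> i _; exact: gr_step|].
  by move=> x y x0 xy ys yx; apply/ltW/hd => //; exact: le_lt_trans h.
rewrite mulrAC ler_pdivrMr; nra.
Qed.

Let rie_j l s x e : (0 < l)%N -> 0 < e -> 0 <= s <= T -> s <= x ->
  exists m0, forall m, (m0 <= m)%N -> (0 < m)%N ->
   `|RI s (fun u => j l u * Gbar (x - u)) - \sum_(i < m) Gbar (x - gr s m i) * (RI (gr s m i.+1) (j l) - RI (gr s m i) (j l))| <= e.
Proof.
move=> l0 e0 sT sx; have /andP[s0 sT'] := sT.
have Ls : 0 <= RI s (fun u => `|j l u|) by apply: Rintegral_ge0 => u _.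
have e1 : 0 < e / (RI s (fun u => `|j l u|) + 1) by rewrite divr_gt0 //; lra.
have [dl d0 hd] := (wgtu 0%N s (Some x)) _ e1; have [m0 m00 hm] := fine_grid s0 d0.
exists m0 => m mm m1; have h := hm m mm.
apply: le_trans (_ : e / (RI s (fun u => `|j l u|) + 1) * RI s (fun u => `|j l u|) <= _).
  apply: (@riemann _ _ _ (fun u => Gbar (x - u)) _ (s / m%:R)); [exact: ltW|exact: Ioo_sub (jI l0)|exact: jGI|exact: gr0|exact: grm|by move=> i _; exact: gr_step|].
  by move=> y z y0 yz zs zy; apply/ltW/hd => //; exact: le_lt_trans h.
rewrite mulrAC ler_pdivrMr; nra.
Qed.

(** Twice the sum [3 H + 30] of the constants collected in [Y_step]. *)
Let A : R := 6 * H + 60.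
Let A0 : 0 < A. Proof. by have := H0; rewrite /A; lra. Qed.
Let phi v := expR (A * (v + Lam v)).
Let phi0 v : 0 < phi v. Proof. exact: expR_gt0. Qed.
Let Lam00 : Lam 0 = 0. Proof. exact: RI0. Qed.
Let phi1 v : 0 <= v <= T -> 1 <= phi v.
Proof.
move=> /andP[v0 vT]; rewrite -expR0 ler_expR; apply: mulr_ge0; first exact: ltW.
by apply: addr_ge0 => //; rewrite -Lam00 Lam_mono.
Qed.

Let gr_in s m i : 0 <= s <= T -> (0 < m)%N -> (i <= m)%N -> 0 <= gr s m i <= s.
Proof.
move=> /andP[s0 sT] m0 im.
have st k : (k < m)%N -> gr s m k <= gr s m k.+1 <= gr s m k + s / m%:R by move=> _; exact: gr_step.
rewrite (grid_ge0 (gr0 s m) st im) /= -{2}(grm s m0); exact: (grid_mono st im (leqnn m)).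
Qed.

Let sum_Lam s m : 0 <= s <= T -> (0 < m)%N ->
  \sum_(i < m) (Lam (gr s m i.+1) - Lam (gr s m i)) * phi (gr s m i) <= phi s / A.
Proof.
move=> sT m0; apply: le_trans (_ : \sum_(i < m) ((gr s m i.+1 + Lam (gr s m i.+1)) - (gr s m i + Lam (gr s m i))) * phi (gr s m i) <= _).
  apply: ler_sum => i _; apply: ler_wpM2r; first exact: ltW (phi0 _).
  have /andP[h _] := gr_step m i (proj1 (andP sT)); lra.
by have := phi_sum (fun i => gr s m i + Lam (gr s m i)) m A0; rewrite grm.
Qed.

Let sum_dt s m : 0 <= s <= T -> (0 < m)%N -> \sum_(i < m) (s / m%:R) * phi (gr s m i) <= phi s / A.
Proof.
move=> sT m0; apply: le_trans (_ : \sum_(i < m) ((gr s m i.+1 + Lam (gr s m i.+1)) - (gr s m i + Lam (gr s m i))) * phi (gr s m i) <= _).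
  apply: ler_sum => i _; apply: ler_wpM2r; first exact: ltW (phi0 _).
  rewrite grS.
  have /andP[h1 h2] := gr_in sT m0 (ltn_ord i); have /andP[h3 h4] := gr_in sT m0 (ltnW (ltn_ord i)).
  have := Lam_mono h3 (proj1 (andP (gr_step m i (proj1 (andP sT))))) (le_trans h2 (proj2 (andP sT))).
  by rewrite grS; lra.
by have := phi_sum (fun i => gr s m i + Lam (gr s m i)) m A0; rewrite grm.
Qed.

Let Lam_fine s e : 0 < e -> 0 <= s <= T -> exists m0, forall m, (m0 <= m)%N -> (0 < m)%N -> forall i, (i < m)%N ->
  Lam (gr s m i.+1) - Lam (gr s m i) <= e.
Proof.
move=> e0 sT; have [dl d0 hd] := uc_RI T0 lamI e0; have [m0 m00 hm] := fine_grid (proj1 (andP sT)) d0.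
exists m0 => m mm m1 i im; have h := hm m mm.
have /andP[h3 h4] := gr_in sT m1 (ltnW im); have /andP[h5 h6] := gr_in sT m1 im.
have := hd _ _ h3 (proj1 (andP (gr_step m i (proj1 (andP sT))))) (le_trans h6 (proj2 (andP sT))).
rewrite grS addrAC subrr add0r => /(_ h) /ltW; rewrite -/(Lam _) -/(Lam _); exact: le_trans (ler_norm _).
Qed.

Let Db0 l N w : (0 < N)%N -> (0 < l)%N -> Db (I N w) N (M N) l 0 = 0.
Proof.
move=> N0 l0; rewrite /Db /Dn cntF ?mul0r // => n nM; apply/negP => /and3P[_ sn ln].
have /cnt_gt0P[k kM /and3P[_ _ tk]] : (0 < lev (I N w) (M N) n)%N by exact: leq_trans ln.
have : 0 <= tau (I N w) k.
  case: (ltnP k (K N * N)) => h; first by have [-> _ _] := c_init (core N0) w h.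
  by have := c_tau (core N0) w h; lra.
lra.
Qed.

Let Db_njobs l s N w : 0 <= Db (I N w) N (M N) l s <= njobs (I N w) N (M N).
Proof.
rewrite /Db /njobs divr_ge0 //= ler_wpM2r ?invr_ge0 // ler_nat.
by apply: leq_cnt => n _ /and3P[].
Qed.

(** The weighted distance is at most [c], as an upper limit at each level and time separately: a
    step of the iteration looks only at finitely many grid points and two neighbouring levels, so no
    rate uniform in them is needed. *)
Let HBY c := forall l x v, (0 < l)%N -> 0 <= v <= T -> v <= x -> LS (eY l v (Some x)) (c * 2 ^+ l * phi v).
Let HBD c := forall l v, (0 < l)%N -> 0 <= v <= T -> LS (eD l v) (c * 2 ^+ l * phi v).
(** There is no error at level [0], hence the weight [0]; only [p2 l + p2 (l + 1) <= 3 * 2 ^ l] is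
    used. *)
Let p2 (l : nat) : R := if l is 0%N then 0 else 2 ^+ l.

Let eY_any c l ox v : 0 <= c -> HBY c -> 0 <= v <= T -> (if ox is Some x then v <= x else true) ->
  (if (l, ox) is (0%N, Some x) then false else true) ->
  LS (eY l v ox) (c * p2 l * phi v).
Proof.
move=> c0 hY vT; case: l => [|l].
  case: ox => // _ _; rewrite /p2 mulr0 mul0r; apply: LSN1 (LS_cst (lexx 0)) => N N0.
  by rewrite /eY (eq_Ex _ (g := fun=> 0)) ?Ex_cst // => w; rewrite yb0_None //= subrr normr0.
case: ox => [x vx _|_ _]; first exact: hY.
apply: LSN1 (hY l.+1 v v (ltn0Sn l) vT (lexx v)) => N N0; rewrite /eY le_eqVlt; apply/orP; left; apply/eqP/eq_Ex => w.
by rewrite yb_None //= ?subrr //; exact: (c_valid (core N0)).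
Qed.

Let bmy N l v ox : (0 < N)%N -> bm (fun w => yb (I N w) N (M N) l v ox - zx l v ox).
Proof. by move=> N0; apply: bmB; [exact: (bm_yb (core N0))|exact: bm_cst]. Qed.

Let bgq N l v ox : (0 < N)%N -> bm (fun w => gq (I N w) N (M N) Gbar l v ox - qz l ox v).
Proof.
move=> N0; apply: bmB; last exact: bm_cst.
have y := bm_yb (core N0); rewrite /yb in y.
by rewrite /gq /gqm; apply: bmM; [apply: bmM; [exact: bm_cst|apply: bmB; exact: y]|apply: bmD; exact: y].
Qed.

Let gq_err N l v ox : (0 < N)%N -> 0 <= v <= T -> (if ox is Some x then v <= x else true) ->
  Ex P (fun w => `|gq (I N w) N (M N) Gbar l v ox - qz l ox v|) <=
  2 * (eY l v (oxl l ox) N + eY l.+1 v (oxl l ox) N) + 2 * (eY l v None N + eY l.+1 v None N).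
Proof.
move=> N0 vT vx; rewrite /eY.
have b l' ox' := bm_abs (bmy l' v ox' N0).
rewrite -!ExD // -!ExZ //; try exact: bmD.
rewrite -ExD; try by apply: bmM; [exact: bm_cst|exact: bmD].
apply: Ex_le => [||w]; first by apply: bm_abs; exact: bgq.
  by apply: bmD; (apply: bmM; [exact: bm_cst|exact: bmD]).
rewrite /gq /gqm -/(yb (I N w) N (M N) l v (oxl l ox)) -/(yb (I N w) N (M N) l.+1 v (oxl l ox)).
rewrite -/(yb (I N w) N (M N) l v None) -/(yb (I N w) N (M N) l.+1 v None) /qz.
have y01 a o : 0 <= yb (I N w) N (M N) a v o <= 1 by exact: Yh01.
have := y01 l None; have := y01 l.+1 None.
have := zxb l vT (oxlP l vx); have := zxb l.+1 vT (oxlP l vx); have /andP[] := wgt1 l ox v.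
move: (yb _ _ _ l v None) (yb _ _ _ l.+1 v None) (yb _ _ _ l v (oxl l ox)) (yb _ _ _ l.+1 v (oxl l ox)) (wgt _ _ _ _) => y1 y2 y3 y4 ww.
move: (zx l v (oxl l ox)) (zx l.+1 v (oxl l ox)) (zx l v None) (zx l.+1 v None) => z3 z4 z1 z2.
move=> w0 w1 b4 b3 /andP[y20 y21] /andP[y10 y11].
have -> : ww * (y3 - y4) * (y1 + y2) - ww * (z3 - z4) * (z1 + z2) =
  ww * (((y3 - z3) - (y4 - z4)) * (y1 + y2) + (z3 - z4) * ((y1 - z1) + (y2 - z2))) by ring.
rewrite normrM (ger0_norm w0); apply: le_trans (ler_wpM2r (normr_ge0 _) w1) _.
rewrite mul1r; apply: le_trans (ler_normD _ _) _; rewrite !normrM; apply: lerD.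
  rewrite mulrC; apply: ler_pM => //; first by rewrite ger0_norm; lra.
  exact: ler_normB.
apply: ler_pM => //; last exact: ler_normD.
by apply: le_trans (ler_normB _ _) _; lra.
Qed.

Let JnC N : (0 < N)%N -> 0 <= Ex P (fun w => njobs (I N w) N (M N)) <= C.
Proof. by move=> N0; rewrite hJ // Jn_ge0. Qed.

Let c2N c : 0 < c -> exists N0, forall N, (N0 <= N)%N -> (0 < N)%N /\ Ex P (fun w => njobs (I N w) N (M N)) <= c ^+ 2 * N%:R.
Proof.
move=> c0; exists (Num.Def.truncn (C / c ^+ 2)).+1 => N hN; have N0 : (0 < N)%N by lia.
split=> //; have /andP[_ h] := JnC N0; apply: le_trans h _.
have c20 : 0 < c ^+ 2 by rewrite exprn_gt0.
rewrite mulrC -ler_pdivrMr //; apply/ltW/lt_le_trans; first exact: truncnS_gt.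
by rewrite ler_nat.
Qed.

(** The routing term is Lipschitz in the tails with constant [2] in each of its four arguments
    ([gq_err]). The four errors weigh at most [4 * 3 * 2 ^ l], which gives the [12], and their sum
    over the grid costs [phi s / A]. *)
Let arr_lim c l s ox : 0 <= c -> HBY c -> 0 <= s <= T -> (if ox is Some x then s <= x else true) ->
  LS (fun N => Ex P (fun w => `|aYb (I N w) N (K N) l s ox - RI s (fun u => lam u * qz l ox u)|)) (12 * c * 2 ^+ l * phi s / A).
Proof.
have Cp := C0; have Hp := H0; move=> c0 hY sT sx; have /andP[s0 sT'] := sT.
apply: LS_lim => e e0.
have L0 : 0 <= Lam s by rewrite -Lam00; apply: Lam_mono.
have L1 : 0 < Lam s + 1 by lra.
(* Five errors of size [q] are spent: two mean-square terms, two for the width of the grid and one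
   for the Riemann sum. *)
pose q := e / 8.
have q0 : 0 < q by rewrite /q divr_gt0.
have q1 : 0 < q / (6 * (Lam s + 1)) by rewrite divr_gt0 // mulr_gt0.
have q2 : 0 < q / ((Lam s + 1) * ((6 * C + 2) * H + 1)).
  rewrite divr_gt0 // mulr_gt0 //; have : 0 <= (6 * C + 2) * H by apply: mulr_ge0 => //; lra.
  lra.
have [m1 hm1] := rie_q l q0 sT sx; have [m2 hm2] := Lam_fine q1 sT; have [m3 m30 hm3] := fine_grid s0 q2.
pose m := maxn m1 (maxn m2 m3).
have mm2 : (m2 <= m)%N by exact: leq_trans (leq_maxl _ _) (leq_maxr _ _).
have mm3 : (m3 <= m)%N by exact: leq_trans (leq_maxr _ _) (leq_maxr _ _).
have m0 : (0 < m)%N := leq_trans m30 mm3.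
have {}hm1 := hm1 m (leq_maxl _ _) m0.
have {}hm2 i : (i < m)%N -> Lam (gr s m i.+1) - Lam (gr s m i) <= q / (6 * (Lam s + 1)).
  exact: hm2.
have {}hm3 := hm3 m mm3.
have st i : (i < m)%N -> gr s m i <= gr s m i.+1 <= gr s m i + s / m%:R by move=> _; exact: gr_step.
pose g := gr s m; pose D i := if (i < m)%N then Lam (g i.+1) - Lam (g i) else 0.
have DE i : (i < m)%N -> D i = Lam (g i.+1) - Lam (g i) by move=> h; rewrite /D h.
have D0 i : 0 <= D i.
  rewrite /D; case: ifP => // im; rewrite subr_ge0; apply: Lam_mono.
  - by case/andP: (gr_in sT m0 (ltnW im)).
  - by case/andP: (st i im).
  - by apply: le_trans sT'; case/andP: (gr_in sT m0 im).
have sD : \sum_(i < m) D i = Lam s.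
  rewrite (eq_bigr (fun i : 'I_m => Lam (g i.+1) - Lam (g i))); last by move=> i _; rewrite DE.
  by rewrite -(big_mkord xpredT (fun i => Lam (g i.+1) - Lam (g i))) telescope_sumr // /g grm // gr0 Lam00 subr0.
pose aN i N := Ex P (fun w => `|dA (I N w) N (K N) (g i) (g i.+1) - D i|).
have aL i : (i < m)%N -> LS (aN i) 0.
  move=> im; rewrite /aN DE //; apply: hA.
  - by case/andP: (gr_in sT m0 (ltnW im)).
  - by case/andP: (st i im).
  - by apply: le_trans sT'; case/andP: (gr_in sT m0 im).
have gT i : (i < m)%N -> 0 <= g i <= T.
  by move=> im; have /andP[-> h] := gr_in sT m0 (ltnW im); exact: le_trans sT'.
have gx i : (i < m)%N -> if ox is Some x then g i <= x else true.
  by move=> im; apply: oxle sx; case/andP: (gr_in sT m0 (ltnW im)).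
pose dl := s / m%:R.
have dl0 : 0 <= dl by rewrite divr_ge0.
pose U N := (2 * q + \sum_(i < m) (4 * aN i N + D i * (6 * (D i + aN i N + H * dl * C) + 2 * (H * dl)))) +
  \sum_(i < m) D i * (2 * (eY l (g i) (oxl l ox) N + eY l.+1 (g i) (oxl l ox) N) + 2 * (eY l (g i) None N + eY l.+1 (g i) None N)) + q.
have [N1 hN1] := c2N q0.
apply: (@LS_le _ _ U).
  exists N1 => N /hN1[N0 JN]; have cN := core N0.
  pose f w := aYb (I N w) N (K N) l s ox - \sum_(i < m) D i * gq (I N w) N (M N) Gbar l (g i) ox.
  pose h w := \sum_(i < m) D i * (gq (I N w) N (M N) Gbar l (g i) ox - qz l ox (g i)).
  pose k := \sum_(i < m) qz l ox (g i) * (Lam (g i.+1) - Lam (g i)) - RI s (fun u => lam u * qz l ox u).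
  have bf : bm f.
    apply: bmB; first exact: bm_aYb cN _ _ _.
    apply: bm_sum => i; apply: bmM; first exact: bm_cst.
    have y := bm_yb cN; rewrite /yb in y.
    by rewrite /gq /gqm; apply: bmM; [apply: bmM; [exact: bm_cst|apply: bmB; exact: y]|apply: bmD; exact: y].
  have bh : bm h by apply: bm_sum => i; apply: bmM; [exact: bm_cst|exact: bgq].
  rewrite (@eq_Ex _ _ _ _ _ (fun w => `|(f w + h w) + k|)); last first.
    move=> w; congr `|_|; rewrite /f /h /k.
    have -> : \sum_(i < m) qz l ox (g i) * (Lam (g i.+1) - Lam (g i)) = \sum_(i < m) D i * qz l ox (g i).
      by apply: eq_bigr => i _; rewrite DE // mulrC.
    have -> : \sum_(i < m) D i * (gq (I N w) N (M N) Gbar l (g i) ox - qz l ox (g i)) =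
      \sum_(i < m) D i * gq (I N w) N (M N) Gbar l (g i) ox - \sum_(i < m) D i * qz l ox (g i).
      by rewrite -sumrB; apply: eq_bigr => i _; rewrite mulrBr.
    ring.
  apply: le_trans (Ex_tri P (bmD bf bh) (bm_cst _ k)) _; apply: lerD; last by rewrite Ex_cst distrC.
  apply: le_trans (Ex_tri P bf bh) _; apply: lerD.
    apply: le_trans (arr_est cN l sT' dl0 (gr0 s m) (grm s m0) st D0 sx q0 JN) _.
    rewrite lerD2l; apply: ler_sum => i _; rewrite lerD2l; apply: ler_wpM2l => //.
    rewrite lerD2r; apply: ler_wpM2l => //; apply: lerD.
      rewrite -[D i](Ex_cst P) -ExD; [|exact: bm_cst|by apply: bm_abs; apply: bmB; [exact: (bm_dA cN)|exact: bm_cst]].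
      apply: Ex_le => [||w]; [exact: (bm_dA cN)|by apply: bmD; [exact: bm_cst|apply: bm_abs; apply: bmB; [exact: (bm_dA cN)|exact: bm_cst]]|].
      have := ler_norm (dA (I N w) N (K N) (g i) (g i.+1) - D i); rewrite /g; lra.
    by apply: ler_wpM2l; [exact: mulr_ge0|have /andP[] := JnC N0].
  apply: le_trans (Ex_tri_sum P m D (f := fun i w => gq (I N w) N (M N) Gbar l (g i) ox - qz l ox (g i)) _) _.
    by move=> i; exact: bgq.
  apply: ler_sum => i _; rewrite ger0_norm //; apply: ler_wpM2l => //; apply: gq_err => //; [exact: gT|exact: gx].
have part1 : LS (fun N => 2 * q + \sum_(i < m) (4 * aN i N + D i * (6 * (D i + aN i N + H * dl * C) + 2 * (H * dl))))
   (2 * q + \sum_(i < m) D i * (6 * (q / (6 * (Lam s + 1)) + H * dl * C) + 2 * (H * dl))).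
  apply: LS_add; first exact: LS_cst.
  apply: LS_sum => i; have im := ltn_ord i.
  apply: (@LS_ext _ _ (fun N => (4 + D i * 6) * aN i N + D i * (6 * (D i + H * dl * C) + 2 * (H * dl)))); first by move=> N; ring.
  rewrite -[X in LS _ X]add0r; apply: LS_add.
    by rewrite -[X in LS _ X](mulr0 (4 + D i * 6)); apply: LS_scale (aL i im); have := D0 i; lra.
  apply: LS_cst; apply: ler_wpM2l => //; rewrite lerD2r; apply: ler_wpM2l => //; rewrite lerD2r DE //; exact: hm2.
have part2 : LS (fun N => \sum_(i < m) D i * (2 * (eY l (g i) (oxl l ox) N + eY l.+1 (g i) (oxl l ox) N) + 2 * (eY l (g i) None N + eY l.+1 (g i) None N)))
   (\sum_(i < m) D i * (12 * c * 2 ^+ l * phi (g i))).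
  apply: LS_sum => i; have im := ltn_ord i; apply: LS_scale => //.
  have a1 := eY_any (l := l) c0 hY (gT i im) (oxlP l (gx i im)).
  have a2 := eY_any (l := l.+1) c0 hY (gT i im) (oxlP l (gx i im)) isT.
  have a3 := eY_any (l := l) (ox := None) c0 hY (gT i im) isT.
  have a4 := eY_any (l := l.+1) (ox := None) c0 hY (gT i im) isT isT.
  have {}a1 := a1 (ltac:(by case: (l))); have {}a3 := a3 (ltac:(by case: (l))).
  apply: LS_mono (LS_add (LS_scale (_ : 0 <= 2) (LS_add a1 a2)) (LS_scale (_ : 0 <= 2) (LS_add a3 a4))) => //.
  have pp : p2 l + p2 l.+1 <= 3 * 2 ^+ l.
    by rewrite /p2; case: (l) => [|a]; [rewrite expr0 expr1; lra|rewrite [2 ^+ a.+2]exprS; lra].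
  have -> : 2 * (c * p2 l * phi (g i) + c * p2 l.+1 * phi (g i)) + 2 * (c * p2 l * phi (g i) + c * p2 l.+1 * phi (g i)) =
    4 * c * phi (g i) * (p2 l + p2 l.+1) by ring.
  have -> : 12 * c * 2 ^+ l * phi (g i) = 4 * c * phi (g i) * (3 * 2 ^+ l) by ring.
  by apply: ler_wpM2l => //; apply: mulr_ge0; [apply: mulr_ge0|apply: ltW].
have part3 := LS_add (LS_add part1 part2) (LS_cst (lexx q)).
apply: LS_mono part3.
have b2 : \sum_(i < m) D i * (12 * c * 2 ^+ l * phi (g i)) <= 12 * c * 2 ^+ l * phi s / A.
  rewrite (eq_bigr (fun i : 'I_m => 12 * c * 2 ^+ l * ((Lam (g i.+1) - Lam (g i)) * phi (g i)))); last by move=> i _; rewrite DE //; ring.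
  rewrite -mulr_sumr -[X in _ <= X]mulrA; apply: ler_wpM2l; last exact: sum_Lam.
  by apply: mulr_ge0; [apply: mulr_ge0|exact: exprn_ge0].
have b1 : \sum_(i < m) D i * (6 * (q / (6 * (Lam s + 1)) + H * dl * C) + 2 * (H * dl)) <= 2 * q.
  rewrite -mulr_suml sD.
  have -> : 6 * (q / (6 * (Lam s + 1)) + H * dl * C) + 2 * (H * dl) = q / (Lam s + 1) + (6 * C + 2) * H * dl.
    by field; rewrite gt_eqF // (_ : 6 * Lam s + 6 = 6 * (Lam s + 1)) ?mulr_gt0 //; ring.
  rewrite mulrDr.
  have u1 : Lam s * (q / (Lam s + 1)) <= q by rewrite mulrA ler_pdivrMr //; nra.
  have u2 : Lam s * ((6 * C + 2) * H * dl) <= q.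
    have z : 0 <= (6 * C + 2) * H by apply: mulr_ge0 => //; lra.
    have z1 : 0 < (Lam s + 1) * ((6 * C + 2) * H + 1) by apply: mulr_gt0 => //; lra.
    move: hm3; rewrite -/dl ltr_pdivlMr // => /ltW; apply: le_trans.
    rewrite [X in _ <= X]mulrC -mulrA; nra.
  lra.
rewrite /q in b1 *; lra.
Qed.

Let Gstep s x m i : 0 <= s <= T -> (0 < m)%N -> (i < m)%N ->
  `|- (Gbar (x - gr s m i.+1) - Gbar (x - gr s m i))| <= H * (s / m%:R).
Proof.
move=> /andP[s0 _] m0 im; have /andP[h1 h2] := gr_step m i s0.
have hh : x - gr s m i.+1 <= x - gr s m i by lra.
have := c_Gdec core1 hh; have := c_GL core1 hh => k1 k2.
rewrite normrN ger0_norm ?subr_ge0 //; apply: le_trans k1 _; apply: ler_wpM2l => //; lra.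
Qed.

(* right endpoints cost one extra step of the grid *)
Let sum_dt_r s m : 0 <= s <= T -> (0 < m)%N ->
  \sum_(i < m) (s / m%:R) * phi (gr s m i.+1) <= phi s / A + s / m%:R * phi s.
Proof.
have p0 := phi0 0; move=> sT m0; have h := sum_dt sT m0; move: p0 h; clearbody phi => p0 h.
have e := sum_shift (s / m%:R) (fun i => phi (gr s m i)) m; rewrite /= grm // gr0 in e.
rewrite e mulrBr addrA; have : 0 <= s / m%:R * phi 0 by apply: mulr_ge0; [apply: divr_ge0 => //; case/andP: sT|exact: ltW].
by move=> t0; rewrite -addrA; apply: lerD h _; rewrite gerBl.
Qed.

(** After summation by parts the error of [Db] enters through its time integral, which is small by
    [phi_sum], and through the boundary term with factor [Gbar (x - s)], which is not small. That
    term is kept on the left: for [x = s] it is the combination appearing in [balance_D]. *)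
Let start_lim c l s x : 0 <= c -> HBD c -> (0 < l)%N -> 0 <= s <= T -> s <= x ->
  LS (fun N => Ex P (fun w => `|(stb (I N w) N (M N) l s x - Gbar (x - s) * Db (I N w) N (M N) l s) -
    (RI s (fun u => j l u * Gbar (x - u)) - Gbar (x - s) * RI s (j l))|)) (H * c * 2 ^+ l * phi s / A).
Proof.
have Cp := C0; have Hp := H0; move=> c0 hD l0 sT sx; have /andP[s0 sT'] := sT.
apply: LS_lim => e e0.
pose q := e / 4; have q0 : 0 < q by rewrite /q divr_gt0.
pose B := H * c * 2 ^+ l * phi s.
have B0 : 0 <= B by apply: mulr_ge0; [apply: mulr_ge0; [exact: mulr_ge0|exact: exprn_ge0]|exact: ltW].
have HC : 0 <= H * C by exact: mulr_ge0.
have q1 : 0 < q / (H * C + B + 1) by rewrite divr_gt0 //; lra.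
have [m1 hm1] := rie_j l0 q0 sT sx; have [m3 m30 hm3] := fine_grid s0 q1.
pose m := maxn m1 m3.
have mm3 : (m3 <= m)%N := leq_maxr _ _.
have m0 : (0 < m)%N := leq_trans m30 mm3.
have {}hm1 := hm1 m (leq_maxl _ _) m0; have {}hm3 := hm3 m mm3.
pose dl := s / m%:R; have dl0 : 0 <= dl by rewrite divr_ge0.
have {}hm3 : (H * C + B) * dl <= q.
  have z : 0 < H * C + B + 1 by lra.
  move: hm3; rewrite -/dl ltr_pdivlMr // => /ltW; nra.
pose g := gr s m.
have st i : (i < m)%N -> g i <= g i.+1 <= g i + dl by move=> _; exact: gr_step.
have gT i : (i < m)%N -> 0 <= g i.+1 <= T.
  by move=> im; have /andP[-> h] := gr_in sT m0 im; exact: le_trans sT'.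
pose a i := Gbar (x - g i).
pose U N := (q + H * dl * C) + \sum_(i < m) (H * dl) * eD l (g i.+1) N + q.
have [N1 hN1] := c2N q0.
apply: (@LS_le _ _ U).
  exists N1 => N /hN1[N0 JN]; have cN := core N0.
  pose f w := stb (I N w) N (M N) l s x - \sum_(i < m) a i * (Db (I N w) N (M N) l (g i.+1) - Db (I N w) N (M N) l (g i)).
  pose h w := \sum_(i < m) - (a i.+1 - a i) * (Db (I N w) N (M N) l (g i.+1) - RI (g i.+1) (j l)).
  pose k := \sum_(i < m) a i * (RI (g i.+1) (j l) - RI (g i) (j l)) - RI s (fun u => j l u * Gbar (x - u)).
  have bD v := bm_Db cN l v.
  have bf : bm f by apply: bmB; [exact: (bm_stb cN)|apply: bm_sum => i; apply: bmM; [exact: bm_cst|apply: bmB; exact: bD]].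
  have bh : bm h by apply: bm_sum => i; apply: bmM; [exact: bm_cst|apply: bmB; [exact: bD|exact: bm_cst]].
  rewrite (@eq_Ex _ _ _ _ _ (fun w => `|(f w + h w) + k|)); last first.
    move=> w; congr `|_|; rewrite /f /h /k.
    have := @by_parts _ a (fun i => Db (I N w) N (M N) l (g i)) m; rewrite /= /g gr0 Db0 // => /(_ erefl).
    have := @by_parts _ a (fun i => RI (g i) (j l)) m; rewrite /= /g gr0 RI0 => /(_ erefl).
    rewrite /a /g grm // => e1 e2.
    have -> : \sum_(i < m) - (Gbar (x - gr s m i.+1) - Gbar (x - gr s m i)) * (Db (I N w) N (M N) l (gr s m i.+1) - RI (gr s m i.+1) (j l)) =
      \sum_(i < m) (Gbar (x - gr s m i.+1) - Gbar (x - gr s m i)) * RI (gr s m i.+1) (j l) -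
      \sum_(i < m) (Gbar (x - gr s m i.+1) - Gbar (x - gr s m i)) * Db (I N w) N (M N) l (gr s m i.+1).
      by rewrite -sumrB; apply: eq_bigr => i _; ring.
    move: e1 e2; lra.
  apply: le_trans (Ex_tri P (bmD bf bh) (bm_cst _ k)) _; apply: lerD; last by rewrite Ex_cst distrC.
  apply: le_trans (Ex_tri P bf bh) _; apply: lerD.
    apply: le_trans (starts_est cN dl0 (gr0 s m) (grm s m0) st l0 sx q0 JN) _.
    by rewrite lerD2l; apply: ler_wpM2l; [exact: mulr_ge0|have /andP[] := JnC N0].
  apply: le_trans (Ex_tri_sum P m (fun i => - (a i.+1 - a i)) (f := fun i w => Db (I N w) N (M N) l (g i.+1) - RI (g i.+1) (j l)) _) _.
    by move=> i; apply: bmB; [exact: bD|exact: bm_cst].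
  by apply: ler_sum => i _; apply: ler_wpM2r; [exact: Ex_ge0|exact: Gstep].
have part : LS (fun N => \sum_(i < m) (H * dl) * eD l (g i.+1) N) (\sum_(i < m) (H * dl) * (c * 2 ^+ l * phi (g i.+1))).
  by apply: LS_sum => i; have im := ltn_ord i; apply: LS_scale; [exact: mulr_ge0|apply: hD => //; exact: gT].
apply: LS_mono (LS_add (LS_add (LS_cst (lexx (q + H * dl * C))) part) (LS_cst (lexx q))).
have -> : \sum_(i < m) H * dl * (c * 2 ^+ l * phi (g i.+1)) = H * c * 2 ^+ l * \sum_(i < m) dl * phi (g i.+1).
  by rewrite mulr_sumr; apply: eq_bigr => i _; ring.
have w0 : 0 <= H * c * 2 ^+ l by apply: mulr_ge0; [exact: mulr_ge0|exact: exprn_ge0].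
have := ler_wpM2l w0 (sum_dt_r sT m0); rewrite -/dl mulrDr mulrA -/B => h.
have e1 : H * c * 2 ^+ l * (dl * phi s) = B * dl by rewrite /B; ring.
rewrite e1 in h; rewrite /q in hm3 *; lra.
Qed.

(** In units of [c 2^l phi / A]: [2 H] from the starts at level [l + 1] and [12] from each of the
    two arrival terms; the initial terms vanish in the limit. *)
Let D_step c : 0 <= c -> HBY c -> HBD c -> HBD ((2 * H + 24) * c / A).
Proof.
have Hp := H0; move=> c0 hY hD l s l0 sT; have /andP[s0 sT'] := sT.
have f1 := start_lim c0 hD (ltn0Sn l) sT (lexx s).
have f2 := hI0 l0; have f3 := hI l s0.
have f4 := @arr_lim _ l s None c0 hY sT isT.
have f5 := @arr_lim _ l s (Some s) c0 hY sT (lexx s).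
apply: LS_mono (LS_le _ (LS_add (LS_add (LS_add (LS_add f1 f2) f3) f4) f5)).
  by rewrite exprS !addr0 le_eqVlt; apply/orP; left; apply/eqP; field; exact: lt0r_neq0.
exists 1%N => N N0; have cN := core N0.
have b1 := bm_stb cN l.+1 s s; have b2 := bm_Db cN l.+1 s; have b3 ox := bm_i0b cN l ox; have b4 ox := bm_aYb cN l s ox.
have bc (f : Om -> R) k : bm f -> bm (fun w => f w - k) by move=> bf; apply: bmB => //; exact: bm_cst.
have G0 : Gbar (s - s) = 1 by rewrite subrr (c_Gneg cN).
rewrite -!ExD; do ?[by apply: bm_abs; apply: bc; try (apply: bmB => //; apply: bmM => //; exact: bm_cst)]; do ?[exact: bmD];
  do ?[by do ?apply: bmD; apply: bm_abs; apply: bc; try (apply: bmB => //; apply: bmM => //; exact: bm_cst)].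
apply: Ex_le => [||w]; [by apply: bm_abs; apply: bc; exact: bm_Db cN _ _|by do ?apply: bmD; apply: bm_abs; apply: bc; try (apply: bmB => //; apply: bmM => //; exact: bm_cst)|].
rewrite (balance_D cN w s0 sT' l0) (ZD l0 sT) G0 !mul1r.
set a1 := Db _ _ _ _ _; set a2 := stb _ _ _ _ _ _; set a3 := i0b _ _ _ _ None; set a4 := i0b _ _ _ _ (Some _).
set a5 := aYb _ _ _ _ _ None; set a6 := aYb _ _ _ _ _ _; set r1 := RI s _; set r2 := RI s _; set r3 := RI s _; set r4 := RI s _.
have -> : a1 - a2 + (a3 - a4) + (a5 - a6) - (r1 - r2 + (Z0 l.+1 0 - Z0 l.+1 s) + r3 - r4) =
  ((((- (a2 - a1 - (r2 - r1)) + (a3 - Z0 l.+1 0)) - (a4 - Z0 l.+1 s)) + (a5 - r3)) - (a6 - r4)) by ring.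
apply: le_trans (ler_normB _ _) _; rewrite lerD2r.
apply: le_trans (ler_normD _ _) _; rewrite lerD2r.
apply: le_trans (ler_normB _ _) _; rewrite lerD2r.
by apply: le_trans (ler_normD _ _) _; rewrite lerD2r normrN.
Qed.

(** In units of [c 2^(l+1) phi / A]: [H] from the starts, [2 H + 24] from the boundary value of
    [Db], and [6] from the arrivals, in all [A / 2]. The boundary value has a coefficient that may
    equal [1], so the bound already improved by [D_step] is used for it. *)
Let Y_step c : 0 <= c -> HBY c -> HBD c -> HBY (c / 2).
Proof.
have Hp := H0; move=> c0 hY hD [//|l] x s _ sT sx; have /andP[s0 sT'] := sT.
have f1 := start_lim c0 hD (ltn0Sn l) sT sx.
have f2 := D_step c0 hY hD (ltn0Sn l) sT.
have f3 := hI l (le_trans s0 sx).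
have f4 := @arr_lim _ l s (Some x) c0 hY sT sx.
apply: LS_mono (LS_le _ (LS_add (LS_add (LS_add f1 f2) f3) f4)).
  rewrite addr0 exprS /A le_eqVlt; apply/orP; left; apply/eqP; field.
  by apply: lt0r_neq0; lra.
exists 1%N => N N0; have cN := core N0.
have b1 := bm_stb cN l.+1 s x; have b2 := bm_Db cN l.+1 s; have b3 ox := bm_i0b cN l ox; have b4 ox := bm_aYb cN l s ox.
have bc (f : Om -> R) k : bm f -> bm (fun w => f w - k) by move=> bf; apply: bmB => //; exact: bm_cst.
rewrite /eY /eD -!ExD; do ?[by apply: bm_abs; apply: bc; try (apply: bmB => //; apply: bmM => //; exact: bm_cst)]; do ?[exact: bmD];
  do ?[by do ?apply: bmD; apply: bm_abs; apply: bc; try (apply: bmB => //; apply: bmM => //; exact: bm_cst)].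
apply: Ex_le => [||w]; [by apply: bm_abs; apply: bc; exact: bm_yb cN _ _ _|by do ?apply: bmD; apply: bm_abs; apply: bc; try (apply: bmB => //; apply: bmM => //; exact: bm_cst)|].
rewrite (balance_Y cN w l s0 sT' sx) /zx (ZY l sT sx).
set a1 := Db _ _ _ _ _; set a2 := stb _ _ _ _ _ _; set a4 := i0b _ _ _ _ (Some _).
set a6 := aYb _ _ _ _ _ _; set r2 := RI s (fun u => j _ u * _); set r4 := RI s (fun u => lam u * _); set r1 := RI s (j _).
have -> : a2 + a4 + a6 - (Z0 l.+1 x + r2 + r4) =
  (((a2 - Gbar (x - s) * a1 - (r2 - Gbar (x - s) * r1)) + Gbar (x - s) * (a1 - r1)) + (a4 - Z0 l.+1 x)) + (a6 - r4) by ring.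
apply: le_trans (ler_normD _ _) _; rewrite lerD2r.
apply: le_trans (ler_normD _ _) _; rewrite lerD2r.
apply: le_trans (ler_normD _ _) _; rewrite lerD2l.
by have /andP[g0 g1] := G01 (x - s); rewrite normrM ger0_norm // ler_piMl.
Qed.

Let Z0b l x : (0 < l)%N -> 0 <= x -> `|Z0 l x| <= 1.
Proof.
case: l => // l _ x0; have t0 : 0 <= (0 : R) <= T by apply/andP.
by have := ZY l t0 x0; rewrite !RI0 !addr0 => <-; apply: Zb => //; rewrite subr0.
Qed.

Let B : R := 2 + 4 * Lam T.
Let B0 : 0 <= B.
Proof. by have := Lam_mono (lexx 0) T0 (lexx T); rewrite Lam00 /B => h; lra. Qed.

(** In the equation for [Z] on the boundary [r = 0] every other term is bounded uniformly in the
    level: [Z] and [Z0] by [1], the routing term by [4 Lam T]. *)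
Let KB l s : (0 < l)%N -> 0 <= s <= T -> `|RI s (fun u => j l u * Gbar (s - u))| <= B.
Proof.
case: l => // l _ sT; have /andP[s0 sT'] := sT.
have e := ZY l sT (lexx s).
have -> : RI s (fun u => j l.+1 u * Gbar (s - u)) = Z l.+1 s (s - s) - Z0 l.+1 s - RI s (fun u => lam u * qz l (Some s) u).
  by rewrite e; ring.
have z1 : `|Z l.+1 s (s - s)| <= 1 by apply: Zb; rewrite ?subrr.
have z2 := Z0b (ltn0Sn l) s0.
have z3 : `|RI s (fun u => lam u * qz l (Some s) u)| <= 4 * Lam T.
  have i1 : Ioo s (fun u => lam u * qz l (Some s) u) by apply: qI.
  have i2 : Ioo s (fun u => 4 * lam u) by apply: Ioo_Z; exact: Ioo_sub lamI.
  have := RI_incr_abs (lexx 0) s0 i1 i2; rewrite !RI0 !subr0 RI_Z; last exact: Ioo_sub lamI.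
  move=> h; apply: le_trans (h _) _; last by apply: ler_wpM2l => //; exact: Lam_mono.
  move=> u u0 us; rewrite normrM (ger0_norm (lam0 u)) mulrC; apply: ler_wpM2r => //.
  by apply: qzb => //; rewrite (ltW u0) (le_trans us).
apply: le_trans (ler_normB _ _) _; rewrite /B; apply: lerD z3.
by apply: le_trans (ler_normB _ _) _; lra.
Qed.

(** Summation by parts turns the integral of [j] into the integral of [j] against [Gbar], bounded by
    [KB], plus a time integral of the same quantity, which the weight reduces by the factor
    [H / A <= 1 / 2]. *)
Let Jstep l c : (0 < l)%N -> 0 <= c -> (forall v, 0 <= v <= T -> `|RI v (j l)| <= c * phi v) ->
  forall s, 0 <= s <= T -> `|RI s (j l)| <= (B + c / 2) * phi s.
Proof.
have Hp := H0; move=> l0 c0 hj s sT; have /andP[s0 sT'] := sT.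
apply/ler_addgt0Pr => e e0.
pose q := e / 2; have q0 : 0 < q by rewrite /q divr_gt0.
pose W := H * c * phi s.
have W0 : 0 <= W by apply: mulr_ge0; [exact: mulr_ge0|exact: ltW].
have q1 : 0 < q / (W + 1) by rewrite divr_gt0 //; lra.
have [m1 hm1] := rie_j l0 q0 sT (lexx s); have [m3 m30 hm3] := fine_grid s0 q1.
pose m := maxn m1 m3.
have mm3 : (m3 <= m)%N := leq_maxr _ _.
have m0 : (0 < m)%N := leq_trans m30 mm3.
have {}hm1 := hm1 m (leq_maxl _ _) m0; have {}hm3 := hm3 m mm3.
pose dl := s / m%:R; have dl0 : 0 <= dl by rewrite divr_ge0.
have {}hm3 : W * dl <= q.
  have z : 0 < W + 1 by lra.
  move: hm3; rewrite -/dl ltr_pdivlMr // => /ltW; nra.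
have := @by_parts _ (fun i => Gbar (s - gr s m i)) (fun i => RI (gr s m i) (j l)) m.
rewrite /= gr0 RI0 grm // subrr (c_Gneg core1 (lexx 0)) mul1r => /(_ erefl) e1.
have k1 := KB l0 sT.
set S1 := \sum_(i < m) _ in e1; set S2 := \sum_(i < m) _ in e1.
have h1 : `|S1| <= B + q.
  have -> : S1 = RI s (fun u => j l u * Gbar (s - u)) - (RI s (fun u => j l u * Gbar (s - u)) - S1) by ring.
  by apply: le_trans (ler_normB _ _) _; exact: lerD.
have h2 : `|S2| <= H * c * (phi s / A + dl * phi s).
  apply: le_trans (ler_norm_sum _ _ _) _.
  apply: le_trans (_ : \sum_(i < m) H * c * (dl * phi (gr s m i.+1)) <= _).
    apply: ler_sum => i _; rewrite normrM -normrN.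
    have -> : H * c * (dl * phi (gr s m i.+1)) = (H * dl) * (c * phi (gr s m i.+1)) by ring.
    apply: (ler_pM (normr_ge0 _) (normr_ge0 _)); first exact: Gstep.
    by apply: hj; have /andP[-> h] := gr_in sT m0 (ltn_ord i); exact: le_trans sT'.
  by rewrite -mulr_sumr; apply: ler_wpM2l; [exact: mulr_ge0|exact: sum_dt_r].
have -> : RI s (j l) = S1 + S2 by rewrite -[S2]opprK -e1; ring.
apply: le_trans (ler_normD _ _) _; apply: le_trans (lerD h1 h2) _.
have p1 := phi1 sT.
have h3 : H * c * (phi s / A) <= c / 2 * phi s.
  rewrite mulrA ler_pdivrMr // /A.
  have z : 0 <= c * phi s by apply: mulr_ge0 => //; exact: ltW.
  have -> : H * c * phi s = H * (c * phi s) by ring.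
  have -> : c / 2 * phi s * (6 * H + 60) = (3 * H + 30) * (c * phi s) by field.
  by apply: ler_wpM2r => //; lra.
have h4 : B <= B * phi s by rewrite ler_peMr.
have -> : H * c * (phi s / A + dl * phi s) = H * c * (phi s / A) + W * dl by rewrite /W; ring.
rewrite mulrDl; rewrite /q in hm3 *.
have -> : B * phi s + c / 2 * phi s + e = B * phi s + e / 2 + (c / 2 * phi s + e / 2) by field.
by apply: lerD; [rewrite lerD2r|apply: lerD].
Qed.

(** Integrability gives a first bound that depends on [l]; iterating [Jstep] forgets it and leaves a
    bound uniform in [l], without which the main iteration could not start. *)
Let JB l s : (0 < l)%N -> 0 <= s <= T -> `|RI s (j l)| <= 2 * B * phi s.
Proof.
move=> l0; move: s.
pose c0 := RI T (fun u => `|j l u|).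
have c00 : 0 <= c0 by apply: Rintegral_ge0.
have iter n : forall s, 0 <= s <= T -> `|RI s (j l)| <= (2 * B + c0 / 2 ^+ n) * phi s.
  elim: n => [|n IH] s sT.
    have /andP[s0 sT'] := sT; have i1 := Ioo_sub sT' (jI l0).
    apply: le_trans (RI_abs i1) _; apply: le_trans (_ : c0 <= _).
      by apply: RI_mono => //; exact: Ioo_abs (jI l0).
    rewrite expr0 divr1; apply: le_trans (_ : c0 * phi s <= _); first by rewrite ler_peMr // phi1.
    by apply: ler_wpM2r; [exact: ltW|rewrite lerDr mulr_ge0].
  have z : 0 <= 2 * B + c0 / 2 ^+ n by rewrite addr_ge0 ?mulr_ge0 // divr_ge0 // exprn_ge0.
  have := Jstep l0 z IH sT.
  by have -> : B + (2 * B + c0 / 2 ^+ n) / 2 = 2 * B + c0 / 2 ^+ n.+1 by rewrite exprS; field; exact: expf_neq0.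
move=> s sT; apply/ler_addgt0Pr => e e0; have [n hn] := halve_le (c0 * phi s) e0.
apply: le_trans (iter n s sT) _; rewrite mulrDl lerD2l.
by apply: le_trans hn; rewrite mulrAC.
Qed.

Theorem eY_lim l s x : (0 < l)%N -> 0 <= s <= T -> s <= x -> LS (eY l s (Some x)) 0.
Proof.
(* Crude start of the iteration: [2] for the difference of two quantities of size at most [1], [C]
   for the mean number of starts per server, [2 B] for the integral of [j] relative to the
   weight. *)
pose c0 := C + 2 * B + 2.
have c00 : 0 <= c0 by rewrite /c0 !addr_ge0 // mulr_ge0.
have e1 k : 1 <= 2 ^+ k :> R by apply: exprn_ege1; rewrite ler1n.
have iter n : HBY (c0 / 2 ^+ n) /\ HBD (c0 / 2 ^+ n).
  elim: n => [|n [IH1 IH2]].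
    rewrite expr0 divr1; split.
      move=> k y v k0 vT vy; apply: LSN1 (LS_cst (c := 2) _) => [N N0|].
        rewrite -[2](Ex_cst P); apply: Ex_le => [||w]; [by apply: bm_abs; exact: bmy|exact: bm_cst|].
        have := Yh01 (I N w) N (arrd (I N w) (M N) v) k v (Some y); rewrite -/(yb _ _ _ _ _ _) => /andP[y0 y1].
        have := @zxb k v (Some y) vT vy => zz.
        by apply: le_trans (ler_normB _ _) _; rewrite (ger0_norm y0); lra.
      apply: le_trans (_ : c0 <= _); first by rewrite /c0 lerDr addr_ge0 // mulr_ge0.
      by rewrite -mulrA ler_peMr // mulr_ege1 // phi1.
    move=> k v k0 vT; apply: LSN1 (LS_cst (c := C + 2 * B * phi v) _) => [N N0|].
      have bD := bm_Db (core N0) k v.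
      apply: le_trans (_ : Ex P (fun w => njobs (I N w) N (M N) + 2 * B * phi v) <= _).
        apply: Ex_le => [||w]; [by apply: bm_abs; apply: bmB => //; exact: bm_cst|by apply: bmD; [exact: (bm_njobs (core N0))|exact: bm_cst]|].
        have /andP[d0 d1] := Db_njobs k v N w.
        by apply: le_trans (ler_normB _ _) _; rewrite (ger0_norm d0); apply: lerD => //; exact: JB.
      rewrite ExD ?Ex_cst ?lerD2r; [exact: hJ|exact: (bm_njobs (core N0))|exact: bm_cst].
    apply: le_trans (_ : c0 * phi v <= _); last by apply: ler_wpM2r; [exact: ltW|rewrite ler_peMr].
    have -> : c0 * phi v = C * phi v + (2 * B + 2) * phi v by rewrite /c0; ring.
    apply: lerD; first by rewrite ler_peMr // phi1.
    by apply: ler_wpM2r; [exact: ltW|rewrite lerDl].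
  have z : 0 <= c0 / 2 ^+ n by rewrite divr_ge0 // exprn_ge0.
  have -> : c0 / 2 ^+ n.+1 = c0 / 2 ^+ n / 2 by rewrite exprS; field; exact: expf_neq0.
  split; first exact: Y_step.
  move=> k v k0 vT; apply: LS_mono (D_step z IH1 IH2 k0 vT).
  apply: ler_wpM2r; first exact: ltW.
  apply: ler_wpM2r; first exact: exprn_ge0.
  rewrite ler_pdivrMr // /A; have Hp := H0; move: (c0 / 2 ^+ n) z => c cp.
  have -> : c / 2 * (6 * H + 60) = (3 * H + 30) * c by field.
  by apply: ler_wpM2r => //; lra.
move=> l0 sT sx; apply: LS_lim => e e0; rewrite add0r.
have [n hn] := halve_le (c0 * 2 ^+ l * phi s) e0; have [h _] := iter n.
apply: LS_mono (h l x s l0 sT sx).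
by apply: le_trans hn; rewrite le_eqVlt; apply/orP; left; apply/eqP; ring.
Qed.

End Limit.

(** * The service distribution and the limit equations *)

Section ServiceDist.
Variable R : realType.
Local Notation mu := (@lebesgue_measure R).
Variables (G g : R -> R) (H : R).
Hypothesis sd : service_dist G g H.
Let gm : measurable_fun setT g. Proof. by case: sd. Qed.
Let g0 y : 0 <= g y. Proof. by case: sd => _ []. Qed.
Let gneg y : y < 0 -> g y = 0. Proof. by case: sd => _ [_ [h _]]; exact: h. Qed.
Let GE x : (G x)%:E = (\int[mu]_(y in `]-oo, x]) (g y)%:E)%E. Proof. by case: sd => _ [_ [_ [h _]]]. Qed.
Let g1 : (\int[mu]_(y in [set: R]) (g y)%:E)%E = 1%E. Proof. by case: sd => _ [_ [_ [_ [h _]]]]. Qed.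
Let gmean : (\int[mu]_(y in `[0%R, +oo[) (y * g y)%:E)%E = 1%E. Proof. by case: sd => _ [_ [_ [_ [_ [h _]]]]]. Qed.
Let ghaz x : 0 <= x -> g x <= H * (1 - G x). Proof. by case: sd => _ [_ [_ [_ [_ [_ h]]]]]; exact: h. Qed.
Let gmE D : measurable_fun D (fun y => (g y)%:E).
Proof. by apply/measurable_EFinP; apply: measurable_funS gm. Qed.
Let gE0 y : (0 <= (g y)%:E)%E. Proof. by rewrite lee_fin. Qed.

Lemma sd_G0 x : 0 <= G x.
Proof. by rewrite -lee_fin GE; apply: integral_ge0 => y _. Qed.

Lemma sd_G1 x : G x <= 1.
Proof. by rewrite -lee_fin GE -g1; apply: ge0_subset_integral => //; exact: gmE. Qed.

Lemma sd_diff x y : x <= y -> (G y - G x)%:E = (\int[mu]_(u in `]x, y]) (g u)%:E)%E.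
Proof.
move=> xy; rewrite EFinB GE.
have -> : `]-oo, y]%classic = `]-oo, x]%classic `|` `]x, y]%classic.
  apply/seteqP; split=> u /=; rewrite !in_itv /=; first by case: (leP u x) => ux uy; [left|right].
  by case=> [ux|/andP[]//]; exact: le_trans ux xy.
rewrite ge0_integral_setU //=; [|exact: gmE|].
  by rewrite -GE addeAC subee // add0e.
by apply/disj_setPS => u [] /=; rewrite !in_itv /= => h /andP[k _]; lra.
Qed.

Lemma sd_Gmono x y : x <= y -> G x <= G y.
Proof. by move=> xy; rewrite -subr_ge0 -lee_fin sd_diff //; apply: integral_ge0 => u _. Qed.

Lemma sd_Gneg x : x <= 0 -> G x = 0.
Proof.
move=> x0; apply/le_anti; rewrite sd_G0 andbT; apply: le_trans (sd_Gmono x0) _.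
rewrite -lee_fin GE -integral_itv_bndo_bndc // integral0_eq // => y /=.
by rewrite in_itv /= => /gneg ->.
Qed.

Lemma sd_H0 : 0 <= H.
Proof. by have := ghaz (lexx 0); rewrite sd_Gneg // subr0 mulr1; exact: le_trans. Qed.

Lemma sd_haz x y : x <= y -> G y - G x <= H * (y - x) * (1 - G x).
Proof.
move=> xy; rewrite -lee_fin sd_diff //.
apply: (@le_trans _ _ (\int[mu]_(u in `]x, y]) (H * (1 - G x))%:E)%E).
  apply: ge0_le_integral => //; first exact: gmE.
  move=> u.
  rewrite /= in_itv /= => /andP[xu uy]; rewrite lee_fin; case: (ltP u 0) => u0.
    by rewrite gneg // mulr_ge0 ?sd_H0 // subr_ge0 sd_G1.
  by apply: le_trans (ghaz u0) _; rewrite ler_wpM2l ?sd_H0 // lerB // sd_Gmono // ltW.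
rewrite integral_cst //= lebesgue_measure_itv /= lte_fin; case: ltP => h.
  by rewrite -EFinD -EFinM lee_fin mulrAC.
by rewrite mule0 lee_fin !mulr_ge0 ?sd_H0 ?subr_ge0 // sd_G1.
Qed.

Lemma sd_GL x y : x <= y -> (1 - G x) - (1 - G y) <= H * (y - x).
Proof.
move=> xy; have := sd_haz xy => h; apply: le_trans (_ : G y - G x <= _); first by lra.
apply: le_trans h _; rewrite ler_piMr ?mulr_ge0 ?sd_H0 ?subr_ge0 //.
by have := sd_G0 x; lra.
Qed.

Lemma sd_Gm : measurable_fun setT (fun x => 1 - G x).
Proof.
apply: measurable_funB; first exact: measurable_cst.
by apply: nondecreasing_measurable => //; exact: sd_Gmono.
Qed.

(** Bounded hazard prevents [G] from reaching [1]: over a step of length [1 / (H + 1)] the survival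
    function loses at most the fraction [H / (H + 1)] of itself. *)
Lemma sd_Gpos x : 0 < 1 - G x.
Proof.
have H0 := sd_H0.
pose dl := (H + 1)^-1; have dl0 : 0 < dl by rewrite invr_gt0; lra.
have Hd : H * dl < 1 by rewrite /dl ltr_pdivrMr; lra.
have step n : 0 < 1 - G (dl * n%:R).
  elim: n => [|n IH]; first by rewrite mulr0 sd_Gneg // subr0.
  have h : dl * n%:R <= dl * n.+1%:R by rewrite ler_pM2l // ler_nat.
  have := sd_haz h; rewrite -[n.+1%:R]natr1.
  have -> : dl * (n%:R + 1) - dl * n%:R = dl by ring.
  move: IH; move: (G _) (G _) => a b a1; nra.
apply: lt_le_trans (step (Num.Def.truncn (x / dl)).+1) _; rewrite lerB // sd_Gmono //.
by rewrite mulrC -ler_pdivrMr //; apply/ltW; exact: truncnS_gt.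
Qed.

Lemma sd_tail r : (1 - G r)%:E = (\int[mu]_(y in `]r, +oo[) (g y)%:E)%E.
Proof.
have : ((G r)%:E + \int[mu]_(y in `]r, +oo[) (g y)%:E = 1)%E.
    rewrite -g1 GE -ge0_integral_setU //=; [|exact: gmE|].
    congr integral; apply/seteqP; split => u //= _; rewrite !in_itv /= andbT.
    by case: (leP u r); [left|right].
  by apply/disj_setPS => u [] /=; rewrite !in_itv /= => h /andP[k _]; lra.
move=> h; rewrite EFinB -h addeAC subee // add0e //.
Qed.

(** Tonelli on the region [0 <= r < y] turns the mean of the density into the integral of the
    survival function. *)
Lemma sd_mean : (\int[mu]_(r in `[0%R, +oo[) (1 - G r)%:E)%E = 1%E.
Proof.
pose f (p : R * R) : \bar R := ((\1_(`[0%R, +oo[ : set R) p.1 * (p.1 < p.2)%R%:R) * g p.2)%:E.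
have mf : measurable_fun setT f.
  apply/measurable_EFinP; apply: measurable_funM; last first.
    by apply: measurableT_comp; [exact: gm|exact: measurable_snd].
  apply: measurable_funM.
    apply: measurableT_comp; last exact: measurable_fst.
    exact: measurable_indic.
  apply: (@measurableT_comp _ _ _ _ _ _ (fun b : bool => b%:R : R)) => //.
  by apply: measurable_fun_ltr; [exact: measurable_fst|exact: measurable_snd].
have f0 p : (0 <= f p)%E by rewrite lee_fin !mulr_ge0.
have <- : (\int[mu]_y \int[mu]_r f (r, y) = 1)%E.
  rewrite -gmean [RHS]integral_mkcond; apply: eq_integral => y _; rewrite patchE.
  transitivity (\int[mu]_r ((g y)%:E * (\1_(`[0%R, y[ : set R) r)%:E))%E.
    apply: eq_integral => r _; rewrite /f /= -EFinM mulrC; congr (_ * _)%:E.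
    rewrite !indicE -natrM mulnb; congr (nat_of_bool _)%:R.
    by rewrite !mem_setE !in_itv /= andbT.
  rewrite ge0_integralZl_EFin //; last by apply/measurable_EFinP; exact: measurable_indic.
  rewrite integral_indic //= setIT lebesgue_measure_itv /= lte_fin.
  rewrite mem_setE in_itv /= andbT oppr0 adde0; case: (ltgtP 0 y) => [y0|y0|<-].
  - by rewrite EFinM muleC.
  - by rewrite mule0.
  - by rewrite mule0 mul0r.
rewrite [LHS]integral_mkcond -fubini_tonelli //; apply: eq_integral => r _; rewrite patchE; case: ifPn => r0.
  rewrite sd_tail integral_mkcond; apply: eq_integral => y _; rewrite patchE /f /= indicE r0 mul1r.
  rewrite mem_setE in_itv /= andbT.
  by case: (r < y); rewrite ?mul1r ?mul0r.
by rewrite integral0_eq // => y _; rewrite /f /= indicE (negbTE r0) !mul0r.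
Qed.

End ServiceDist.

(** * Consequences of the hydrodynamic equations *)

Section HydroFacts.
Variable R : realType.
Local Notation mu := (@lebesgue_measure R).
Variables (lam G g : R -> R) (H : R) (Z0 : nat -> R -> R) (Z : nat -> R -> R -> R).
Let Gbar x := 1 - G x.
Hypotheses (lamP : rate_ok lam) (sd : service_dist G g H) (hs : hydro_solution lam Gbar Z0 Z).

Definition jz (l : nat) (u : R) : R := - rderiv0 (Z l.+1 u).

Lemma hs_C1 l (t : R) : (0 < l)%N -> 0 <= t -> C1le1 (Z l t).
Proof. by case: hs => h _ l0 t0; case: (h l l0) => h1 _; exact: h1. Qed.

Lemma hs_Zb l (v r : R) : (0 < l)%N -> 0 <= v -> 0 <= r -> `|Z l v r| <= 1.
Proof. by move=> l0 v0 r0; case: (hs_C1 l0 v0) => df [_ [_ [_ [_ h]]]]; exact: h. Qed.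

Let sx0 (s x : R) : s <= x -> 0 <= x - s. Proof. by rewrite subr_ge0. Qed.
Let sxE (s x : R) : s + (x - s) = x. Proof. by ring. Qed.

Lemma hs_jGI l (s x : R) : (0 < l)%N -> 0 <= s -> s <= x -> Ioo s (fun u => jz l u * Gbar (x - u)).
Proof.
move=> l0 s0 sx; have [_ /(_ s (x - s) s0 (sx0 sx))] := hs.
case=> [[h1 _]] /(_ l) hl; rewrite !sxE in h1.
have h : Ioo s (fun u => Gbar (x - u) * rderiv0 (Z l.+1 u)).
  have [l2|] := leqP 2 l; first by have [] := hl l2; rewrite sxE.
  by case: l l0 {hl} => [|[|l]].
by apply: eq_Ioo (Ioo_Z (-1) h) => u _; rewrite /jz; ring.
Qed.

(** Divides the integrable product [jz l u * Gbar (T - u)] by [Gbar], which on [[0, T]] stays above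
    [Gbar T > 0]. *)
Lemma hs_jI l (T : R) : (0 < l)%N -> 0 <= T -> Ioo T (jz l).
Proof.
move=> l0 T0; have := hs_jGI l0 T0 (lexx T); rewrite /Ioo => h.
have GT u : 0 <= u <= T -> Gbar T <= Gbar (T - u).
  by move=> /andP[u0 _]; rewrite /Gbar lerB // (sd_Gmono sd) //; lra.
have mg : measurable_fun `[0, T] (fun u => (Gbar (T - u))^-1).
  apply: (@measurable_comp _ _ _ _ _ _ [set r : R | r != 0] (fun r => r^-1)).
  - rewrite (_ : [set r : R | r != 0] = ~` [set 0]); first exact: measurableC.
    by apply/seteqP; split => r /= /eqP.
  - by move=> _ [u _ <-] /=; rewrite lt0r_neq0 // (sd_Gpos sd).
  - apply: open_continuous_measurable_fun; first exact: open_neq.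
    by move=> r /set_mem /= r0; exact: inv_continuous.
  - apply: measurable_funS (_ : measurable_fun setT _) => //.
    by apply: measurableT_comp; [exact: (sd_Gm sd)|exact: measurable_funB].
have bg : [bounded (Gbar (T - u))^-1 | u in `[0, T]].
  exists (Gbar T)^-1; split; first exact: num_real.
  move=> M hM u /=; rewrite in_itv /= => hu; apply: le_trans (ltW hM).
  have p1 := sd_Gpos sd T; have p2 := sd_Gpos sd (T - u).
  rewrite ger0_norm; last by rewrite invr_ge0; exact: ltW p2.
  by rewrite lef_pV2 ?posrE //; exact: GT.
pose f1 u : R := (Gbar (T - u))^-1; pose f2 u : R := jz l u * Gbar (T - u).
have {h} : mu.-integrable `[0, T] ((EFin \o f1) \* (EFin \o f2))%E.
  by apply: integrableMr => //; exact: measurable_itv.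
apply: eq_integrable => // u _ /=; rewrite -EFinM; congr EFin.
by rewrite mulrC mulfK // lt0r_neq0 // (sd_Gpos sd).
Qed.

Lemma hs_qI l (s : R) ox : 0 <= s -> (if ox is Some x then s <= x else true) ->
  Ioo s (fun u => lam u * qz Gbar Z l ox u).
Proof.
move=> s0; case: ox => [x sx|_].
  have [_ /(_ s (x - s) s0 (sx0 sx))] := hs.
  case=> [[_ [h2 _]]] /(_ l.+1) hl; rewrite !sxE in h2.
  case: l hl => [|l] hl.
    by apply: eq_Ioo h2 => u _; rewrite /qz /wgt /=; ring.
  have [//|_ [h _]] := hl; rewrite sxE in h.
  by apply: eq_Ioo h => u _; rewrite /qz /wgt /=; ring.
have [_ /(_ s 0 s0 (lexx 0))] := hs.
case=> [[_ [_ [_ [h2 _]]]]] /(_ l.+1) hl.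
case: l hl => [|l] hl.
  by apply: eq_Ioo h2 => u _; rewrite /qz /wgt /=; ring.
have [//|_ [_ [_ [h _]]]] := hl.
by apply: eq_Ioo h => u _; rewrite /qz /wgt /=; ring.
Qed.

Lemma hs_ZY l (s x : R) : 0 <= s -> s <= x ->
  Z l.+1 s (x - s) = Z0 l.+1 x + RI s (fun u => jz l.+1 u * Gbar (x - u)) + RI s (fun u => lam u * qz Gbar Z l (Some x) u).
Proof.
move=> s0 sx; have [_ /(_ s (x - s) s0 (sx0 sx))] := hs.
case=> [[h1 [h2 [_ [_ [e _]]]]]] /(_ l.+1) hl; rewrite !sxE in h1 h2 e hl.
have jE k : Ioo s (fun u => Gbar (x - u) * rderiv0 (Z k.+1 u)) ->
   RI s (fun u => jz k u * Gbar (x - u)) = - RI s (fun u => Gbar (x - u) * rderiv0 (Z k.+1 u)).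
  by move=> h; rewrite -mulN1r -RI_Z //; apply: eq_RI => u _; rewrite /jz; ring.
case: l hl => [|l] hl.
  rewrite jE // e; congr (_ + _); apply: eq_RI => u _; rewrite /qz /wgt /=; ring.
have [//|k1 [k2 [_ [_ [e' _]]]]] := hl.
rewrite jE // e'; congr (_ + _); apply: eq_RI => u _; rewrite /qz /wgt /=; ring.
Qed.

Let hs_Zat0 l (s : R) : (0 < l)%N -> 0 <= s ->
  [/\ Ioo s (fun u => jz l.+1 u - jz l u), Ioo s (fun u => lam u * qz Gbar Z l None u) &
  Z l.+1 s 0 = Z0 l.+1 0 + RI s (fun u => jz l.+1 u - jz l u) + RI s (fun u => lam u * qz Gbar Z l None u)].
Proof.
move=> l0 s0; have [_ /(_ s 0 s0 (lexx 0))] := hs.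
case=> [_] /(_ l.+1); case=> [//|_ [_ [h3 [h4 [_ e]]]]].
have e3 u : rderiv0 (Z l.+1 u) - rderiv0 (Z l.+2 u) = jz l.+1 u - jz l u by rewrite /jz; ring.
have e4 u : lam u * (Z l u 0 ^+ 2 - Z l.+1 u 0 ^+ 2) = lam u * qz Gbar Z l None u.
  by case: l l0 {h3 h4 e e3} => // l _; rewrite /qz /wgt /=; ring.
split; [by apply: eq_Ioo h3 => u _|by apply: eq_Ioo h4 => u _; rewrite -e4|].
by rewrite e; congr (_ + _ + _); apply: eq_RI => u _; rewrite -?e4 -?e3.
Qed.

(** The two equations for [Z_(l+1) (s, 0)], the boundary one and the interior one at [r = 0], are
    equated and solved for the integral of [jz l]; the result has the shape of [balance_D]. *)
Lemma hs_ZD l (s : R) : (0 < l)%N -> 0 <= s ->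
  RI s (jz l) = (RI s (jz l.+1) - RI s (fun u => jz l.+1 u * Gbar (s - u))) + (Z0 l.+1 0 - Z0 l.+1 s) +
    RI s (fun u => lam u * qz Gbar Z l None u) - RI s (fun u => lam u * qz Gbar Z l (Some s) u).
Proof.
move=> l0 s0; have [_ _] := hs_Zat0 l0 s0.
rewrite RI_B; [|exact: hs_jI|exact: hs_jI].
have := hs_ZY l s0 (lexx s); rewrite subrr => ->.
move: (RI s _) (RI s _) (RI s _) (RI s _) (RI s _) => a b c e f; lra.
Qed.

(** Along the line [t + r = x] the initial datum is constant and the integrands do not depend on the
    end point, so the equation writes [Z] as a sum of primitives. *)
Lemma hs_Zu l (s x : R) : (0 < l)%N -> 0 <= s -> s <= x -> uc s (fun u => Z l u (x - u)).
Proof.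
case: l => // l _ s0 sx.
have h1 : uc s (fun u => RI u (fun v => jz l.+1 v * Gbar (x - v))) by apply: uc_RI => //; exact: hs_jGI.
have h2 : uc s (fun u => RI u (fun v => lam v * qz Gbar Z l (Some x) v)) by apply: uc_RI => //; exact: hs_qI.
apply: uc_eq (uc_D (uc_D (uc_cst s (Z0 l.+1 x)) h1) h2) => u /andP[u0 us] /=.
by rewrite hs_ZY // (le_trans us).
Qed.

Lemma hs_Zu0 l (T : R) : (0 < l)%N -> 0 <= T -> uc T (fun u => Z l u 0).
Proof.
move=> l0 T0.
have [F [F1 [h1 [F2 h2 e]]]] : exists F, exists F1, Ioo T F1 /\ exists2 F2, Ioo T F2 &
   forall u, 0 <= u <= T -> F + RI u F1 + RI u F2 = Z l u 0.
  have hh := hs; case: hh => _ hh; case: l l0 => // -[|l] _.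
    have [[_ [_ [h3 [h4 _]]]] _] := hh T 0 T0 (lexx 0).
    exists (Z0 1%N 0), (fun u => rderiv0 (Z 1%N u) - rderiv0 (Z 2%N u)); split => //.
    exists (fun u => lam u * (1 - Z 1%N u 0 ^+ 2)) => // u /andP[u0 _].
    by have [[_ [_ [_ [_ [_ e]]]]] _] := hh u 0 u0 (lexx 0).
  have [h3 h4 _] := hs_Zat0 (ltn0Sn l) T0.
  exists (Z0 l.+2 0), (fun u => jz l.+2 u - jz l.+1 u); split => //.
  exists (fun u => lam u * qz Gbar Z l.+1 None u) => // u /andP[u0 _].
  by have [_ _ ->] := hs_Zat0 (ltn0Sn l) u0.
by apply: uc_eq e (uc_D (uc_D (uc_cst T F) (uc_RI T0 h1)) (uc_RI T0 h2)).
Qed.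

End HydroFacts.

(** * The SQ(2) network as an instance *)

Section ArrivalTimes.
Variables (R : realType) (e : R -> nat).
Hypothesis e0 : e 0 = 0%N.
Hypothesis emono : forall s t, 0 <= s -> s <= t -> (e s <= e t)%N.
Hypothesis erc : forall t, 0 <= t -> exists2 dl, 0 < dl & forall s, t <= s -> s < t + dl -> e s = e t.

Lemma arrtime_le k (s : R) : 0 <= s -> (k <= e s)%N -> arrtime e k <= s.
Proof. by move=> s0 ks; apply: ge_inf => //; exists 0 => x /= []. Qed.

Lemma arrtime_ge0 k (T : R) : 0 <= T -> (k <= e T)%N -> 0 <= arrtime e k.
Proof. by move=> T0 kT; apply: lb_le_inf; [exists T|move=> x []]. Qed.

(** Right continuity of the counting path makes the infimum in [arrtime] attained. *)
Lemma arrtimeP k (s T : R) : 0 <= T -> (k <= e T)%N -> 0 <= s -> (arrtime e k <= s) = (k <= e s)%N.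
Proof.
move=> T0 kT s0; apply/idP/idP => [h|]; last exact: arrtime_le.
have x0 := arrtime_ge0 T0 kT.
have [dl d0 hd] := erc x0.
have [y [/= y0 ky] yx] : exists2 y, [set u : R | 0 <= u /\ (k <= e u)%N] y & y < arrtime e k + dl.
  by apply: inf_adherent => //; split; [exists T|exists 0 => x /= []].
have xy : arrtime e k <= y by exact: arrtime_le.
by rewrite (hd y xy yx) in ky; apply: leq_trans ky _; exact: emono.
Qed.

Lemma arrtime_gt0 k (T : R) : 0 <= T -> (0 < k <= e T)%N -> 0 < arrtime e k.
Proof.
move=> T0 /andP[k0 kT]; rewrite lt_neqAle (arrtime_ge0 T0 kT) andbT; apply/eqP => h.
have := arrtimeP T0 kT (lexx 0); rewrite e0 -h lexx => /esym; lia.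
Qed.

Lemma arrtime_mono j k (T : R) : 0 <= T -> (j <= k)%N -> (k <= e T)%N -> arrtime e j <= arrtime e k.
Proof.
move=> T0 jk kT; have jT := leq_trans jk kT.
rewrite (arrtimeP T0 jT (arrtime_ge0 T0 kT)); apply: leq_trans jk _.
by rewrite -(arrtimeP T0 kT (arrtime_ge0 T0 kT)).
Qed.

End ArrivalTimes.

Section Residual.
Variables (R : realType) (G g : R -> R) (H : R).
Hypothesis sd : service_dist G g H.
Let Gbar (x : R) := 1 - G x.

(** Markov inequality at [b = 1 / c]: the product of [b] and [Gbar b] is at most the mean [1]. *)
Lemma sd_Gbar_to0 (c : R) : 0 < c -> exists2 r, 0 <= r & Gbar r <= c.
Proof.
move=> c0; pose b := c^-1; have ci : 0 < b by rewrite invr_gt0.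
exists b; first exact: ltW.
have m : measurable_fun (`[0%R, +oo[ : set R) (fun r => (1 - G r)%:E).
  by apply/measurable_EFinP; apply: measurable_funS (sd_Gm sd).
have G0 (r : R) : (0 <= (1 - G r)%:E)%E by rewrite lee_fin subr_ge0 (sd_G1 sd).
have : (\int[@lebesgue_measure R]_(r in `[0%R, b]) (Gbar b)%:E <= 1)%E.
  rewrite -(sd_mean sd); apply: (@le_trans _ _ (\int[@lebesgue_measure R]_(r in `[0%R, b]) (1 - G r)%:E)%E).
    apply: ge0_le_integral => //; first by move=> x _; exact: G0.
      by apply: measurable_funS m => // x /=; rewrite !in_itv /= => /andP[->].
    by move=> x /=; rewrite in_itv /= => /andP[_ h]; rewrite lee_fin lerB // (sd_Gmono sd).
  apply: ge0_subset_integral => //.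
  by move=> x /=; rewrite !in_itv /= => /andP[->].
rewrite integral_cst //= lebesgue_measure_itv /= lte_fin ci sube0 -EFinM lee_fin.
by rewrite /b ler_pdivrMr // mul1r.
Qed.

(** Generalised inverse of a continuous survival function. For the strict inequality, the Lipschitz
    bound leaves an interval of length [dl] beyond [r] on which the threshold is not yet reached. *)
Lemma resid_gt (a u r : R) : 0 < u < 1 -> 0 <= r -> (r < resid Gbar a u) = (u * Gbar a < Gbar (a + r)).
Proof.
move=> /andP[u0 u1] r0; have H0 := sd_H0 sd.
have Ga := sd_Gpos sd a.
have c0 : 0 < u * Gbar a by rewrite mulr_gt0.
have ne : [set r : R | 0 <= r /\ Gbar (a + r) <= u * Gbar a] !=set0.
  have [y y0 hy] := sd_Gbar_to0 c0; exists (`|a| + y); split; first by rewrite addr_ge0.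
  apply: le_trans hy; rewrite /Gbar lerB // (sd_Gmono sd) //; have := ler_norm (- a); rewrite normrN; lra.
have lb : has_lbound [set r : R | 0 <= r /\ Gbar (a + r) <= u * Gbar a] by exists 0 => x /= [].
apply/idP/idP => [h|h].
  rewrite ltNge; apply/negP => h'; have := ge_inf lb (conj r0 h'); rewrite -/(resid _ _ _); lra.
pose dl := (Gbar (a + r) - u * Gbar a) / (H + 1).
have d0 : 0 < dl by rewrite divr_gt0 ?subr_gt0 //; lra.
apply: lt_le_trans (_ : r + dl <= _); first by rewrite ltrDl.
apply: lb_le_inf => // y /= [y0 hy]; rewrite leNgt; apply/negP => yd.
have k1 : Gbar (a + r) - Gbar (a + r + dl) <= H * dl.
  have hh : a + r <= a + r + dl by lra.
  by have := sd_GL sd hh; have -> : a + r + dl - (a + r) = dl by ring.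
have k2 : Gbar (a + r + dl) <= Gbar (a + y) by rewrite /Gbar lerB // (sd_Gmono sd) //; lra.
have k3 : dl * (H + 1) = Gbar (a + r) - u * Gbar a by rewrite /dl mulfVK // gt_eqF //; lra.
nra.
Qed.

Lemma resid_gt0 (a u : R) : 0 < u < 1 -> 0 < resid Gbar a u.
Proof.
move=> hu; rewrite (resid_gt _ hu (lexx 0)) addr0 gtr_pMl; first by case/andP: hu.
exact: sd_Gpos sd a.
Qed.

End Residual.

Lemma prob_md_eq d (Om : measurableType d) (R : realType) (P : probability Om R) (D : countType) (f f' : Om -> D) :
  md f -> md f' -> (forall x, P (f @^-1` [set x]) = P (f' @^-1` [set x])) -> forall A, P (f @^-1` A) = P (f' @^-1` A).
Proof.
move=> mf mf' h A.
pose F (q : Om -> D) n := if @unpickle D n is Some x then (if (x \in A) && (pickle x == n) then q @^-1` [set x] else set0) else set0.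
have mF q n : md q -> measurable (F q n).
  move=> mq; rewrite /F; case: unpickle => [x|]; last exact: measurable0.
  by case: ifP => _; [exact: mq|exact: measurable0].
have tF q : trivIset setT (F q).
  move=> i k _ _ [w []]; rewrite /F.
  case: unpickle => [x|//]; case: ifP => // /andP[_ /eqP <-] /= <-.
  by case: unpickle => [y|//]; case: ifP => // /andP[_ /eqP <-] /= <-.
have UF q : q @^-1` A = \bigcup_n F q n.
  apply/seteqP; split => w /=.
    by move=> Aq; exists (pickle (q w)) => //; rewrite /F pickleK eqxx (mem_set Aq).
  by move=> [n _]; rewrite /F; case: unpickle => [x|//]; case: ifP => // /andP[/set_mem Ax _] /= ->.
have e n : P (F f n) = P (F f' n) by rewrite /F; case: unpickle => [x|//]; case: ifP => // _; exact: h.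
rewrite !UF.
have [c1 _] := conj (@measure_semi_sigma_additive _ _ _ P _ (fun n => mF f n mf) (tF f) (bigcup_measurable (fun n _ => mF f n mf))) I.
have [c2 _] := conj (@measure_semi_sigma_additive _ _ _ P _ (fun n => mF f' n mf') (tF f') (bigcup_measurable (fun n _ => mF f' n mf'))) I.
rewrite -(cvg_lim _ c1) // -(cvg_lim _ c2) //; congr (limn _); apply/funext => n.
by apply: eq_bigr => i _; exact: e.
Qed.

(** Requirements and uniforms are corrected on null sets, so that service times are positive, and
    [valid] holds, at every outcome and not just almost surely. *)
Definition sane (R : realType) (v : R) := if 0 < v then v else 1.
Definition sau (R : realType) (u : R) := if (0 < u) && (u < 1) then u else 2^-1.

Lemma sane_gt0 (R : realType) (v : R) : 0 < sane v. Proof. by rewrite /sane; case: ifP. Qed.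
Lemma sau01 (R : realType) (u : R) : 0 < sau u < 1.
Proof. by rewrite /sau; case: ifP => // _; lra. Qed.

(** * Laws of the corrected variables *)

Section Laws.
Context d (Om : measurableType d) (R : realType) (P : probability Om R).

Let leS (A B : set Om) : measurable A -> measurable B -> A `<=` B -> (P A <= P B)%E.
Proof. by move=> mA mB AB; apply: le_measure => //; rewrite inE. Qed.

Let mle (V : Om -> R) (x : R) : measurable_fun setT V -> measurable [set w | V w <= x].
Proof. by move=> mV; apply: (md_set (md_ler _ _)). Qed.

Let mlt (V : Om -> R) (x : R) : measurable_fun setT V -> measurable [set w | x < V w].
Proof. by move=> mV; apply: (md_set (md_ltr _ _)). Qed.

Let nullU (A B : set Om) : measurable A -> measurable B -> P B = 0%E -> (P (A `|` B) <= P A)%E.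
Proof. by move=> mA mB B0; rewrite -[leRHS]adde0 -B0; exact: measureU2. Qed.

Lemma prob_gt (V : Om -> R) (x y : R) : measurable_fun setT V -> P [set w | V w <= x] = y%:E ->
  P [set w | x < V w] = (1 - y)%:E.
Proof.
move=> mV h; rewrite EFinB -h -(probability_setC P (mle x mV)); congr (P _).
by apply/seteqP; split => w /=; rewrite ltNge => /negP.
Qed.

Lemma sane_meas (V : Om -> R) : measurable_fun setT V -> measurable_fun setT (fun w => sane (V w)).
Proof. by move=> mV; apply: measurable_if => //; exact: md_ltr. Qed.

Lemma sau_meas (V : Om -> R) : measurable_fun setT V -> measurable_fun setT (fun w => sau (V w)).
Proof. by move=> mV; apply: measurable_if => //; apply: md_and; exact: md_ltr. Qed.

Lemma sane_law (G g : R -> R) (H : R) (V : Om -> R) : service_dist G g H -> measurable_fun setT V ->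
  (forall x, P [set w | V w <= x] = (G x)%:E) -> forall y, P [set w | y < sane (V w)] = (1 - G y)%:E.
Proof.
move=> sd mV h y; have ms := sane_meas mV.
case: (ltP y 0) => y0.
  rewrite (sd_Gneg sd (ltW y0)) subr0 (_ : [set w | _] = setT) ?probability_setT //.
  by apply/seteqP; split => // w _ /=; apply: lt_trans y0 (sane_gt0 _).
rewrite -(prob_gt mV (h y)); apply/le_anti/andP; split.
  apply: (@le_trans _ _ (P ([set w | y < V w] `|` [set w | V w <= 0]))).
    apply: leS; [exact: mlt|by apply: measurableU; [exact: mlt|exact: mle]|].
    by move=> w /=; rewrite /sane; case: (ltP 0 (V w)) => hv k; [left|right].
  by apply: nullU; [exact: mlt|exact: mle|rewrite h (sd_Gneg sd (lexx 0))].
apply: leS; [exact: mlt|exact: mlt|] => w /= yV; rewrite /sane ifT //; exact: le_lt_trans yV.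
Qed.

Lemma unif_null (V : Om -> R) : measurable_fun setT V -> (forall x, 0 <= x -> x <= 1 -> P [set w | V w <= x] = x%:E) ->
  P [set w | ~~ ((0 < V w) && (V w < 1))] = 0%E.
Proof.
move=> mV h.
have m1 : measurable [set w | 1 <= V w] by apply: (md_set (md_ler _ _)).
have p1 : P [set w | 1 <= V w] = 0%E.
  apply/le_anti/andP; split => //; apply/lee_addgt0Pr => e e0; rewrite add0e.
  have [e1|e1] := leP e 1; last first.
    by apply: le_trans (probability_le1 _ m1) _; rewrite lee_fin ltW.
  have k1 : 0 <= 1 - e / 2 by lra.
  have k2 : 1 - e / 2 <= 1 by lra.
  apply: (@le_trans _ _ (P [set w | 1 - e / 2 < V w])).
    by apply: leS => //; [exact: mlt|move=> w /=; lra].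
  by rewrite (prob_gt mV (h _ k1 k2)) lee_fin; lra.
apply/le_anti/andP; split => //.
have -> : [set w | ~~ ((0 < V w) && (V w < 1))] = [set w | V w <= 0] `|` [set w | 1 <= V w].
  apply/seteqP; split => w /=; first by rewrite negb_and -!leNgt => /orP.
  by rewrite negb_and -!leNgt => /orP.
apply: (le_trans (nullU _ m1 p1)); first exact: mle.
by rewrite h.
Qed.

(** Stated for the negative of the uniform because [freeze_gt] treats events of the form [y < V],
    while a residual time is long when the uniform is small. *)
Lemma sau_law (V : Om -> R) : measurable_fun setT V -> (forall x, 0 <= x -> x <= 1 -> P [set w | V w <= x] = x%:E) ->
  forall y, P [set w | y < - sau (V w)] = (Num.min 1 (Num.max 0 (- y)))%:E.
Proof.
move=> mV h y; have ms := sau_meas mV.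
have mN : measurable [set w | ~~ ((0 < V w) && (V w < 1))].
  by apply: md_set; apply: md_neg; apply: md_and; exact: md_ltr.
have mD (x : R) : measurable [set w | x < - sau (V w)] by apply: mlt; exact: measurableT_comp.
have [y0|y0] := leP 0 y.
  have -> : [set w | y < - sau (V w)] = set0.
    by apply/seteqP; split => // w /=; have /andP[] := sau01 (V w); lra.
  by rewrite measure0 max_l ?oppr_le0 // min_r.
rewrite max_r; last lra.
have [y1|y1] := leP y (-1).
  have -> : [set w | y < - sau (V w)] = setT.
    by apply/seteqP; split => // w _ /=; have /andP[] := sau01 (V w); lra.
  by rewrite probability_setT min_l //; lra.
rewrite min_r; last lra.
have z := unif_null mV h.
apply/le_anti/andP; split.
  have k1 : 0 <= - y by lra.
  have k2 : - y <= 1 by lra.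
  apply: (@le_trans _ _ (P ([set w | V w <= - y] `|` [set w | ~~ ((0 < V w) && (V w < 1))]))).
    apply: leS => //; first by apply: measurableU => //; exact: mle.
    by move=> w /=; rewrite /sau; case: ifP => hh k; [left; lra|right].
  apply: (le_trans (nullU _ mN z)); first exact: mle.
  by rewrite h.
apply/lee_addgt0Pr => e e0.
have [ey|ey] := leP (- y) e.
  by apply: (@le_trans _ _ (0 + e%:E)%E); [rewrite add0e lee_fin|rewrite leeD2r].
have k1 : 0 <= - y - e by lra.
have k2 : - y - e <= 1 by lra.
have -> : (- y)%:E = ((- y - e)%:E + e%:E)%E by rewrite -EFinD subrK.
rewrite leeD2r // -(h _ k1 k2).
apply: (@le_trans _ _ (P ([set w | y < - sau (V w)] `|` [set w | ~~ ((0 < V w) && (V w < 1))]))).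
  apply: leS; [exact: mle|exact: measurableU|].
  by move=> w /= k; rewrite /sau; case: ifP => hh; [left; lra|right].
exact: nullU.
Qed.

End Laws.

(** * Construction of the capped system and its specification *)

Section Instance.
Context d (Om : measurableType d) (R : realType) (P : probability Om R).
Variables (a : nat -> R) (lam G g : R -> R) (H : R) (nw : network R Om) (N : nat).
Hypothesis N0 : (0 < N)%N.
Hypothesis sd : service_dist G g H.
Hypothesis mdl : sq2_model P a lam G nw N.
Let Gbar (x : R) := 1 - G x.
Let Cl := src_events nw N.
Implicit Types (L : seq src) (k n i : nat).

Lemma mdl_earr0 w : arr nw N w 0 = 0%N. Proof. by move: mdl; do 12 (case=> _); case. Qed.
Lemma mdl_emono w s t : 0 <= s -> s <= t -> (arr nw N w s <= arr nw N w t)%N.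
Proof. by move: mdl; do 13 (case=> _); case=> h _; exact: h. Qed.
Lemma mdl_erc w t : 0 <= t -> exists2 dl, 0 < dl & forall s, t <= s -> s < t + dl -> arr nw N w s = arr nw N w t.
Proof. by move: mdl; do 14 (case=> _); case=> h _; exact: h. Qed.
Lemma mdl_poisson (s : R) (n : nat) : 0 <= s -> P [set w | arr nw N w s = n] = (Defs.poisson_pmf (a N * RI s lam) n)%:E.
Proof.
move=> s0; have e0 := mdl_earr0; move: mdl; do 16 (case=> _); case=> h _.
have := h 1%N (fun m => if m is 0%N then 0 else s) (fun=> n) erefl.
rewrite big_ord1 /= => <-; last by case.
congr (P _); apply/seteqP; split => w /=; first by move=> <- [|//] _; rewrite e0 subn0.
by move=> /(_ 0%N isT); rewrite e0 subn0.
Qed.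
Lemma mdl_serv j x : P [set w | serv nw N j w <= x] = (G x)%:E.
Proof. by move: mdl; do 17 (case=> _); case=> h _; exact: h. Qed.
Lemma mdl_wait i k x : P [set w | wait0 nw N w i k <= x] = (G x)%:E.
Proof. by move: mdl; do 18 (case=> _); case=> h _; exact: h. Qed.
Lemma mdl_smp1 j i : (i < N)%N -> P [set w | smp1 nw N j w = i] = (N%:R^-1)%:E.
Proof. by move: mdl; do 19 (case=> _); case=> h _; exact: h. Qed.
Lemma mdl_smp2 j i : (i < N)%N -> P [set w | smp2 nw N j w = i] = (N%:R^-1)%:E.
Proof. by move: mdl; do 20 (case=> _); case=> h _; exact: h. Qed.
Lemma mdl_tie j : P [set w | tie nw N j w = true] = (2^-1)%:E.
Proof. by move: mdl; do 21 (case=> _); case=> h _; exact: h. Qed.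
Lemma mdl_fsmp1 i : (i < N)%N -> P [set w | fsmp1 nw N w = i] = (N%:R^-1)%:E.
Proof. by move: mdl; do 22 (case=> _); case=> h _; exact: h. Qed.
Lemma mdl_fsmp2 i : (i < N)%N -> P [set w | fsmp2 nw N w = i] = (N%:R^-1)%:E.
Proof. by move: mdl; do 23 (case=> _); case=> h _; exact: h. Qed.
Lemma mdl_ftie : P [set w | ftie nw N w = true] = (2^-1)%:E.
Proof. by move: mdl; do 24 (case=> _); case. Qed.
Lemma mdl_unif i x : 0 <= x -> x <= 1 -> P [set w | unif0 nw N w i <= x] = x%:E.
Proof. by move: mdl; do 25 (case=> _); case=> h _; exact: h. Qed.
Lemma mdl_age w i : (i < N)%N -> (0 < X0 nw N w i)%N -> 0 <= age0 nw N w i.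
Proof. by move: mdl; do 26 (case=> _); case=> h _; exact: h. Qed.

Let Clm (k : src) A : Cl k A -> measurable A. Proof. exact: (src_measurable mdl). Qed.
Let ClI (k : src) A B : Cl k A -> Cl k B -> Cl k (A `&` B) \/ A `&` B = set0. Proof. exact: src_setI. Qed.
Let ind : mutually_indep P Cl. Proof. exact: (src_indep mdl). Qed.

Lemma genm L : gen Cl L `<=` measurable. Proof. exact: gen_measurable. Qed.

(** Enlarging the list of excluded sources shrinks the generated family, so the one-source case of
    [gen_indep] suffices. *)
Lemma gen_one L (k : src) B (E : set Om) : List.In k L -> List.NoDup L -> Cl k B -> 
  measurable (E : set (g_sigma_algebraType (gen Cl L))) -> P (E `&` B) = (P E * P B)%E.
Proof.
move=> kL nL cB mE.
have sub : gen Cl L `<=` gen Cl [:: k].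
  move=> F [->|[J [A [nJ JK clA ->]]]]; first by left.
  by right; exists J, A; split => // j jJ [kj|//]; apply: (JK j jJ); rewrite -kj.
have nk : List.NoDup [:: k] by apply: List.NoDup_cons; [case|exact: List.NoDup_nil].
have e1 : capL [:: k] (fun=> B) = B.
  by apply/seteqP; split => [w h|w Bw j]; [apply: (h k); left|].
have := @gen_indep _ _ _ P _ Cl Clm ClI ind [:: k] (fun=> B) nk _ E; rewrite e1; apply.
  by move=> j [<-|[]].
by move: E mE; apply: sub_smallest2r => //; exact: smallest_sigma_algebra.
Qed.

Section Sources.
Variable L : seq src.
Let TC := g_sigma_algebraType (gen Cl L).

Lemma msrc (k : src) (A : set Om) : ~ List.In k L -> Cl k A -> measurable (A : set TC).
Proof. by move=> kL h; apply: sub_sigma_algebra; exact: gen_source kL h. Qed.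

Lemma md_arr t : ~ List.In SArr L -> md (fun w : TC => arr nw N w t).
Proof.
move=> kL n; apply: (msrc kL); exists 1%N, (fun=> t), (fun=> n).
by apply/seteqP; split => w /= h; [move=> m _|exact: (h 0%N)].
Qed.

(** Events of the source [SInit] prescribe all initial queue lengths at once; a single coordinate is
    reached as a countable union over the whole vector. *)
Let ttX (w : Om) : N.-tuple nat := [tuple X0 nw N w i | i < N].

Let ttXP w (v : N.-tuple nat) : (forall i (iN : (i < N)%N), X0 nw N w i = nth 0%N v i) <-> ttX w = v.
Proof.
split => [h|<- i iN].
  by apply: eq_from_tnth => i; rewrite tnth_mktuple h // (tnth_nth 0%N).
by rewrite -[i]/(val (Ordinal iN)) -tnth_nth tnth_mktuple.
Qed.

Lemma md_ttX : ~ List.In SInit L -> md (fun w : TC => ttX w).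
Proof.
move=> kL v; apply: (msrc kL); exists (nth 0%N v), (fun=> setT); split => //.
by apply/seteqP; split => w /=; [move=> /ttXP h i iN; split => //; exact: h|move=> h; apply/ttXP => i iN; have [] := h i iN].
Qed.

Lemma md_X0 i : (i < N)%N -> ~ List.In SInit L -> md (fun w : TC => X0 nw N w i).
Proof.
move=> iN kL; rewrite (_ : (fun w => _) = fun w => tnth (ttX w) (Ordinal iN)).
  exact: (md_comp (fun v => tnth v (Ordinal iN)) (md_ttX kL)).
by apply/funext => w; rewrite tnth_mktuple.
Qed.

Lemma meas_age i : (i < N)%N -> ~ List.In SInit L -> measurable_fun setT (fun w : TC => age0 nw N w i).
Proof.
move=> iN kL _ B mB; rewrite setTI.
rewrite (_ : _ @^-1` B = \bigcup_n (if @unpickle (N.-tuple nat : countType) n is Some v then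
   [set w | forall k, (k < N)%N -> X0 nw N w k = nth 0%N v k /\ (if k == i then B else setT) (age0 nw N w k)] else set0)).
  apply: bigcup_measurable => n _; case: unpickle => [v|]; last exact: measurable0.
  apply: (msrc kL); exists (nth 0%N v), (fun k => if k == i then B else setT); split => // k.
  by case: ifP.
apply/seteqP; split => w /=.
  move=> Bw; exists (pickle (ttX w)) => //; rewrite pickleK => k kN; split; first exact: (proj2 (ttXP w (ttX w)) erefl k kN).
  by case: eqP => // ->.
by move=> [n _]; case: unpickle => // v /(_ i iN) []; rewrite eqxx.
Qed.

Let mpre (f : Om -> R) (k : src) : ~ List.In k L -> (forall B, measurable B -> Cl k (f @^-1` B)) -> measurable_fun setT (f : TC -> R).
Proof. by move=> kL h _ B mB; rewrite setTI; apply: (msrc kL); exact: h. Qed.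

Lemma meas_serv j : ~ List.In (SServ j) L -> measurable_fun setT (fun w : TC => serv nw N j w).
Proof. by move=> kL; apply: (mpre kL) => B mB; exists B. Qed.
Lemma meas_unif i : ~ List.In (SU i) L -> measurable_fun setT (fun w : TC => unif0 nw N w i).
Proof. by move=> kL; apply: (mpre kL) => B mB; exists B. Qed.
Lemma meas_wait i k : ~ List.In (SW i k) L -> measurable_fun setT (fun w : TC => wait0 nw N w i k).
Proof. by move=> kL; apply: (mpre kL) => B mB; exists B. Qed.
Lemma md_smp1 j : ~ List.In (SS1 j) L -> md (fun w : TC => smp1 nw N j w).
Proof. by move=> kL i; apply: (msrc kL); exists i. Qed.
Lemma md_smp2 j : ~ List.In (SS2 j) L -> md (fun w : TC => smp2 nw N j w).
Proof. by move=> kL i; apply: (msrc kL); exists i. Qed.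
Lemma md_tie j : ~ List.In (STie j) L -> md (fun w : TC => tie nw N j w).
Proof. by move=> kL i; apply: (msrc kL); exists i. Qed.
Lemma md_fsmp1 : ~ List.In SF1 L -> md (fun w : TC => fsmp1 nw N w).
Proof. by move=> kL i; apply: (msrc kL); exists i. Qed.
Lemma md_fsmp2 : ~ List.In SF2 L -> md (fun w : TC => fsmp2 nw N w).
Proof. by move=> kL i; apply: (msrc kL); exists i. Qed.
Lemma md_ftie : ~ List.In SFT L -> md (fun w : TC => ftie nw N w).
Proof. by move=> kL i; apply: (msrc kL); exists i. Qed.

Let meas_gt (f : TC -> R) : (forall x, md (fun w => x < f w)) -> measurable_fun setT f.
Proof.
move=> h; apply: (measurability _ (RGenOInfty.measurableE R)) => //= _ [_ [x ->] <-].
rewrite setTI (_ : _ @^-1` _ = [set w | x < f w]); first exact: md_set (h x).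
by apply/seteqP; split => w /=; rewrite in_itv /= andbT.
Qed.

Lemma meas_resid i : (i < N)%N -> ~ List.In SInit L -> ~ List.In (SU i) L ->
  measurable_fun setT (fun w : TC => resid Gbar (age0 nw N w i) (sau (unif0 nw N w i))).
Proof.
move=> iN k1 k2; apply: meas_gt => x.
have [x0|x0] := ltP x 0.
  rewrite (_ : (fun w => _) = fun=> true); first exact: md_cst.
  by apply/funext => w; apply: lt_trans x0 _; exact: (resid_gt0 sd _ (sau01 _)).
rewrite (_ : (fun w => _) = fun w : TC => sau (unif0 nw N w i) * Gbar (age0 nw N w i) < Gbar (age0 nw N w i + x)).
  have ma := meas_age iN k1; have mG := sd_Gm sd.
  apply: md_ltr; last exact: (measurableT_comp mG (measurable_funD ma (measurable_cst x))).
  by apply: measurable_funM; [apply: sau_meas; exact: meas_unif|exact: measurableT_comp].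
by apply/funext => w; rewrite (resid_gt sd _ (sau01 _) x0).
Qed.

(** The event that the arrival time exceeds [x] only concerns the counting path at the fixed times
    [x] and [T], where it is countably valued. *)
Lemma meas_tauA (T : R) K j : 0 <= T -> ~ List.In SArr L ->
  measurable_fun setT (fun w : TC => if (j < minn K (arr nw N w T))%N then arrtime (arr nw N w) j.+1 else T + 1).
Proof.
move=> T0 kL; apply: meas_gt => x.
have [x0|x0] := ltP x 0.
  rewrite (_ : (fun w => _) = fun=> true); first exact: md_cst.
  apply/funext => w; case: ifP => h; last by lra.
  by apply: lt_le_trans x0 _; apply: (@arrtime_ge0 _ _ _ T) => //; lia.
pose hh (m m' : nat) := if (j < minn K m)%N then (m' <= j)%N else x < T + 1.
rewrite (_ : (fun w => _) = fun w : TC => hh (arr nw N w T) (arr nw N w x)).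
  exact: (md_comp2 hh (md_arr T kL) (md_arr x kL)).
apply/funext => w; rewrite /hh; case: ifP => h //; rewrite ltNge (@arrtimeP _ _ (mdl_emono w) (mdl_erc w) _ _ T) //; lia.
Qed.

End Sources.

Lemma cond_surv01 w i (x : R) : 0 <= x -> 0 <= Gbar (age0 nw N w i + x) / Gbar (age0 nw N w i) <= 1.
Proof.
move=> x0; have Gp := sd_Gpos sd (age0 nw N w i).
apply/andP; split; first by apply: divr_ge0; apply: ltW; [exact: (sd_Gpos sd)|exact: Gp].
by rewrite ler_pdivrMr // mul1r /Gbar lerB // (sd_Gmono sd) // lerDl.
Qed.

Lemma bm_cond_surv L i (x : R) : (i < N)%N -> ~ List.In SInit L -> 0 <= x ->
  bm (fun w : g_sigma_algebraType (gen Cl L) => Gbar (age0 nw N w i + x) / Gbar (age0 nw N w i)).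
Proof.
move=> iN kL x0; have ma := @meas_age L _ iN kL; have mG := sd_Gm sd.
split; last by exists 1 => w; have /andP[h1 h2] := cond_surv01 w i x0; rewrite ger0_norm.
apply: measurable_funM; first exact: (measurableT_comp mG (measurable_funD ma (measurable_cst x))).
have mi : measurable_fun setT (fun r : R => (Gbar r)^-1).
  apply: nondecreasing_measurable => // u v uv; rewrite lef_pV2 ?posrE ?(sd_Gpos sd) //.
  by rewrite /Gbar lerB // (sd_Gmono sd).
exact: (measurableT_comp mi ma).
Qed.

Variables (K : nat) (T : R).
Hypotheses (K0 : (0 < K)%N) (T0 : 0 <= T).

(* Job [m * N + i] with [m < K] is the [m]-th initial job of server [i], or is sent to the dummy
   server [N] when there is no such job; job [K * N + j] is the [j]-th arrival, postponed beyond the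
   horizon [T] if it comes after [T] or after the first [K] arrivals. *)
Definition sysI (w : Om) : inp R :=
  let e := arr nw N w in
  Inp (fun n => if (n < K * N)%N then 0 else
         if (n - K * N < minn K (e T))%N then arrtime e (n - K * N).+1 else T + 1)
      (fun n => if (n < N)%N then resid Gbar (age0 nw N w n) (sau (unif0 nw N w n)) else
         if (n < K * N)%N then sane (wait0 nw N w (n %% N) (n %/ N).-1) else sane (serv nw N (n - K * N) w))
      (fun n => if (n < K * N)%N then (if (n %/ N < X0 nw N w (n %% N))%N then n %% N else N)%N
         else if (minn K (e T) <= n - K * N)%N then N else if (smp1 nw N (n - K * N) w < N)%N then smp1 nw N (n - K * N) w else 0%N)
      (fun n => if (n < K * N)%N then (if (n %/ N < X0 nw N w (n %% N))%N then n %% N else N)%N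
         else if (minn K (e T) <= n - K * N)%N then N else if (smp2 nw N (n - K * N) w < N)%N then smp2 nw N (n - K * N) w else 0%N)
      (fun n => if (n < K * N)%N then true else tie nw N (n - K * N) w).

Definition srcv n := if (n < N)%N then SU n else if (n < K * N)%N then SW (n %% N) (n %/ N).-1 else SServ (n - K * N).

Let NK : (N <= K * N)%N. Proof. by rewrite leq_pmull. Qed.

Lemma srcv_inj n n' : srcv n = srcv n' -> n = n'.
Proof.
rewrite /srcv; case: (ltnP n N) => h1; case: (ltnP n' N) => h2; first by case.
- by case: ifP.
- by case: ifP.
case: (ltnP n (K * N)) => h3; case: (ltnP n' (K * N)) => h4 //.
  case=> e1 e2; rewrite (divn_eq n N) (divn_eq n' N) e1; congr (_ * _ + _)%N.
  have : (0 < n %/ N)%N by rewrite divn_gt0.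
  have : (0 < n' %/ N)%N by rewrite divn_gt0.
  lia.
case; lia.
Qed.

Lemma meas_sv L k : ~ List.In (srcv k) L -> ((k < N)%N -> ~ List.In SInit L) ->
  measurable_fun setT (fun w : g_sigma_algebraType (gen Cl L) => sv (sysI w) k).
Proof.
rewrite /srcv /=; case: ifP => kN.
  by move=> h1 h2; apply: meas_resid => //; exact: h2.
case: ifP => kK h1 _; apply: sane_meas; [exact: meas_wait|exact: meas_serv].
Qed.

Lemma meas_tauI L k : ~ List.In SArr L -> measurable_fun setT (fun w : g_sigma_algebraType (gen Cl L) => tau (sysI w) k).
Proof.
move=> h; rewrite /sysI /=; case: (boolP (k < K * N)%N) => kK; first exact: measurable_cst.
exact: meas_tauA.
Qed.

Let md_init L k : ~ List.In SInit L -> md (fun w : g_sigma_algebraType (gen Cl L) => if (k %/ N < X0 nw N w (k %% N))%N then (k %% N)%N else N).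
Proof.
move=> h; apply: (md_comp (fun m => if (k %/ N < m)%N then (k %% N)%N else N)).
by apply: md_X0 => //; rewrite ltn_mod.
Qed.

Let md_smpI (f : Om -> nat) L k : ~ List.In SArr L -> md (f : g_sigma_algebraType (gen Cl L) -> nat) ->
  md (fun w : g_sigma_algebraType (gen Cl L) => if (minn K (arr nw N w T) <= k)%N then N else if (f w < N)%N then f w else 0%N).
Proof. by move=> h mf; apply: (md_comp2 (fun m m' => if (minn K m <= k)%N then N else if (m' < N)%N then m' else 0%N)) => //; exact: md_arr. Qed.

Lemma md_saI L k : ~ List.In SInit L -> ~ List.In SArr L -> ((K * N <= k)%N -> ~ List.In (SS1 (k - K * N)) L) ->
  md (fun w : g_sigma_algebraType (gen Cl L) => sa (sysI w) k).
Proof.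
move=> h1 h3 h2 /=; case: (ltnP k (K * N)) => kK; first exact: md_init.
by apply: md_smpI => //; apply: md_smp1; exact: h2.
Qed.

Lemma md_sbI L k : ~ List.In SInit L -> ~ List.In SArr L -> ((K * N <= k)%N -> ~ List.In (SS2 (k - K * N)) L) ->
  md (fun w : g_sigma_algebraType (gen Cl L) => sb (sysI w) k).
Proof.
move=> h1 h3 h2 /=; case: (ltnP k (K * N)) => kK; first exact: md_init.
by apply: md_smpI => //; apply: md_smp2; exact: h2.
Qed.

Lemma md_tbI L k : ((K * N <= k)%N -> ~ List.In (STie (k - K * N)) L) ->
  md (fun w : g_sigma_algebraType (gen Cl L) => tb (sysI w) k).
Proof.
by move=> h2 /=; case: (ltnP k (K * N)) => kK; [exact: md_cst|apply: md_tie; exact: h2].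
Qed.

Definition Cvg n := gen Cl [:: srcv n].
Definition Csg n := gen Cl [:: SS1 (n - K * N); SS2 (n - K * N); STie (n - K * N)].

Lemma srcv_cases n : [\/ srcv n = SU n, exists i k, srcv n = SW i k | exists j, srcv n = SServ j].
Proof.
rewrite /srcv; case: ifP => _; first exact: Or31.
by case: ifP => _; [apply: Or32; exists (n %% N)%N, (n %/ N).-1|apply: Or33; exists (n - K * N)%N].
Qed.

Let notin1 n (k : src) : (forall i, k <> SU i) -> (forall i j, k <> SW i j) -> (forall j, k <> SServ j) -> ~ List.In k [:: srcv n].
Proof. by move=> h1 h2 h3 [|[]]; case: (srcv_cases n) => [->|[i [j ->]]|[j ->]] e; [exact: (h1 n)|exact: (h2 i j)|exact: (h3 j)]. Qed.

Lemma minp_Cv n : minp (fun w : g_sigma_algebraType (Cvg n) => setv (sysI w) n 1).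
Proof.
split=> k.
- by apply: meas_tauI; apply: notin1.
- rewrite [X in measurable_fun _ X](_ : _ = fun w : g_sigma_algebraType (Cvg n) => if k == n then 1 else sv (sysI w) k) //.
  case: eqP => kn; first exact: measurable_cst.
  by apply: meas_sv => [[e|[]]|_]; [apply: kn; apply: srcv_inj|apply: notin1].
- by apply: md_saI; [apply: notin1|apply: notin1|move=> _; apply: notin1].
- by apply: md_sbI; [apply: notin1|apply: notin1|move=> _; apply: notin1].
- by apply: md_tbI => _; apply: notin1.
Qed.

Lemma minp_Cs n : (K * N <= n)%N -> minp (fun w : g_sigma_algebraType (Csg n) => sets (sysI w) n 0 0 true).
Proof.
move=> Kn.
have nn k (C : nat -> src) : injective C -> (K * N <= k)%N -> k <> n -> C (k - K * N)%N <> C (n - K * N)%N.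
  by move=> ic kk kn /ic; lia.
split=> k.
- by apply: meas_tauI => -[|[|[|[]]]].
- apply: meas_sv => [|_]; last by move=> [|[|[|[]]]].
  by case: (srcv_cases k) => [->|[i [j ->]]|[j ->]] [|[|[|[]]]].
- rewrite [X in md X](_ : _ = fun w : g_sigma_algebraType (Csg n) => if k == n then 0%N else sa (sysI w) k) //.
  case: eqP => kn; first exact: md_cst.
  by apply: md_saI => [[|[|[|[]]]] //|[|[|[|[]]]] //|kk [e|[|[|[]]]] //]; apply: (nn k SS1) => //; move=> ? ? [].
- rewrite [X in md X](_ : _ = fun w : g_sigma_algebraType (Csg n) => if k == n then 0%N else sb (sysI w) k) //.
  case: eqP => kn; first exact: md_cst.
  by apply: md_sbI => [[|[|[|[]]]] //|[|[|[|[]]]] //|kk [|[e|[|[]]]] //]; apply: (nn k SS2) => //; move=> ? ? [].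
- rewrite [X in md X](_ : _ = fun w : g_sigma_algebraType (Csg n) => if k == n then true else tb (sysI w) k) //.
  case: eqP => kn; first exact: md_cst.
  by apply: md_tbI => kk [|[|[e|[]]]] //; apply: (nn k STie) => //; move=> ? ? [].
Qed.

Lemma minpI : minp sysI.
Proof.
have s1 (f : Om -> R) : measurable_fun setT (f : g_sigma_algebraType (gen Cl [::]) -> R) -> measurable_fun setT f.
  exact: sub_measurable_fun (@genm [::]) _ _ f.
have s2 D (f : Om -> D) : md (f : g_sigma_algebraType (gen Cl [::]) -> D) -> md f.
  exact: sub_md (@genm [::]) _ f.
split=> k.
- by apply: s1; apply: meas_tauI => -[].
- by apply: s1; apply: meas_sv => [[]|_ []].
- by apply: s2; apply: md_saI => [[]|[]|_ []].
- by apply: s2; apply: md_sbI => [[]|[]|_ []].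
- by apply: s2; apply: md_tbI => _ [].
Qed.

Lemma validI w : valid (sysI w).
Proof.
split=> [j k jk|k] /=; last first.
  by case: ifP => _; [exact: (resid_gt0 sd _ (sau01 _))|case: ifP => _; exact: sane_gt0].
case: (ltnP j (K * N)) => jK; case: (ltnP k (K * N)) => kK //.
- by case: ifP => h; [apply: (@arrtime_ge0 _ _ _ T) => //; lia|have := T0; lra].
- lia.
case: (ltnP _ (minn _ _)) => h1; case: (ltnP _ (minn _ _)) => h2 //; last by lia.
  by apply: (@arrtime_mono _ _ (mdl_emono w) (mdl_erc w) _ _ T) => //; lia.
apply: (@le_trans _ _ T); last by have := T0; lra.
by apply: arrtime_le => //; lia.
Qed.


Let meas_sane : measurable_fun setT (@sane R). Proof. exact: (@sane_meas _ _ _ id). Qed.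
Let meas_sau : measurable_fun setT (@sau R). Proof. exact: (@sau_meas _ _ _ id). Qed.

Let indep_sv n B (E : set Om) : (N <= n)%N -> measurable B -> measurable (E : set (g_sigma_algebraType (Cvg n))) ->
  P (E `&` (fun w => sv (sysI w) n) @^-1` B) = (P E * P ((fun w => sv (sysI w) n) @^-1` B))%E.
Proof.
move=> Nn mB; apply: (@gen_one _ (srcv n)); [by left|by apply: List.NoDup_cons; [case|exact: List.NoDup_nil]|].
have mS : measurable (@sane R @^-1` B) by rewrite -[X in measurable X]setTI; exact: meas_sane.
by rewrite /srcv /= ltnNge Nn /=; case: ifP => _; exists (@sane R @^-1` B).
Qed.

Lemma freezeV n (c y : g_sigma_algebraType (Cvg n) -> R) : (N <= n)%N -> bm c -> measurable_fun setT y ->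
  Ex P (fun w => c w * (y w < sv (sysI w) n)%R%:R) = Ex P (fun w => c w * Gbar (y w)).
Proof.
move=> Nn; apply: freeze_gt.
- exact: genm.
- by case: minpI.
- by move=> E B mE mB; exact: indep_sv.
- exact: (sd_Gm sd).
- move=> z; rewrite /sysI /= ltnNge Nn /=; case: (boolP (n < K * N)%N) => _; apply: (sane_law sd).
  + exact: (sub_measurable_fun (@genm [::]) (meas_wait _)).
  + exact: mdl_wait.
  + exact: (sub_measurable_fun (@genm [::]) (meas_serv _)).
  + exact: mdl_serv.
Qed.

(** The residual time exceeds [s] when the uniform is below [Gbar (a + s) / Gbar a], a threshold
    known from the initial state. Signs are reversed to match [freeze_gt]. *)
Lemma resid_freeze i (c : g_sigma_algebraType (Cvg i) -> R) (s : R) : (i < N)%N -> bm c -> 0 <= s ->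
  Ex P (fun w => c w * (s < resid Gbar (age0 nw N w i) (sau (unif0 nw N w i)))%R%:R) =
  Ex P (fun w => c w * (Gbar (age0 nw N w i + s) / Gbar (age0 nw N w i))).
Proof.
move=> iN bc s0.
pose V (w : Om) := - sau (unif0 nw N w i).
pose y (w : g_sigma_algebraType (Cvg i)) : R := - (Gbar (age0 nw N w i + s) / Gbar (age0 nw N w i)).
have mU := sub_measurable_fun (@genm [::]) (@meas_unif [::] i (fun x => x)).
have mV : measurable_fun setT V by apply: measurableT_comp => //; exact: sau_meas.
have nI : ~ List.In SInit [:: srcv i] by apply: notin1.
have my : measurable_fun setT y by apply: measurableT_comp => //; case: (bm_cond_surv iN nI s0).
pose surv (z : R) := Num.min 1 (Num.max 0 (- z)).
have ms : measurable_fun setT surv.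
  apply: measurable_minr; first exact: measurable_cst.
  by apply: measurable_maxr; [exact: measurable_cst|apply: measurable_funN; exact: measurable_id].
have indV : forall E B, measurable (E : set (g_sigma_algebraType (Cvg i))) -> measurable B ->
    P (E `&` V @^-1` B) = (P E * P (V @^-1` B))%E.
  move=> E B mE mB; apply: (@gen_one _ (srcv i)) mE; [by left|by apply: List.NoDup_cons; [case|exact: List.NoDup_nil]|].
  rewrite /srcv iN; exists ((fun u => - sau u) @^-1` B); split => //.
  by rewrite -[X in measurable X]setTI; apply: measurableT_comp mB.
have lawV z : P [set w | z < V w] = (surv z)%:E by apply: sau_law => // x x0 x1; exact: mdl_unif.
have := @freeze_gt _ _ _ P _ (@genm _) V mV indV surv ms lawV c y bc my.
have Gp (w : Om) : 0 < Gbar (age0 nw N w i) by exact: (sd_Gpos sd).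
move=> h; transitivity (Ex P (fun w : Om => c w * (y w < V w)%R%:R)).
  by apply: eq_Ex => w; rewrite (resid_gt sd _ (sau01 _) s0) /y /V ltrN2 ltr_pdivlMr //; exact: Gp.
rewrite h; apply: eq_Ex => w; have /andP[q0 q1] := cond_surv01 w i s0; congr (_ * _).
by rewrite /surv /y opprK max_r // min_r.
Qed.

Let Ex_null (f f' : Om -> R) (p : Om -> bool) : bm f -> bm f' -> md p -> P [set w | p w] = 0%E ->
  (forall w, ~~ p w -> f w = f' w) -> Ex P f = Ex P f'.
Proof.
move=> [mf _] [mf' _] mp p0 h; rewrite /Ex /Rintegral; congr fine.
apply: ae_eq_integral => //; [exact/measurable_EFinP|exact/measurable_EFinP|].
exists [set w | p w]; split => //; first exact: md_set.
by move=> w /= hw; apply: contrapT => /negP pw; apply: hw => _; rewrite (h w).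
Qed.

(** Only the probabilities of the values below [N] are prescribed, and these already add up to
    [1]. *)
Lemma smp_null (f : Om -> nat) : md f -> (forall i, (i < N)%N -> P [set w | f w = i] = (N%:R^-1)%:E) ->
  P [set w | ~~ (f w < N)%N] = 0%E.
Proof.
move=> mf h.
have mb i : md (fun w => f w == i) by exact: (md_comp (eq_op^~ i)).
have mN : md (fun w => (f w < N)%N) by exact: (md_comp (fun m => (m < N)%N)).
have e1 : Ex P (fun w => (f w < N)%N%:R) = 1.
  rewrite (@eq_Ex _ _ _ _ _ (fun w => \sum_(i < N) (f w == i)%:R)); last first.
    by move=> w; rewrite -natr_sum; congr _%:R; have := @cnt_eq1 N (f w) xpredT; rewrite /cnt andbT => <-; apply: eq_bigr => i _; rewrite andbT eq_sym.
  rewrite Ex_sum; last by move=> i; exact: bm_ind.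
  rewrite (eq_bigr (fun=> N%:R^-1)); last first.
    move=> i _; rewrite Ex_ind // (_ : [set w | f w == i] = [set w | f w = i]) ?h //.
    by apply/seteqP; split => w /= /eqP.
  by rewrite sumr_const card_ord -[N%:R^-1 *+ N]mulr_natr mulVf // pnatr_eq0 -lt0n.
rewrite Ex_ind // in e1.
have mS := md_set mN.
have fin : P [set w | (f w < N)%N] = 1%E by rewrite -[LHS]fineK ?e1 // fin_num_measure.
rewrite (_ : [set w | _] = ~` [set w | (f w < N)%N]); last by apply/seteqP; split => w /= /negP.
by rewrite probability_setC // fin subee.
Qed.

Lemma freezeS n (c : g_sigma_algebraType (Csg n) -> R) i j b : (K * N <= n)%N -> bm c -> (forall w, T < tau (sysI w) n -> c w = 0) -> (i < N)%N -> (j < N)%N ->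
  Ex P (fun w => c w * [&& sa (sysI w) n == i, sb (sysI w) n == j & tb (sysI w) n == b]%:R) =
  (2 * N%:R ^+ 2)^-1 * Ex P c.
Proof.
move=> Kn bc hc iN jN; set q := (n - K * N)%N.
have m1 := sub_md (@genm [::]) (@md_smp1 [::] q (fun x => x)).
have m2 := sub_md (@genm [::]) (@md_smp2 [::] q (fun x => x)).
have m3 := sub_md (@genm [::]) (@md_tie [::] q (fun x => x)).
pose bb (w : Om) := [&& smp1 nw N q w == i, smp2 nw N q w == j & tie nw N q w == b].
have mbb : md bb by apply: md_and; [exact: (md_comp (eq_op^~ i))|apply: md_and; [exact: (md_comp (eq_op^~ j))|exact: (md_comp (eq_op^~ b))]].
have [t1 t2 t3 _ _] := minpI.
have mI k : md (fun w : Om => [&& sa (sysI w) k == i, sb (sysI w) k == j & tb (sysI w) k == b]).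
  case: minpI => _ _ a1 a2 a3.
  by apply: md_and; [exact: (md_comp (eq_op^~ i))|apply: md_and; [exact: (md_comp (eq_op^~ j))|exact: (md_comp (eq_op^~ b))]].
have bcO : bm (c : Om -> R) by exact: (sub_bm (@genm _) bc).
rewrite (@Ex_null _ (fun w => c w * (bb w)%:R) (fun w => ~~ (smp1 nw N q w < N)%N || ~~ (smp2 nw N q w < N)%N)); last first.
(* [sysI] replaces samples out of range by [0], which matters only on a null set; beyond the horizon
   [c] vanishes. *)
- move=> w; rewrite negb_or !negbK => /andP[h1 h2]; rewrite /bb.
  have := hc w; rewrite /sysI /= ltnNge Kn /= -/q h1 h2 //; case: ltnP => [//|_ ->]; first by rewrite !mul0r.
  by have := T0; lra.
- apply/le_anti/andP; split => //.
  have mN f : md f -> md (fun w : Om => ~~ (f w < N)%N) by move=> mf; apply: (md_comp (fun m => ~~ (m < N)%N)).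
  have n1 := md_set (mN _ m1); have n2 := md_set (mN _ m2).
  rewrite (_ : [set w | _] = [set w | ~~ (smp1 nw N q w < N)%N] `|` [set w | ~~ (smp2 nw N q w < N)%N]); last first.
    by apply/seteqP; split => w /= /orP.
  have z1 := smp_null m1 (mdl_smp1 q); have z2 := smp_null m2 (mdl_smp2 q).
  by apply: le_trans (measureU2 P n1 n2) _; rewrite -[X in (X + _)%E]/(P _) -[X in (_ + X)%E]/(P _) z1 z2 adde0.
- by apply: md_or; [apply: (md_comp (fun m => ~~ (m < N)%N))|apply: (md_comp (fun m => ~~ (m < N)%N))].
- by apply: bmM => //; exact: bm_ind.
- by apply: bmM => //; exact: bm_ind.
have nd : List.NoDup [:: SS1 q; SS2 q; STie q].
  by repeat (apply: List.NoDup_cons; [by repeat case|]); exact: List.NoDup_nil.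
pose B (k : src) : set Om := match k with SS1 _ => [set w | smp1 nw N q w = i] | SS2 _ => [set w | smp2 nw N q w = j] | _ => [set w | tie nw N q w = b] end.
have clB (k : src) : List.In k [:: SS1 q; SS2 q; STie q] -> Cl k (B k).
  by move=> [<-|[<-|[<-|[]]]]; [exists i|exists j|exists b].
have eB : [set w | bb w] = capL [:: SS1 q; SS2 q; STie q] B.
  apply/seteqP; split => w /=.
    by move=> /and3P[/eqP h1 /eqP h2 /eqP h3] k [<-|[<-|[<-|[]]]].
  move=> h; apply/and3P; split; apply/eqP; [exact: (h (SS1 q) (or_introl erefl))|exact: (h (SS2 q) (or_intror (or_introl erefl)))|].
  exact: (h (STie q) (or_intror (or_intror (or_introl erefl)))).
have ptie : P [set w | tie nw N q w = b] = (2^-1)%:E.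
  have h := mdl_tie q; case: b {bb mbb mI B clB eB} => //.
  have mt : measurable [set w | tie nw N q w = true] by exact: (m3 true).
  rewrite (_ : [set w | _] = ~` [set w | tie nw N q w = true]).
    by rewrite probability_setC // h -EFinB; congr EFin; lra.
  by apply/seteqP; split => w /=; case: (tie _ _ _ _).
have pB : P [set w | bb w] = ((2 * N%:R ^+ 2)^-1)%:E.
  rewrite eB [LHS]ind // !big_cons big_nil /= -[fine (P [set w | smp1 _ _ _ _ = i])]/(fine (P _)) mdl_smp1 // mdl_smp2 // ptie /=.
  congr EFin; field; rewrite pnatr_eq0 -lt0n; exact: N0.
apply: freeze_event => //; first exact: genm.
move=> E mE; rewrite eB (gen_indep Clm ClI ind nd clB mE) -eB; congr (_ * _)%E; exact: pB.
Qed.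

Lemma init_srv w n : (n < K * N)%N -> srv (sysI w) n = sa (sysI w) n.
Proof. by move=> nK; rewrite srvE /sysI /= nK /rt ltnn. Qed.

Lemma init_sta w n : (n < N)%N -> (srv (sysI w) n < N)%N -> sta (sysI w) n = 0.
Proof.
move=> nN sN; have nK := leq_trans nN NK.
have e k : (k < N)%N -> (srv (sysI w) k < N)%N -> srv (sysI w) k = k.
  by move=> kN; rewrite init_srv ?(leq_trans kN NK) //= (leq_trans kN NK) (modn_small kN); case: ifP; rewrite ?ltnn.
case: (sta_cases (sysI w) n) => [->|[k [kn ek _]]]; first by rewrite /= nK.
have := e n nN sN; rewrite -{1}ek e ?(ltn_trans kn) //; last by rewrite ek.
lia.
Qed.

Lemma init_srv_lt w n : (n < N)%N -> (srv (sysI w) n < N)%N = (0 < X0 nw N w n)%N.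
Proof.
move=> nN; rewrite init_srv ?(leq_trans nN NK) //= (leq_trans nN NK) divn_small // modn_small //.
by case: ifP => _; rewrite ?nN ?ltnn.
Qed.

Let bm_busy L i : (i < N)%N -> ~ List.In SInit L ->
  bm (fun w : g_sigma_algebraType (gen Cl L) => (0 < X0 nw N w i)%N%:R : R).
Proof. by move=> iN kL; apply: bm_ind; apply: (md_comp (fun m => (0 < m)%N)); exact: md_X0. Qed.

Lemma bm_init_survival n (x : R) : (n < N)%N -> 0 <= x ->
  bm (fun w : Om => (0 < X0 nw N w n)%N%:R * (Gbar (age0 nw N w n + x) / Gbar (age0 nw N w n))).
Proof. by move=> nN x0; apply: (sub_bm (@genm [::])); apply: bmM; [exact: bm_busy|exact: bm_cond_surv]. Qed.

Lemma init_survival n (s : R) : (n < N)%N -> 0 <= s ->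
  Ex P (fun w => [&& (srv (sysI w) n < N)%N & s < cpl (sysI w) n]%:R) =
  Ex P (fun w => (0 < X0 nw N w n)%N%:R * (Gbar (age0 nw N w n + s) / Gbar (age0 nw N w n))).
Proof.
move=> nN s0; have nI : ~ List.In SInit [:: srcv n] by apply: notin1.
rewrite -(resid_freeze nN (bm_busy nN nI) s0); apply: eq_Ex => w.
rewrite init_srv_lt //; case: ltnP => X0w /=; last by rewrite mul0r.
by rewrite mul1r cplE init_sta // ?init_srv_lt // add0r /sysI /= nN.
Qed.

(** The hazard bound at age [age0 + s] is proportional to the survival there, which is at most the
    survival at [age0]; the bound therefore does not depend on the age. *)
Lemma haz0 n (s s' : R) : (n < N)%N -> 0 <= s -> s <= s' ->
  Ex P (fun w => [&& (srv (sysI w) n < N)%N, s < cpl (sysI w) n & cpl (sysI w) n <= s']%R%:R) <=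
  H * (s' - s) * Ex P (fun w => (srv (sysI w) n < N)%N%:R).
Proof.
move=> nN s0 ss'; have H0 := sd_H0 sd; have s'0 := le_trans s0 ss'.
have bg (x : R) : bm (fun w => ((srv (sysI w) n < N)%N && (x < cpl (sysI w) n))%:R : R).
  by apply: bm_ind; apply: md_and; [apply: md_srv_lt'|apply: md_ltr; [exact: measurable_cst|apply: meas_cpl]]; exact: minpI.
rewrite (@eq_Ex _ _ _ _ _ (fun w => ((srv (sysI w) n < N)%N && (s < cpl (sysI w) n))%:R - ((srv (sysI w) n < N)%N && (s' < cpl (sysI w) n))%:R)); last first.
  move=> w; case: (_ < N)%N => /=; last by rewrite subrr.
  by case: (ltP s (cpl (sysI w) n)) => h1; case: (leP (cpl (sysI w) n) s') => h2 /=; rewrite ?subr0 ?subrr //; lra.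
have bi := bm_init_survival nN s0; have bi' := bm_init_survival nN s'0.
have bb := sub_bm (@genm [::]) (@bm_busy [::] n nN (fun x => x)).
rewrite ExB // !init_survival // -ExB //.
rewrite -(eq_Ex _ (fun w => congr1 (fun b : bool => b%:R) (esym (init_srv_lt w nN)))) -ExZ //.
apply: Ex_le => [||w]; [exact: bmB|by apply: bmM => //; exact: bm_cst|].
rewrite -mulrBr [leRHS]mulrC; apply: ler_wpM2l => //.
have Gp := sd_Gpos sd (age0 nw N w n).
rewrite -mulrBl ler_pdivrMr //.
have hh : age0 nw N w n + s <= age0 nw N w n + s' by rewrite lerD2l.
have := sd_haz sd hh; rewrite (_ : age0 nw N w n + s' - _ = s' - s); last by ring.
have : 1 - G (age0 nw N w n + s) <= 1 - G (age0 nw N w n) by rewrite lerB // (sd_Gmono sd) // lerDl.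
move=> h1 h2; have hs : 0 <= H * (s' - s) by rewrite mulr_ge0 // subr_ge0.
have := ler_wpM2l hs h1; rewrite /Gbar; lra.
Qed.

Lemma sysI_core : core_spec P N K sysI Gbar H T Cvg Csg.
Proof.
split => //; last exact: haz0.
- exact: minpI.
- exact: validI.
- exact: sd_H0 sd.
- exact: sd_Gm sd.
- by move=> x; rewrite /Gbar subr_ge0 (sd_G1 sd) /= gerBl (sd_G0 sd).
- by move=> x x0; rewrite /Gbar (sd_Gneg sd x0) subr0.
- by move=> x y xy; rewrite /Gbar lerB // (sd_Gmono sd).
- by move=> x y xy; exact: sd_GL sd _ _ xy.
- by move=> k w kK; rewrite /sysI /= kK; split => //; case: ifP => _; [left|right].
- move=> k w; rewrite /sysI /= leqNgt => /negbTE ->; case: ifP => h; last by have := T0; lra.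
  by apply: (@arrtime_gt0 _ _ (mdl_earr0 w) (mdl_emono w) (mdl_erc w) _ T) => //; lia.
- move=> k w; rewrite /sysI /= leqNgt => /negbTE ->; case: ltnP => h; last by have := T0; lra.
  by move=> _; split; case: ifP.
- by move=> n _; exact: minp_Cv.
- by move=> n /andP[h _]; exact: minp_Cs.
- by move=> n /andP[h _] c y; exact: freezeV.
- by move=> n /andP[h _] c i j b bc hc; exact: freezeS.
Qed.

End Instance.

(** * Laws of large numbers for the primitive data *)

Section CountMore.
Implicit Types (m n : nat) (p : nat -> bool).

Lemma cnt_add m n p : cnt (m + n) p = (cnt m p + cnt n (fun j => p (m + j)))%N.
Proof.
elim: n => [|n IH]; first by rewrite addn0 cnt0 addn0.
by rewrite addnS !cntS IH addnA.
Qed.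

Lemma cnt_mul K N p : cnt (K * N) p = (\sum_(m < K) cnt N (fun i => p (m * N + i)))%N.
Proof.
elim: K => [|K IH]; first by rewrite mul0n cnt0 big_ord0.
by rewrite mulSn addnC cnt_add IH big_ord_recr.
Qed.

Lemma cnt_mod m N i : (i < N)%N -> cnt (m * N + i) (fun j => j %% N == i)%N = m.
Proof.
move=> iN; rewrite cnt_add cnt_mul.
rewrite [X in (_ + X)%N]cntF ?addn0 => [|j ji]; last by rewrite modnMDl modn_small ?(ltn_trans ji) //; lia.
rewrite (eq_bigr (fun=> 1%N)) ?sum1_card ?card_ord // => a _.
rewrite (eq_cnt (q := fun k => (k == i) && true)) ?(@cnt_eq1 N i xpredT) ?iN // => k kN.
by rewrite modnMDl modn_small // andbT.
Qed.

Lemma cnt_ltn m n : cnt m (fun j => (j < n)%N) = minn m n.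
Proof. by elim: m => [|m IH]; rewrite ?cnt0 ?cntS ?IH; lia. Qed.

End CountMore.

(** * Moments of the Poisson distribution through exact partial sums *)

Section PoissonMoments.
Variables (R : realType) (m : R).
Hypothesis m0 : 0 <= m.
Let p n := Defs.poisson_pmf m n.

Lemma pmf_ge0 n : 0 <= p n.
Proof. by rewrite /p /Defs.poisson_pmf divr_ge0 // mulr_ge0 ?exprn_ge0 // expR_ge0. Qed.

Let pS n : n.+1%:R * p n.+1 = m * p n.
Proof.
rewrite /p /Defs.poisson_pmf factS natrM exprS.
have f0 : (n`!)%:R != 0 :> R by rewrite pnatr_eq0 -lt0n fact_gt0.
have n0 : n.+1%:R != 0 :> R by rewrite pnatr_eq0.
by field; rewrite f0 nat1r n0.
Qed.

Lemma pmf_mean n : \sum_(k < n.+1) k%:R * p k = m * \sum_(k < n) p k.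
Proof.
elim: n => [|n IH]; first by rewrite big_ord1 big_ord0 mul0r mulr0.
by rewrite big_ord_recr IH [in RHS]big_ord_recr /= mulrDr pS.
Qed.

(** The remainder is nonpositive as soon as [n >= m], so the variance bound follows without summing
    a series. *)
Lemma pmf_var n : \sum_(k < n.+1) (k%:R - m) ^+ 2 * p k = m * \sum_(k < n) p k + m * (m - n%:R) * p n.
Proof.
elim: n => [|n IH]; first by rewrite big_ord1 big_ord0 /=; ring.
rewrite big_ord_recr IH [in RHS]big_ord_recr /=.
have e : m * p n = n.+1%:R * p n.+1 by rewrite pS.
have -> : m * (m - n%:R) * p n = (m - n%:R) * (m * p n) by ring.
rewrite mulrDr e -natr1; ring.
Qed.

End PoissonMoments.

Section NatTails.
Context d (Om : measurableType d) (R : realType) (P : probability Om R).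

Lemma dom_L1 (f : nat -> Om -> R) (c M : R) : (forall n, measurable_fun setT (f n)) ->
  (forall n w, `|f n w| <= M) -> {ae P, forall w, f n w @[n --> \oo] --> c} ->
  LS (fun n => Ex P (fun w => `|f n w - c|)) 0.
Proof.
move=> mf fM fc.
have bf n : bm (fun w => `|f n w - c|) by apply/bm_abs/bmB; [split => //; exists M|exact: bm_cst].
have := @dominated_convergence _ _ _ P setT measurableT (fun n w => (f n w)%:E) (cst c%:E) (cst M%:E).
case.
- by move=> n; exact/measurable_EFinP.
- exact: measurable_cst.
- apply: filterS fc => w /= h _; by apply: cvg_EFin; [exact: nearW|exact: h].
- exact: (bm_integrable P (bm_cst Om M)).
- by apply: aeW => w n _ /=; rewrite lee_fin.
move=> _ h _ e e0.
have {h} : (fun n => (Ex P (fun w => `|f n w - c|))%:E) @ \oo --> 0%E.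
  move: h; apply: cvg_trans; apply: near_eq_cvg; apply: nearW => n /=.
  by rewrite -(ExE P (bf n)); apply: eq_integral => w _.
move=> /fine_cvgP[_] /cvgrPdist_lt /(_ e e0)[N _ hN].
by exists N => n Nn; rewrite add0r; have := hN n Nn; rewrite sub0r normrN /= => /ltW; apply: le_trans; exact: ler_norm.
Qed.

Lemma tail_to0 (f : Om -> nat) : md f -> LS (fun B => Ex P (fun w => (B <= f w)%N%:R)) 0.
Proof.
move=> mf; have mB B : md (fun w => (B <= f w)%N) by exact: (md_comp (fun n => (B <= n)%N)).
have := @dom_L1 (fun B w => (B <= f w)%N%:R) 0 1; move=> h.
apply: LS_ext (h _ _ _) => [B|B|B w|].
- by apply: eq_Ex => w; rewrite subr0 ger0_norm.
- by case: (bm_ind R (mB B)).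
- by rewrite ger0_norm //; case: (leqP B (f w)); rewrite ?ler01 ?lexx.
apply: aeW => w /=; apply: cvg_near_cst; exists (f w).+1 => // n /= hn.
by rewrite leqNgt hn.
Qed.

End NatTails.

Section PoissonLLN.
Context d (Om : measurableType d) (R : realType) (P : probability Om R).
Variables (e : Om -> nat) (m : R).
Hypotheses (m0 : 0 <= m) (me : md e).
Hypothesis law : forall n, P [set w | e w = n] = (Defs.poisson_pmf m n)%:E.
Let p n := Defs.poisson_pmf m n.

Let Exp n : Ex P (fun w => (e w == n)%:R) = p n.
Proof.
rewrite Ex_ind; last exact: (md_comp (eq_op^~ n)).
by rewrite (_ : [set w | e w == n] = [set w | e w = n]) ?law //; apply/seteqP; split => w /= /eqP.
Qed.

Let be n : bm (fun w => (e w == n)%:R : R). Proof. by apply/bm_ind/(md_comp (eq_op^~ n)). Qed.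

Let head_sum (F : nat -> R) n w : (e w < n)%N%:R * F (e w) = \sum_(k < n) F k * (e w == k)%:R.
Proof.
case: (ltnP (e w) n) => h.
  rewrite mul1r (bigD1 (Ordinal h)) //= eqxx mulr1 big1 ?addr0 // => k.
  by rewrite -val_eqE eq_sym /= => /negbTE ->; rewrite mulr0.
rewrite mul0r big1 // => k _; have kn := ltn_ord k.
by case: eqP => [ek|_]; rewrite ?mulr0 //; exfalso; lia.
Qed.

Lemma pmf_sum n : \sum_(k < n) p k <= 1.
Proof.
rewrite (eq_bigr (fun k : 'I_n => Ex P (fun w => (e w == k)%:R))); last by move=> k _; rewrite Exp.
rewrite -Ex_sum; last by move=> k; exact: be.
rewrite -[leRHS](Ex_cst P 1); apply: Ex_le => [||w]; [by apply: bm_sum => k; exact: be|exact: bm_cst|].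
rewrite (eq_bigr (fun k : 'I_n => (fun=> 1) k * (e w == k)%:R)); last by move=> k _; rewrite mul1r.
by rewrite -(head_sum (fun=> 1)) mulr1 lern1; case: (_ < _)%N.
Qed.

(* dominates a bounded functional of the Poisson variable by the partial sums of its moment series *)
Let mom_le (f F : nat -> R) (C A : R) : (forall n, 0 <= f n <= F n) -> (forall n, f n <= C) ->
  (exists n0, forall n, (n0 <= n)%N -> \sum_(k < n.+1) F k * p k <= A) -> Ex P (fun w => f (e w)) <= A.
Proof.
move=> fF fC [n0 h]; apply/ler_addgt0Pr => eps eps0.
have C0 : 0 <= C by apply: le_trans (fC 0%N); case/andP: (fF 0%N).
have bf : bm (fun w => f (e w)).
  by split; [exact: measurable_md|exists C => w; have /andP[h0 _] := fF (e w); rewrite ger0_norm].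
have C1 : 0 < C + 1 by lra.
have [N hN] := tail_to0 P me (divr_gt0 eps0 C1).
pose n := maxn n0 N; have {}hN := hN n.+1 (leq_trans (leq_maxr _ _) (leqnSn _)); rewrite add0r in hN.
have {}h := h n (leq_maxl _ _).
have mB : md (fun w => (n.+1 <= e w)%N) by exact: (md_comp (fun a => (n.+1 <= a)%N)).
apply: le_trans (_ : Ex P (fun w => \sum_(k < n.+1) f k * (e w == k)%:R + C * (n.+1 <= e w)%N%:R) <= _).
  have bs : bm (fun w => \sum_(k < n.+1) f k * (e w == k)%:R).
    by apply: bm_sum => k; apply: bmM; [exact: bm_cst|exact: be].
  apply: Ex_le => [//||w]; first by apply: bmD => //; apply: bmM; [exact: bm_cst|exact: bm_ind].
  rewrite -head_sum; case: (ltnP (e w) n.+1) => _; rewrite ?mul1r ?mulr0 ?mulr1 ?addr0 ?mul0r ?add0r //.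
rewrite ExD; last first.
- by apply: bmM; [exact: bm_cst|exact: bm_ind].
- by apply: bm_sum => k; apply: bmM; [exact: bm_cst|exact: be].
apply: lerD.
  apply: le_trans h; rewrite Ex_sum => [|k]; last by apply: bmM; [exact: bm_cst|exact: be].
  apply: ler_sum => k _; rewrite ExZ // Exp; apply: ler_wpM2r; first exact: pmf_ge0.
  by case/andP: (fF k).
rewrite ExZ; last exact: bm_ind.
apply: le_trans (ler_wpM2l C0 hN) _; rewrite mulrCA ler_piMr // ?(ltW eps0) //.
by rewrite ler_pdivrMr //; lra.
Qed.

Lemma poisson_mean_min (K : nat) : Ex P (fun w => (minn K (e w))%:R) <= m.
Proof.
apply: (@mom_le (fun n => (minn K n)%:R) (fun n => n%:R) K%:R).
- by move=> n; rewrite ler0n ler_nat geq_minr.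
- by move=> n; rewrite ler_nat geq_minl.
- by exists 0%N => n _; rewrite pmf_mean // ler_piMr // pmf_sum.
Qed.

(** A cap above the mean [m] only moves the variable towards [m]. *)
Lemma poisson_var_min (K : nat) : m <= K%:R -> Ex P (fun w => ((minn K (e w))%:R - m) ^+ 2) <= m.
Proof.
move=> mK.
have Kd n : ((minn K n)%:R - m) ^+ 2 <= (n%:R - m) ^+ 2.
  case: (leqP K n) => Kn; last by [].
  have : (K%:R : R) <= n%:R by rewrite ler_nat.
  by move=> h; rewrite ler_sqr ?nnegrE ?subr_ge0 //; [rewrite lerD2r|exact: le_trans h].
apply: (@mom_le (fun n => ((minn K n)%:R - m) ^+ 2) (fun n => (n%:R - m) ^+ 2) ((K%:R + m) ^+ 2)).
- by move=> n; rewrite sqr_ge0 Kd.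
- move=> n; have h1 : ((minn K n)%:R : R) <= K%:R by rewrite ler_nat geq_minl.
  have h2 : 0 <= ((minn K n)%:R : R) by [].
  by move: h1 h2; move: (minn K n)%:R K%:R mK m0 => x y h0 h3 h1 h2; rewrite -subr_ge0 (_ : _ - _ = (y + x) * (y + 2 * m - x)); [apply: mulr_ge0; lra|ring].
- exists (Num.Def.truncn m).+1 => n hn; rewrite pmf_var //.
  have mn : m <= n%:R by apply/ltW/lt_le_trans; [exact: truncnS_gt|rewrite ler_nat].
  have h1 : m * \sum_(k < n) p k <= m by rewrite ler_piMr // pmf_sum.
  have h2 : m * (m - n%:R) * p n <= 0.
    by rewrite -mulrA; apply: mulr_ge0_le0 => //; apply: mulr_le0_ge0; [rewrite subr_le0|exact: pmf_ge0].
  by rewrite -[leRHS]addr0; apply: lerD.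
Qed.

End PoissonLLN.

(** * Initial state and arrivals of the capped system *)

Section SystemLLN.
Context d (Om : measurableType d) (R : realType) (P : probability Om R).
Variables (a : nat -> R) (lam G g : R -> R) (H : R) (nw : network R Om) (N : nat).
Hypothesis N0 : (0 < N)%N.
Hypothesis sd : service_dist G g H.
Hypothesis mdl : sq2_model P a lam G nw N.
Variables (K : nat) (T : R).
Hypotheses (K0 : (0 < K)%N) (T0 : 0 <= T).
Let Gbar (x : R) := 1 - G x.
Let I := sysI G nw N K T.
Let M := (K * N + K)%N.
Let rsd (w : Om) i := resid Gbar (age0 nw N w i) (sau (unif0 nw N w i)).
Let vI w : valid (I w). Proof. exact: (validI N0 sd mdl K0 T0). Qed.

Let ltKN m i : (i < N)%N -> (m * N + i < K * N)%N = (m < K)%N.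
Proof.
move=> iN; apply/idP/idP => h; last by nia.
by rewrite ltnNge; apply/negP => h'; move: h; rewrite ltnNge; nia.
Qed.

Let init_srvE w m i : (i < N)%N -> (m < K)%N -> srv (I w) (m * N + i) = if (m < X0 nw N w i)%N then i else N.
Proof.
move=> iN mK; rewrite /I init_srv ?ltKN //= ltKN // mK modnMDl (modn_small iN) divnMDl // (divn_small iN) addn0 //.
Qed.

Let init_lvl w m i : (i < N)%N -> (m < X0 nw N w i)%N -> (m < K)%N -> lvl (I w) (m * N + i) = m.
Proof.
move=> iN mX mK; rewrite /lvl init_srvE // mX -[RHS](cnt_mod m iN); apply: eq_cnt => j jk.
have jN : (j %% N < N)%N by rewrite ltn_mod.
have jm : (j %/ N < K)%N by rewrite ltn_divLR //; nia.
have -> : tau (I w) (m * N + i) < cpl (I w) j.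
  apply: le_lt_trans (tau_cpl (vI w) j); rewrite /I /= ltKN // mK (_ : (j < K * N)%N) //; nia.
rewrite andbT {1}(divn_eq j N) init_srvE //.
case: (eqVneq (j %% N) i)%N => [ji|ji].
  rewrite ji ifT ?eqxx // (leq_ltn_trans _ mX) //.
  by rewrite -ltnS ltn_divLR //; nia.
by case: ifP => _; apply/negbTE => //; rewrite neq_ltn iN orbT.
Qed.

Let init_cpl0 w i : (i < N)%N -> (0 < X0 nw N w i)%N -> [/\ srv (I w) i = i, sta (I w) i = 0 & cpl (I w) i = rsd w i].
Proof.
move=> iN X0i; have e : srv (I w) i = i by have := @init_srvE w 0 i iN K0; rewrite mul0n add0n X0i.
have s0 : sta (I w) i = 0 by apply: (init_sta N0 K0 T0); rewrite // -/I ?e.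
by split => //; rewrite cplE s0 add0r /I /= iN.
Qed.

Let init_res w m i x : (i < N)%N -> (m < X0 nw N w i)%N -> (m < K)%N -> 0 <= x ->
  res (I w) (m * N + i).+1 i 0 (Some x) = (x < rsd w i).
Proof.
move=> iN mX mK x0 /=.
have [e1 e2 e3] := init_cpl0 iN (leq_ltn_trans (leq0n m) mX).
apply/cnt_gt0P/idP => [[j jk /and3P[/eqP ej sj xj]]|h]; last first.
  by exists i; [lia|rewrite e1 e2 e3 eqxx lexx].
have [ji|ij] := eqVneq j i; first by rewrite -e3 -ji.
have [ji|ij'] := ltnP j i.
  have := @init_srvE w 0 j (ltn_trans ji iN) K0; rewrite mul0n add0n ej.
  by case: ifP => _; lia.
have := @cpl_sta _ (I w) i j (ltac:(lia)); rewrite e1 ej e3 => /(_ erefl) h.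
have := resid_gt0 sd (age0 nw N w i) (sau01 (unif0 nw N w i)); rewrite -/(rsd w i); lra.
Qed.

(** At server [i] the job of layer [l] meets the [l] initial jobs of lower layers, so level [l]
    selects at most one job per server, and the job in service is the one of layer [0]. *)
Lemma i0bE w l ox : (if ox is Some x then 0 <= x else true) -> i0b (I w) N K l ox =
  N%:R^-1 * \sum_(i < N) [&& (l < K)%N, (l < X0 nw N w i)%N & (if ox is Some x then x < rsd w i else true)]%:R.
Proof.
move=> ox0; rewrite /i0b mulrC; congr (_ * _); rewrite -natr_sum; congr _%:R.
rewrite /arrY cnt_mul (exchange_cnt K N (fun m i => [&& (srv (I w) (m * N + i) < N)%N, lvl (I w) (m * N + i) == l & res (I w) (m * N + i).+1 (srv (I w) (m * N + i)) (tau (I w) (m * N + i)) ox])).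
apply: eq_bigr => i _; have iN := ltn_ord i.
have pE m : (m < K)%N -> [&& (srv (I w) (m * N + i) < N)%N, lvl (I w) (m * N + i) == l & res (I w) (m * N + i).+1 (srv (I w) (m * N + i)) (tau (I w) (m * N + i)) ox] =
    (m == l) && ((l < X0 nw N w i)%N && (if ox is Some x then x < rsd w i else true)).
  move=> mK; rewrite init_srvE //; case: (ltnP m (X0 nw N w i)) => mX; last first.
    by rewrite ltnn /=; apply/esym/negbTE/negP => /and3P[/eqP ml h _]; lia.
  rewrite iN init_lvl //=; case: eqP => //= <-; rewrite mX /=.
  rewrite ltKN // mK.
  by case: ox ox0 => // x x0; rewrite init_res.
by rewrite (eq_cnt pE) cnt_eq1.
Qed.

Lemma Zbar0E w l x : Zbar0 Gbar nw N w l.+1 x =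
  N%:R^-1 * \sum_(i < N) (l < X0 nw N w i)%N%:R * (Gbar (age0 nw N w i + x) / Gbar (age0 nw N w i)).
Proof.
rewrite /Zbar0 mulrC big_mkcond; congr (_ * _); apply: eq_bigr => i _.
by case: ifP => _; rewrite ?mul1r ?mul0r.
Qed.

Lemma i0b_None w l : (l < K)%N -> i0b (I w) N K l None = Zbar0 Gbar nw N w l.+1 0.
Proof.
move=> lK; rewrite i0bE // Zbar0E; congr (_ * _); apply: eq_bigr => i _.
by rewrite lK andbT addr0 divff ?mulr1 // lt0r_neq0 // (sd_Gpos sd).
Qed.

Let rho w i x := Gbar (age0 nw N w i + x) / Gbar (age0 nw N w i).
Let rho01 w i x : 0 <= x -> 0 <= rho w i x <= 1.
Proof. by move=> x0; exact: (cond_surv01 nw N sd). Qed.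
Let bm_rho L i x : (i < N)%N -> ~ List.In SInit L -> 0 <= x ->
  bm (fun w : g_sigma_algebraType (gen (src_events nw N) L) => rho w i x).
Proof. by move=> iN kL x0; exact: (bm_cond_surv nw sd iN kL x0). Qed.

Lemma Zbar0_01 w l x : 0 <= x -> 0 <= Zbar0 Gbar nw N w l.+1 x <= 1.
Proof.
move=> x0; rewrite Zbar0E.
have n0 : 0 < N%:R :> R by rewrite ltr0n.
have h i : 0 <= (l < X0 nw N w i)%N%:R * rho w i x <= 1.
  by have /andP[h1 h2] := rho01 w i x0; case: (l < _)%N; rewrite ?mul1r ?mul0r ?h1 ?h2 ?lexx ?ler01.
apply/andP; split.
  by rewrite mulr_ge0 ?invr_ge0 // sumr_ge0 // => i _; case/andP: (h i).
rewrite mulrC ler_pdivrMr // mul1r -[leRHS](_ : \sum_(i < N) 1 = _); last by rewrite sumr_const card_ord.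
by apply: ler_sum => i _; case/andP: (h i).
Qed.

Let gen0m := @genm _ _ _ _ _ _ _ _ _ mdl [::].

Lemma bm_Zbar0 l x : 0 <= x -> bm (fun w => Zbar0 Gbar nw N w l.+1 x).
Proof.
move=> x0; split; last by exists 1 => w; have /andP[h1 h2] := Zbar0_01 w l x0; rewrite ger0_norm.
rewrite (_ : (fun w => _) = fun w => N%:R^-1 * \sum_(i < N) (l < X0 nw N w i)%N%:R * rho w i x); last by apply/funext => w; exact: Zbar0E.
apply: measurable_funM; first exact: measurable_cst.
apply: measurable_sum => i; apply: measurable_funM.
  have mX := sub_md gen0m (@md_X0 _ _ _ nw N [::] i (ltn_ord i) (fun x => x)).
  exact: (measurable_md (fun n => (l < n)%N%:R) mX).
by case: (sub_bm gen0m (@bm_rho [::] i x (ltn_ord i) (fun x => x) x0)).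
Qed.

(** Given the initial state, residual times at different servers come from independent uniforms: the
    [xi] are centred and orthogonal, and their average has second moment at most [1 / N]. *)
Lemma i0b_L1 l x (c : R) : (l < K)%N -> 0 <= x -> 0 < c -> N%:R^-1 <= c ^+ 2 ->
  Ex P (fun w => `|i0b (I w) N K l (Some x) - Zbar0 Gbar nw N w l.+1 x|) <= c.
Proof.
move=> lK x0 c0 hc.
pose xi i w : R := (l < X0 nw N w i)%N%:R * ((x < rsd w i)%R%:R - rho w i x).
have bxiL L i : (i < N)%N -> ~ List.In SInit L -> ~ List.In (SU i) L -> bm (xi i : g_sigma_algebraType (gen (src_events nw N) L) -> R).
  move=> iN k1 k2; apply: bmM; first by apply: bm_ind; apply: (md_comp (fun m => (l < m)%N)); exact: md_X0.
  apply: bmB; first by apply: bm_ind; apply: md_ltr; [exact: measurable_cst|exact: (meas_resid sd)].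
  exact: bm_rho.
have bxi i : (i < N)%N -> bm (xi i) by move=> iN; apply: (sub_bm gen0m); apply: bxiL.
have xi1 i w : xi i w ^+ 2 <= 1.
  rewrite /xi; have /andP[h1 h2] := rho01 w i x0; case: (l < _)%N; last by rewrite mul0r expr0n.
  by rewrite mul1r; case: (x < _); rewrite ?mulr1n ?mulr0n; nra.
rewrite (@eq_Ex _ _ _ _ _ (fun w => `|N%:R^-1 * \sum_(i < N) xi i w|)); last first.
  move=> w; rewrite i0bE // Zbar0E -mulrBr -sumrB; congr (`|_ * _|); apply: eq_bigr => i _.
  by rewrite lK /xi mulrBr /= -natrM mulnb.
have bS : bm (fun w => \sum_(i < N) xi i w).
  by apply: bm_sum => i; exact: bxi (ltn_ord i).
have bi (i : 'I_N) := bxi i (ltn_ord i).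
apply: Ex_abs_sqr => //; first by apply: bmM => //; exact: bm_cst.
rewrite (_ : (fun w => _) = fun w => N%:R^-1 ^+ 2 * (\sum_(i < N) xi i w) ^+ 2); last by apply/funext => w; rewrite exprMn.
rewrite ExZ; last exact: bmX.
have n0 : 0 < N%:R :> R by rewrite ltr0n.
apply: le_trans (_ : N%:R^-1 ^+ 2 * N%:R <= _); last by rewrite expr2 -mulrA mulVf ?mulr1 // gt_eqF.
rewrite ler_pM2l ?exprn_gt0 ?invr_gt0 //.
rewrite (@eq_Ex _ _ _ _ _ (fun w => \sum_(i < N) \sum_(k < N) xi i w * xi k w)); last by move=> w; rewrite expr2 big_distrlr.
rewrite Ex_sum => [|i]; last by apply: bm_sum => k; exact: bmM.
rewrite -[leRHS](_ : \sum_(i < N) 1 = _); last by rewrite sumr_const card_ord.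
apply: ler_sum => i _; rewrite Ex_sum => [|k]; last exact: bmM.
rewrite (bigD1 i) //= big1 ?addr0 => [|k ki].
  rewrite -(Ex_cst P 1); apply: Ex_le => [||w]; [exact: bmM|exact: bm_cst|].
  by rewrite -expr2.
have nk : ~ List.In (SU i) [:: srcv N K k].
  by rewrite /srcv ltn_ord => -[|[]] // [] /val_inj; apply/eqP.
have nI : ~ List.In SInit [:: srcv N K k] by rewrite /srcv ltn_ord => -[].
pose c' (w : Om) := xi i w * (l < X0 nw N w k)%N%:R.
have bc : bm (c' : g_sigma_algebraType (Cvg nw N K k) -> R).
  by apply: bmM; [exact: bxiL|apply: bm_ind; apply: (md_comp (fun m => (l < m)%N)); exact: md_X0].
have := resid_freeze sd mdl (ltn_ord k) bc x0.
move/eqP; rewrite -subr_eq0 -ExB; last first.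
- apply: bmM; first exact: (sub_bm (@genm _ _ _ _ _ _ _ _ _ mdl _) bc).
  exact: (sub_bm gen0m (@bm_rho [::] k x (ltn_ord k) (fun x => x) x0)).
- apply: bmM; first exact: (sub_bm (@genm _ _ _ _ _ _ _ _ _ mdl _) bc).
  apply: bm_ind; apply: md_ltr; first exact: measurable_cst.
  by apply: (sub_measurable_fun gen0m); apply: (meas_resid sd).
have dist (p q r s : R) : p * (q * (r - s)) = p * q * r - p * q * s by ring.
by move=> /eqP h; rewrite -[RHS]h; apply: eq_Ex => w; exact: dist.
Qed.

Lemma dAE w (s s' : R) : 0 <= s -> s <= s' -> s' <= T ->
  dA (I w) N K s s' = ((minn K (arr nw N w s'))%:R - (minn K (arr nw N w s))%:R) / N%:R.
Proof.
move=> s0 ss' sT; have s'0 := le_trans s0 ss'.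
have ee : (arr nw N w s <= arr nw N w s')%N by exact: (mdl_emono mdl).
rewrite -natrB ?leq_min ?geq_minl ?(leq_trans (geq_minr _ _)) //; congr (_%:R / _).
have tE (u : R) j : 0 <= u -> u <= T -> (j < K)%N -> (tau (I w) (K * N + j) <= u) = (j < minn K (arr nw N w u))%N.
  move=> u0 uT jK; rewrite /I /= ltnNge leq_addr /= addKn.
  have uu : (arr nw N w u <= arr nw N w T)%N by exact: (mdl_emono mdl).
  case: ifP => h; last by rewrite leNgt (_ : u < T + 1) /=; [apply/esym/negbTE; lia|lra].
  by rewrite (@arrtimeP _ _ (mdl_emono mdl w) (mdl_erc mdl w) _ _ T) //; lia.
rewrite cnt_add cntF ?add0n => [|j jK]; last by rewrite leqNgt jK.
rewrite (eq_cnt (q := fun j => ~~ (j < minn K (arr nw N w s))%N && (j < minn K (arr nw N w s'))%N)); last first.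
  by move=> j jK; rewrite leq_addr /= ltNge !tE // ?(le_trans ss').
have := cnt_split K (fun j => (j < minn K (arr nw N w s'))%N) (fun j => (j < minn K (arr nw N w s))%N).
rewrite cnt_ltn (eq_cnt (q := fun j => (j < minn K (arr nw N w s))%N)) => [|j jK]; last first.
  by apply/andP/idP => [[]|h] //; split => //; lia.
rewrite cnt_ltn (eq_cnt (p := fun j => _ && ~~ _) (q := fun j => ~~ (j < minn K (arr nw N w s))%N && (j < minn K (arr nw N w s'))%N)) => [|j _]; last exact: andbC.
lia.
Qed.

Lemma njobs_le w : njobs (I w) N M <= N%:R^-1 * (\sum_(i < N) (minn K (X0 nw N w i))%:R + (minn K (arr nw N w T))%:R).
Proof.
rewrite /njobs mulrC ler_pM2l ?invr_gt0 ?ltr0n // -natr_sum -natrD ler_nat /M cnt_add; apply: leq_add.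
  rewrite cnt_mul (exchange_cnt K N (fun m i => (srv (I w) (m * N + i) < N)%N)); apply: leq_sum => i _.
  rewrite -cnt_ltn; apply: leq_cnt => m mK; rewrite init_srvE //.
  by case: ifP; rewrite ?ltnn.
rewrite -[leqRHS](minn_idPr (geq_minl K (arr nw N w T))) -cnt_ltn; apply: leq_cnt => j jK.
case: (ltnP j (minn K (arr nw N w T))) => // h.
have [e1 e2] : sa (I w) (K * N + j) = N /\ sb (I w) (K * N + j) = N.
  by rewrite /I /sysI /= ltnNge leq_addr /= addKn h.
by rewrite srvE e1 e2 /rt !ltnn; case: (tb _ _); rewrite ltnn.
Qed.

End SystemLLN.

Lemma nneseries_tails (R : realType) (u : nat -> \bar R) : (forall l, (0 <= u l)%E) ->
  (\sum_(1 <= l <oo) u l < +oo)%E ->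
  exists pl : nat -> R, [/\ forall l, 0 <= pl l, forall l, (0 < l)%N -> u l = (pl l)%:E &
    forall e, 0 < e -> exists L, forall B, \sum_(L <= l < B) pl l.+1 <= e].
Proof.
move=> u0 h; pose pl l := fine (u l).
have ul l : (0 < l)%N -> u l = (pl l)%:E.
  move=> l0; rewrite /pl fineK // ge0_fin_numE //; apply: le_lt_trans h.
  apply: le_trans (nneseries_lim_ge (P := xpredT) l.+1 _) => //=.
  rewrite big_nat_recr //= leeDr // sume_ge0 //.
have p0 l : 0 <= pl l by rewrite fine_ge0.
exists pl; split => // e e0.
pose S n := \sum_(1 <= l < n.+1) pl l.
have Sle n : ((S n)%:E <= \sum_(1 <= l <oo) u l)%E.
  rewrite /S -sumEFin big_nat (eq_bigr u) -?big_nat => [|i /andP[i1 _]]; last by rewrite ul.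
  by apply: nneseries_lim_ge => *; exact: u0.
pose tot := fine (\sum_(1 <= l <oo) u l)%E.
have totE : (\sum_(1 <= l <oo) u l)%E = tot%:E.
  by rewrite /tot fineK // ge0_fin_numE // nneseries_ge0.
have hs : has_sup [set S n | n in setT].
  split; first by exists (S 0%N), 0%N.
  by exists tot => _ [n _ <-]; rewrite -lee_fin -totE.
have [_ [L _ <-] hL] := sup_adherent e0 hs.
exists L => B; have [LB|BL] := leqP L B; last by rewrite big_geq ?ltW // ltnW.
have : S B <= sup [set S n | n in setT] by apply: ub_le_sup; [case: hs|exists B].
rewrite /S [in X in X <= _](big_cat_nat (n := L.+1)) //= -/(S L).
rewrite -[X in _ + X <= _ -> _]/(\sum_(L.+1 <= l < B.+1) pl l) (big_add1 _ _ L B.+1) /=.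
lra.
Qed.

(** * Limits of the initial data and of the arrivals *)

Section SystemLimits.
Context d (Om : measurableType d) (R : realType) (P : probability Om R).
Variables (a : nat -> R) (lam G g : R -> R) (H : R) (nw : network R Om) (Z0 : nat -> R -> R) (T : R).
Let Gbar (x : R) := 1 - G x.
Hypothesis lamP : rate_ok lam.
Hypothesis a0 : forall N, 0 < a N.
Hypothesis a1 : (fun N : nat => a N / N%:R) @ \oo --> (1 : R).
Hypothesis sd : service_dist G g H.
Hypothesis mdl : forall N, (0 < N)%N -> sq2_model P a lam G nw N.
Hypothesis exch : forall N, (0 < N)%N -> exchangeable_init P nw N.
Hypothesis Z0cv : {ae P, forall w, forall (l : nat) (r : R), (1 <= l)%N -> 0 <= r ->
      (fun N : nat => Zbar0 Gbar nw N w l r) @ \oo --> Z0 l r}.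
Variable pl : nat -> R.
Hypothesis pl0 : forall l, 0 <= pl l.
Hypothesis plE : forall N l, (0 < N)%N -> (0 < l)%N -> fine (P [set w | (l <= X0 nw N w 0)%N]) <= pl l.
Hypothesis pltail : forall e, 0 < e -> exists L, forall B, \sum_(L <= l < B) pl l.+1 <= e.
Hypothesis T0 : 0 <= T.
Variable K : nat -> nat.
Hypothesis K0 : forall N, (0 < K N)%N.
Hypothesis KN : forall N, (N <= K N)%N.
Hypothesis Ka : forall N, a N * RI T lam <= (K N)%:R.
Let I N := sysI G nw N (K N) T.
Let M N := (K N * N + K N)%N.
Let Lam s := RI s lam.

Let lam0 u : 0 <= lam u. Proof. by case: lamP. Qed.
Let lamI s : Ioo s lam. Proof. by case: lamP => _; exact. Qed.
Let Lam_mono s t : 0 <= s -> s <= t -> Lam s <= Lam t.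
Proof. by move=> s0 st; apply: RI_mono. Qed.
Let Lam0 s : 0 <= s -> 0 <= Lam s.
Proof. by move=> s0; rewrite -(RI0 lam); exact: Lam_mono. Qed.

Lemma sysI_cores N : (0 < N)%N -> core_spec P N (K N) (I N) Gbar H T (Cvg nw N (K N)) (Csg nw N (K N)).
Proof. by move=> N0; apply: (sysI_core N0 sd (mdl N0) (K0 N) T0). Qed.

Let mX N i : (i < N)%N -> md (fun w => X0 nw N w i).
Proof. by move=> iN; apply: (sub_md (@genm _ _ _ _ _ _ _ _ _ (mdl (leq_ltn_trans (leq0n i) iN)) [::])); exact: md_X0. Qed.

Lemma X0_marginal N i l : (i < N)%N -> Ex P (fun w => (l < X0 nw N w i)%N%:R) <= pl l.+1.
Proof.
move=> iN; have N0 := leq_ltn_trans (leq0n i) iN.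
have mi k (kN : (k < N)%N) : md (fun w => (l < X0 nw N w k)%N) by apply: (md_comp (fun n => (l < n)%N)); exact: mX.
rewrite Ex_ind; last exact: mi.
apply: le_trans (plE N0 (ltn0Sn l)).
(* The transposition of [0] and [i]. Exchangeability concerns the joint law, so the marginals are
   compared through the atoms of the countable law of the whole vector. *)
pose sg k := if k == 0%N then i else if k == i then 0%N else k.
have sgN k : (k < N)%N -> (sg k < N)%N by rewrite /sg; case: (k == 0%N) => //; case: (k == i).
have nthT (s : nat -> nat) w k (kN : (k < N)%N) : nth 0%N [tuple X0 nw N w (s k) | k < N] k = X0 nw N w (s k).
  by have := tnth_nth 0%N [tuple X0 nw N w (s k) | k < N] (Ordinal kN); rewrite tnth_mktuple.
have mt (s : nat -> nat) : (forall k, (k < N)%N -> (s k < N)%N) -> md (fun w => [tuple X0 nw N w (s k) | k < N]).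
  move=> sN v; rewrite (_ : _ @^-1` _ = \bigcap_(k < N) ((fun w => X0 nw N w (s k)) @^-1` [set nth 0%N v k])).
    by apply: fin_bigcap_measurable => // k kN; apply: mX; exact: sN.
  apply/seteqP; split => w /=.
    by move=> <- k kN /=; rewrite nthT.
  move=> h; apply: eq_from_tnth => k; rewrite tnth_mktuple (tnth_nth 0%N); exact: (h k (ltn_ord k)).
have e := exch N0 sgN.
have sgi k k' : (k < N)%N -> (k' < N)%N -> sg k = sg k' -> k = k'.
  move=> _ _; rewrite /sg; case: (altP (k =P 0%N)) => h1; case: (altP (k' =P 0%N)) => h2; case: (altP (k =P i)) => h3; case: (altP (k' =P i)) => h4; move: h1 h2 h3 h4; clear; lia.
have {}e := e sgi.
have ff : forall v, P ((fun w => [tuple X0 nw N w (id k) | k < N]) @^-1` [set v]) = P ((fun w => [tuple X0 nw N w (sg k) | k < N]) @^-1` [set v]).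
  move=> v; have := e (nth 0%N v) (fun=> setT) (fun=> measurableT).
  have tE (s : nat -> nat) : [set w | forall k, (k < N)%N -> X0 nw N w (s k) = nth 0%N v k /\ setT (if (0 < X0 nw N w (s k))%N then age0 nw N w (s k) else 0)] =
      (fun w => [tuple X0 nw N w (s k) | k < N]) @^-1` [set v].
    apply/seteqP; split => w /=.
      by move=> h; apply: eq_from_tnth => k; rewrite tnth_mktuple (tnth_nth 0%N); case: (h k (ltn_ord k)).
    by move=> <- k kN; rewrite nthT.
  by rewrite -(tE id) -(tE sg).
have := prob_md_eq (mt id (fun k kN => kN)) (mt sg sgN) ff [set v : N.-tuple nat | (l < nth 0%N v 0)%N].
rewrite (_ : _ @^-1` _ = [set w | (l.+1 <= X0 nw N w 0)%N]); last first.
  by apply/seteqP; split => w /=; rewrite (nthT id).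
move=> ->; rewrite (_ : [set w | (l < X0 nw N w i)%N] = (fun w => [tuple X0 nw N w (sg k) | k < N]) @^-1` [set v : N.-tuple nat | (l < nth 0%N v 0)%N]) //.
by apply/seteqP; split => w /=; rewrite (nthT sg).
Qed.

Let arr_md N t : (0 < N)%N -> md (fun w => arr nw N w t).
Proof. by move=> N0; apply: (sub_md (@genm _ _ _ _ _ _ _ _ _ (mdl N0) [::])); exact: md_arr. Qed.

Let aL0 N s : 0 <= s -> 0 <= a N * Lam s. Proof. by move=> s0; rewrite mulr_ge0 ?Lam0 // ltW. Qed.

Lemma hI_sys l x : 0 <= x -> LS (fun N => Ex P (fun w => `|i0b (I N w) N (K N) l (Some x) - Z0 l.+1 x|)) 0.
Proof.
move=> x0; have Zl : LS (fun N => Ex P (fun w => `|Zbar0 Gbar nw N w l.+1 x - Z0 l.+1 x|)) 0.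
  pose f N w := if (0 < N)%N then Zbar0 Gbar nw N w l.+1 x else 0.
  apply: (@LS_le _ _ (fun N => Ex P (fun w => `|f N w - Z0 l.+1 x|))).
    by exists 1%N => N N0; rewrite /f N0.
  apply: (@dom_L1 _ _ _ _ f (Z0 l.+1 x) 1) => [N|N w|]; rewrite /f.
  - by case: (ltnP 0 N) => [N0|_]; [case: (bm_Zbar0 N0 sd (mdl N0) l x0)|exact: measurable_cst].
  - case: (ltnP 0 N) => [N0|_]; last by rewrite normr0.
    by have /andP[h1 h2] := Zbar0_01 nw N0 sd w l x0; rewrite ger0_norm.
  apply: filterS Z0cv => w /(_ l.+1 x isT x0); apply: cvg_trans; apply: near_eq_cvg.
  by exists 1%N => // N /= ->.
apply: LS_lim => e e0.
apply: (@LS_le _ _ (fun N => e + Ex P (fun w => `|Zbar0 Gbar nw N w l.+1 x - Z0 l.+1 x|))).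
  exists (maxn l.+1 (Num.Def.truncn (e ^+ 2)^-1).+1) => N; rewrite geq_max => /andP[h1 h2].
  have N0 : (0 < N)%N by lia.
  have bi := bm_i0b (sysI_cores N0) l (Some x); have bz := bm_Zbar0 N0 sd (mdl N0) l x0.
  have hN : N%:R^-1 <= e ^+ 2.
    rewrite -[leRHS]invrK lef_pV2 ?posrE ?ltr0n ?invr_gt0 ?exprn_gt0 //.
    by apply/ltW/lt_le_trans; [exact: truncnS_gt|rewrite ler_nat].
  have lK : (l < K N)%N by apply: leq_trans (KN N).
  apply: le_trans (lerD (i0b_L1 N0 sd (mdl N0) (K0 N) T0 lK x0 e0 hN) (lexx _)).
  apply: le_trans (Ex_tri P _ _); last first.
  - by apply: bmB => //; exact: bm_cst.
  - exact: bmB.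
  by rewrite le_eqVlt; apply/orP; left; apply/eqP/eq_Ex => w; congr `|_|; ring.
by rewrite addrC; apply: LS_add => //; exact: LS_cst.
Qed.

Lemma hI0_sys l : (0 < l)%N -> LS (fun N => Ex P (fun w => `|i0b (I N w) N (K N) l None - Z0 l.+1 0|)) 0.
Proof.
move=> _; apply: (@LS_le _ _ (fun N => Ex P (fun w => `|(if (0 < N)%N then Zbar0 Gbar nw N w l.+1 0 else 0) - Z0 l.+1 0|))).
  exists l.+1 => N lN; have N0 : (0 < N)%N by lia.
  rewrite N0 le_eqVlt; apply/orP; left; apply/eqP/eq_Ex => w.
  by rewrite (i0b_None N0 sd (mdl N0) (K0 N) T0) //; apply: leq_trans (KN N).
apply: (@dom_L1 _ _ _ _ (fun N w => if (0 < N)%N then Zbar0 Gbar nw N w l.+1 0 else 0) (Z0 l.+1 0) 1) => [N|N w|].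
- by case: (ltnP 0 N) => [N0|_]; [case: (bm_Zbar0 N0 sd (mdl N0) l (lexx 0))|exact: measurable_cst].
- case: (ltnP 0 N) => [N0|_]; last by rewrite normr0.
  by have /andP[h1 h2] := Zbar0_01 nw N0 sd w l (lexx 0); rewrite ger0_norm.
apply: filterS Z0cv => w /(_ l.+1 0 isT (lexx 0)); apply: cvg_trans; apply: near_eq_cvg.
by exists 1%N => // N /= ->.
Qed.

Let aN1 : LS (fun N => `|a N / N%:R - 1|) 0.
Proof.
move=> e e0; move/cvgrPdist_lt: a1 => /(_ e e0)[N0 _ h].
by exists N0 => N /h; rewrite add0r distrC => /ltW.
Qed.

Let abound : exists2 A, 0 <= A & forall N, a N / N%:R <= A.
Proof.
have /cvg_seq_bounded [A [Ar hA]] := cvgP _ a1.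
exists (`|A| + 1) => [|N]; first by have := normr_ge0 A; lra.
apply: le_trans (ler_norm _) _; apply: hA => //; have := ler_norm A; lra.
Qed.

(** Chebyshev: the second moment of the capped count around [m] is at most [m], which is of order
    [N], the cap lying above [m] by [Ka]. *)
Let arrL s : 0 <= s -> s <= T -> LS (fun N => Ex P (fun w => `|(minn (K N) (arr nw N w s))%:R / N%:R - Lam s|)) 0.
Proof.
move=> s0 sT; have [A A0 hA] := abound.
apply: LS_lim => e e0.
have e2 : 0 < e ^+ 2 by rewrite exprn_gt0.
apply: (@LS_le _ _ (fun N => e + Lam s * `|a N / N%:R - 1|)).
  exists (Num.Def.truncn (A * Lam s / e ^+ 2)).+1 => N hN; have N0 : (0 < N)%N by lia.
  have n0 : 0 < N%:R :> R by rewrite ltr0n.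
  pose m := a N * Lam s; have m0 : 0 <= m := aL0 N s0.
  have mK : m <= (K N)%:R by apply: le_trans (Ka N); rewrite ler_pM2l // Lam_mono.
  have law n := mdl_poisson (mdl N0) n s0.
  have mn : md (fun w => minn (K N) (arr nw N w s)) by exact: (md_comp (minn (K N)) (arr_md s N0)).
  have bf : bm (fun w => (minn (K N) (arr nw N w s))%:R - m).
    apply: bmB; last exact: bm_cst.
    split; first exact: (measurable_md (fun n => n%:R) mn).
    by exists (K N)%:R => w; rewrite ger0_norm // ler_nat geq_minl.
  have eN : 0 < e * N%:R by rewrite mulr_gt0.
  have h1 : Ex P (fun w => `|(minn (K N) (arr nw N w s))%:R - m|) <= e * N%:R.
    apply: Ex_abs_sqr => //; apply: le_trans (poisson_var_min m0 (arr_md s N0) law mK) _.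
    have h2 : A * Lam s <= e ^+ 2 * N%:R.
      rewrite [leRHS]mulrC -ler_pdivrMr //; apply/ltW/lt_le_trans; first exact: truncnS_gt.
      by rewrite ler_nat.
    have h3 : a N <= A * N%:R by rewrite -ler_pdivrMr.
    have h4 : m <= A * Lam s * N%:R.
      by apply: le_trans (ler_wpM2r (Lam0 s0) h3) _; rewrite mulrAC.
    apply: le_trans h4 _; rewrite exprMn [N%:R ^+ 2]expr2 mulrA; exact: ler_wpM2r.
  apply: le_trans (_ : Ex P (fun w => N%:R^-1 * `|(minn (K N) (arr nw N w s))%:R - m| + Lam s * `|a N / N%:R - 1|) <= _).
    apply: Ex_le => [||w].
    - apply: bm_abs; apply: bmB; last exact: bm_cst.
      split; first exact: (measurable_md (fun n => n%:R / N%:R) mn).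
      exists ((K N)%:R / N%:R) => w; rewrite ger0_norm ?divr_ge0 //.
      by rewrite ler_pM2r ?invr_gt0 // ler_nat geq_minl.
    - by apply: bmD; [apply: bmM; [exact: bm_cst|exact: bm_abs]|exact: bm_cst].
    rewrite -[X in X * `|_ - m|]gtr0_norm ?invr_gt0 // -[X in X * `|_ - 1|](ger0_norm (Lam0 s0)) -!normrM.
    apply: le_trans (ler_normD _ _); rewrite le_eqVlt; apply/orP; left; apply/eqP; congr `|_|.
    by rewrite /m; field; rewrite gt_eqF.
  rewrite ExD; [|by apply: bmM; [exact: bm_cst|exact: bm_abs]|exact: bm_cst].
  rewrite Ex_cst lerD2r ExZ; last exact: bm_abs.
  by rewrite mulrC ler_pdivrMr.
have := LS_add (LS_cst (lexx e)) (LS_scale (Lam0 s0) aN1); rewrite mulr0 addr0 add0r; exact.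
Qed.

Lemma hA_sys s s' : 0 <= s -> s <= s' -> s' <= T ->
  LS (fun N => Ex P (fun w => `|dA (I N w) N (K N) s s' - (Lam s' - Lam s)|)) 0.
Proof.
move=> s0 ss' sT; have s'0 := le_trans s0 ss'.
rewrite -[X in LS _ X]addr0.
apply: LS_le (LS_add (arrL s'0 sT) (arrL s0 (le_trans ss' sT))).
exists 1%N => N N0.
have bf u : bm (fun w => (minn (K N) (arr nw N w u))%:R / N%:R - Lam u).
  apply: bmB; last exact: bm_cst.
  have mn : md (fun w => minn (K N) (arr nw N w u)) by exact: (md_comp (minn (K N)) (arr_md u N0)).
  split; first exact: (measurable_md (fun n => n%:R / N%:R) mn).
  exists ((K N)%:R / N%:R) => w; rewrite ger0_norm ?divr_ge0 //.
  by rewrite ler_pM2r ?invr_gt0 ?ltr0n // ler_nat geq_minl.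
rewrite -ExD; try exact: bm_abs.
apply: Ex_le => [||w]; [by apply: bm_abs; apply: bmB; [exact: (bm_dA (sysI_cores N0))|exact: bm_cst]|by apply: bmD; exact: bm_abs|].
rewrite (dAE N0 (mdl N0) (K0 N) T0) //.
rewrite (_ : _ - (Lam s' - Lam s) = ((minn (K N) (arr nw N w s'))%:R / N%:R - Lam s') - ((minn (K N) (arr nw N w s))%:R / N%:R - Lam s)); first exact: ler_normB.
ring.
Qed.

Let minE k n : ((minn k n)%:R : R) = \sum_(l < k) (l < n)%N%:R.
Proof. by rewrite -cnt_ltn /cnt natr_sum. Qed.

Lemma hJ_sys : exists2 C, 0 <= C & forall N, (0 < N)%N -> Ex P (fun w => njobs (I N w) N (M N)) <= C.
Proof.
have [A A0 hA] := abound.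
have [L hL] := pltail ltr01.
(* The tail beyond [L] is at most [1], so the mean initial number of jobs per server is bounded
   uniformly in the cap. *)
pose S := \sum_(0 <= l < L) pl l.+1 + 1.
have S0 : 0 <= S by rewrite addr_ge0 // sumr_ge0.
exists (S + A * Lam T) => [|N N0]; first by rewrite addr_ge0 // mulr_ge0 // Lam0.
have n0 : 0 < N%:R :> R by rewrite ltr0n.
have mn : md (fun w => minn (K N) (arr nw N w T)) by exact: (md_comp (minn (K N)) (arr_md T N0)).
have bA : bm (fun w => (minn (K N) (arr nw N w T))%:R : R).
  split; first exact: (measurable_md (fun n => n%:R) mn).
  by exists (K N)%:R => w; rewrite ger0_norm // ler_nat geq_minl.
have bl (i : 'I_N) (l : nat) : bm (fun w => (l < X0 nw N w i)%N%:R : R).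
  by apply: bm_ind; apply: (md_comp (fun n => (l < n)%N)); exact: mX.
have bX (i : 'I_N) : bm (fun w => (minn (K N) (X0 nw N w i))%:R : R).
  rewrite (_ : (fun w => _) = fun w => \sum_(l < K N) (l < X0 nw N w i)%N%:R); last by apply/funext => w; exact: minE.
  by apply: bm_sum => l.
apply: le_trans (_ : Ex P (fun w => N%:R^-1 * (\sum_(i < N) (minn (K N) (X0 nw N w i))%:R + (minn (K N) (arr nw N w T))%:R)) <= _).
  apply: Ex_le => [||w]; [exact: (bm_njobs (sysI_cores N0))|by apply: bmM; [exact: bm_cst|apply: bmD => //; exact: bm_sum]|].
  exact: (njobs_le G nw N0 (K0 N) T0).
rewrite ExZ; last by apply: bmD => //; exact: bm_sum.
rewrite ExD //; last exact: bm_sum.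
rewrite mulrDr; apply: lerD.
  rewrite mulrC ler_pdivrMr // Ex_sum //.
  rewrite [leRHS](_ : _ = \sum_(i < N) S); last by rewrite sumr_const card_ord mulr_natr.
  apply: ler_sum => i _; rewrite (eq_Ex P (fun w => minE (K N) (X0 nw N w i))) Ex_sum //.
  apply: le_trans (_ : \sum_(l < K N) pl l.+1 <= _); first by apply: ler_sum => l _; exact: X0_marginal.
  rewrite -(big_mkord xpredT (fun l => pl l.+1)) /S.
  have [LK|KL] := leqP L (K N); first by rewrite (big_cat_nat (n := L)) //= lerD2l.
  rewrite [X in _ <= X + _](big_cat_nat (n := K N)) //=; last exact: ltnW.
  by rewrite -addrA lerDl addr_ge0 // sumr_ge0.
rewrite mulrC ler_pdivrMr //; apply: le_trans (poisson_mean_min (aL0 N T0) (arr_md T N0) (fun n => mdl_poisson (mdl N0) n T0) (K N)) _.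
rewrite mulrAC; apply: ler_wpM2r; first exact: Lam0.
by rewrite -ler_pdivrMr.
Qed.

End SystemLimits.

(** * The waiting time *)

Section Link.
Variable R : realType.
Implicit Types (q : seq (job R)) (cs : seq R) (J : inp R).

Fixpoint flowr (d : R) (rs : seq R) : seq R :=
  if rs is r :: rest then (if d < r then (r - d) :: rest else flowr (d - r) rest) else [::].

Definition resq q : seq R := [seq j.1 - j.2 | j <- q].
Definition fresh_tail q := all (fun j => j.2 == 0) (behead q).
Definition gaps (s : R) cs : seq R := pairmap (fun x y => y - x) s cs.

Lemma flow_resq d q : resq (flow d q) = flowr d (resq q).
Proof.
by elim: q d => [//|[v e] q IH] d /=; case: ifP => _ /=; [rewrite opprD addrA|exact: IH].
Qed.

Lemma fresh_flow d q : fresh_tail q -> fresh_tail (flow d q).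
Proof.
elim: q d => [//|[v e] q IH] d /=; rewrite /fresh_tail /= => h; case: ifP => _ //=.
by apply: IH; case: q h => //= a q /andP[].
Qed.

Lemma fresh_rcons q v : fresh_tail q -> fresh_tail (rcons q (v, 0)).
Proof. by case: q => //= a q; rewrite /fresh_tail /= all_rcons /= eqxx. Qed.

Lemma resq_rcons q v : resq (rcons q (v, 0)) = rcons (resq q) v.
Proof. by rewrite /resq map_rcons /= subr0. Qed.

Lemma gaps_rcons s cs c : gaps s (rcons cs c) = rcons (gaps s cs) (c - last s cs).
Proof. by elim: cs s => [//|b cs IH] s /=; rewrite /gaps /= -/(gaps _ _) IH. Qed.

Lemma size_gaps s cs : size (gaps s cs) = size cs. Proof. exact: size_pairmap. Qed.

Lemma sum_gaps s cs : \sum_(r <- gaps s cs) r = last s cs - s.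
Proof.
elim: cs s => [|c cs IH] s; first by rewrite big_nil subrr.
by rewrite /gaps /= big_cons -/(gaps _ _) IH addrC subrKA.
Qed.

Lemma workload_resq q : fresh_tail q -> workload q = \sum_(r <- resq q) r.
Proof.
case: q => [|[v e] q] /=; first by rewrite big_nil.
rewrite /fresh_tail /= big_cons big_map => h; congr (_ + _).
elim: q h => [|a q IH] /=; first by rewrite !big_nil.
by move=> /andP[/eqP a0 h]; rewrite !big_cons a0 subr0 IH.
Qed.

(** Described by completion times, a queue evolves trivially: completed jobs are dropped, and
    residual times are the gaps between successive completions. This links [flow] to the job
    recursion. *)
Lemma flow_gaps s d cs : path <%R s cs -> flowr d (gaps s cs) = gaps (s + d) [seq c <- cs | s + d < c].
Proof.
elim: cs s d => [//|c cs IH] s d /= /andP[sc pc]; rewrite /gaps /= -/(gaps _ _) ltrBrDl addrC.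
case: ifP => h.
  rewrite /= -/(gaps _ _); congr (_ :: _); first lra.
  congr (gaps c _); apply/esym/all_filterP; apply: sub_all (order_path_min lt_trans pc) => y /= cy; exact: lt_trans h cy.
by rewrite IH // (_ : c + _ = d + s) //; lra.
Qed.

Definition pend J m i s := [seq cpl J n | n <- iota 0 m & (srv J n == i) && (s < cpl J n)].

Lemma size_pend J m i s : size (pend J m i s) = X J m i s.
Proof.
rewrite size_map size_filter -sum1_count big_mkcond /X /cnt -[m in iota 0 m]subn0 -/(index_iota 0 m) big_mkord.
by apply: eq_bigr => j _; case: ifP.
Qed.

Lemma pendS J m i s : pend J m.+1 i s =
  if (srv J m == i) && (s < cpl J m) then rcons (pend J m i s) (cpl J m) else pend J m i s.
Proof.
rewrite /pend -addn1 iotaD add0n filter_cat map_cat /=; case: ifP => _ /=; last by rewrite cats0.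
by rewrite cats1.
Qed.

Lemma pend_filter J m i s s' : s <= s' -> [seq c <- pend J m i s | s' < c] = pend J m i s'.
Proof.
move=> ss'; rewrite /pend filter_map -filter_predI; congr (map _ _); apply: eq_filter => n /=.
case: (srv J n == i); rewrite ?andbF //= andbC; case h: (s' < cpl J n); last by rewrite andbF.
by rewrite (le_lt_trans ss' h).
Qed.

Lemma mem_pend J m i s c :
  reflect (exists n, [/\ (n < m)%N, srv J n = i, s < cpl J n & c = cpl J n]) (c \in pend J m i s).
Proof.
apply: (iffP mapP) => [[n]|[n [nm e h ->]]].
  by rewrite mem_filter mem_iota add0n => /andP[/andP[/eqP e h] nm] ->; exists n.
by exists n => //; rewrite mem_filter mem_iota add0n e eqxx h.
Qed.

Section Valid.
Variable J : inp R.
Hypothesis vJ : valid J.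

Lemma pend_path m i s : path <%R s (pend J m i s).
Proof.
elim: m => [//|m IH]; rewrite pendS; case: ifP => // /andP[/eqP e h].
rewrite rcons_path IH /=; have := mem_last s (pend J m i s); rewrite inE => /orP[/eqP -> //|].
by move=> /mem_pend [n [nm en _ ->]]; apply: (cpl_cpl vJ nm); rewrite en.
Qed.

Lemma sta_last k : sta J k = last (tau J k) (pend J k (srv J k) (tau J k)).
Proof.
set p := pend _ _ _ _; have ts := tau_sta J k.
have h1 : last (tau J k) p <= sta J k.
  have := mem_last (tau J k) p; rewrite inE => /orP[/eqP -> //|].
  by move=> /mem_pend [n [nm en _ ->]]; exact: cpl_sta.
apply/le_anti; rewrite h1 andbT.
have tl : tau J k <= last (tau J k) p.
  have := mem_last (tau J k) p; rewrite inE => /orP[/eqP -> //|].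
  by move=> /mem_pend [n [_ _ /ltW h ->]].
case: (sta_cases J k) => [-> //|[j [jk ej ->]]].
have [cj|cj] := leP (cpl J j) (tau J k); first exact: le_trans tl.
have : cpl J j \in p by apply/mem_pend; exists j.
have := pend_path k (srv J k) (tau J k); rewrite -/p; clear h1 tl; clearbody p.
elim: p (tau J k) => // c p IH s /= /andP[_ pp]; rewrite inE => /orP[/eqP ->|cp].
  have := mem_last c p; rewrite inE => /orP[/eqP lc|lp]; first by rewrite lc.
  by apply: ltW; move/allP: (order_path_min lt_trans pp); apply.
exact: IH pp cp.
Qed.

(* An arriving job extends the residual times of its queue by its own service time. *)
Lemma gaps_arrival k i : gaps (tau J k) (pend J k.+1 i (tau J k)) =
  if srv J k == i then rcons (gaps (tau J k) (pend J k i (tau J k))) (sv J k)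
  else gaps (tau J k) (pend J k i (tau J k)).
Proof.
rewrite pendS tau_cpl // andbT; case: eqP => // <-.
by rewrite gaps_rcons -sta_last cplE addrC addKr.
Qed.

Lemma gaps_init m i : (forall n, (n < m)%N -> tau J n = 0) ->
  gaps 0 (pend J m i 0) = [seq sv J n | n <- iota 0 m & srv J n == i].
Proof.
elim: m => // m IH t0; have := gaps_arrival m i; rewrite t0 // => ->.
rewrite IH => [|n nm]; last by apply: t0; exact: leqW.
by rewrite -[m.+1]addn1 iotaD add0n filter_cat map_cat /=; case: ifP => _ /=; rewrite ?cats1 ?cats0.
Qed.

(** Splits the workload into one term per job, the part of its service after [s], so that
    expectations can be taken job by job. *)
Lemma last_pend_sum m i s : (forall k, (k < m)%N -> tau J k <= s) ->
  last s (pend J m i s) - s =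
  \sum_(n < m) ((srv J n == i) && (s < cpl J n))%:R * (cpl J n - Num.max (sta J n) s).
Proof.
elim: m => [|m IH] ts; first by rewrite big_ord0 subrr.
rewrite big_ord_recr /= -IH => [|k km]; last by apply: ts; exact: leqW.
rewrite pendS; case: ifP => [/andP[/eqP e h]|_] /=; last by rewrite mul0r addr0.
rewrite last_rcons mul1r.
suff -> : last s (pend J m i s) = Num.max (sta J m) s by lra.
have tm := ts m (ltnSn m); rewrite sta_last e.
rewrite -(pend_filter J m i tm).
have := pend_path m i (tau J m).
move: (pend J m i (tau J m)) => p; elim: p (tau J m) tm => [|c p IHp] u us /=.
  move=> _; rewrite max_r //.
move=> /andP[uc pp]; case: (ltP s c) => sc /=; last exact: IHp.
rewrite (_ : seq.filter _ p = p); last first.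
  by apply/all_filterP; apply: sub_all (order_path_min lt_trans pp) => y /=; exact: lt_trans.
rewrite max_l //; have := mem_last c p; rewrite inE => /orP[/eqP -> |lp]; first exact: ltW.
by apply/ltW/(lt_trans sc); move/allP: (order_path_min lt_trans pp); apply.
Qed.

End Valid.

End Link.

(** * The network as described by [qstate] and the capped system agree *)

Section VWaitLink.
Context d (Om : measurableType d) (R : realType) (P : probability Om R).
Variables (a : nat -> R) (lam G g : R -> R) (H : R) (nw : network R Om) (N : nat).
Hypothesis N0 : (0 < N)%N.
Hypothesis sd : service_dist G g H.
Hypothesis mdl : sq2_model P a lam G nw N.
Variables (K : nat) (T : R).
Hypotheses (K0 : (0 < K)%N) (T0 : 0 <= T).
Let Gbar (x : R) := 1 - G x.
Let I := sysI G nw N K T.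
Let M := (K * N + K)%N.
Let vI w : valid (I w). Proof. exact: (validI N0 sd mdl K0 T0). Qed.

(** The event that the cap removes no job up to the horizon. *)
Definition undercap (w : Om) := (arr nw N w T <= K)%N && [forall i : 'I_N, (X0 nw N w i <= K)%N].

(** The almost sure conditions under which [sane], [sau] and the reset of samples out of range
    change nothing. *)
Definition regular (w : Om) := [/\ forall i k, (i < N)%N -> 0 < wait0 nw N w i k, forall j, 0 < serv nw N j w,
  forall j, (smp1 nw N j w < N)%N /\ (smp2 nw N j w < N)%N, forall i, (i < N)%N -> 0 < unif0 nw N w i < 1 &
  (fsmp1 nw N w < N)%N /\ (fsmp2 nw N w < N)%N].

Lemma tau_arr w j : (j < minn K (arr nw N w T))%N -> tau (I w) (K * N + j) = arrtime (arr nw N w) j.+1.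
Proof. by move=> h; rewrite /= ltnNge leq_addr /= addKn h. Qed.

Lemma late_srv w j : (minn K (arr nw N w T) <= j)%N -> srv (I w) (K * N + j) = N.
Proof. by move=> h; rewrite srvE /= ltnNge leq_addr /= addKn h /rt ltnn; case: ifP. Qed.

Section Regular.
Variable w : Om.
Hypotheses (reg : regular w) (uc : undercap w).
Let e := arr nw N w.
Let eT : (e T <= K)%N. Proof. by case/andP: uc. Qed.
Let X0K i : (i < N)%N -> (X0 nw N w i <= K)%N.
Proof. by move=> iN; case/andP: uc => _ /forallP /(_ (Ordinal iN)). Qed.
Let q0 := queue0 Gbar (X0 nw N w) (age0 nw N w) (unif0 nw N w) (wait0 nw N w).
Let qk := qafter q0 e (fun j => serv nw N j w) (fun j => smp1 nw N j w) (fun j => smp2 nw N j w) (fun j => tie nw N j w).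

Let init_filter i k : (i < N)%N -> (k <= K)%N ->
  [seq n <- iota 0 (k * N) | srv (I w) n == i] = [seq (m * N + i)%N | m <- iota 0 (minn k (X0 nw N w i))].
Proof.
move=> iN; elim: k => [|k IH] kK; first by rewrite min0n.
rewrite mulSn addnC iotaD add0n filter_cat IH ?(ltnW kK) //.
have sE r : (r < N)%N -> srv (I w) (k * N + r) = if (k < X0 nw N w r)%N then r else N.
  move=> rN; have h : (k * N + r < K * N)%N by nia.
  by rewrite /I init_srv //= h modnMDl (modn_small rN) divnMDl // (divn_small rN) addn0.
have -> : [seq n <- iota (k * N) N | srv (I w) n == i] = if (k < X0 nw N w i)%N then [:: (k * N + i)%N] else [::].
  rewrite (_ : iota (k * N) N = [seq (k * N + r)%N | r <- iota 0 N]); last by rewrite -iotaDl addn0.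
  rewrite filter_map.
  rewrite (eq_in_filter (a2 := fun r => (r == i) && (k < X0 nw N w i)%N)) => [|r]; last first.
    rewrite mem_iota add0n /= => rN; rewrite sE //; case: (r =P i) => [->|ri].
      by case: ifP => _ /=; [rewrite eqxx|apply/negbTE; rewrite neq_ltn iN orbT].
    by case: ifP => _; apply/negbTE => //=; [apply/eqP|rewrite neq_ltn iN orbT].
  case: ifP => _.
    rewrite (eq_filter (a2 := pred1 i)) => [|r]; last by rewrite /= andbT.
    by rewrite filter_pred1_uniq ?iota_uniq // mem_iota add0n.
  by rewrite (eq_filter (a2 := pred0)) ?filter_pred0 // => r; rewrite /= andbF.
case: ltnP => kX; last first.
  by rewrite cats0; congr (map _ (iota 0 _)); lia.
by rewrite (minn_idPl kX) -[in RHS]addn1 iotaD map_cat.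
Qed.

Let init_resq i : (i < N)%N -> resq (q0 i) = gaps 0 (pend (I w) (K * N) i 0) /\ fresh_tail (q0 i).
Proof.
move=> iN; have [w0 _ _ u0 _] := reg; split; last first.
  rewrite /q0 /queue0 /fresh_tail; case: (X0 nw N w i) => //= n.
  by rewrite all_map; apply/allP => k _ /=.
rewrite gaps_init // => [|n nK]; last by rewrite /= nK.
rewrite init_filter // (minn_idPr (X0K iN)) -map_comp /q0 /queue0.
have := X0K iN; case: (X0 nw N w i) => // n nK /=; rewrite mul0n add0n iN addrC addKr; congr (_ :: _).
  by rewrite /sau u0.
rewrite (_ : iota 1 n = [seq (1 + r)%N | r <- iota 0 n]); last by rewrite -iotaDl.
rewrite /resq -!map_comp; apply/eq_in_map => m.
rewrite mem_iota add0n => mn /=.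
rewrite mulnDl mul1n -addnA.
have h2 : (N + (m * N + i) < N)%N = false by apply/negbTE; rewrite -leqNgt leq_addr.
have h3 : (N + (m * N + i) < K * N)%N by nia.
rewrite h2 h3 modnDl modnMDl (modn_small iN) divnDl // divnn N0 divnMDl // (divn_small iN) addn0 add1n /= subr0.
by rewrite /sane w0.
Qed.

Let arrtime0 : arrtime e 0 = 0.
Proof.
apply/le_anti; rewrite (@arrtime_ge0 _ e 0 T) // andbT.
by apply: arrtime_le.
Qed.

(** Induction over arrivals: [flow_gaps] between two of them, [gaps_arrival] at each, and equal
    queue lengths make [route] and [srv] choose the same server. *)
Lemma qafter_link j : (j <= e T)%N -> forall i, (i < N)%N ->
  resq (qk j i) = gaps (arrtime e j) (pend (I w) (K * N + j) i (arrtime e j)) /\ fresh_tail (qk j i).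
Proof.
have [_ v0 sN _ _] := reg.
elim: j => [|j IH] jT i iN; first by rewrite addn0 arrtime0; exact: init_resq.
set s := arrtime e j; set s' := arrtime e j.+1.
have ss' : s <= s' by apply: (@arrtime_mono _ _ (mdl_emono mdl w) (mdl_erc mdl w) _ _ T).
pose q (i : nat) := flow (s' - s) (qk j i).
have hq k : (k < N)%N -> resq (q k) = gaps s' (pend (I w) (K * N + j) k s') /\ fresh_tail (q k).
  move=> kN; have [h1 h2] := IH (ltnW jT) k kN; split; last exact: fresh_flow.
  by rewrite flow_resq h1 flow_gaps ?pend_path // subrKC pend_filter.
have tE : tau (I w) (K * N + j) = s' by apply: tau_arr; rewrite leq_min jT (leq_trans jT eT).
have sz k : (k < N)%N -> size (q k) = X (I w) (K * N + j) k s'.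
  by move=> kN; rewrite -size_pend -(size_gaps s') -(hq k kN).1 size_map.
have [s1N s2N] := sN j.
have sE : route q (smp1 nw N j w) (smp2 nw N j w) (tie nw N j w) = srv (I w) (K * N + j).
  have nl : (minn K (arr nw N w T) <= j)%N = false by apply/negbTE; rewrite -ltnNge leq_min jT (leq_trans jT eT).
  rewrite srvE tE /= ltnNge leq_addr /= addKn s1N s2N nl.
  by rewrite /route /rt !sz.
rewrite /qk [qafter _ _ _ _ _ _ _]/= -/qk -[X in push X]/q -/s -/s' /push sE.
have [h1 h2] := hq i iN.
rewrite addnS -tE gaps_arrival // eq_sym tE; case: ifP => [_|_]; last by [].
split; last exact: fresh_rcons.
rewrite resq_rcons h1; congr rcons.
have h : (K * N + j < N)%N = false by apply/negbTE; rewrite -leqNgt; nia.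
by rewrite /= h ltnNge leq_addr /= addKn /sane v0.
Qed.

Definition vsrv (w : Om) := rt (fun i => X (I w) (arrd (I w) M T) i T) (fsmp1 nw N w) (fsmp2 nw N w) (ftie nw N w).

Let arrdE : arrd (I w) M T = (K * N + e T)%N.
Proof.
have vd j : (j < M)%N -> (j < arrd (I w) M T)%N = (tau (I w) j <= T) by exact: arrd_val.
apply/eqP; rewrite eqn_leq; apply/andP; split.
  have [eK|Ke] := ltnP (e T) K; last by apply: leq_trans (arrd_le _ _ _) _; rewrite /M leq_add2l.
  rewrite leqNgt vd; last by rewrite /M ltn_add2l.
  rewrite /= ltnNge leq_addr /= addKn ifF; first by rewrite -ltNge ltrDl.
  by apply/negbTE; rewrite -leqNgt geq_min leqnn orbT.
case: (posnP (K * N + e T)) => [->//|k0].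
suff : ((K * N + e T).-1 < arrd (I w) M T)%N by lia.
rewrite vd; last by rewrite /M; have := eT; lia.
have [e0|e0] := posnP (e T).
  by rewrite /= e0 addn0 ifT //; move: k0; rewrite e0 addn0; lia.
have -> : (K * N + e T).-1 = (K * N + (e T).-1)%N by lia.
rewrite tau_arr; last by rewrite leq_min; apply/andP; split; have := eT; rewrite -/e; lia.
by rewrite prednK //; apply: arrtime_le.
Qed.

Lemma vwait_link : vwait Gbar nw N w T = last T (pend (I w) (arrd (I w) M T) (vsrv w) T) - T.
Proof.
have [_ _ _ _ [f1 f2]] := reg.
pose q i := qstate Gbar nw N w T i.
have at0 := arrtime_le T0 (leqnn (e T)).
have hq i : (i < N)%N -> resq (q i) = gaps T (pend (I w) (arrd (I w) M T) i T) /\ fresh_tail (q i).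
  move=> iN; have [h1 h2] := qafter_link (leqnn (e T)) iN; split; last exact: fresh_flow.
  by rewrite /q /qstate flow_resq h1 flow_gaps ?pend_path // subrKC pend_filter // arrdE.
have sz i : (i < N)%N -> size (q i) = X (I w) (arrd (I w) M T) i T.
  by move=> iN; rewrite -size_pend -(size_gaps T) -(hq i iN).1 size_map.
have rE : route (qstate Gbar nw N w T) (fsmp1 nw N w) (fsmp2 nw N w) (ftie nw N w) = vsrv w.
  by rewrite /route /vsrv /rt !sz.
rewrite /vwait rE.
have vN : (vsrv w < N)%N by rewrite /vsrv /rt; do 3 case: ifP => _ //.
by have [h1 h2] := hq _ vN; rewrite workload_resq // h1 sum_gaps.
Qed.

End Regular.

End VWaitLink.

Section NullSets.
Import HBNNSimple.
Context d (T : measurableType d) (R : realType) (mu : {measure set T -> \bar R}).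
Local Open Scope ereal_scope.

Let ge0_integral_off_null_le (f g : T -> \bar R) (A : set T) : measurable A -> mu A = 0 ->
  (forall x, 0 <= f x) -> (forall x, 0 <= g x) -> (forall x, ~ A x -> f x = g x) ->
  \int[mu]_x f x <= \int[mu]_x g x.
Proof.
move=> mA A0 f0 g0 fg; rewrite !ge0_integralTE //; apply: ge_ereal_sup => _ [h hf <-].
pose h' := mul_nnsfun h (indic_nnsfun R (measurableC mA)).
have -> : sintegral mu h = sintegral mu h'.
  rewrite -!integralT_nnsfun; apply: ae_eq_integral => //.
  - by apply/measurable_EFinP; exact: measurable_funP.
  - by apply/measurable_EFinP; exact: measurable_funP.
  exists A; split => // x /= hx; apply: contrapT => Ax; apply: hx => _.
  by rewrite mindicE mem_set // mulr1.
apply: ereal_sup_ubound; exists h' => // x /=; rewrite mindicE.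
by case: (boolP (x \in ~` A)) => [/set_mem Ax|_]; rewrite ?mulr1 ?mulr0 //; rewrite -fg.
Qed.

Let ge0_integral_off_null (f g : T -> \bar R) (A : set T) : measurable A -> mu A = 0 ->
  (forall x, 0 <= f x) -> (forall x, 0 <= g x) -> (forall x, ~ A x -> f x = g x) ->
  \int[mu]_x f x = \int[mu]_x g x.
Proof.
move=> mA A0 f0 g0 fg; apply/eqP; rewrite eq_le.
by rewrite (ge0_integral_off_null_le mA) // (ge0_integral_off_null_le mA) // => x /fg.
Qed.

(** No measurability of [f] and [g] is asked for: [vwait] is only known to agree with a measurable
    function off a null set. A simple function below one of them is cut off on that set, which does
    not change its integral. *)
Lemma integral_off_null (f g : T -> \bar R) (A : set T) : measurable A -> mu A = 0 ->
  (forall x, ~ A x -> f x = g x) -> \int[mu]_x f x = \int[mu]_x g x.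
Proof.
move=> mA A0 fg; rewrite integralE [RHS]integralE; congr (_ - _); apply: (ge0_integral_off_null mA) => // x /fg.
  by rewrite !funeposE => ->.
by rewrite !funenegE => ->.
Qed.

End NullSets.

Section Truncation.
Context d (Om : measurableType d) (R : realType) (P : probability Om R).

Lemma md_bigmax n (f : nat -> Om -> nat) : (forall i, (i < n)%N -> md (f i)) -> md (fun w => \max_(i < n) f i w).
Proof.
elim: n => [|n IH] mf.
  rewrite (_ : (fun w => _) = fun=> 0%N); first exact: md_cst.
  by apply/funext => w; rewrite big_ord0.
rewrite (_ : (fun w => _) = fun w => maxn (\max_(i < n) f i w) (f n w)); last by apply/funext => w; rewrite big_ord_recr.
by apply: (md_comp2 maxn); [apply: IH => i h; apply: mf; exact: ltnW|exact: mf].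
Qed.

(* The second alternative records that a divergent integral stays large after truncation. *)
Lemma truncation (f : Om -> R) (e : Om -> nat) (c : R) (K1 : nat) : measurable_fun setT f -> (forall w, 0 <= f w) ->
  md e -> 0 < c -> exists K, [/\ (K1 <= K)%N, Ex P (fun w => (~~ (e w <= K)%N)%:R) <= c &
    ((\int[P]_w (f w)%:E <= \int[P]_w (f w * (e w <= K)%N%:R)%:E + c%:E) \/
     (c^-1%:E <= \int[P]_w (f w * (e w <= K)%N%:R)%:E))%E].
Proof.
move=> mf f0 me c0.
have mK K : md (fun w => (e w <= K)%N) by exact: (md_comp (fun n => (n <= K)%N)).
pose u K := (\int[P]_w (f w * (e w <= K)%N%:R)%:E)%E.
have uc : u K @[K --> \oo] --> (\int[P]_w (f w)%:E)%E.
  have := @cvg_monotone_convergence _ _ _ P setT measurableT (fun K w => (f w * (e w <= K)%N%:R)%:E).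
  move=> /(_ _ _ _)/cvg_trans; apply.
  - move=> K; apply/measurable_EFinP; apply: measurable_funM => //.
    exact: (bm_meas (bm_ind R (mK K))).
  - by move=> K w _; rewrite lee_fin mulr_ge0.
  - move=> w _ K K' KK'; rewrite lee_fin ler_wpM2l // ler_nat.
    by case: (leqP (e w) K) => // h; rewrite (leq_trans h KK').
  rewrite (_ : (\int[P]_x _)%E = (\int[P]_w (f w)%:E)%E) //.
  apply: eq_integral => w _; apply/cvg_lim => //; apply: cvg_near_cst.
  by exists (e w) => // K /= ->; rewrite mulr1.
have [L hL] := tail_to0 P me c0.
have tl K : (L <= K)%N -> Ex P (fun w => (~~ (e w <= K)%N)%:R) <= c.
  move=> LK; have := hL K.+1 (leqW LK); rewrite add0r; apply: le_trans; rewrite le_eqVlt; apply/orP; left.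
  by apply/eqP/eq_Ex => w; rewrite -ltnNge.
have I0 : (0 <= \int[P]_w (f w)%:E)%E by apply: integral_ge0 => w _; rewrite lee_fin.
case Ii : (\int[P]_w (f w)%:E)%E I0 => [i| |] // i0; last first.
  move: uc; rewrite Ii => /cvgeyPge /(_ c^-1) [L' _ h].
  exists (maxn K1 (maxn L L')); split; first exact: leq_maxl.
    by apply: tl; rewrite !leq_max leqnn orbT.
  by right; apply: h; rewrite /= !leq_max leqnn !orbT.
move: uc; rewrite Ii => /fine_cvgP[[L2 _ fu] /cvgrPdist_le /(_ c c0) [L' _ h]].
pose K := maxn K1 (maxn L (maxn L' L2)).
exists K; split; first exact: leq_maxl.
  by apply: tl; rewrite /K !leq_max leqnn orbT.
left; rewrite -/(u K).
have fK : u K \is a fin_num by apply: fu; rewrite /= /K !leq_max leqnn !orbT.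
have := h K; rewrite /= => /(_ _); rewrite /K !leq_max leqnn !orbT => /(_ isT); rewrite -/K => hK.
rewrite -(fineK fK) -EFinD lee_fin.
by have := ler_norm (i - fine (u K)); move: hK; rewrite /=; lra.
Qed.

End Truncation.

(** * Routing of the virtual job *)

Section FreshRoute.
Context d (Om : measurableType d) (R : realType) (P : probability Om R).
Variables (a : nat -> R) (lam G : R -> R) (nw : network R Om) (N : nat).
Hypothesis N0 : (0 < N)%N.
Hypothesis mdl : sq2_model P a lam G nw N.
Let Cl := src_events nw N.
Definition fresh_sources := gen (src_events nw N) [:: SF1; SF2; SFT].
Let TF := g_sigma_algebraType fresh_sources.
Let Clm (k : src) A : Cl k A -> measurable A. Proof. exact: (src_measurable mdl). Qed.
Let ClI (k : src) A B : Cl k A -> Cl k B -> Cl k (A `&` B) \/ A `&` B = set0. Proof. exact: src_setI. Qed.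
Let m1 : md (fsmp1 nw N).
Proof. by apply: (sub_md (@genm _ _ _ _ _ _ _ _ _ mdl [::])); apply: md_fsmp1 => -[]. Qed.
Let m2 : md (fsmp2 nw N).
Proof. by apply: (sub_md (@genm _ _ _ _ _ _ _ _ _ mdl [::])); apply: md_fsmp2 => -[]. Qed.
Let m3 : md (ftie nw N).
Proof. by apply: (sub_md (@genm _ _ _ _ _ _ _ _ _ mdl [::])); apply: md_ftie => -[]. Qed.

Let freezeF (c : TF -> R) i j b : bm c -> (i < N)%N -> (j < N)%N ->
  Ex P (fun w => c w * [&& fsmp1 nw N w == i, fsmp2 nw N w == j & ftie nw N w == b]%:R) =
  (2 * N%:R ^+ 2)^-1 * Ex P c.
Proof.
move=> bc iN jN.
have nd : List.NoDup [:: SF1; SF2; SFT].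
  by repeat (apply: List.NoDup_cons; [by repeat case|]); exact: List.NoDup_nil.
pose B (k : src) : set Om := match k with SF1 => [set w | fsmp1 nw N w = i] | SF2 => [set w | fsmp2 nw N w = j] | _ => [set w | ftie nw N w = b] end.
have clB (k : src) : List.In k [:: SF1; SF2; SFT] -> Cl k (B k).
  by move=> [<-|[<-|[<-|[]]]]; [exists i|exists j|exists b].
have eB : [set w | [&& fsmp1 nw N w == i, fsmp2 nw N w == j & ftie nw N w == b]] = capL [:: SF1; SF2; SFT] B.
  apply/seteqP; split => w /=.
    by move=> /and3P[/eqP h1 /eqP h2 /eqP h3] k [<-|[<-|[<-|[]]]].
  move=> h; apply/and3P; split; apply/eqP; [exact: (h SF1 (or_introl erefl))|exact: (h SF2 (or_intror (or_introl erefl)))|].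
  exact: (h SFT (or_intror (or_intror (or_introl erefl)))).
have ptie : P [set w | ftie nw N w = b] = (2^-1)%:E.
  have h := mdl_ftie mdl; case: b {B clB eB} => //.
  have mt : measurable [set w | ftie nw N w = true] by exact: (m3 true).
  rewrite (_ : [set w | _] = ~` [set w | ftie nw N w = true]).
    by rewrite probability_setC // h -EFinB; congr EFin; lra.
  by apply/seteqP; split => w /=; case: (ftie _ _ _).
have ind := src_indep mdl.
have pB : P [set w | [&& fsmp1 nw N w == i, fsmp2 nw N w == j & ftie nw N w == b]] = ((2 * N%:R ^+ 2)^-1)%:E.
  rewrite eB [LHS]ind // !big_cons big_nil /= -[fine (P [set w | fsmp1 _ _ _ = i])]/(fine (P _)) (mdl_fsmp1 mdl) // (mdl_fsmp2 mdl) // ptie /=.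
  congr EFin; field; rewrite pnatr_eq0 -lt0n; exact: N0.
apply: (@freeze_event _ _ _ P fresh_sources) => //.
  exact: (@genm _ _ _ _ _ _ _ _ _ mdl).
  by apply: md_and; [exact: (md_comp (eq_op^~ i))|apply: md_and; [exact: (md_comp (eq_op^~ j))|exact: (md_comp (eq_op^~ b))]].
move=> E mE; rewrite eB (gen_indep Clm ClI ind nd clB mE) -eB.
congr (_ * _)%E; exact: pB.
Qed.

(** The argument of [route_mean], with the samples and coin of the virtual job frozen and a random
    target server [A]. *)
Lemma fresh_route (c : TF -> R) (A : TF -> nat) (f : TF -> nat -> nat) : bm c -> md A -> (forall i, md (fun w => f w i)) ->
  (forall w, c w != 0 -> (A w < N)%N) ->
  Ex P (fun w => c w * [&& (fsmp1 nw N w < N)%N, (fsmp2 nw N w < N)%N & rt (f w) (fsmp1 nw N w) (fsmp2 nw N w) (ftie nw N w) == A w]%:R) =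
  Ex P (fun w => c w * ((cnt N (fun j => (f w (A w) <= f w j)%N) + cnt N (fun j => (f w (A w) < f w j)%N))%:R / N%:R ^+ 2)).
Proof.
move=> bc mA mf cA.
pose q (w : Om) i j b : R := c w * (rt (f w) i j b == A w)%:R.
pose e w i j b : R := [&& fsmp1 nw N w == i, fsmp2 nw N w == j & ftie nw N w == b]%:R.
have gm := @genm _ _ _ _ _ _ _ _ _ mdl [:: SF1; SF2; SFT].
have bqF i j b : bm (fun w : TF => q w i j b).
  apply: bmM => //; apply: bm_ind.
  have mr : md (fun w : TF => rt (f w) i j b).
    exact: (md_comp2 (fun p q : nat => if (p < q)%N then i else if (q < p)%N then j else if b then i else j) (mf i) (mf j)).
  exact: (md_comp2 (fun p q : nat => p == q) mr mA).
have bq i j b : bm (fun w : Om => q w i j b) by exact: (sub_bm gm (bqF i j b)).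
have be i j b : bm (fun w => e w i j b).
  apply: bm_ind; apply: md_and; first exact: (md_comp (eq_op^~ i) m1).
  by apply: md_and; [exact: (md_comp (eq_op^~ j) m2)|exact: (md_comp (eq_op^~ b) m3)].
have bqe i j b : bm (fun w : Om => q w i j b * e w i j b) by exact: (bmM (bq i j b) (be i j b)).
have qe i j b : (i < N)%N -> (j < N)%N -> Ex P (fun w => q w i j b * e w i j b) = (2 * N%:R ^+ 2)^-1 * Ex P (fun w => q w i j b).
  by move=> iN jN; exact: (freezeF b (bqF i j b)).
transitivity (Ex P (fun w => \sum_(i < N) \sum_(j < N) (q w i j true * e w i j true + q w i j false * e w i j false))).
  apply: eq_Ex => w.
  have [sN|sN] := ltnP (fsmp1 nw N w) N; last first.
    rewrite mulr0 big1 // => i _; apply: big1 => j _.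
    by rewrite /e (_ : (fsmp1 nw N w == i) = false) ?mulr0 ?addr0 //; apply/negbTE; rewrite neq_ltn (leq_trans (ltn_ord i) sN) orbT.
  have [sN'|sN'] := ltnP (fsmp2 nw N w) N; last first.
    rewrite mulr0 big1 // => i _; apply: big1 => j _.
    by rewrite /e (_ : (fsmp2 nw N w == j) = false) ?andbF ?mulr0 ?addr0 //; apply/negbTE; rewrite neq_ltn (leq_trans (ltn_ord j) sN') orbT.
  rewrite (bigD1 (Ordinal sN)) //= [X in _ + X]big1 ?addr0 => [|i]; last first.
    rewrite -val_eqE eq_sym /= => /negbTE iN; by apply: big1 => j _; rewrite /e iN !mulr0 addr0.
  rewrite (bigD1 (Ordinal sN')) //= [X in _ + X]big1 ?addr0 => [|j]; last first.
    by rewrite -val_eqE eq_sym /= => /negbTE jN; rewrite /e jN !andbF !mulr0 addr0.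
  by rewrite /e !eqxx /q; case: (ftie _ _ _); rewrite /= ?mulr1 ?mulr0 ?addr0 ?add0r.
rewrite Ex_sum => [|i]; last by apply: bm_sum => j; exact: bmD.
have bq2 (i j : nat) : bm (fun w : Om => q w i j true + q w i j false) by exact: bmD.
transitivity (\sum_(i < N) \sum_(j < N) (2 * N%:R ^+ 2)^-1 * (Ex P (fun w => q w i j true + q w i j false))).
  apply: eq_bigr => i _; rewrite Ex_sum => [|j]; last exact: bmD.
  apply: eq_bigr => j _; rewrite ExD //.
  by rewrite ExD // !qe // mulrDr.
transitivity ((2 * N%:R ^+ 2)^-1 * Ex P (fun w => \sum_(i < N) \sum_(j < N) (q w i j true + q w i j false))).
  rewrite Ex_sum => [|i]; last by apply: bm_sum => j; exact: bq2.
  rewrite big_distrr /=; apply: eq_bigr => i _; rewrite Ex_sum => [|j]; last exact: bq2.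
  by rewrite big_distrr.
rewrite -ExZ; last by apply: bm_sum => i; apply: bm_sum => j; exact: bmD.
apply: eq_Ex => w.
have [c0|/cA AN] := eqVneq (c w) 0.
  by rewrite c0 mul0r big1 ?mulr0 // => i _; apply: big1 => j _; rewrite /q c0 !mul0r addr0.
have := route_count (f w) AN => /(congr1 (fun m => m%:R : R)); rewrite natrM => h.
transitivity ((2 * N%:R ^+ 2)^-1 * (c w * (\sum_(i < N) \sum_(j < N) ((rt (f w) i j true == A w) + (rt (f w) i j false == A w)))%N%:R)).
  congr (_ * _); rewrite natr_sum big_distrr /=; apply: eq_bigr => i _; rewrite natr_sum big_distrr /=.
  by apply: eq_bigr => j _; rewrite natrD mulrDr.
rewrite h; have n0 : N%:R != 0 :> R by rewrite pnatr_eq0; have := N0; lia.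
by field.
Qed.

End FreshRoute.

(** * Sums over levels and sums over jobs *)

Section WaitingIdentities.
Variables (R : realType) (N M : nat) (T : R) (J : inp R).
Hypothesis N0 : (0 < N)%N.
Hypothesis vJ : valid J.
Hypothesis late : forall n, (n < M)%N -> (srv J n < N)%N -> tau J n <= T.
Let m := arrd J M T.

Definition queue_at (J : inp R) i := X J (arrd J M T) i T.
(* probability that the [SQ(2)] rule picks server [i] at time [T] *)
Definition pick (J : inp R) i : R := (cnt N (fun j => (queue_at J i <= queue_at J j)%N) +
  cnt N (fun j => (queue_at J i < queue_at J j)%N))%:R / N%:R ^+ 2.
(** Probability, given the system, that the virtual job joins a busy server whose job in service
    completes after [x]; [waiting_part] is the mean number of jobs waiting in the queue it joins. *)
Definition serving_part (J : inp R) (x : R) : R := \sum_(l < M)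
  (yb J N M l.+1 T None + yb J N M l.+2 T None) * (yb J N M l.+1 T (Some x) - yb J N M l.+2 T (Some x)).
Definition waiting_part (J : inp R) : R := \sum_(l < M) yb J N M l.+2 T None ^+ 2.

Let n0 : N%:R != 0 :> R. Proof. by rewrite pnatr_eq0; have := N0; lia. Qed.
Let vd j : (j < M)%N -> (j < m)%N = (tau J j <= T). Proof. exact: arrd_val. Qed.
Let mM : (m <= M)%N. Proof. exact: arrd_le. Qed.

Let pickE i : pick J i = (yb J N M (queue_at J i) T None + yb J N M (queue_at J i).+1 T None) / N%:R.
Proof.
rewrite /yb /Yh /Yn -/m -mulrDl -natrD /pick expr2 invfM mulrA; congr (_%:R / _ / _).
by congr (_ + _)%N; apply: eq_cnt => j _; rewrite /= andbT.
Qed.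

Let queue_le i : (queue_at J i <= M)%N. Proof. by apply: leq_trans mM; exact: cnt_le. Qed.

Let by_level (p : nat -> bool) : (forall n, (n < M)%N -> p n -> (0 < queue_at J (srv J n))%N) ->
  \sum_(n < M) (p n)%:R * pick J (srv J n) = \sum_(l < M) (yb J N M l.+1 T None + yb J N M l.+2 T None) *
    ((cnt M (fun n => p n && (queue_at J (srv J n) == l.+1)))%:R / N%:R).
Proof.
move=> p0; transitivity (\sum_(n < M) \sum_(l < M) (yb J N M l.+1 T None + yb J N M l.+2 T None) * ((p n && (queue_at J (srv J n) == l.+1))%:R / N%:R)).
  apply: eq_bigr => n _; case pn: (p n); last by rewrite mul0r big1 // => l _; rewrite mul0r mulr0.
  have q0 := p0 n (ltn_ord n) pn; have q1 := queue_le (srv J n).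
  have qM : ((queue_at J (srv J n)).-1 < M)%N by rewrite prednK.
  rewrite (bigD1 (Ordinal qM)) //= prednK // eqxx big1 ?addr0 ?mul1r ?pickE ?mulrA ?mulr1 // => l.
  rewrite -val_eqE /= => h; rewrite (_ : (_ == l.+1) = false) ?mul0r ?mulr0 //.
  by apply/negbTE; apply: contraNneq h => ->.
rewrite exchange_big; apply: eq_bigr => l _ /=; rewrite -mulr_sumr; congr (_ * _).
by rewrite -mulr_suml /cnt natr_sum.
Qed.

Lemma serving_partE x : T <= x -> serving_part J x =
  \sum_(n < M) [&& (srv J n < N)%N, sta J n <= T & x < cpl J n]%:R * pick J (srv J n).
Proof.
move=> Tx; rewrite (by_level (p := fun n => [&& (srv J n < N)%N, sta J n <= T & x < cpl J n])) => [|n nM /and3P[h1 h2 h3]].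
  apply: eq_bigr => l _; congr (_ * _); rewrite /yb /Yh -mulrBl; congr (_ / _).
  rewrite !YnE // -/m; apply/(addIr (cnt m (fun n => [&& (srv J n < N)%N, sta J n <= T, x < cpl J n & (l.+2 <= X J m (srv J n) T)%N]))%:R).
  rewrite subrK -natrD; congr _%:R; rewrite [in RHS](@cnt_widen m) // => [|j /andP[mj jM]].
    rewrite (cnt_split m _ (fun n => X J m (srv J n) T == l.+1)); congr (_ + _)%N; apply: eq_cnt => n _.
      rewrite /queue_at -/m -!andbA; do 3 congr (_ && _); case: eqP => [->|]; by rewrite ?leqnn ?andbF.
    rewrite -!andbA; do 3 congr (_ && _); lia.
  apply/negP => /andP[/and3P[_ h _] _]; have := vd jM; rewrite ltnNge mj /= => /esym/negbT.
  by rewrite -ltNge => /lt_le_trans/(_ (tau_sta J j)); rewrite ltNge h.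
apply/cnt_gt0P; exists n; last by rewrite eqxx (le_lt_trans Tx).
by rewrite -/m vd //; exact: le_trans (tau_sta J n) h2.
Qed.

Lemma waiting_partE : waiting_part J =
  \sum_(n < M) ((srv J n < N)%N && (T < sta J n))%:R * pick J (srv J n).
Proof.
rewrite (by_level (p := fun n => (srv J n < N)%N && (T < sta J n))) => [|n nM /andP[h1 h2]]; last first.
  apply/cnt_gt0P; exists n; last by rewrite eqxx (lt_trans h2) // sta_cpl.
  by rewrite -/m vd //; exact: late.
pose s l := yb J N M l T None.
have cE l : (cnt M (fun n => [&& (srv J n < N)%N, T < sta J n & queue_at J (srv J n) == l.+1]))%:R / N%:R = l%:R * (s l.+1 - s l.+2).
  have -> : cnt M (fun n => [&& (srv J n < N)%N, T < sta J n & queue_at J (srv J n) == l.+1]) = (l * cnt N (fun i => queue_at J i == l.+1))%N.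
    rewrite -(sum_cnt_fiber M N (srv J) (fun i n => (T < sta J n) && (queue_at J i == l.+1))).
    rewrite /cnt big_distrr /=; apply: eq_bigr => i _; case: eqP => qi; last first.
      by rewrite muln0 big1 // => n _; rewrite !andbF.
    have q0 : (0 < queue_at J i)%N by rewrite qi.
    rewrite muln1 -/(cnt M (fun n => (srv J n == i) && ((T < sta J n) && true))).
    rewrite (@cnt_widen m) // => [|j /andP[mj jM]]; last first.
      apply/negP => /andP[/eqP e _]; have := late jM; rewrite e ltn_ord => /(_ isT).
      by rewrite -vd // ltnNge mj.
    apply: (@addnI 1%N); rewrite [in RHS]add1n -qi /queue_at -/m /X.
    rewrite (cnt_split m (fun j => (srv J j == i) && (T < cpl J j)) (fun j => sta J j <= T)); congr (_ + _)%N.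
      rewrite -[LHS](_ : ((0 < isv J m i T T)%N : nat) = 1%N); last by rewrite (X_isv _ q0) // => k km; rewrite -vd // (leq_trans km).
      rewrite isv_uniq // /isv; apply: eq_cnt => j _; rewrite -andbA; congr (_ && _); exact: andbC.
    apply: eq_cnt => j _; rewrite andbT -andbA -ltNge; congr (_ && _); apply/idP/andP => [h|[]] //.
    by split => //; apply: lt_trans h _; exact: sta_cpl.
  rewrite natrM -mulrA; congr (_ * _); rewrite /s /yb /Yh /Yn -/m -mulrBl; congr (_ / _).
  apply/(addIr (cnt N (fun i => (l.+2 <= X J m i T)%N && res J m i T None))%:R); rewrite subrK -natrD; congr _%:R.
  rewrite (cnt_split N (fun i => (l.+1 <= X J m i T)%N && res J m i T None) (fun i => X J m i T == l.+1)); congr (_ + _)%N; apply: eq_cnt => i _ /=.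
    by rewrite andbT /queue_at -/m; case: eqP => [->|]; rewrite ?leqnn ?andbF.
  rewrite !andbT; lia.
rewrite (eq_bigr (fun l : 'I_M => l%:R * (s l.+1 ^+ 2 - s l.+2 ^+ 2))) => [|l _]; last first.
  rewrite -/(s l.+1) -/(s l.+2) (eq_cnt (q := fun n => [&& (srv J n < N)%N, T < sta J n & queue_at J (srv J n) == l.+1])) => [|n _]; last by rewrite andbA.
  by rewrite cE; ring.
(* A queue of length [l + 1] has [l] waiting jobs; summation by parts turns this weighted sum into a
   sum of squared tails. The boundary term vanishes since no queue exceeds [M]. *)
have abel B : \sum_(l < B) l%:R * (s l.+1 ^+ 2 - s l.+2 ^+ 2) = \sum_(l < B) s l.+2 ^+ 2 - B%:R * s B.+1 ^+ 2.
  elim: B => [|B IH]; first by rewrite !big_ord0 mul0r subrr.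
  by rewrite !big_ord_recr /= IH -[in RHS]natr1; ring.
rewrite abel (_ : s M.+1 = 0) ?expr0n ?mulr0 ?subr0 //.
rewrite /s /yb /Yh /Yn cntF ?mul0r // => i _; rewrite /= andbT -ltnNge ltnS; exact: queue_le.
Qed.

End WaitingIdentities.

Section LayerCake.
Context d (Om : measurableType d) (R : realType) (P : probability Om R).

Lemma layer_cake (f : Om -> R) : measurable_fun setT f -> (forall w, 0 <= f w) ->
  (\int[P]_w (f w)%:E = \int[@lebesgue_measure R]_(r in `[0%R, +oo[) (Ex P (fun w => (r < f w)%R%:R))%:E)%E.
Proof.
move=> mf f0; pose X := mfun_Sub (mem_set mf) : {mfun Om >-> R}.
have := @ge0_expectation_ccdf _ _ _ P X f0; rewrite expectation_def => ->.
apply: eq_integral => r _; rewrite /ccdf /distribution /pushforward.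
have mr : md (fun w => (r < f w)%R) by apply: md_ltr => //; exact: measurable_cst.
rewrite Ex_ind // fineK ?fin_num_measure //; last exact: md_set.
by congr (P _); apply/seteqP; split => w /=; rewrite in_itv /= andbT.
Qed.

Lemma measurable_antitone (h : R -> R) (D : set R) : measurable D -> {homo h : x y / x <= y >-> y <= x} ->
  measurable_fun D (fun r => (h r)%:E).
Proof. by move=> mD hh; apply/measurable_EFinP; apply: nonincreasing_measurable. Qed.

End LayerCake.

(** * Mean of the capped waiting time *)

Section WaitingMean.
Context d (Om : measurableType d) (R : realType) (P : probability Om R).
Variables (a : nat -> R) (lam G g : R -> R) (H : R) (nw : network R Om) (N : nat).
Hypothesis N0 : (0 < N)%N.
Hypothesis sd : service_dist G g H.
Hypothesis mdl : sq2_model P a lam G nw N.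
Variables (K : nat) (T : R).
Hypotheses (K0 : (0 < K)%N) (T0 : 0 <= T).
Let Gbar (x : R) := 1 - G x.
Let I := sysI G nw N K T.
Let M := (K * N + K)%N.
Let vI w : valid (I w). Proof. exact: (validI N0 sd mdl K0 T0). Qed.
Let core := sysI_core N0 sd mdl K0 T0.
Let uc := undercap nw N K T.
Let mI : minp I := c_minp core.

Lemma late w n : (n < M)%N -> (srv (I w) n < N)%N -> tau (I w) n <= T.
Proof.
move=> nM; case: (ltnP n (K * N)) => nK; first by rewrite /= nK.
have -> : n = (K * N + (n - K * N))%N by lia.
case: (leqP (minn K (arr nw N w T)) (n - K * N)) => h; first by rewrite late_srv // ltnn.
move=> _; rewrite tau_arr //; apply: arrtime_le => //.
by apply: leq_trans h _; exact: geq_minr.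
Qed.

Lemma md_undercap L : ~ List.In SArr L -> ~ List.In SInit L ->
  md (fun w : g_sigma_algebraType (gen (src_events nw N) L) => uc w).
Proof.
move=> h1 h2; apply: md_and; first by apply: (md_comp (fun n => (n <= K)%N)); exact: md_arr.
rewrite (_ : (fun w => _) = fun w => (fun v : N.-tuple nat => [forall i, (tnth v i <= K)%N]) [tuple X0 nw N w i | i < N]).
  by apply: (md_comp (fun v : N.-tuple nat => [forall i, (tnth v i <= K)%N])); exact: md_ttX.
by apply/funext => w; apply: eq_forallb => i; rewrite tnth_mktuple.
Qed.

Let genO L : gen (src_events nw N) L `<=` measurable. Proof. exact: (@genm _ _ _ _ _ _ _ _ _ mdl). Qed.
Let md_uc : md uc. Proof. by apply: (sub_md (@genO [::])); apply: md_undercap. Qed.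

Section Measurability.
Context d' (S : measurableType d') (J : S -> inp R).
Hypothesis mJ : minp J.

Lemma md_queue (f : S -> nat) : md f -> md (fun w => queue_at M T (J w) (f w)).
Proof.
move=> mf; apply: (md_select (F := fun m w => X (J w) m (f w) T)) => [|m]; first exact: (mfd_arrd M T mJ).
by apply: md_X => //; exact: measurable_cst.
Qed.

Lemma bm_pick n : bm (fun w => pick N M T (J w) (srv (J w) n)).
Proof.
have mq j := md_queue (md_cst _ j); have ms := md_queue (md_srv mJ n).
rewrite (_ : (fun w => _) = fun w => ((cnt N (fun j => (queue_at M T (J w) (srv (J w) n) <= queue_at M T (J w) j)%N))%:R +
  (cnt N (fun j => (queue_at M T (J w) (srv (J w) n) < queue_at M T (J w) j)%N))%:R) * (N%:R ^+ 2)^-1); last first.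
  by apply/funext => w; rewrite /pick natrD.
apply: bmM; last exact: bm_cst.
apply: bmD; apply: bm_cnt => j _; first exact: (md_comp2 (fun p q : nat => (p <= q)%N) ms (mq j)).
exact: (md_comp2 (fun p q : nat => (p < q)%N) ms (mq j)).
Qed.

Lemma md_serving n x : md (fun w => [&& (srv (J w) n < N)%N, sta (J w) n <= T & x < cpl (J w) n]).
Proof.
apply: md_and; first exact: md_srv_lt'.
apply: md_and; first by apply: md_ler; [exact: meas_sta|exact: measurable_cst].
by apply: md_ltr; [exact: measurable_cst|exact: meas_cpl].
Qed.

Lemma md_waiting n : md (fun w => (srv (J w) n < N)%N && (T < sta (J w) n)).
Proof. by apply: md_and; [exact: md_srv_lt'|apply: md_ltr; [exact: measurable_cst|exact: meas_sta]]. Qed.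

End Measurability.

Let present n r w := [&& uc w, (srv (I w) n < N)%N & Num.max (sta (I w) n) T + r < cpl (I w) n].
Let routed n w := [&& (fsmp1 nw N w < N)%N, (fsmp2 nw N w < N)%N & vsrv G nw N K T w == srv (I w) n].
Let chosen n w := present n 0 w && routed n w.
Let rest n w : R := (chosen n w)%:R * (cpl (I w) n - Num.max (sta (I w) n) T).
(** Defined by completion times at every outcome, hence measurable; it is compared with [vwait] only
    on regular outcomes. *)
Definition capped_wait w := \sum_(n < M) rest n w.

Lemma capped_waitE w : regular nw N w -> capped_wait w = vwait Gbar nw N w T * (uc w)%:R.
Proof.
move=> reg; rewrite /capped_wait; case uw: (uc w); last first.
  by rewrite mulr0 big1 // => n _; rewrite /rest /chosen /present uw mul0r.
rewrite mulr1 (vwait_link N0 sd mdl K0 T0 reg uw) -/I -/M last_pend_sum //; last first.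
  by move=> k km; rewrite -(arrd_val (m := M) T (vI w)) //; apply: leq_trans km (arrd_le _ _ _).
have [_ _ _ _ [f1 f2]] := reg.
have vN : (vsrv G nw N K T w < N)%N by rewrite /vsrv /rt; do 3 case: ifP => _ //.
rewrite [RHS](big_ord_widen M (fun n => ((srv (I w) n == vsrv G nw N K T w) && (T < cpl (I w) n))%:R * (cpl (I w) n - Num.max (sta (I w) n) T)) (arrd_le _ _ _)).
rewrite [RHS]big_mkcond; apply: eq_bigr => n _.
rewrite /rest /chosen /present /routed uw f1 f2 /= addr0 gt_max sta_cpl //=.
have [e|e] := eqVneq (srv (I w) n) (vsrv G nw N K T w); last first.
  by rewrite !andbF !mul0r; case: ifP.
rewrite e vN /= andbT; case: ifP => // /negbT h.
have := @late w n (ltn_ord n); rewrite e vN => /(_ isT).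
by rewrite -(arrd_val (m := M) T (vI w)) // (negbTE h).
Qed.

Let meas_left n : measurable_fun setT (fun w => cpl (I w) n - Num.max (sta (I w) n) T).
Proof.
by apply: measurable_funB; [exact: meas_cpl|apply: measurable_maxr; [exact: meas_sta|exact: measurable_cst]].
Qed.

Let md_vsrv : md (vsrv G nw N K T).
Proof.
have m1 : md (fsmp1 nw N) by apply: (sub_md (@genO [::])); apply: md_fsmp1 => -[].
have m2 : md (fsmp2 nw N) by apply: (sub_md (@genO [::])); apply: md_fsmp2 => -[].
have m3 : md (ftie nw N) by apply: (sub_md (@genO [::])); apply: md_ftie => -[].
have mq f : md f -> md (fun w => queue_at M T (I w) (f w)) by exact: md_queue.
pose hh (p q : nat * nat) (c : bool) := if (p.2 < q.2)%N then p.1 else if (q.2 < p.2)%N then q.1 else if c then p.1 else q.1.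
exact: (md_comp3 hh (md_pair m1 (mq _ m1)) (md_pair m2 (mq _ m2)) m3).
Qed.

Let md_present n r : md (present n r).
Proof.
apply: (md_and md_uc); apply: (md_and (md_srv_lt' mI n N)).
apply: md_ltr; last exact: meas_cpl.
apply: measurable_funD; last exact: measurable_cst.
by apply: measurable_maxr; [exact: meas_sta|exact: measurable_cst].
Qed.

Let md_routed n : md (routed n).
Proof.
have m1 : md (fsmp1 nw N) by apply: (sub_md (@genO [::])); apply: md_fsmp1 => -[].
have m2 : md (fsmp2 nw N) by apply: (sub_md (@genO [::])); apply: md_fsmp2 => -[].
apply: md_and; first exact: (md_comp (fun i => (i < N)%N)).
apply: md_and; first exact: (md_comp (fun i => (i < N)%N)).
by apply: (md_comp2 (fun p q : nat => p == q)) => //; exact: md_srv.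
Qed.

Let meas_rest n : measurable_fun setT (rest n).
Proof.
apply: measurable_funM => //; apply: (bm_meas (bm_ind R _)).
exact: md_and.
Qed.

Let rest_ge0 n w : 0 <= rest n w.
Proof.
rewrite /rest; case h: (chosen n w); last by rewrite mul0r.
move: h => /andP[/and3P[_ _ h] _]; rewrite mul1r subr_ge0; apply: ltW; by rewrite addr0 in h.
Qed.

Lemma meas_capped_wait : measurable_fun setT capped_wait.
Proof. exact: measurable_sum. Qed.

Lemma capped_wait_ge0 w : 0 <= capped_wait w.
Proof. by apply: sumr_ge0. Qed.

Let U n r w : R := (uc w)%:R * ([&& (srv (I w) n < N)%N, sta (I w) n <= T & T + r < cpl (I w) n]%:R * pick N M T (I w) (srv (I w) n)).
Let V n w : R := (uc w)%:R * (((srv (I w) n < N)%N && (T < sta (I w) n))%:R * pick N M T (I w) (srv (I w) n)).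

Let bU n r : bm (U n r).
Proof.
apply: bmM; first exact: bm_ind.
by apply: bmM; [apply: bm_ind; exact: md_serving|exact: bm_pick].
Qed.

Let bV n : bm (V n).
Proof.
apply: bmM; first exact: bm_ind.
by apply: bmM; [apply: bm_ind; exact: md_waiting|exact: bm_pick].
Qed.

(** If [n] still waits at [T], the state at [T] precedes its start and does not see its service
    time, which is thus fresh given [V n]. Jobs of layer [0] never wait. *)
Let waiting_law n r : (n < M)%N -> 0 <= r -> Ex P (fun w => V n w * (r < sv (I w) n)%R%:R) = Gbar r * Ex P (V n).
Proof.
move=> nM r0; case: (ltnP n N) => nN.
  have V0 w : V n w = 0.
    rewrite /V; case sN: (srv (I w) n < N)%N; last by rewrite mul0r mulr0.
    by rewrite (init_sta N0 K0 T0 nN sN) ltNge T0 mul0r mulr0.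
  rewrite (eq_Ex P (g := fun=> 0)) ?Ex_cst => [|w]; last by rewrite V0 mul0r.
  by rewrite (eq_Ex P (g := fun=> 0)) ?Ex_cst ?mulr0 // => w; exact: V0.
pose J (w : Om) := setv (I w) n 1.
have frz w : T < sta (I w) n -> [/\ srv (I w) n = srv (J w) n, sta (I w) n = sta (J w) n &
    forall i, queue_at M T (I w) i = queue_at M T (J w) i].
  move=> h; split; first by apply: setv_srv => //; exact: tau_sta.
    exact: setv_sta_self.
  move=> i; apply: (setv_X (v := 1)) => //; first exact: ltW.
  move=> j jm; apply: le_trans (ltW h); rewrite -(arrd_val (m := M) T (vI w)) //.
  by apply: leq_trans jm _; exact: arrd_le.
have VE w : V n w = (uc w)%:R * (((srv (J w) n < N)%N && (T < sta (J w) n))%:R * pick N M T (J w) (srv (J w) n)).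
  rewrite /V; have sE := setv_sta_self (I w) n 1; rewrite -/(J w) in sE.
  have [h|h] := boolP (T < sta (I w) n); last by rewrite -sE (negbTE h) !andbF !mul0r.
  have [e1 e2 e3] := frz w h; rewrite -e1 -e2 h; congr (_ * (_ * _)).
  by rewrite /pick e3; congr ((_ + _)%:R / _); apply: eq_cnt => j _; rewrite e3.
have mv := c_minpv core (introT andP (conj nN nM)).
have cV := c_freezeV core (introT andP (conj nN nM)) (c := V n) (y := fun=> r).
rewrite cV; last exact: measurable_cst.
  rewrite (eq_Ex P (g := fun w => Gbar r * V n w)) ?ExZ // => w; exact: mulrC.
have -> : V n = (fun w => (uc w)%:R * (((srv (J w) n < N)%N && (T < sta (J w) n))%:R * pick N M T (J w) (srv (J w) n))) by apply/funext; exact: VE.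
have nl k : (forall i, k <> SU i) -> (forall i j, k <> SW i j) -> (forall j, k <> SServ j) -> ~ List.In k [:: srcv N K n].
  by move=> h1 h2 h3 [|[]]; case: (srcv_cases N K n) => [->|[i [j ->]]|[j ->]] e; [exact: (h1 n)|exact: (h2 i j)|exact: (h3 j)].
apply: bmM; first by apply: bm_ind; apply: md_undercap; apply: nl.
by apply: bmM; [apply: bm_ind; exact: md_waiting|exact: bm_pick].
Qed.

(** The samples of the virtual job are averaged first and become [pick]; then a job in service at
    [T] contributes [U], and a waiting job a fresh service time. *)
Let rest_law n r : (n < M)%N -> 0 <= r -> Ex P (fun w => (r < rest n w)%R%:R) = Ex P (U n r) + Gbar r * Ex P (V n).
Proof.
move=> nM r0.
transitivity (Ex P (fun w => (present n r w)%:R * (routed n w)%:R)).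
  apply: eq_Ex => w; rewrite -natrM mulnb; congr (nat_of_bool _)%:R.
  rewrite /rest /chosen /present; case: (routed n w); rewrite ?andbF ?andbT ?mul0r ?ltNge ?r0 //=.
  case: (uc w); rewrite ?mul0r ?ltNge ?r0 //=; case: (srv (I w) n < N)%N; rewrite ?mul0r ?ltNge ?r0 //= -!ltNge addr0.
  case: (ltP (Num.max (sta (I w) n) T)) => h; first by rewrite mul1r ltrBrDl.
  by rewrite mul0r ltNge r0 /=; apply/esym/negbTE; rewrite -leNgt (le_trans h) // lerDl.
have noF k : List.In k [:: SF1; SF2; SFT] -> [\/ k = SF1, k = SF2 | k = SFT].
  by move=> [<-|[<-|[<-|[]]]]; [exact: Or31|exact: Or32|exact: Or33].
have mF : minp (fun w : g_sigma_algebraType (fresh_sources nw N) => I w).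
  split=> k.
  - by apply: (meas_tauI N0 mdl K T0) => -[|[|[|[]]]].
  - apply: (meas_sv sd) => [|_]; last by move=> [|[|[|[]]]].
    by case: (srcv_cases N K k) => [->|[i [j ->]]|[j ->]] [|[|[|[]]]].
  - by apply: (md_saI G N0 T) => [[|[|[|[]]]]|[|[|[|[]]]]|_ [|[|[|[]]]]].
  - by apply: (md_sbI G N0 T) => [[|[|[|[]]]]|[|[|[|[]]]]|_ [|[|[|[]]]]].
  - by apply: md_tbI => _ [|[|[|[]]]].
have mp : md (fun w : g_sigma_algebraType (fresh_sources nw N) => present n r w).
  apply: md_and; first by apply: md_undercap => -[|[|[|[]]]].
  apply: md_and; first exact: md_srv_lt'.
  apply: md_ltr; last exact: meas_cpl.
  apply: measurable_funD; last exact: measurable_cst.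
  by apply: measurable_maxr; [exact: meas_sta|exact: measurable_cst].
have := @fresh_route _ _ _ P _ _ _ _ N N0 mdl (fun w => (present n r w)%:R) (fun w => srv (I w) n) (fun w => queue_at M T (I w)).
move=> /(_ (bm_ind R mp) (md_srv mF n) (fun i => md_queue mF (md_cst _ i))) fr.
transitivity (Ex P (fun w => (present n r w)%:R * pick N M T (I w) (srv (I w) n))).
  by apply: fr => w; rewrite pnatr_eq0 eqb0 negbK => /and3P[].
rewrite -waiting_law // -ExD //; last first.
  apply: bmM => //; apply: bm_ind; apply: md_ltr; first exact: measurable_cst.
  by case: mI.
apply: eq_Ex => w; rewrite /U /V /present cplE.
case: (uc w); rewrite ?mul0r ?addr0 // !mul1r; case: (srv (I w) n < N)%N; rewrite ?mul0r ?addr0 //=.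
case: (leP (sta (I w) n) T) => h /=; first by rewrite !mul0r addr0.
by rewrite mul0r add0r mul1r ltrD2l mulrC.
Qed.

(** The mean is an integral of survival probabilities. For waiting jobs these are constants times
    [Gbar], whose integral is the mean service time [1]; hence the last term contains no
    integral. *)
Lemma capped_wait_mean : (\int[P]_w (capped_wait w)%:E =
  \int[@lebesgue_measure R]_(r in `[0%R, +oo[) (Ex P (fun w => (uc w)%:R * serving_part N M T (I w) (T + r)))%:E +
  (Ex P (fun w => (uc w)%:R * waiting_part N M T (I w)))%:E)%E.
Proof.
have m0 : measurable (`[0%R, +oo[%classic : set R) by [].
have U0 n r : 0 <= Ex P (U n r).
  by apply: Ex_ge0 => w; rewrite !mulr_ge0 // divr_ge0.
have V0 n : 0 <= Ex P (V n).
  by apply: Ex_ge0 => w; rewrite !mulr_ge0 // divr_ge0.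
have mU n : measurable_fun (`[0%R, +oo[%classic : set R) (fun r => (Ex P (U n r))%:E).
  apply: measurable_antitone => // r r' rr'; apply: Ex_le => // w; rewrite /U ler_wpM2l // ler_wpM2r //.
    by rewrite divr_ge0.
  rewrite ler_nat; case: (srv _ _ < N)%N => //=; case: (sta _ _ <= T) => //=.
  by have [h|//] := boolP (T + r' < _); rewrite (le_lt_trans _ h) // lerD2l.
have G0 r : 0 <= Gbar r by have := sd_G1 sd r; rewrite /Gbar; lra.
have mG : measurable_fun (`[0%R, +oo[%classic : set R) (fun r => (Gbar r)%:E).
  by apply/measurable_EFinP; apply: measurable_funTS; exact: (sd_Gm sd).
rewrite (eq_integral (fun w => \sum_(n < M) (rest n w)%:E)%E) => [|w _]; last by rewrite sumEFin.
rewrite ge0_integral_sum //; last 2 first.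
- by move=> n; apply/measurable_EFinP; exact: meas_rest.
- by move=> n w _; rewrite lee_fin.
have restE n : (n < M)%N -> (\int[P]_w (rest n w)%:E =
    \int[@lebesgue_measure R]_(r in `[0%R, +oo[) (Ex P (U n r))%:E + (Ex P (V n))%:E)%E.
  move=> nM; rewrite layer_cake //.
  transitivity (\int[@lebesgue_measure R]_(r in `[0%R, +oo[) ((Ex P (U n r))%:E + (Ex P (V n))%:E * (Gbar r)%:E))%E.
    apply: eq_integral => r; by rewrite inE /= in_itv /= andbT => r0; rewrite rest_law // EFinD EFinM muleC.
  have mVG : measurable_fun (`[0%R, +oo[%classic : set R) (fun r => (Ex P (V n))%:E * (Gbar r)%:E)%E.
    by apply: emeasurable_funM => //; exact: measurable_cst.
  rewrite ge0_integralD //; last 3 first.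
  - by move=> r _; rewrite lee_fin.
  - exact: mU.
  - by first [exact: mVG | move=> r _; rewrite mule_ge0 ?lee_fin].
  congr (_ + _)%E; rewrite ge0_integralZl //; last 2 first.
  - by move=> r _; rewrite lee_fin.
  - by rewrite lee_fin.
  by rewrite (sd_mean sd) mule1.
rewrite (eq_bigr (fun n : 'I_M => \int[@lebesgue_measure R]_(r in `[0%R, +oo[) (Ex P (U n r))%:E + (Ex P (V n))%:E)%E) => [|n _]; last exact: restE.
rewrite big_split /= -ge0_integral_sum //; last 2 first.
- by move=> n; exact: mU.
- by move=> n r _; rewrite lee_fin.
congr (_ + _)%E.
  apply: eq_integral => r; rewrite inE /= in_itv /= andbT => r0; rewrite sumEFin; congr (_%:E).
  rewrite -Ex_sum //; apply: eq_Ex => w; rewrite serving_partE ?lerDl // -?mulr_sumr //.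
rewrite sumEFin; congr (_%:E); rewrite -Ex_sum //; apply: eq_Ex => w.
rewrite waiting_partE // -?mulr_sumr // => n; exact: late.
Qed.

End WaitingMean.

(** * Interchange of the limit in [N] with the sum over levels *)

Section SeriesLimit.
Context d (Om : measurableType d) (R : realType) (P : probability Om R).
Variables (M : nat -> nat) (uc : nat -> Om -> bool) (F : nat -> nat -> Om -> R) (phi : nat -> R).
Hypothesis NM : forall N, (N <= M N)%N.
Hypothesis muc : forall N, (0 < N)%N -> md (uc N).
Hypothesis uc0 : LS (fun N => Ex P (fun w => (~~ uc N w)%:R)) 0.
Hypothesis bF : forall N l, (0 < N)%N -> bm (F N l).
Hypothesis F02 : forall N l w, (0 < N)%N -> 0 <= F N l w <= 2.
Hypothesis Flim : forall l, LS (fun N => Ex P (fun w => `|F N l w - phi l|)) 0.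
Hypothesis Ftail : forall e, 0 < e -> exists L0, forall L, (L0 <= L)%N ->
  LS (fun N => Ex P (fun w => \sum_(L <= l < M N) F N l w)) e.

Lemma L1_limit_ge0 l : 0 <= phi l.
Proof.
rewrite leNgt; apply/negP => h; have e0 : 0 < - phi l / 2 by lra.
have [N0 /(_ (maxn N0 1))] := Flim l e0; rewrite leq_maxl add0r => /(_ isT).
set N := maxn N0 1; have Np : (0 < N)%N by rewrite /N leq_max orbT.
move=> hN; have : - phi l <= Ex P (fun w => `|F N l w - phi l|).
  rewrite -[X in X <= _](Ex_cst P); apply: Ex_le => [||w]; [exact: bm_cst|exact: (bm_abs (bmB (bF l Np) (bm_cst _ _)))|].
  by have /andP[f0 _] := F02 l w Np; apply: le_trans (ler_norm _); lra.
lra.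
Qed.

Let u N := Ex P (fun w => (uc N w)%:R * \sum_(l < M N) F N l w).
Let s L := \sum_(l < L) phi l.

(** Off the event [uc] the first [L] terms are bounded by [2 L]; beyond [L] the tail hypothesis
    takes over. *)
Let near_partial e : 0 < e -> exists L0, forall L, (L0 <= L)%N -> LS (fun N => `|u N - s L|) e.
Proof.
move=> e0; have [L0 hL] := Ftail e0; exists L0 => L L0L.
apply: (@LS_le _ _ (fun N => ((2 * L%:R) * Ex P (fun w => (~~ uc N w)%:R) + \sum_(l < L) Ex P (fun w => `|F N l w - phi l|)) +
   Ex P (fun w => \sum_(L <= l < M N) F N l w))).
  exists (maxn 1 L) => N; rewrite geq_max => /andP[N0 LN]; have LM := leq_trans LN (NM N).
  have mu := muc N0; have bs (A B : nat) : bm (fun w => \sum_(A <= l < B) F N l w) by apply: bm_sum => l; exact: bF.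
  have bd (l : nat) : bm (fun w => `|F N l w - phi l|) by apply/bm_abs/bmB; [exact: bF|exact: bm_cst].
  have bsd : bm (fun w => \sum_(l < L) `|F N l w - phi l|) by apply: bm_sum.
  have bu : bm (fun w => (uc N w)%:R * \sum_(l < M N) F N l w) by apply: bmM; [exact: bm_ind|apply: bm_sum => l; exact: bF].
  have bn : bm (fun w => (~~ uc N w)%:R : R) by apply: bm_ind; exact: md_neg.
  rewrite -[s L](Ex_cst P) /u -ExB //; last exact: bm_cst.
  apply: le_trans (Ex_abs P (bmB bu (bm_cst _ _))) _.
  have -> : \sum_(l < L) Ex P (fun w => `|F N l w - phi l|) = Ex P (fun w => \sum_(l < L) `|F N l w - phi l|) by rewrite Ex_sum.
  rewrite -ExZ // -ExD //; last by apply: bmM => //; exact: bm_cst.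
  rewrite -ExD //; last by apply: bmD => //; apply: bmM => //; exact: bm_cst.
  apply: Ex_le => [||w]; [by apply/bm_abs/bmB => //; exact: bm_cst|by apply: bmD => //; apply: bmD => //; apply: bmM => //; exact: bm_cst|].
  have Fp l : 0 <= F N l w by have /andP[] := F02 l w N0.
  have F2 l : F N l w <= 2 by have /andP[] := F02 l w N0.
  have sp : 0 <= \sum_(L <= l < M N) F N l w by apply: sumr_ge0.
  have h1 : `|\sum_(l < L) F N l w - s L| <= \sum_(l < L) `|F N l w - phi l|.
    by rewrite /s -sumrB; exact: ler_norm_sum.
  have h2 : \sum_(l < L) F N l w <= 2 * L%:R.
    apply: le_trans (_ : \sum_(l < L) 2 <= _); first by apply: ler_sum.
    by rewrite sumr_const card_ord mulr_natr.
  have h3 : 0 <= \sum_(l < L) F N l w by apply: sumr_ge0.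
  case: (uc N w); rewrite /= ?mulr1 ?mulr0 ?mul1r ?mul0r ?add0r.
    rewrite -(big_mkord xpredT (fun l => F N l w)) (big_cat_nat (n := L)) //= big_mkord addrAC.
    by apply: le_trans (ler_normD _ _) _; rewrite lerD // ger0_norm.
  have h4 : `|s L| <= `|\sum_(l < L) F N l w - s L| + \sum_(l < L) F N l w.
    have := ler_normD (\sum_(l < L) F N l w) (s L - \sum_(l < L) F N l w).
    by rewrite [_ + (_ - _)]addrC subrK (ger0_norm h3) distrC addrC.
  rewrite normrN; lra.
have := LS_add (LS_add (LS_scale _ uc0) (LS_sum (U := fun (l : 'I_L) N => Ex P (fun w => `|F N l w - phi l|)) (C := fun=> 0) (fun l => Flim l))) (hL L L0L).
move=> /(_ (2 * L%:R)); rewrite mulr0 big1 // !add0r; apply; exact: mulr_ge0.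
Qed.

(** Convergence of the series is part of the conclusion: two partial sums are both close to the same
    [u N], so they are close to each other. *)
Lemma series_limit : exists2 x, s L @[L --> \oo] --> x & LS (fun N => `|u N - x|) 0.
Proof.
have s_mono L L' : (L <= L')%N -> s L <= s L'.
  move=> LL; rewrite /s (big_ord_widen L' phi LL) [leRHS](bigID (fun l : 'I_L' => (l < L)%N)) /= lerDl.
  by apply: sumr_ge0 => l _; exact: L1_limit_ge0.
have cmp e : 0 < e -> exists L0, forall L L', (L0 <= L)%N -> (L0 <= L')%N -> `|s L - s L'| <= e.
  move=> e0; have e4 : 0 < e / 4 by lra.
  have [L0 hL] := near_partial e4; exists L0 => L L' h h'.
  have [N1 h1] := hL L h _ e4; have [N2 h2] := hL L' h' _ e4.
  have {}h1 := h1 (maxn N1 N2) (leq_maxl _ _); have {}h2 := h2 (maxn N1 N2) (leq_maxr _ _).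
  set x := u _ in h1 h2; have -> : s L - s L' = (x - s L') - (x - s L) by ring.
  by apply: le_trans (ler_normB _ _) _; lra.
have [B hB] := cmp 1 ltr01.
have sc : cvgn s.
  apply: nondecreasing_is_cvgn => //; exists (s B + 1) => _ [L _ <-].
  have := hB (maxn B L) B (leq_maxl _ _) (leqnn _); have := s_mono L (maxn B L) (leq_maxr _ _).
  by have := ler_norm (s (maxn B L) - s B); lra.
exists (limn s) => //; apply: LS_lim => e e0; rewrite add0r.
have e2 : 0 < e / 2 by lra.
have [L1 hL] := near_partial e2; have [L2 _ hs] := (cvgrPdist_le _ _).1 sc _ e2.
pose L := maxn L1 L2; have := hL L (leq_maxl _ _) => h; have := hs L (leq_maxr _ _) => h'.
apply: LS_le (_ : LS (fun N => `|u N - s L| + e / 2) e).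
  exists 0%N => N _; have -> : u N - limn s = (u N - s L) - (limn s - s L) by ring.
  by apply: le_trans (ler_normB _ _) _; rewrite lerD2l.
rewrite [X in LS _ X](_ : e = e / 2 + e / 2); last by field.
by apply: LS_add => //; apply: LS_cst.
Qed.

End SeriesLimit.

(** * Uniform summability over the levels *)

Section TailEstimate.
Context d (Om : measurableType d) (R : realType) (P : probability Om R).
Variables (N K : nat) (I : Om -> inp R) (Gbar : R -> R) (H hor : R) (Cv Cs : nat -> set (set Om)).
Hypothesis core : core_spec P N K I Gbar H hor Cv Cs.
Hypothesis hor0 : 0 <= hor.
Let M := (K * N + K)%N.
Let n : R := N%:R.
Let n0 : 0 < n. Proof. by rewrite ltr0n (c_N0 core). Qed.
Let vI w : valid (I w) := c_valid core w.
Let mI := c_minp core.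

Let early k w := (K * N <= k)%N && (tau (I w) k <= hor).
Let share L w : R := Num.min 1 (njobs (I w) N M / L%:R).

Let bm_early k : bm (fun w => (early k w)%:R : R).
Proof.
by apply: bm_ind; apply: md_and; [exact: md_cst|apply: md_ler; [exact: meas_tau|exact: measurable_cst]].
Qed.

Let bm_share L : bm (share L).
Proof. by apply: bm_min; [exact: bm_cst|apply: bmM; [exact: (bm_njobs core)|exact: bm_cst]]. Qed.

Let njobs_ge0 w : 0 <= njobs (I w) N M. Proof. by rewrite divr_ge0. Qed.

(** Every queue of length at least [L] holds [L] jobs, which bounds the share of such queues; the
    square of a share is at most the share. *)
Let Sn_share L k w : (0 < L)%N -> (k < M)%N -> ((Sn N (I w) k L)%:R / n) ^+ 2 <= share L w.
Proof.
move=> L0 kM; have L0' : 0 < L%:R :> R by rewrite ltr0n.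
have s0 : 0 <= (Sn N (I w) k L)%:R / n by rewrite divr_ge0 // ltW.
have s1 : (Sn N (I w) k L)%:R / n <= 1 by rewrite ler_pdivrMr // mul1r ler_nat cnt_le.
rewrite le_min exprn_ile1 //= expr2; apply: le_trans (ler_piMl s0 s1) _.
rewrite ler_pdivlMr // mulrAC ler_pM2r ?invr_gt0 // -natrM ler_nat mulnC /Sn.
apply: leq_trans (_ : \sum_(i < N) X (I w) k i (tau (I w) k) <= _)%N.
  rewrite /cnt big_distrr /=; apply: leq_sum => i _; by case: (leqP L (X (I w) k i (tau (I w) k))) => h; rewrite ?muln0 ?muln1.
rewrite (sum_cnt_fiber k N (srv (I w)) (fun i j => tau (I w) k < cpl (I w) j)).
apply: leq_trans (leq_cnt_widen _ (ltnW kM)); apply: leq_cnt => j _ /andP[] //.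
Qed.

(** To meet [L] jobs, both samples must hit queues of length at least [L]: the probabilities [prt]
    over the levels from [L] on telescope to the square of the share of such queues. *)
Let arrival_level L k : (0 < L)%N -> (K * N <= k < M)%N ->
  Ex P (fun w => [&& early k w & (L <= lvl (I w) k)%N]%:R) <= Ex P (fun w => (early k w)%:R * share L w).
Proof.
move=> L0 kM; have /andP[Kk kM'] := kM.
pose A := fun l => fun (k i : nat) (J : inp R) => X J k i (tau J k) == l.
have Am l a i : mfd (A l a i).
  move=> d' S J mJ; apply: (md_comp (eq_op^~ l)); apply: md_X => //; [exact: md_cst|exact: meas_tau].
have Ap l a i J J' : hist J a = hist J' a -> (forall j, tau J j = tau J' j) -> A l a i J = A l a i J'.
  by move=> e et; rewrite /A et (hist_X _ _ e).
have Al l a i J : A l a i J -> X J a i (tau J a) = l by move/eqP.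
pose c (J : inp R) : R := (tau J k <= hor)%R%:R.
have mc : mfm c by move=> d' S J mJ; apply: bm_ind; apply: md_ler; [exact: meas_tau|exact: measurable_cst].
have ch w : hor < tau (I w) k -> c (I w) = 0 by rewrite /c ltNge => /negbTE ->.
have cp J J' : hist J k = hist J' k -> (forall i, tau J i = tau J' i) -> c J = c J' by move=> _ et; rewrite /c et.
have bc : bm (fun w => c (I w)) by exact: mc.
have ba l : bm (fun w => c (I w) * (A l k (srv (I w) k) (I w))%:R).
  by apply: bmM => //; apply: bm_ind; apply: (md_comp (eq_op^~ l)); exact: md_lvl.
have bp l : bm (fun w => c (I w) * prt N (A l) l k (I w)) by apply: bmM => //; exact: (mfm_prt N l (Am l) k mI).
rewrite (@eq_Ex _ _ _ _ _ (fun w => \sum_(L <= l < M) c (I w) * (A l k (srv (I w) k) (I w))%:R)); last first.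
  move=> w; rewrite -mulr_sumr /early Kk -mulnb natrM /c; congr (_ * _).
  have lM : (lvl (I w) k < M)%N by apply: leq_ltn_trans kM'; exact: cnt_le.
  rewrite -natr_sum; congr (_%:R).
  rewrite -[X in _ = X](_ : (\sum_(L <= l < M) (lvl (I w) k == l) = _)%N) //.
  case: leqP => h.
    rewrite (bigD1_seq (lvl (I w) k)) ?mem_index_iota ?h ?lM ?iota_uniq //= eqxx big1 ?addn0 // => l.
    by rewrite eq_sym => /negbTE ->.
  rewrite big_nat_cond big1 // => l /andP[/andP[Ll _] _].
  by rewrite (_ : (_ == l) = false) //; apply/negbTE; rewrite neq_ltn (leq_trans h Ll).
rewrite Ex_sum // (eq_bigr (fun l => Ex P (fun w => c (I w) * prt N (A l) l k (I w)))) => [|l _]; last first.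
  exact: (route_mean core (Am l) (Ap l) (Al l) kM mc ch cp).
rewrite -Ex_sum //; apply: Ex_le => [||w]; [exact: bm_sum|exact: bmM|].
rewrite -mulr_sumr {1}/early Kk /= /c; case: (_ <= hor); rewrite ?mul0r // !mul1r.
apply: le_trans (Sn_share w L0 kM').
have pE l : prt N (A l) l k (I w) = ((Sn N (I w) k l)%:R / n) ^+ 2 - ((Sn N (I w) k l.+1)%:R / n) ^+ 2.
  have e : Sn N (I w) k l = (cnt N (fun i => A l k i (I w)) + Sn N (I w) k l.+1)%N.
    rewrite /Sn (cnt_split N (fun i => (l <= X (I w) k i (tau (I w) k))%N) (fun i => A l k i (I w))).
    congr (_ + _)%N; apply: eq_cnt => i _; rewrite /A; case: ltngtP; lia.
  by rewrite /prt e !natrD /n; field; rewrite gt_eqF.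
have [ML|LM] := leqP M L; first by rewrite big_geq // sqr_ge0.
rewrite -[X in X <= _]opprK -sumrN (eq_bigr (fun l => ((Sn N (I w) k l.+1)%:R / n) ^+ 2 - ((Sn N (I w) k l)%:R / n) ^+ 2)) => [|l _].
  by rewrite telescope_sumr ?(ltnW LM) // opprB lerBlDr lerDl sqr_ge0.
by rewrite pE opprB.
Qed.

Let lvl_lt w k : (k < K * N)%N -> (lvl (I w) k < (K * N).+1)%N.
Proof. by move=> h; apply: leq_trans (ltnW h); exact: cnt_le. Qed.

(** A job that met at least [L] others is initial or a true arrival. Both bounds inside [share] are
    used, [1] against the deviation of the arrivals from [Lam] and [njobs / L] against [Lam], so no
    product of random quantities needs a mean. *)
Lemma tail_est L B (Lam : R) : (0 < L)%N -> 0 <= Lam ->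
  Ex P (fun w => \sum_(L <= l < B) yb (I w) N M l.+1 hor None) <=
  \sum_(L <= l < (K * N).+1) Ex P (fun w => i0b (I w) N K l None) +
  (Ex P (fun w => `|dA (I w) N K 0 hor - Lam|) + Lam * (Ex P (fun w => njobs (I w) N M) / L%:R)).
Proof.
move=> L0 Lam0.
pose b w : R := \sum_(k < M) n^-1 * [&& early k w & (L <= lvl (I w) k)%N]%:R.
have be k : bm (fun w => [&& early k w & (L <= lvl (I w) k)%N]%:R : R).
  apply: bm_ind; apply: md_and; last by apply: (md_comp (fun l => (L <= l)%N)); exact: md_lvl.
  by apply: md_and; [exact: md_cst|apply: md_ler; [exact: meas_tau|exact: measurable_cst]].
have bb : bm b by apply: bm_sum => k; apply: bmM => //; exact: bm_cst.
have bi l : bm (fun w => i0b (I w) N K l None) by exact: (bm_i0b core).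
have by_ : bm (fun w => \sum_(L <= l < B) yb (I w) N M l.+1 hor None) by apply: bm_sum => l; exact: (bm_yb core).
apply: le_trans (_ : Ex P (fun w => \sum_(L <= l < (K * N).+1) i0b (I w) N K l None + b w) <= _).
  apply: Ex_le => // [|w]; first by apply: bmD => //; exact: bm_sum.
  set m := arrd (I w) M hor.
  have vd j : (j < M)%N -> (j < m)%N = (tau (I w) j <= hor) by exact: arrd_val.
  have mM : (m <= M)%N by exact: arrd_le.
  have := @tail_bound R (I w) N m hor L B.
  move=> tb; have {}tb := tb (fun k km => etrans (esym (vd k (leq_trans km mM))) km).
  apply: le_trans (_ : (cnt m (fun k => (srv (I w) k < N)%N && (L <= lvl (I w) k)%N))%:R / n <= _).
    by rewrite -mulr_suml ler_pM2r ?invr_gt0 // -natr_sum ler_nat.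
  rewrite (cnt_ge _ (arrd_init core w hor0)) natrD mulrDl; apply: lerD.
    rewrite -mulr_suml ler_pM2r ?invr_gt0 // -natr_sum ler_nat /arrY /cnt exchange_big /=.
    apply: leq_sum => k _; case sk: (srv (I w) k < N)%N => //=; case: (leqP L (lvl (I w) k)) => //= h.
    rewrite (bigD1_seq (lvl (I w) k)) ?mem_index_iota ?h ?lvl_lt ?iota_uniq //= eqxx; lia.
  rewrite /b -mulr_sumr mulrC ler_pM2l ?invr_gt0 // -natr_sum ler_nat.
  rewrite -[X in (_ <= X)%N]/(cnt M (fun k => early k w && (L <= lvl (I w) k)%N)).
  apply: leq_trans (leq_cnt_widen _ mM); apply: leq_cnt => k km /and3P[h1 _ h2].
  by rewrite /early h1 h2 -vd ?km // (leq_trans km).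
rewrite ExD //; last exact: bm_sum.
rewrite Ex_sum // lerD2l.
have bs := bm_share L.
have bes k : bm (fun w => (early k w)%:R * share L w) by exact: bmM.
apply: le_trans (_ : Ex P (fun w => \sum_(k < M) n^-1 * ((early k w)%:R * share L w)) <= _).
  rewrite /b !Ex_sum; [|by move=> k; apply: bmM => //; exact: bm_cst|by move=> k; apply: bmM => //; exact: bm_cst].
  apply: ler_sum => k _; rewrite !ExZ // ler_pM2l ?invr_gt0 //.
  have [Kk|kK] := leqP (K * N) k; first by apply: arrival_level; rewrite ?Kk /=.
  apply: Ex_le => // w; by rewrite /early leqNgt kK /= mul0r.
have bd : bm (fun w => `|dA (I w) N K 0 hor - Lam|) by apply/bm_abs/bmB; [exact: (bm_dA core)|exact: bm_cst].
have bj : bm (fun w => njobs (I w) N M) by exact: (bm_njobs core).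
rewrite [X in Lam * X]mulrC -!ExZ //; last by apply: bmM => //; exact: bm_cst.
rewrite -ExD //; last by apply: bmM; [exact: bm_cst|apply: bmM => //; exact: bm_cst].
apply: Ex_le => [||w]; [by apply: bm_sum => k; apply: bmM => //; exact: bm_cst|by apply: bmD => //; apply: bmM; [exact: bm_cst|apply: bmM => //; exact: bm_cst]|].
rewrite -mulr_sumr -mulr_suml mulrA.
have -> : n^-1 * \sum_(k < M) (early k w)%:R = dA (I w) N K 0 hor.
  rewrite /dA mulrC -natr_sum; congr (_%:R / _); apply: eq_bigr => k _; rewrite /early.
  by case Kk : (K * N <= k)%N => //=; rewrite (c_tau core).
have s0 : 0 <= share L w by rewrite le_min ler01 divr_ge0.
have s1 : share L w <= 1 by rewrite ge_min lexx.
have sj : share L w <= L%:R^-1 * njobs (I w) N M by rewrite ge_min; apply/orP; right; rewrite mulrC.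
have := ler_norm (dA (I w) N K 0 hor - Lam).
set D := `|_|; have D0 : 0 <= D by exact: normr_ge0.
move=> h; apply: le_trans (_ : (D + Lam) * share L w <= _); first by apply: ler_wpM2r => //; lra.
by rewrite mulrDl; apply: lerD; [exact: ler_piMr|exact: ler_wpM2l].
Qed.

End TailEstimate.

(** * Convergence of the mean waiting time of the capped systems *)

Section WaitLimit.
Context d (Om : measurableType d) (R : realType) (P : probability Om R).
Variables (K : nat -> nat) (I : nat -> Om -> inp R) (G g : R -> R) (H T : R) (Cv Cs : nat -> nat -> set (set Om)).
Hypothesis sd : service_dist G g H.
Let Gbar (x : R) := 1 - G x.
Hypothesis core : forall N, (0 < N)%N -> core_spec P N (K N) (I N) Gbar H T (Cv N) (Cs N).
Hypothesis T0 : 0 <= T.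
Hypothesis KN : forall N, (N <= K N)%N.
Variables (uc : nat -> Om -> bool) (Z : nat -> R -> R) (C Lam D : R) (pl : nat -> R).
Let M N := (K N * N + K N)%N.
Let y N l ox w := yb (I N w) N (M N) l T ox.
Hypothesis Ylim : forall l r, (0 < l)%N -> 0 <= r -> LS (fun N => Ex P (fun w => `|y N l (Some (T + r)) w - Z l r|)) 0.
Hypothesis muc : forall N, (0 < N)%N -> md (uc N).
Hypothesis uc0 : LS (fun N => Ex P (fun w => (~~ uc N w)%:R)) 0.
Hypothesis C0 : 0 <= C.
Hypothesis hJ : forall N, (0 < N)%N -> Ex P (fun w => njobs (I N w) N (M N)) <= C.
Hypothesis Lam0 : 0 <= Lam.
Hypothesis hA : LS (fun N => Ex P (fun w => `|dA (I N w) N (K N) 0 T - Lam|)) 0.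
Hypothesis pl0 : forall l, 0 <= pl l.
Hypothesis hp : forall N l, (0 < N)%N -> Ex P (fun w => i0b (I N w) N (K N) l None) <= pl l.+1.
Hypothesis pltail : forall e, 0 < e -> exists L, forall B, \sum_(L <= l < B) pl l.+1 <= e.
Hypothesis hD : forall N r, (0 < N)%N -> 0 <= r -> Ex P (y N 1 (Some (T + r))) <= D * Gbar r.

Let NM N : (N <= M N)%N. Proof. by apply: leq_trans (KN N) (leq_addl _ _). Qed.
Let by_ N l ox : (0 < N)%N -> bm (y N l ox). Proof. by move=> N0; exact: (bm_yb (core N0)). Qed.
Let y01 N l ox w : 0 <= y N l ox w <= 1. Proof. exact: Yh01. Qed.

Let y_mono N l l' ox ox' w : (l <= l')%N -> (forall m i, res (I N w) m i T ox' -> res (I N w) m i T ox) -> y N l' ox' w <= y N l ox w.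
Proof.
move=> ll h; rewrite /y /yb /Yh; apply: ler_wpM2r; first by rewrite invr_ge0.
by rewrite ler_nat; apply: leq_cnt => i _ /andP[h1 h2]; rewrite (leq_trans ll h1) h.
Qed.

Let y_level N l ox w : y N l.+1 ox w <= y N l ox w. Proof. by apply: y_mono. Qed.
Let y_left N l ox w : y N l ox w <= y N l None w. Proof. by apply: y_mono. Qed.
Let y_time N l r r' w : r <= r' -> y N l (Some (T + r')) w <= y N l (Some (T + r)) w.
Proof.
move=> rr; apply: y_mono => // m i /= /cnt_gt0P[j jm /and3P[h1 h2 h3]]; apply/cnt_gt0P; exists j => //.
by rewrite h1 h2 (le_lt_trans _ h3) // lerD2l.
Qed.

Let y_None N l w : (0 < N)%N -> (0 < l)%N -> y N l None w = y N l (Some (T + 0)) w.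
Proof. by move=> N0 l0; rewrite addr0; apply: yb_None => //; exact: (c_valid (core N0)). Qed.

Let Ylim0 l : (0 < l)%N -> LS (fun N => Ex P (fun w => `|y N l None w - Z l 0|)) 0.
Proof.
move=> l0; apply: LS_le (Ylim l0 (lexx 0)); exists 1%N => N N0.
by rewrite le_eqVlt; apply/orP; left; apply/eqP/eq_Ex => w; rewrite y_None.
Qed.

Let L1_cmp (f f' : nat -> Om -> R) c c' : (forall N, (0 < N)%N -> bm (f N)) -> (forall N, (0 < N)%N -> bm (f' N)) ->
  LS (fun N => Ex P (fun w => `|f N w - c|)) 0 -> LS (fun N => Ex P (fun w => `|f' N w - c'|)) 0 ->
  (forall N w, (0 < N)%N -> f N w <= f' N w) -> c <= c'.
Proof.
move=> bf bf' h h' ff; rewrite leNgt; apply/negP => cc; have e0 : 0 < (c - c') / 3 by lra.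
have [N1 h1] := h _ e0; have [N2 h2] := h' _ e0.
pose N := maxn 1 (maxn N1 N2); have N0 : (0 < N)%N by rewrite /N leq_max.
have {}h1 := h1 N; have {}h2 := h2 N; rewrite /N !leq_max !leqnn !orbT in h1 h2.
have {}h1 := h1 isT; have {}h2 := h2 isT; rewrite -/N in h1 h2.
have b1 : bm (fun w => `|f N w - c|) by apply/bm_abs/bmB; [exact: bf|exact: bm_cst].
have b2 : bm (fun w => `|f' N w - c'|) by apply/bm_abs/bmB; [exact: bf'|exact: bm_cst].
have : c - c' <= Ex P (fun w => `|f N w - c|) + Ex P (fun w => `|f' N w - c'|).
  rewrite -[X in X <= _](Ex_cst P) -ExD //; apply: Ex_le => [||w]; [exact: bm_cst|exact: bmD|].
  have := ff N w N0; have := ler_norm (- (f N w - c)); rewrite normrN; have := ler_norm (f' N w - c'); lra.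
lra.
Qed.

Let cst_lim (c : R) : LS (fun N : nat => Ex P (fun w : Om => `|c - c|)) 0.
Proof. by move=> e e0; exists 0%N => N _; rewrite subrr normr0 Ex_cst add0r ltW. Qed.

Let bmc (c : R) : forall N, (0 < N)%N -> bm (fun _ : Om => c). Proof. by move=> *; exact: bm_cst. Qed.
Let byr l r : forall N, (0 < N)%N -> bm (y N l (Some (T + r))). Proof. by move=> N N0; exact: by_. Qed.

Let Z01 l r : (0 < l)%N -> 0 <= r -> 0 <= Z l r <= 1.
Proof.
move=> l0 r0; apply/andP; split.
  by apply: (L1_cmp (bmc 0) (byr l r) (cst_lim 0) (Ylim l0 r0)) => N w _; have /andP[] := y01 N l (Some (T + r)) w.
by apply: (L1_cmp (byr l r) (bmc 1) (Ylim l0 r0) (cst_lim 1)) => N w _; have /andP[] := y01 N l (Some (T + r)) w.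
Qed.

Let Z_level l r : (0 < l)%N -> 0 <= r -> Z l.+1 r <= Z l r.
Proof.
move=> l0 r0; exact: (L1_cmp (byr l.+1 r) (byr l r) (Ylim (ltn0Sn l) r0) (Ylim l0 r0) (fun N w _ => y_level N l _ w)).
Qed.

Let Z_time l r r' : (0 < l)%N -> 0 <= r -> r <= r' -> Z l r' <= Z l r.
Proof.
move=> l0 r0 rr; have r'0 := le_trans r0 rr.
exact: (L1_cmp (byr l r') (byr l r) (Ylim l0 r'0) (Ylim l0 r0) (fun N w _ => y_time N l w rr)).
Qed.

Let tailS e : 0 < e -> exists L0, forall L, (L0 <= L)%N -> LS (fun N => Ex P (fun w => \sum_(L <= l < M N) y N l.+1 None w)) e.
Proof.
move=> e0; have e2 : 0 < e / 2 by lra.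
have [L1 hL] := pltail e2.
pose q := Lam * C / (e / 2).
have q0 : 0 <= q by rewrite divr_ge0 ?mulr_ge0 // ltW.
pose L2 := (Num.Def.truncn q).+1.
exists (maxn L1 L2) => L; rewrite geq_max => /andP[L1L L2L].
have L0 : (0 < L)%N by apply: leq_trans L2L.
have L0' : 0 < L%:R :> R by rewrite ltr0n.
apply: (@LS_le _ _ (fun N => Ex P (fun w => `|dA (I N w) N (K N) 0 T - Lam|) + e)); last first.
  by rewrite -[X in LS _ X]add0r; apply: LS_add => //; exact: LS_cst.
exists 1%N => N N0; apply: le_trans (tail_est (core N0) T0 _ L0 Lam0) _.
have h1 : \sum_(L <= l < (K N * N).+1) Ex P (fun w => i0b (I N w) N (K N) l None) <= e / 2.
  apply: le_trans (_ : \sum_(L <= l < (K N * N).+1) pl l.+1 <= _); first by apply: ler_sum => l _; exact: hp.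
  have [h|h] := leqP (K N * N).+1 L; first by rewrite big_geq // ltW.
  apply: le_trans (hL (K N * N).+1); rewrite [leRHS](big_cat_nat (n := L)) //=; last exact: ltnW.
  by rewrite lerDr sumr_ge0.
have h2 : Lam * (Ex P (fun w => njobs (I N w) N (M N)) / L%:R) <= e / 2.
  rewrite mulrA ler_pdivrMr //; apply: le_trans (ler_wpM2l Lam0 (hJ N0)) _.
  rewrite [leRHS]mulrC -ler_pdivrMr //; apply: le_trans (_ : L2%:R <= _); last by rewrite ler_nat.
  by apply/ltW; exact: truncnS_gt.
lra.
Qed.

Let lim_waiting : exists2 x, (\sum_(l < L) Z l.+2 0 ^+ 2) @[L --> \oo] --> x &
  LS (fun N => `|Ex P (fun w => (uc N w)%:R * waiting_part N (M N) T (I N w)) - x|) 0.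
Proof.
apply: (series_limit (F := fun N l w => y N l.+2 None w ^+ 2) (phi := fun l => Z l.+2 0 ^+ 2) NM muc uc0) => [N l N0|N l w N0|l|e e0].
- by apply: bmX; exact: by_.
- have /andP[h1 h2] := y01 N l.+2 None w; rewrite sqr_ge0 /=.
  by apply: le_trans (exprn_ile1 2 h1 h2) _; lra.
- have /andP[z0 z1] := Z01 (ltn0Sn l.+1) (lexx 0).
  have := LS_scale (ler0n R 2) (Ylim0 (ltn0Sn l.+1)); rewrite mulr0; apply: LS_le; exists 1%N => N N0.
  rewrite -ExZ; last by apply/bm_abs/bmB; [exact: by_|exact: bm_cst].
  apply: Ex_le => [||w]; [by apply/bm_abs/bmB; [apply: bmX; exact: by_|exact: bm_cst]|by apply: bmM; [exact: bm_cst|apply/bm_abs/bmB; [exact: by_|exact: bm_cst]]|].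
  have /andP[h1 h2] := y01 N l.+2 None w.
  rewrite subr_sqr normrM mulrC; apply: ler_wpM2r => //.
  by rewrite ger0_norm ?addr_ge0 //; lra.
have [L0 hL] := tailS e0; exists L0 => L /hL; apply: LS_le; exists 1%N => N N0.
apply: Ex_le => [||w]; [by apply: bm_sum => l; apply: bmX; exact: by_|by apply: bm_sum => l; exact: by_|].
apply: ler_sum => l _; have /andP[h1 h2] := y01 N l.+2 None w; rewrite expr2.
by apply: le_trans (ler_piMl h1 h2) _; exact: y_level.
Qed.

Let F r N l w := (y N l.+1 None w + y N l.+2 None w) * (y N l.+1 (Some (T + r)) w - y N l.+2 (Some (T + r)) w).
Let phi r l := (Z l.+1 0 + Z l.+2 0) * (Z l.+1 r - Z l.+2 r).

Let F0 r N l w : 0 <= F r N l w.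
Proof.
have /andP[h1 h2] := y01 N l.+1 None w; have /andP[h3 h4] := y01 N l.+2 None w.
by apply: mulr_ge0; [exact: addr_ge0|rewrite subr_ge0].
Qed.

Let F2 r N l w : F r N l w <= 2 * (y N l.+1 (Some (T + r)) w - y N l.+2 (Some (T + r)) w).
Proof.
have /andP[h1 h2] := y01 N l.+1 None w; have /andP[h3 h4] := y01 N l.+2 None w.
by apply: ler_wpM2r; [rewrite subr_ge0|lra].
Qed.

Let bF r N l : (0 < N)%N -> bm (F r N l).
Proof. by move=> N0; apply: bmM; [apply: bmD|apply: bmB]; exact: by_. Qed.

Let lim_serving r : 0 <= r -> exists2 x, (\sum_(l < L) phi r l) @[L --> \oo] --> x &
  LS (fun N => `|Ex P (fun w => (uc N w)%:R * serving_part N (M N) T (I N w) (T + r)) - x|) 0.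
Proof.
move=> r0; apply: (series_limit (F := F r) (phi := phi r) NM muc uc0) => [N l N0|N l w N0|l|e e0].
- exact: bF.
- rewrite F0 /=; apply: le_trans (F2 _ _ _ _) _.
  have /andP[h1 h2] := y01 N l.+1 (Some (T + r)) w; have /andP[h3 h4] := y01 N l.+2 (Some (T + r)) w; lra.
- have /andP[z0 z1] := Z01 (ltn0Sn l) (lexx 0); have /andP[z2 z3] := Z01 (ltn0Sn l.+1) (lexx 0).
  have := LS_scale (ler0n R 2) (LS_add (LS_add (Ylim0 (ltn0Sn l)) (Ylim0 (ltn0Sn l.+1))) (LS_add (Ylim (ltn0Sn l) r0) (Ylim (ltn0Sn l.+1) r0))).
  rewrite !addr0 mulr0; apply: LS_le; exists 1%N => N N0.
  have b (l' : nat) ox c : bm (fun w => `|y N l' ox w - c|) by apply/bm_abs/bmB; [exact: by_|exact: bm_cst].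
  rewrite -!ExD //; [|exact: bmD|exact: bmD].
  rewrite -ExZ; last by apply: bmD; exact: bmD.
  apply: Ex_le => [||w]; [by apply/bm_abs/bmB; [exact: bF|exact: bm_cst]|by apply: bmM; [exact: bm_cst|apply: bmD; exact: bmD]|].
  rewrite /F /phi; set a := y N l.+1 None w; set b' := y N l.+2 None w; set c := y N l.+1 _ w; set e := y N l.+2 _ w.
  set a1 := Z l.+1 0; set b1 := Z l.+2 0; set c1 := Z l.+1 r; set e1 := Z l.+2 r.
  have -> : (a + b') * (c - e) - (a1 + b1) * (c1 - e1) = ((a - a1) + (b' - b1)) * (c - e) + (a1 + b1) * ((c - c1) - (e - e1)) by ring.
  have /andP[h1 h2] := y01 N l.+1 (Some (T + r)) w; have /andP[h3 h4] := y01 N l.+2 (Some (T + r)) w.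
  have k1 : `|c - e| <= 2 by apply: le_trans (ler_normB _ _) _; rewrite !ger0_norm // /c /e; lra.
  have k2 : `|a1 + b1| <= 2 by rewrite ger0_norm ?addr_ge0 // /a1 /b1; lra.
  apply: le_trans (ler_normD _ _) _; rewrite !normrM [X in _ <= X]mulrDr; apply: lerD.
    rewrite mulrC; apply: ler_pM => //; exact: ler_normD.
  apply: ler_pM => //; exact: ler_normB.
have e2 : 0 < e / 2 by lra.
have [L0 hL] := tailS e2; exists L0 => L /hL h.
have := LS_scale (ler0n R 2) h; rewrite (_ : 2 * (e / 2) = e); last by field.
apply: LS_le; exists 1%N => N N0; rewrite -ExZ; last by apply: bm_sum => l; exact: by_.
apply: Ex_le => [||w]; [by apply: bm_sum => l; exact: bF|by apply: bmM; [exact: bm_cst|apply: bm_sum => l; exact: by_]|].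
rewrite mulr_sumr; apply: ler_sum => l _; apply: le_trans (F2 _ _ _ _) _; apply: ler_wpM2l => //.
have /andP[h3 _] := y01 N l.+2 (Some (T + r)) w; have := y_left N l.+1 (Some (T + r)) w; lra.
Qed.

Let u N r := Ex P (fun w => (uc N w)%:R * serving_part N (M N) T (I N w) (T + r)).

(** Bounding the first factor by [2] makes the sum over levels telescope to the share of servers
    whose job in service lasts beyond [T + r], which [hD] dominates by a multiple of [Gbar]. *)
Let u_dom N r : (0 < N)%N -> 0 <= r -> 0 <= u N r <= 2 * D * Gbar r.
Proof.
move=> N0 r0; apply/andP; split.
  by apply: Ex_ge0 => w; apply: mulr_ge0 => //; apply: sumr_ge0 => l _; exact: F0.
rewrite -mulrA; apply: le_trans (ler_wpM2l (ler0n R 2) (hD N0 r0)); rewrite -ExZ; last exact: by_.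
apply: Ex_le => [||w]; [by apply: bmM; [apply: bm_ind; exact: muc|apply: bm_sum => l; exact: bF]|by apply: bmM; [exact: bm_cst|exact: by_]|].
apply: le_trans (_ : serving_part N (M N) T (I N w) (T + r) <= _).
  by case: (uc N w); rewrite ?mul1r ?mul0r //; apply: sumr_ge0 => l _; exact: F0.
apply: le_trans (_ : \sum_(l < M N) 2 * (y N l.+1 (Some (T + r)) w - y N l.+2 (Some (T + r)) w) <= _).
  by apply: ler_sum => l _; exact: F2.
rewrite -mulr_sumr; apply: ler_wpM2l => //.
have tele B : \sum_(l < B) (y N l.+1 (Some (T + r)) w - y N l.+2 (Some (T + r)) w) = y N 1 (Some (T + r)) w - y N B.+1 (Some (T + r)) w.
  elim: B => [|B IH]; first by rewrite big_ord0 subrr.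
  by rewrite big_ord_recr /= IH addrA subrK.
by rewrite tele; have /andP[h3 _] := y01 N (M N).+1 (Some (T + r)) w; lra.
Qed.

Let D0 : measurable (`[0%R, +oo[%classic : set R). Proof. by []. Qed.

(** Every piece is monotone in [r], hence measurable; their difference need not be monotone. *)
Let mu_ N : (0 < N)%N -> measurable_fun (`[0%R, +oo[%classic : set R) (u N).
Proof.
move=> N0; pose a l l' r := Ex P (fun w => (uc N w)%:R * ((y N l.+1 None w + y N l.+2 None w) * y N l' (Some (T + r)) w)).
have ba l l' r : bm (fun w => (uc N w)%:R * ((y N l.+1 None w + y N l.+2 None w) * y N l' (Some (T + r)) w)).
  by apply: bmM; [apply: bm_ind; exact: muc|apply: bmM; [apply: bmD|]; exact: by_].
have ma l l' : measurable_fun (`[0%R, +oo[%classic : set R) (a l l').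
  apply: nonincreasing_measurable => // r r' rr; apply: Ex_le => // w.
  apply: ler_wpM2l => //; apply: ler_wpM2l; last exact: y_time.
  by have /andP[h1 _] := y01 N l.+1 None w; have /andP[h2 _] := y01 N l.+2 None w; rewrite addr_ge0.
have -> : u N = fun r => \sum_(l < M N) (a l l.+1 r - a l l.+2 r).
  apply/funext => r; rewrite /u (@eq_Ex _ _ _ _ _ (fun w => \sum_(l < M N) ((uc N w)%:R * ((y N l.+1 None w + y N l.+2 None w) * y N l.+1 (Some (T + r)) w) -
     (uc N w)%:R * ((y N l.+1 None w + y N l.+2 None w) * y N l.+2 (Some (T + r)) w)))); last first.
    by move=> w; rewrite mulr_sumr; apply: eq_bigr => l _; rewrite mulrBr mulrBr.
  by rewrite Ex_sum => [|l]; [apply: eq_bigr => l _; rewrite ExB|exact: bmB].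
by apply: measurable_sum => l; apply: measurable_funB.
Qed.

Let mZ l : (0 < l)%N -> measurable_fun (`[0%R, +oo[%classic : set R) (Z l).
Proof.
move=> l0; have h : measurable_fun (`[0%R, +oo[%classic : set R) (fun r => Z l (Num.max r 0)).
  apply: nonincreasing_measurable => // r r' rr; apply: Z_time => //; first by rewrite le_max lexx orbT.
  by rewrite ge_max !le_max rr lexx orbT.
apply: eq_measurable_fun h => r; rewrite inE /= in_itv /= andbT => r0; by rewrite max_l.
Qed.

(** Dominated convergence in [r] gives the limit in [N]; monotone convergence exchanges the series
    over levels with the integral. *)
Lemma wait_limit : exists w s2 : R, [/\ (\sum_(l < L) Z l.+2 0 ^+ 2) @[L --> \oo] --> w,
  ((fun n => \sum_(0 <= l < n) ((Z l.+1 0 + Z l.+2 0)%:E *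
    \int[@lebesgue_measure R]_(r in `[0%R, +oo[) (Z l.+1 r - Z l.+2 r)%:E)) @ \oo --> s2%:E)%E &
  ((fun N => \int[@lebesgue_measure R]_(r in `[0%R, +oo[) (u N.+1 r)%:E +
     (Ex P (fun w => (uc N.+1 w)%:R * waiting_part N.+1 (M N.+1) T (I N.+1 w)))%:E) @ \oo --> (w + s2)%:E)%E].
Proof.
have [w sw uw] := lim_waiting.
pose s r L := \sum_(l < L) phi r l.
pose A r := limn (s r).
have sA r : 0 <= r -> s r L @[L --> \oo] --> A r.
  by move=> r0; have [x h _] := lim_serving r0; apply: cvgP h.
have uA r : 0 <= r -> LS (fun N => `|u N r - A r|) 0.
  by move=> r0; have [x h k] := lim_serving r0; rewrite /A (cvg_lim _ h).
have uc_ r : 0 <= r -> u N.+1 r @[N --> \oo] --> A r.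
  move=> r0; apply/cvgrPdist_le => e e0; have [N0 h] := uA r r0 e e0.
  by exists N0 => // N /= hN; rewrite distrC; have := h N.+1 (leqW hN); rewrite add0r.
have phi0 r l : 0 <= r -> 0 <= phi r l.
  move=> r0; have /andP[z0 z1] := Z01 (ltn0Sn l) (lexx 0); have /andP[z2 z3] := Z01 (ltn0Sn l.+1) (lexx 0).
  by apply: mulr_ge0; [exact: addr_ge0|rewrite subr_ge0; exact: Z_level].
have ms L : measurable_fun (`[0%R, +oo[%classic : set R) (fun r => s r L).
  apply: measurable_sum => l; apply: measurable_funM; first exact: measurable_cst.
  by apply: measurable_funB; exact: mZ.
have mA : measurable_fun (`[0%R, +oo[%classic : set R) A.
  apply: (measurable_fun_cvg (h := fun L r => s r L)) => // r /=.
  by rewrite in_itv /= andbT => r0; exact: sA.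
have G0 r : 0 <= Gbar r by have := sd_G1 sd r; rewrite /Gbar; lra.
have iG : (@lebesgue_measure R).-integrable `[0%R, +oo[ (fun r => (2 * D * Gbar r)%:E).
  have iG0 : (@lebesgue_measure R).-integrable `[0%R, +oo[ (fun r => (Gbar r)%:E).
    apply/integrableP; split; first by apply/measurable_EFinP; apply: measurable_funTS; exact: (sd_Gm sd).
    under eq_integral => r _ do rewrite gee0_abs ?lee_fin //.
    by rewrite (sd_mean sd) ltry.
  have mD : measurable (`[0%R, +oo[%classic : set (@g_sigma_algebraType R (R.-ocitv.-measurable))) by exact: D0.
  exact: (integrableZl mD (2 * D) iG0).
have aeD (p : R -> Prop) : (forall r, 0 <= r -> p r) -> {ae @lebesgue_measure R, forall r, (`[0%R, +oo[%classic : set R) r -> p r}.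
  by move=> h; apply: aeW => r; rewrite /= in_itv /= andbT; exact: h.
have mE (f : R -> R) : measurable_fun (`[0%R, +oo[%classic : set R) f -> measurable_fun (`[0%R, +oo[%classic : set R) (fun r => (f r)%:E).
  by move=> h; apply/measurable_EFinP.
have [iA cA] : (@lebesgue_measure R).-integrable `[0%R, +oo[ (fun r => (A r)%:E) /\
    (fun N => \int[@lebesgue_measure R]_(r in `[0%R, +oo[) (u N.+1 r)%:E)%E @ \oo --> (\int[@lebesgue_measure R]_(r in `[0%R, +oo[) (A r)%:E)%E.
  have := @dominated_convergence _ _ _ (@lebesgue_measure R) `[0%R, +oo[%classic D0 (fun N r => (u N.+1 r)%:E) (fun r => (A r)%:E) (fun r => (2 * D * Gbar r)%:E).
  move=> /(_ (fun N => mE _ (mu_ (ltn0Sn N))) (mE _ mA)).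
  have uE r : 0 <= r -> (u N.+1 r)%:E @[N --> \oo] --> (A r)%:E by move=> r0; apply: cvg_EFin; [exact: nearW|exact: uc_].
  move=> /(_ (aeD _ uE) iG).
  case=> [|h1 _ h3]; last by split; [exact: h1|exact: h3].
  apply: aeW => r N; rewrite /= in_itv /= andbT => r0.
  by have /andP[k1 k2] := u_dom (ltn0Sn N) r0; rewrite lee_fin ger0_norm.
pose s2 := fine (\int[@lebesgue_measure R]_(r in `[0%R, +oo[) (A r)%:E)%E.
have s2E : (\int[@lebesgue_measure R]_(r in `[0%R, +oo[) (A r)%:E)%E = s2%:E.
  by rewrite /s2 fineK //; exact: integrable_fin_num.
exists w, s2; split => //.
  rewrite -s2E.
  have sE n : (\sum_(0 <= l < n) ((Z l.+1 0 + Z l.+2 0)%:E * \int[@lebesgue_measure R]_(r in `[0%R, +oo[) (Z l.+1 r - Z l.+2 r)%:E) =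
      \int[@lebesgue_measure R]_(r in `[0%R, +oo[) (s r n)%:E)%E.
    have Zp l r : (`[0%R, +oo[%classic : set R) r -> 0 <= Z l.+1 r - Z l.+2 r.
      by rewrite /= in_itv /= andbT => r0; rewrite subr_ge0; exact: Z_level.
    have mZZ l : measurable_fun (`[0%R, +oo[%classic : set R) (fun r => (Z l.+1 r - Z l.+2 r)%:E).
      by apply: mE; apply: measurable_funB; exact: mZ.
    rewrite (eq_bigr (fun l => \int[@lebesgue_measure R]_(r in `[0%R, +oo[) (phi r l)%:E)%E) => [|l _]; last first.
      rewrite -ge0_integralZl //; last 2 first.
      - by move=> r h; rewrite lee_fin; exact: Zp.
      - by have /andP[z0 _] := Z01 (ltn0Sn l) (lexx 0); have /andP[z2 _] := Z01 (ltn0Sn l.+1) (lexx 0); rewrite lee_fin addr_ge0.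
      exact: mZZ.
    rewrite big_mkord -ge0_integral_sum //; last 2 first.
    - by move=> l; apply: mE; apply: measurable_funM; [exact: measurable_cst|apply: measurable_funB; exact: mZ].
    - by move=> l r; rewrite /= in_itv /= andbT => r0; rewrite lee_fin; exact: phi0.
    by apply: eq_integral => r _; rewrite sumEFin.
  under eq_fun do rewrite sE.
  have := @cvg_monotone_convergence _ _ _ (@lebesgue_measure R) `[0%R, +oo[%classic D0 (fun n r => (s r n)%:E) (fun n => mE _ (ms n)).
  rewrite (_ : (\int[@lebesgue_measure R]_(r in `[0%R, +oo[) (A r)%:E)%E = (\int[@lebesgue_measure R]_(r in `[0%R, +oo[) (limn (fun n => (s r n)%:E)))%E); last first.
    apply: eq_integral => r; rewrite inE /= in_itv /= andbT => r0; apply/esym/cvg_lim => //.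
    by apply: cvg_EFin; [exact: nearW|exact: sA].
  apply.
  - by move=> n r; rewrite /= in_itv /= andbT => r0; rewrite lee_fin; apply: sumr_ge0 => l _; exact: phi0.
  - move=> r; rewrite /= in_itv /= andbT => r0 n n' nn; rewrite lee_fin /s (big_ord_widen n' (phi r) nn) [leRHS](bigID (fun l : 'I_n' => (l < n)%N)) /= lerDl.
    by apply: sumr_ge0 => l _; exact: phi0.
rewrite addrC EFinD; apply: cvgeD; rewrite -?s2E //.
  by rewrite s2E.
apply: cvg_EFin; first exact: nearW.
apply/cvgrPdist_le => e e0; have [N0 h] := uw e e0.
by exists N0 => // N /= hN; rewrite distrC; have := h N.+1 (leqW hN); rewrite add0r.
Qed.

End WaitLimit.

(** * Choice of the cap *)

Section BusyTail.
Context d (Om : measurableType d) (R : realType) (P : probability Om R).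
Variables (a : nat -> R) (lam G g : R -> R) (H : R) (nw : network R Om) (N : nat).
Hypothesis N0 : (0 < N)%N.
Hypothesis sd : service_dist G g H.
Hypothesis mdl : sq2_model P a lam G nw N.
Variables (K : nat) (T : R).
Hypotheses (K0 : (0 < K)%N) (T0 : 0 <= T).
Let Gbar (x : R) := 1 - G x.
Local Notation sysI := (sysI G nw N K T).

(** A job started by time [T] lasts beyond [T + r] with probability at most [Gbar r]. For a job in
    service at time [0] the survival probability is conditional on its age, which is below [A],
    hence the factor [1 / Gbar A]. *)
Lemma busy_tail (A r : R) : (forall w i, (i < N)%N -> (0 < X0 nw N w i)%N -> age0 nw N w i < A) -> 0 <= r ->
  Ex P (fun w => yb (sysI w) N (K * N + K) 1 T (Some (T + r))) <=
  Ex P (fun w => njobs (sysI w) N (K * N + K)) / Gbar A * Gbar r.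
Proof.
move=> ageA r0; set M := (K * N + K)%N.
have core := sysI_core N0 sd mdl K0 T0.
have vI w : valid (sysI w) := c_valid core w.
have mI : minp sysI := c_minp core.
have GA : 0 < Gbar A by exact: sd_Gpos sd A.
have Gr : 0 < Gbar r by exact: sd_Gpos sd r.
have GA1 : Gbar A <= 1 by rewrite /Gbar gerBl (sd_G0 sd).
pose pr (n : nat) (w : Om) : R := [&& (srv (sysI w) n < N)%N, sta (sysI w) n <= T & T + r < cpl (sysI w) n]%:R.
have bpr n : bm (pr n).
  by apply: bm_ind; apply: md_and; [exact: md_srv_lt'|apply: md_and; [apply: md_ler; [exact: meas_sta|exact: measurable_cst]|apply: md_ltr; [exact: measurable_cst|exact: meas_cpl]]].
have bs n : bm (fun w => (srv (sysI w) n < N)%N%:R : R) by apply: bm_ind; exact: md_srv_lt'.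
have key n : (n < M)%N -> Ex P (pr n) <= Ex P (fun w => (srv (sysI w) n < N)%N%:R) / Gbar A * Gbar r.
  move=> nM; have [nN|Nn] := ltnP n N.
    have Tr : 0 <= T + r by rewrite addr_ge0.
    apply: le_trans (_ : Ex P (fun w => [&& (srv (sysI w) n < N)%N & T + r < cpl (sysI w) n]%:R) <= _).
      apply: Ex_le => // [|w]; first by apply: bm_ind; apply: md_and; [exact: md_srv_lt'|apply: md_ltr => //; exact: meas_cpl].
      by rewrite /pr ler_nat; case: (_ < _)%N; case: (_ <= _); case: (_ < _).
    rewrite (init_survival N0 sd mdl) // -mulrA mulrC -ExZ //.
    apply: Ex_le => [||w]; [exact: (bm_init_survival sd mdl)|by apply: bmM => //; exact: bm_cst|].
    rewrite init_srv_lt //; case: ltnP => X0w; rewrite ?mul0r ?mulr0 // mul1r mulr1.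
    have ag := ltW (ageA w n nN X0w); have a0 := mdl_age mdl nN X0w.
    have Gp : 0 < Gbar (age0 nw N w n) by exact: (sd_Gpos sd).
    rewrite [leRHS]mulrC; apply: ler_pM => //.
    - exact/ltW/(sd_Gpos sd).
    - by rewrite invr_ge0 ltW.
    - by rewrite /Gbar lerB // (sd_Gmono sd) // addrA lerDr addr_ge0.
    - by rewrite lef_pV2 ?posrE // /Gbar lerB // (sd_Gmono sd).
  have nM' : (N <= n < M)%N by rewrite Nn.
  pose f (J : inp R) : R := ((srv J n < N)%N && (sta J n <= T))%:R.
  pose y (J : inp R) : R := T + r - sta J n.
  have mf : mfm f by move=> d' S J mJ; apply: bm_ind; apply: md_and; [exact: md_srv_lt'|apply: md_ler => //; exact: meas_sta].
  have my : mfr y by move=> d' S J mJ; apply: measurable_funB => //; exact: meas_sta.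
  have h := @coreV _ _ _ _ _ _ _ _ _ _ _ _ core n f y nM' mf my.
  rewrite (@eq_Ex _ _ _ _ _ (fun w => f (sysI w) * (y (sysI w) < sv (sysI w) n)%R%:R)); last first.
    by move=> w; rewrite /pr /f /y cplE ltrBlDl; case: (srv _ _ < _)%N; case: (_ <= _); rewrite ?mul0r ?mul1r.
  rewrite h; first last.
  - by move=> w; rewrite /y -setv_sta_self.
  - by move=> w; rewrite /f -setv_sta_self -setv_srv // tau_sta.
  have bsn := bs n; have bf := mf _ _ _ mI.
  apply: le_trans (_ : Ex P (fun w => Gbar r * f (sysI w)) <= _).
    apply: Ex_le => [||w].
    - by apply: bmM => //; exact: (@mfm_gbar _ _ _ _ _ _ _ _ _ _ _ _ core (T + r) n _ _ _ mI).
    - by apply: bmM => //; exact: bm_cst.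
    rewrite mulrC /f; case: (srv _ _ < _)%N; case: (leP (sta _ _) T) => /= hs; rewrite ?mulr0 // !mulr1.
    by rewrite /Gbar lerB // (sd_Gmono sd) // /y; lra.
  rewrite ExZ // mulrC; apply: ler_wpM2r; first exact: ltW.
  apply: le_trans (_ : Ex P (fun w => (srv (sysI w) n < N)%N%:R) <= _).
    by apply: Ex_le => // w; rewrite /f ler_nat; case: (_ < _)%N; case: (_ <= _).
  rewrite ler_peMr ?invf_ge1 //; exact: Ex_ge0.
have Mn w : njobs (sysI w) N M = N%:R^-1 * \sum_(n < M) (srv (sysI w) n < N)%N%:R.
  by rewrite /njobs mulrC /cnt natr_sum.
rewrite (eq_Ex P Mn) ExZ ?Ex_sum //; last exact: bm_sum.
apply: le_trans (_ : Ex P (fun w => N%:R^-1 * \sum_(n < M) pr n w) <= _).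
  apply: Ex_le => [||w]; [exact: (bm_yb core)|by apply: bmM; [exact: bm_cst|exact: bm_sum]|].
  rewrite /yb /Yh mulrC ler_wpM2l ?invr_ge0 // YnE //; last by lra.
  rewrite -natr_sum ler_nat -/(cnt M (fun n => [&& (srv (sysI w) n < N)%N, sta (sysI w) n <= T & T + r < cpl (sysI w) n])).
  apply: leq_trans (leq_cnt_widen _ (arrd_le (sysI w) M T)).
  by apply: leq_cnt => j _ /and4P[h1 h2 h3 _]; rewrite h1 h2 h3.
rewrite ExZ ?Ex_sum //; last exact: bm_sum.
rewrite -!mulrA ler_wpM2l ?invr_ge0 // mulr_suml; apply: ler_sum => n _.
by rewrite mulrA; exact: key.
Qed.
End BusyTail.

Section CapChoice.
Context d (Om : measurableType d) (R : realType) (P : probability Om R).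
Variables (a : nat -> R) (lam G g : R -> R) (H : R) (nw : network R Om) (N : nat).
Hypothesis N0 : (0 < N)%N.
Hypothesis sd : service_dist G g H.
Hypothesis mdl : sq2_model P a lam G nw N.
Variable T : R.
Hypothesis T0 : 0 <= T.
Let Gbar (x : R) := 1 - G x.
Let gm := @genm _ _ _ _ _ _ _ _ _ mdl [::].

Lemma regular_ae : {ae P, forall w, regular nw N w}.
Proof.
have null (p : Om -> bool) : md p -> P [set w | ~~ p w] = 0%E -> {ae P, forall w, p w}.
  by move=> mp p0; exists [set w | ~~ p w]; split => //; [apply: md_set; exact: md_neg|move=> w /= /negP].
have pos (V : Om -> R) : measurable_fun setT V -> (forall x, P [set w | V w <= x] = (G x)%:E) -> {ae P, forall w, 0 < V w}.
  move=> mV hV; apply: null; first exact: md_ltr.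
  rewrite (_ : [set w | _] = [set w | V w <= 0]) ?hV ?(sd_Gneg sd) //.
  by apply/seteqP; split => w /=; rewrite -leNgt.
have hw : {ae P, forall w i k, (i < N)%N -> 0 < wait0 nw N w i k}.
  apply: ae_foralln => i; apply: ae_foralln => k; have [iN|Ni] := ltnP i N; last by apply: aeW.
  apply: filterS (pos (fun w => wait0 nw N w i k) _ (mdl_wait mdl i k)) => //.
  exact: (sub_measurable_fun gm (@meas_wait _ _ _ nw N [::] i k (fun x => x))).
have hs : {ae P, forall w j, 0 < serv nw N j w}.
  apply: ae_foralln => j; apply: pos; last exact: (mdl_serv mdl).
  exact: (sub_measurable_fun gm (@meas_serv _ _ _ nw N [::] j (fun x => x))).
have smp f : md f -> (forall i, (i < N)%N -> P [set w | f w = i] = (N%:R^-1)%:E) -> {ae P, forall w, (f w < N)%N}.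
  by move=> mf hf; apply: null (smp_null N0 mf hf); exact: (md_comp (fun m => (m < N)%N)).
have h1 : {ae P, forall w j, (smp1 nw N j w < N)%N}.
  by apply: ae_foralln => j; apply: smp (mdl_smp1 mdl j); exact: (sub_md gm (@md_smp1 _ _ _ nw N [::] j (fun x => x))).
have h2 : {ae P, forall w j, (smp2 nw N j w < N)%N}.
  by apply: ae_foralln => j; apply: smp (mdl_smp2 mdl j); exact: (sub_md gm (@md_smp2 _ _ _ nw N [::] j (fun x => x))).
have hu : {ae P, forall w i, (i < N)%N -> 0 < unif0 nw N w i < 1}.
  apply: ae_foralln => i; have [iN|Ni] := ltnP i N; last by apply: aeW.
  have mu := sub_measurable_fun gm (@meas_unif _ _ _ nw N [::] i (fun x => x)).
  by apply: filterS (null _ _ (unif_null mu (mdl_unif mdl i))) => //; apply: md_and; exact: md_ltr.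
have f1 : {ae P, forall w, (fsmp1 nw N w < N)%N}.
  by apply: smp (mdl_fsmp1 mdl); exact: (sub_md gm (@md_fsmp1 _ _ _ nw N [::] (fun x => x))).
have f2 : {ae P, forall w, (fsmp2 nw N w < N)%N}.
  by apply: smp (mdl_fsmp2 mdl); exact: (sub_md gm (@md_fsmp2 _ _ _ nw N [::] (fun x => x))).
by apply: filterS (filterI hw (filterI hs (filterI (filterI h1 h2) (filterI hu (filterI f1 f2))))) => w [? [? [[? ?] [? [? ?]]]]].
Qed.

(** With the random cap [e] the capped wait is a measurable function almost surely equal to [vwait],
    and [truncation] applies to it. *)
Lemma cap_choice (c : R) (K1 : nat) : 0 < c -> (0 < K1)%N -> exists K, [/\ (K1 <= K)%N,
  Ex P (fun w => (~~ undercap nw N K T w)%:R) <= c,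
  (\int[P]_w (capped_wait G nw N K T w)%:E <= \int[P]_w (vwait Gbar nw N w T)%:E)%E &
  ((\int[P]_w (vwait Gbar nw N w T)%:E <= \int[P]_w (capped_wait G nw N K T w)%:E + c%:E) \/
   (c^-1%:E <= \int[P]_w (capped_wait G nw N K T w)%:E))%E].
Proof.
move=> c0 K10.
(* The least positive cap that removes no job at the outcome [w]. *)
pose e w := maxn 1 (maxn (arr nw N w T) (\max_(i < N) X0 nw N w i)).
have me : md e.
  apply: (md_comp2 maxn); first exact: md_cst.
  apply: (md_comp2 maxn); first by apply: (sub_md gm); exact: md_arr.
  by apply: (md_bigmax (f := fun i w => X0 nw N w i)) => i iN; exact: (sub_md gm (@md_X0 _ _ _ nw N [::] i iN (fun x => x))).
have eE K w : (0 < K)%N -> (e w <= K)%N = undercap nw N K T w.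
  move=> K0; rewrite /e !geq_max K0 /=; congr (_ && _).
  by apply/bigmax_leqP/forallP => h i; [exact: h|move=> _; exact: h].
pose f w := capped_wait G nw N (maxn 1 (e w)) T w.
have mf : measurable_fun setT f.
  by apply: (measurable_select (F := fun n w => capped_wait G nw N (maxn 1 n) T w)) => // n; exact: (meas_capped_wait N0 sd mdl (leq_maxl 1 n) T0).
have f0 w : 0 <= f w by exact: capped_wait_ge0.
have [A [mA A0 hA]] := regular_ae.
have reg w : ~ A w -> regular nw N w by move=> nA; apply: contrapT => h; apply: nA; exact: hA.
have fE w : ~ A w -> f w = vwait Gbar nw N w T.
  move=> /reg hw; rewrite /f (capped_waitE N0 sd mdl (leq_maxl 1 (e w)) T0 hw) -eE ?leq_maxl //.
  by rewrite leq_max leqnn orbT mulr1.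
have [K [KK1 hK hor]] := truncation P K1 mf f0 me c0.
have K0 : (0 < K)%N by exact: leq_trans KK1.
have cE : (\int[P]_w (f w * (e w <= K)%N%:R)%:E = \int[P]_w (capped_wait G nw N K T w)%:E)%E.
  apply: (integral_off_null mA A0) => w nA; by rewrite (fE _ nA) (capped_waitE N0 sd mdl K0 T0 (reg _ nA)) eE.
have vE : (\int[P]_w (f w)%:E = \int[P]_w (vwait Gbar nw N w T)%:E)%E.
  by apply: (integral_off_null mA A0) => w nA; rewrite fE.
exists K; rewrite -vE -cE; split => //.
  by rewrite (eq_Ex P (g := fun w => (~~ (e w <= K)%N)%:R)) // => w; rewrite eE.
apply: ge0_le_integral => //.
- by move=> w _; rewrite lee_fin mulr_ge0.
- apply/measurable_EFinP; apply: measurable_funM => //.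
  exact: (measurable_md (fun n => (n <= K)%N%:R) me).
- exact/measurable_EFinP.
- by move=> w _; rewrite lee_fin ler_piMr //; case: (_ <= _)%N.
Qed.

End CapChoice.

(** * Limit of the mean virtual waiting time *)

Unset Implicit Arguments.
Set Printing Implicit Defensive.
Theorem theorem4p4 (R : realType) (d : measure_display) (Omega : measurableType d)
  (P : probability Omega R) (a : nat -> R) (lam G g : R -> R) (H : R)
  (nw : network R Omega) (Z0 : nat -> R -> R) (Z : nat -> R -> R -> R) (T0 : R) :
  let Gbar := fun x : R => 1 - G x in
  (* arrivals *)
  rate_ok lam ->
  (forall N, 0 < a N) ->
  (fun N : nat => a N / N%:R) @ \oo --> (1 : R) ->
  (* service *)
  service_dist G g H ->
  (* the N-server SQ(2) networks *)
  (forall N, (0 < N)%N -> sq2_model P a lam G nw N) ->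
  (* initial conditions (a) and (b) *)
  init_cond_a P nw ->
  (forall N, (0 < N)%N -> exchangeable_init P nw N) ->
  (* Z0_l(r) = lim_N \bar Z^(N)_l(0, r) (almost surely) *)
  {ae P, forall w, forall (l : nat) (r : R), (1 <= l)%N -> 0 <= r ->
      (fun N : nat => Zbar0 Gbar nw N w l r) @ \oo --> Z0 l r} ->
  (* Z solves the hydrodynamic PDE associated to (lam, Z0) *)
  hydro_solution lam Gbar Z0 Z ->
  (* additional assumptions *)
  (\sum_(1 <= l <oo)
      ereal_sup [set P [set w | (l <= X0 nw N w 0)%N] | N in [set N : nat | (0 < N)%N]]
   < +oo)%E ->
  (forall N w i, (i < N)%N -> (0 < X0 nw N w i)%N -> age0 nw N w i < T0) ->
  forall t : R, 0 <= t ->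
  exists s2 : \bar R,
    (fun n : nat => \sum_(1 <= l < n)
        ((Z l t 0 + Z l.+1 t 0)%:E *
         \int[@lebesgue_measure R]_(r in `[0%R, +oo[) (Z l t r - Z l.+1 t r)%:E))%E
      @ \oo --> s2 /\
    (fun N : nat => \int[P]_w (vwait Gbar nw N w t)%:E)%E @ \oo -->
      ((\sum_(2 <= l <oo) (Z l t 0 ^+ 2)%:E) + s2)%E.
Proof.
move=> Gbar lamP a0 a1 sd mdl _ exch Z0cv hs sumfin ageT t t0.
have [pl [pl0 plE pltail]] : exists pl : nat -> R, [/\ forall l, 0 <= pl l,
    forall N l, (0 < N)%N -> (0 < l)%N -> fine (P [set w | (l <= X0 nw N w 0)%N]) <= pl l &
    forall e, 0 < e -> exists L, forall B, \sum_(L <= l < B) pl l.+1 <= e].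
  have [|pl [h1 h2 h3]] := nneseries_tails _ sumfin.
    by move=> l; apply: (@le_trans _ _ (P [set w | (l <= X0 nw 1 w 0)%N])) => //; apply: ereal_sup_ubound; exists 1%N.
  exists pl; split => // N l N0 l0.
  rewrite -lee_fin -h2 // fineK ?fin_num_measure //.
    by apply: ereal_sup_ubound; exists N.
  rewrite (_ : [set w | _] = ~` [set w | (X0 nw N w 0 < l)%N]); last first.
    by apply/seteqP; split => w /=; rewrite [(l <= _)%N]leqNgt => /negP.
  apply: measurableC; apply: md_set; apply: (md_comp (fun m => (m < l)%N)).
  exact: (sub_md (@genm _ _ _ _ _ _ _ _ _ (mdl N N0) [::]) (@md_X0 _ _ _ nw N [::] 0 N0 (fun x => x))).
have [lam0 lamI] : (forall u, 0 <= lam u) /\ Ioo t lam by case: lamP => h1 h2; split => //; exact: h2.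
have Lam0 : 0 <= RI t lam by rewrite -(RI0 lam); exact: RI_mono.
(* The cap exceeds [N], so that each level is eventually below it, and the mean number of arrivals,
   as [poisson_var_min] requires. *)
pose K1 N := (maxn N (Num.Def.truncn (a N * RI t lam))).+1.
have [K hK] : {K : nat -> nat & forall N, (K1 N <= K N)%N /\ ((0 < N)%N ->
  [/\ Ex P (fun w => (~~ undercap nw N (K N) t w)%:R) <= N%:R^-1,
  (\int[P]_w (capped_wait G nw N (K N) t w)%:E <= \int[P]_w (vwait Gbar nw N w t)%:E)%E &
  ((\int[P]_w (vwait Gbar nw N w t)%:E <= \int[P]_w (capped_wait G nw N (K N) t w)%:E + (N%:R^-1)%:E) \/
   (N%:R%:E <= \int[P]_w (capped_wait G nw N (K N) t w)%:E))%E])}.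
  apply: (@choice _ _ (fun N k => (K1 N <= k)%N /\ ((0 < N)%N -> [/\ Ex P (fun w => (~~ undercap nw N k t w)%:R) <= N%:R^-1,
    (\int[P]_w (capped_wait G nw N k t w)%:E <= \int[P]_w (vwait Gbar nw N w t)%:E)%E &
    ((\int[P]_w (vwait Gbar nw N w t)%:E <= \int[P]_w (capped_wait G nw N k t w)%:E + (N%:R^-1)%:E) \/
    (N%:R%:E <= \int[P]_w (capped_wait G nw N k t w)%:E))%E]))) => -[|N]; first by exists (K1 0).
  have c0 : 0 < N.+1%:R^-1 :> R by rewrite invr_gt0 ltr0n.
  have [k [h1 h2 h3 h4]] := cap_choice (ltn0Sn N) sd (mdl N.+1 isT) t0 c0 (ltn0Sn _ : (0 < K1 N.+1)%N).
  by exists k; split => // _; split => //; move: h4; rewrite invrK.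
have K0 N : (0 < K N)%N by apply: leq_ltn_trans (hK N).1.
have KN N : (N <= K N)%N by apply: leq_trans (hK N).1; rewrite leqW // leq_maxl.
have Ka N : a N * RI t lam <= (K N)%:R.
  apply/ltW/(lt_le_trans (truncnS_gt _)); rewrite ler_nat; apply: leq_trans (hK N).1.
  by rewrite ltnS leq_maxr.
have core := sysI_cores sd mdl t0 K0.
have [C C0 hJ] := hJ_sys lamP a0 a1 sd mdl exch pl0 plE pltail t0 K0.
have hA s s' (s0 : 0 <= s) (ss' : s <= s') (s't : s' <= t) := hA_sys lamP a0 a1 sd mdl t0 K0 Ka s0 ss' s't.
have hI l x (x0 : 0 <= x) := hI_sys sd mdl Z0cv t0 K0 KN l x0.
have hI0 l (l0 : (0 < l)%N) := hI0_sys sd mdl Z0cv t0 K0 KN l0.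
have Ylim l r : (0 < l)%N -> 0 <= r -> LS (fun N => Ex P (fun w => `|yb (sysI G nw N (K N) t w) N (K N * N + K N) l t (Some (t + r)) - Z l t r|)) 0.
  move=> l0 r0.
  have tt : 0 <= t <= t by rewrite t0 lexx.
  have tr : t <= t + r by rewrite lerDl.
  have := eY_lim core t0 C0 lam0 lamI (j := jz Z) (Z0 := Z0) (Z := Z) _ _ _ _ _ _ _ _ hJ hA hI hI0 l0 tt tr.
  rewrite /eY /zx; case: l l0 => // l l0; rewrite addrAC subrr add0r; apply.
  - by move=> k k0; apply: (hs_jI sd hs).
  - by move=> k s x k0 /andP[s0 _]; apply: (hs_jGI hs).
  - by move=> k s ox /andP[s0 _]; apply: (hs_qI hs).
  - by move=> k v x k0 /andP[v0 _]; apply: (hs_Zb hs).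
  - by move=> k s x k0 /andP[s0 _]; apply: (hs_Zu hs).
  - by move=> k k0; apply: (hs_Zu0 hs).
  - by move=> k s x /andP[s0 _]; apply: (hs_ZY hs).
  - by move=> k s k0 /andP[s0 _]; apply: (hs_ZD sd hs).
have muc N : (0 < N)%N -> md (undercap nw N (K N) t).
  move=> N0; apply: (sub_md (@genm _ _ _ _ _ _ _ _ _ (mdl N N0) [::])).
  exact: (@md_undercap _ _ _ nw N (K N) t [::] (fun x => x) (fun x => x)).
have uc0 : LS (fun N => Ex P (fun w => (~~ undercap nw N (K N) t w)%:R)) 0.
  move=> e e0; exists (Num.Def.truncn e^-1).+1 => N hN.
  have [_ h] := hK N; have N0 : (0 < N)%N by exact: leq_trans hN.
  have [h1 _ _] := h N0; apply: le_trans h1 _.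
  rewrite add0r -[leRHS]invrK lef_pV2 ?posrE ?ltr0n ?invr_gt0 //.
  by apply/ltW/(lt_le_trans (truncnS_gt _)); rewrite ler_nat.
have hp N l : (0 < N)%N -> Ex P (fun w => i0b (sysI G nw N (K N) t w) N (K N) l None) <= pl l.+1.
  move=> N0; have n0 : 0 < N%:R :> R by rewrite ltr0n.
  have bX (i : 'I_N) : bm (fun w => (l < X0 nw N w i)%N%:R : R).
    apply: bm_ind; apply: (md_comp (fun n => (l < n)%N)).
    exact: (sub_md (@genm _ _ _ _ _ _ _ _ _ (mdl N N0) [::]) (@md_X0 _ _ _ nw N [::] i (ltn_ord i) (fun x => x))).
  apply: le_trans (_ : Ex P (fun w => N%:R^-1 * \sum_(i < N) (l < X0 nw N w i)%N%:R) <= _).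
    apply: Ex_le => [||w]; [exact: (bm_i0b (core N N0))|by apply: bmM; [exact: bm_cst|exact: bm_sum]|].
    rewrite (i0bE N0 sd (mdl N N0) (K0 N) t0) // ler_wpM2l ?invr_ge0 //.
    by apply: ler_sum => i _; rewrite ler_nat andbT; case: (_ < _)%N.
  rewrite ExZ ?Ex_sum //; last exact: bm_sum.
  rewrite mulrC ler_pdivrMr // [leRHS](_ : _ = \sum_(i < N) pl l.+1); last by rewrite sumr_const card_ord mulr_natr.
  by apply: ler_sum => i _; apply: (X0_marginal mdl exch plE).
have hD N r : (0 < N)%N -> 0 <= r -> Ex P (fun w => yb (sysI G nw N (K N) t w) N (K N * N + K N) 1 t (Some (t + r))) <= C / Gbar T0 * Gbar r.
  move=> N0 r0; apply: le_trans (busy_tail N0 sd (mdl N N0) (K0 N) t0 (ageT N) r0) _.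
  apply: ler_wpM2r; first exact/ltW/(sd_Gpos sd).
  by apply: ler_wpM2r; [rewrite invr_ge0; exact/ltW/(sd_Gpos sd)|exact: hJ].
have hA0 : LS (fun N => Ex P (fun w => `|dA (sysI G nw N (K N) t w) N (K N) 0 t - RI t lam|)) 0.
  by have := hA 0 t (lexx 0) t0 (lexx t); rewrite RI0 subr0.
have [w [s2 [cw cs2 cW]]] := wait_limit sd core t0 KN Ylim muc uc0 C0 hJ Lam0 hA0 pl0 hp pltail hD.
exists s2%:E; split.
  rewrite -cvg_shiftS; apply: cvg_trans cs2; apply: near_eq_cvg; apply: nearW => n /=.
  by rewrite big_add1.
have -> : (\sum_(2 <= l <oo) (Z l t 0 ^+ 2)%:E = w%:E)%E.
  rewrite -nneseries_addn => [|l]; last by rewrite lee_fin sqr_ge0.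
  apply/cvg_lim => //; rewrite (_ : (fun n => _) = EFin \o (fun L => \sum_(l < L) Z l.+2 t 0 ^+ 2)).
    by apply: cvg_EFin => //; exact: nearW.
  by apply/funext => n /=; rewrite -sumEFin big_mkord; apply: eq_bigr => l _; rewrite addn2.
rewrite -EFinD -cvg_shiftS /=.
pose c N := (\int[P]_w (capped_wait G nw N.+1 (K N.+1) t w)%:E)%E.
have cc : c N @[N --> \oo] --> (w + s2)%:E.
  apply: cvg_trans cW; apply: near_eq_cvg; apply: nearW => N.
  by rewrite /c (capped_wait_mean (ltn0Sn N) sd (mdl N.+1 isT) (K0 N.+1) t0).
(* The true mean lies between the capped mean and the capped mean plus [1 / N]. The other
   alternative, a capped mean of at least [N], fails for large [N] because the capped means
   converge. *)
apply: (squeeze_cvge (h := fun N => (c N + (N.+1%:R^-1)%:E)%E) _ cc); last first.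
  rewrite -[X in _ --> X]adde0; apply: cvgeD => //.
  apply: cvg_EFin; [exact: nearW|exact: cvg_harmonic].
have [N1 _ hN1] : \forall N \near \oo, (c N < (w + s2 + 1)%:E)%E.
  apply: (cc [set x | (x < (w + s2 + 1)%:E)%E]); apply: open_nbhs_nbhs; split; first exact: open_ereal_lt_ereal.
  by rewrite /= lte_fin ltrDl.
exists (maxn N1 (Num.Def.truncn (w + s2 + 1)).+1) => // N /=; rewrite geq_max => /andP[h1 h2].
have [_ /(_ isT)[_ h3 h4]] := hK N.+1; rewrite h3 /=; case: h4 => // h4.
have := le_lt_trans h4 (hN1 N h1); rewrite lte_fin ltNge => /negP[].
by apply/ltW/(lt_le_trans (truncnS_gt _)); rewrite ler_nat ltnW.
Qed.
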